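(* Let $0<\alpha<1$ and $\theta>0$. The random variable $M_{\alpha\theta}(\varrho_\alpha)\overset{d}{=}[\ell^{(\alpha,\alpha\theta)}_{S_\alpha}]^{1/\alpha}\overset{d}{=}S_\alpha/T_{\alpha,\alpha\theta}$ has cdf $$\mathbb{P}(M_{\alpha\theta}(\varrho_\alpha)\le x)=\int_0^x(x-t)^{\alpha\theta-1}\Delta_{\alpha\theta}(t|\varrho_\alpha)\,dt,\qquad x>0,$$ where $$\Delta_{\alpha\theta}(x|\varrho_\alpha)=\frac1\pi\,\frac{\sin(\pi\theta\alpha F_{X_\alpha}(x))}{[x^{2\alpha}+2x^\alpha\cos(\alpha\pi)+1]^{\theta/2}}$$ and $F_{X_\alpha}(x)=1-\frac{1}{\pi\alpha}\cot^{-1}\!\big(\cot(\pi\alpha)+\frac{x^\alpha}{\sin(\pi\alpha)}\big)$. Furthermore its density is $$\int_0^x(x-t)^{\alpha\theta-1}d_{\alpha\theta}(t|\varrho_\alpha)\,dt,\qquad x>0,$$ where $$d_{\alpha\theta}(x|\varrho_\alpha)=\frac{\alpha\theta x^{\alpha-1}}{\pi}\,\frac{\sin(\pi\alpha[1-\theta F_{X_\alpha}(x)])-x^\alpha\sin(\pi\theta\alpha F_{X_\alpha}(x))}{[x^{2\alpha}+2x^\alpha\cos(\alpha\pi)+1]^{\theta/2+1}}.$$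
   Context: $\cot^{-1}$ takes values in $(0,\pi)$. $S_\alpha$ is positive $\alpha$-stable with $\mathbb{E}[e^{-\lambda S_\alpha}]=e^{-\lambda^\alpha}$ and density $f_\alpha$; $T_{\alpha,\alpha\theta}$ is independent of $S_\alpha$ with density proportional to $t^{-\alpha\theta}f_\alpha(t)$; $X_\alpha\overset{d}{=}S_\alpha/S'_\alpha$ (independent copies) has density $\varrho_\alpha(y)=\frac{\sin(\pi\alpha)}{\pi}\frac{y^{\alpha-1}}{y^{2\alpha}+2y^\alpha\cos(\pi\alpha)+1}$, $y>0$, and cdf $F_{X_\alpha}$. $(\ell^{(\alpha,\alpha\theta)}_t)$ is the local time of a generalized Bessel bridge, for which $\ell^{(\alpha,\alpha\theta)}_\tau\overset{d}{=}\tau^\alpha T_{\alpha,\alpha\theta}^{-\alpha}$ for an independent positive $\tau$; $S_\alpha$ is independent of it. $M_{\alpha\theta}(\varrho_\alpha)$ is the mean of a Dirichlet process with shape $\alpha\theta\varrho_\alpha$; its law is characterized by $\mathbb{E}[(1+\lambda M_{\alpha\theta}(\varrho_\alpha))^{-\alpha\theta}]=\exp(-\alpha\theta\int_0^\infty\log(1+\lambda x)\varrho_\alpha(x)dx)$, $\lambda>0$. *)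

(* Defs.v *)
From HB Require Import structures.
From mathcomp Require Import all_boot all_order all_algebra.
From mathcomp Require Import all_classical all_reals all_analysis.

Set Implicit Arguments.
Unset Strict Implicit.
Unset Printing Implicit Defensive.

Import Order.TTheory GRing.Theory Num.Theory.
Import numFieldNormedType.Exports.

Local Open Scope classical_set_scope.
Local Open Scope ring_scope.

Section Laws.
Context {R : realType} {d : measure_display} {Omega : measurableType d}.
Variable P : probability Omega R.

Definition eq_in_law (X Y : Omega -> R) : Prop :=
  forall A : set R, measurable A -> P (X @^-1` A) = P (Y @^-1` A).

Definition indep_families (F G : set (set Omega)) : Prop :=
  forall A B, F A -> G B -> P (A `&` B) = (P A * P B)%E.

Definition sigma_rv (X : Omega -> R) : set (set Omega) :=
  [set X @^-1` B | B in measurable].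

(* Processes are indexed by [R], but only the times [t > 0] are relevant. *)
Definition sigma_process (ell : R -> Omega -> R) : set (set Omega) :=
  <<s [set A | exists t, 0 < t /\ sigma_rv (ell t) A] >>.

Definition indep_rv (X Y : Omega -> R) : Prop :=
  indep_families (sigma_rv X) (sigma_rv Y).

Definition indep_rv_process (X : Omega -> R) (ell : R -> Omega -> R) : Prop :=
  indep_families (sigma_rv X) (sigma_process ell).

(* Since some [B i] may be [setT], the product rule for all of ['I_n] contains
   the one for every subfamily. *)
Definition mutually_indep (n : nat) (X : 'I_n -> Omega -> R) : Prop :=
  forall B : 'I_n -> set R, (forall i, measurable (B i)) ->
    fine (P [set w | forall i, B i (X i w)]) =
    \prod_(i < n) fine (P (X i @^-1` B i)).

Definition positive_rv (X : Omega -> R) : Prop := {ae P, forall w, 0 < X w}.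

End Laws.

(* The measure f(x) dx on ]0, +oo[; the values of [f] outside ]0, +oo[ are
   irrelevant. *)
Definition density_measure {R : realType} (f : R -> R) (A : set R) : \bar R :=
  (\int[lebesgue_measure]_(x in A `&` `]0%R, +oo[) (f x)%:E)%E.

(* [X] is concentrated on ]0, +oo[ and has density [f] there. *)
Definition has_pos_density {R : realType} {d : measure_display}
    {Omega : measurableType d} (P : probability Omega R) (X : Omega -> R)
    (f : R -> R) : Prop :=
  [/\ measurable_fun (`]0, +oo[ : set R) f,
      (forall x, 0 < x -> 0 <= f x) &
      forall A : set R, measurable A -> P (X @^-1` A) = density_measure f A].

Section Dirichlet.
Context {R : realType}.

Definition Gamma_fun (a : R) : R :=
  \int[lebesgue_measure]_(t in `]0, +oo[) (t `^ (a - 1) * expR (- t)).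

(* The Gamma law of shape 0 is the Dirac mass at 0. *)
Definition is_gamma {d : measure_display} {Omega : measurableType d}
    (P : probability Omega R) (X : Omega -> R) (a : R) : Prop :=
  if a == 0 then {ae P, forall w, X w = 0}
  else has_pos_density P X
         (fun x => x `^ (a - 1) * expR (- x) / Gamma_fun a).

(* Ferguson's definition, which allows some of the parameters to be 0: the law
   of (G_i / sum_j G_j)_i for independent G_i ~ Gamma(a_i).  The equality of
   the two laws on R^n is expressed on measurable boxes, which form a
   generating pi-system. *)
Definition is_dirichlet {d : measure_display} {Omega : measurableType d}
    (P : probability Omega R) (n : nat) (V : 'I_n -> Omega -> R)
    (a : 'I_n -> R) : Prop :=
  exists (d' : measure_display) (Omega' : measurableType d')
         (Q : probability Omega' R) (G : 'I_n -> {RV Q >-> R}),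
    [/\ mutually_indep Q (fun i => G i : Omega' -> R),
        (forall i, is_gamma Q (G i) (a i)) &
        forall B : 'I_n -> set R, (forall i, measurable (B i)) ->
          P [set w | forall i, B i (V i w)] =
          Q [set w | forall i, B i (G i w / \sum_(j < n) G j w)]].

(* A random probability measure on R, i.e. a probability kernel from the sample
   space, is a Dirichlet process with shape the finite measure [a]. *)
Definition is_dirichlet_process {d : measure_display}
    {Omega : measurableType d} (P : probability Omega R)
    (D : R.-pker Omega ~> (measurableTypeR R)) (a : set R -> \bar R) : Prop :=
  forall (n : nat) (A : 'I_n -> set R),
    (forall i, measurable (A i)) -> trivIset setT A ->
    \bigcup_i A i = setT ->
    is_dirichlet P (fun i w => fine (D w (A i))) (fun i => fine (a (A i))).

Definition random_mean {d : measure_display} {Omega : measurableType d}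
    (D : R.-pker Omega ~> (measurableTypeR R)) (w : Omega) : R :=
  \int[D w]_x x.

End Dirichlet.

Section Stable.
Context {R : realType} {d : measure_display} {Omega : measurableType d}.
Variable P : probability Omega R.

Definition is_pos_stable (alpha : R) (S : Omega -> R) : Prop :=
  positive_rv P S /\
  forall lambda : R, 0 < lambda ->
    ('E_P[fun w => expR (- lambda * S w)%R] = (expR (- (lambda `^ alpha))%R)%:E)%E.

(* The law of T is proportional to t^(-p) f(t) dt. *)
Definition is_neg_power_tilt (p : R) (f : R -> R) (T : Omega -> R) : Prop :=
  exists2 c : R, 0 < c & has_pos_density P T (fun t => c * (t `^ (- p) * f t)).

(* Local times at independent random times: ell_tau has the law of
   tau^alpha T^(-alpha), where tau and T are taken independent, whence the
   product of their laws.  Joint measurability makes ell_tau a random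
   variable. *)
Definition is_bridge_local_time (alpha : R) (T : {RV P >-> R})
    (ell : R -> Omega -> R) : Prop :=
  measurable_fun setT (fun p : measurableTypeR R * Omega => ell p.1 p.2) /\
  forall tau : {RV P >-> R},
    positive_rv P tau -> indep_rv_process P tau ell ->
    forall A : set R, measurable A ->
      P ((fun w => ell (tau w) w) @^-1` A) =
      (distribution P tau \x distribution P T)%E
        [set p | A (p.1 `^ alpha * p.2 `^ (- alpha))].

Definition real_cdf (X : Omega -> R) (x : R) : R := fine (P [set w | X w <= x]).

End Stable.

Section Formulas.
Context {R : realType}.

Definition cot (x : R) : R := cos x / sin x.

(* The branch of the inverse cotangent with values in ]0, pi[. *)
Definition acot (x : R) : R := pi / 2 - atan x.

Definition lamperti_poly (alpha x : R) : R :=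
  x `^ (2 * alpha) + 2 * x `^ alpha * cos (pi * alpha) + 1.

Definition varrho (alpha x : R) : R :=
  sin (pi * alpha) / pi * (x `^ (alpha - 1) / lamperti_poly alpha x).

Definition Delta (alpha theta : R) (F : R -> R) (x : R) : R :=
  pi^-1 * (sin (pi * theta * alpha * F x) /
           lamperti_poly alpha x `^ (theta / 2)).

Definition d_dens (alpha theta : R) (F : R -> R) (x : R) : R :=
  alpha * theta * x `^ (alpha - 1) / pi *
  ((sin (pi * alpha * (1 - theta * F x))
    - x `^ alpha * sin (pi * theta * alpha * F x)) /
   lamperti_poly alpha x `^ (theta / 2 + 1)).

Definition abel (p : R) (h : R -> R) (x : R) : R :=
  \int[lebesgue_measure]_(t in `]0, x[) ((x - t) `^ (p - 1) * h t).

End Formulas.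

(* Main.v *)
Require Import Defs.
From HB Require Import structures.
From mathcomp Require Import all_boot all_order all_algebra finmap.
From mathcomp Require Import all_classical all_reals all_analysis.
From mathcomp Require Import measurable_realfun ring lra.

Set Implicit Arguments.
Unset Strict Implicit.
Unset Printing Implicit Defensive.

Import Order.TTheory GRing.Theory Num.Theory.
Import numFieldNormedType.Exports HBNNSimple.

Local Open Scope classical_set_scope.
Local Open Scope ring_scope.

(* All the variables are identified by their generalized Stieltjes transform.
   With a = alpha theta, both X = M and X = S / T satisfy
   E (z + X)^(- a) = (1 + z^alpha)^(- theta).  For S / T this follows from the
   Laplace transform of S, after writing (z T + S)^(- a) as a gamma integral.
   For the random mean M, approximation by simple functions reduces the
   Markov-Krein identity E (z + M)^(- a) = exp (- a int log (z + x) rho(x) dx)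
   to Dirichlet vectors, where it follows from the representation by
   independent gamma variables; and int log (z + x) rho(x) dx =
   log (1 + z^alpha) / alpha.

   On the analytic side, int Delta(t) / (z + t) dt = (1 + z^alpha)^(- theta).
   Indeed, with t = z e^v, c = z^alpha and
   m(q) = e^(q/2) (1 + c e^(alpha q))^(- theta), this amounts to the vanishing
   of the integral over the line Im q = pi of the imaginary part of
   (m(q) - m(0)) / (2 sinh (q/2)); by the Cauchy-Riemann equations that
   integral does not depend on the height of the line, and it vanishes at
   height 0, where the function is real.  By Fubini, the Abel
   transform of Delta then has the same generalized Stieltjes transform as the
   cdf of X.  Such a transform determines a right-continuous function:
   differentiation in z raises the exponent, and polynomials in
   1 / (2 + x) approximate indicators.  The density is the Abel transform of
   d = Delta', because Delta vanishes at 0.  The kernel 1 / (z + x) identifies the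
   cdf of S / S' in the same way. *)

(** * Integration on the half-line *)

(** Only real analysis is used: a holomorphic function is a pair of real functions with four partial
    derivatives, and moving the contour means differentiating an integral over [- n, n] in the
    height of the line. Subtracting m(0) removes the pole of 1 / sinh at 0, and the subtracted term
    produces the answer: at height pi it contributes m(0) times the integral of 1 / (2 cosh (v/2)),
    which is pi. The strip extends a little above pi, to make pi an interior height.

    For S / T, the factor T^a in T^a (z T + S)^(- a) cancels the tilt t^(- a), so both variables
    enter through the Laplace transform of S alone; neither f nor the tilting constant is computed.
    No value of Gamma is computed either: Gamma(a) is finite and positive because a gamma variable
    of shape a exists, and the Dirichlet process provides one.

    Two facts hidden by the formulas come out of the transforms: the random mean is finite almost
    surely (let z tend to infinity), and the Abel transform of d is nonnegative (it is the
    continuous derivative of a cdf). *)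

Section iterated_integrals.
Context {d1 d2 : measure_display} {T1 : measurableType d1}
  {T2 : measurableType d2} {R : realType}.
Variables (m1 : {sigma_finite_measure set T1 -> \bar R})
  (m2 : {sigma_finite_measure set T2 -> \bar R}).
Variables (E : set (T1 * T2)) (D1 : set T1) (A : T1 -> set T2)
  (D2 : set T2) (B : T2 -> set T1).
Hypothesis mE : measurable E.
Hypothesis E1 : forall x y, E (x, y) <-> D1 x /\ A x y.
Hypothesis E2 : forall x y, E (x, y) <-> D2 y /\ B y x.

Lemma iterated_patch1 (f : T1 * T2 -> \bar R) :
  (\int[m1]_(x in D1) \int[m2]_(y in A x) f (x, y) =
   \int[m1]_x \int[m2]_y (f \_ E) (x, y))%E.
Proof.
rewrite integral_mkcond; apply: eq_integral => x _.
rewrite /patch; case: ifPn => [/set_mem xD|/negP xD].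
  rewrite integral_mkcond; apply: eq_integral => y _; rewrite /patch.
  congr (if _ then _ else _).
  apply/idP/idP => /set_mem h; apply/mem_set; first exact/E1.
  by have /E1[] := h.
rewrite integral0_eq// => y _; case: ifPn => // /set_mem /E1[xD1 _].
by exfalso; apply: xD; exact/mem_set.
Qed.

Lemma iterated_patch2 (f : T1 * T2 -> \bar R) :
  (\int[m2]_(y in D2) \int[m1]_(x in B y) f (x, y) =
   \int[m2]_y \int[m1]_x (f \_ E) (x, y))%E.
Proof.
rewrite integral_mkcond; apply: eq_integral => x _.
rewrite /patch; case: ifPn => [/set_mem xD|/negP xD].
  rewrite integral_mkcond; apply: eq_integral => y _; rewrite /patch.
  congr (if _ then _ else _).
  apply/idP/idP => /set_mem h; apply/mem_set; first exact/E2.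
  by have /E2[] := h.
rewrite integral0_eq// => y _; case: ifPn => // /set_mem /E2[xD1 _].
by exfalso; apply: xD; exact/mem_set.
Qed.

(** Extension by 0 outside [E] reduces a domain that need not be a rectangle to the product space;
    [E1] and [E2] describe its two families of sections. *)
Lemma tonelli_dom (f : T1 * T2 -> \bar R) :
  measurable_fun E f -> (forall p, E p -> (0 <= f p)%E) ->
  (\int[m1]_(x in D1) \int[m2]_(y in A x) f (x, y) =
   \int[m2]_(y in D2) \int[m1]_(x in B y) f (x, y))%E.
Proof.
move=> mf f0; rewrite iterated_patch1 iterated_patch2.
apply: (@fubini_tonelli _ _ _ _ _ m1 m2 (f \_ E)).
  exact: (iffLR (measurable_restrictT _ _) mf).
by move=> p; exact: erestrict_ge0.
Qed.

Lemma fubini_dom (f : T1 * T2 -> \bar R) :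
  measurable_fun E f ->
  (\int[m1]_(x in D1) \int[m2]_(y in A x) `|f (x, y)| < +oo)%E ->
  (\int[m1]_(x in D1) \int[m2]_(y in A x) f (x, y) =
   \int[m2]_(y in D2) \int[m1]_(x in B y) f (x, y))%E.
Proof.
move=> mf ffin; rewrite iterated_patch1 iterated_patch2.
apply: (@Fubini _ _ _ _ _ m1 m2 (f \_ E)).
have mfE : measurable_fun setT (f \_ E) by exact: (iffLR (measurable_restrictT _ _) mf).
apply/integrable12ltyP => //.
move: ffin; rewrite (iterated_patch1 (fun p : T1 * T2 => `|f p|%E)).
apply: le_lt_trans; rewrite le_eqVlt; apply/orP; left; apply/eqP.
apply: eq_integral => x _; apply: eq_integral => y _.
by rewrite /patch; case: ifPn => //; rewrite abse0.
Qed.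

End iterated_integrals.

(** * Derivatives and improper integrals with explicit primitives *)

Section pointwise_derivatives.
Context {R : realType}.
Implicit Types (f g : R -> R) (x df dg : R).

(* [is_derive] is a type class; this alias is not resolved automatically. *)
Definition has_deriv f x df : Prop := is_derive x 1 f df.

Lemma has_deriv_eq f x df dg : has_deriv f x df -> df = dg -> has_deriv f x dg.
Proof. by move=> h <-. Qed.

Lemma der_cst (c x : R) : has_deriv (fun _ : R => c) x 0.
Proof. exact: is_derive_cst. Qed.

Lemma der_id x : has_deriv (fun y : R => y) x 1.
Proof. exact: is_derive_id. Qed.

Lemma derD f g x df dg : has_deriv f x df -> has_deriv g x dg ->
  has_deriv (fun y => f y + g y) x (df + dg).
Proof. by rewrite /has_deriv => hf hg; exact: is_deriveD. Qed.

Lemma derN f x df : has_deriv f x df -> has_deriv (fun y => - f y) x (- df).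
Proof. by rewrite /has_deriv => hf; exact: is_deriveN. Qed.

Lemma derM f g x df dg : has_deriv f x df -> has_deriv g x dg ->
  has_deriv (fun y => f y * g y) x (f x * dg + g x * df).
Proof. by rewrite /has_deriv => hf hg; exact: is_deriveM. Qed.

Lemma der_comp f g x df dg : has_deriv f (g x) df -> has_deriv g x dg ->
  has_deriv (fun y => f (g y)) x (dg * df).
Proof.
by rewrite /has_deriv => hf hg; rewrite mulrC; exact: is_derive1_comp.
Qed.

Lemma derV f x df : f x != 0 -> has_deriv f x df ->
  has_deriv (fun y => (f y)^-1) x (- (f x) ^- 2 * df).
Proof. by rewrite /has_deriv => f0 hf; exact: is_deriveV. Qed.

Lemma der_exp f x df : has_deriv f x df ->
  has_deriv (fun y => expR (f y)) x (df * expR (f x)).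
Proof. by move=> hf; apply: der_comp hf; exact: is_derive_expR. Qed.

Lemma der_sin f x df : has_deriv f x df ->
  has_deriv (fun y => sin (f y)) x (df * cos (f x)).
Proof. by move=> hf; apply: der_comp hf; exact: is_derive_sin. Qed.

Lemma der_cos f x df : has_deriv f x df ->
  has_deriv (fun y => cos (f y)) x (df * - sin (f x)).
Proof. by move=> hf; apply: der_comp hf; exact: is_derive_cos. Qed.

Lemma der_atan f x df : has_deriv f x df ->
  has_deriv (fun y => atan (f y)) x (df * (1 + f x ^+ 2)^-1).
Proof. by move=> hf; apply: der_comp hf; exact: is_derive1_atan. Qed.

Lemma der_ln f x df : 0 < f x -> has_deriv f x df ->
  has_deriv (fun y => ln (f y)) x (df * (f x)^-1).
Proof. by move=> f0 hf; apply: der_comp hf; exact: is_derive1_ln. Qed.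

Lemma der_powR p f x df : 0 < f x -> has_deriv f x df ->
  has_deriv (fun y => f y `^ p) x (df * (p * f x `^ (p - 1))).
Proof.
by move=> f0 hf; apply: (der_comp (f := fun y => y `^ p)) => //; exact: is_derive1_powR.
Qed.

Lemma has_deriv_cont f x df : has_deriv f x df -> {for x, continuous f}.
Proof.
by move=> [df1 _]; apply: differentiable_continuous; exact/derivable1_diffP.
Qed.

End pointwise_derivatives.

Ltac der := repeat first
  [ eassumption | apply: der_cst | apply: der_id | apply: derN | apply: derD
  | apply: derV | apply: der_exp | apply: der_sin | apply: der_cos
  | apply: der_atan | apply: der_ln | apply: der_powR | apply: derM ].

Section real_integrals.
Context {R : realType}.
Notation mu := (@lebesgue_measure R).

(* Exhaustion by segments allows singular endpoints. *)
Lemma ge0_FTC_exhaust (f F : R -> R) (D : set R) (a_ b_ : nat -> R) (la lb : R) :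
  (forall n, a_ n < b_ n) -> (forall n, a_ n.+1 <= a_ n) ->
  (forall n, b_ n <= b_ n.+1) -> D = \bigcup_n `[a_ n, b_ n]%classic ->
  (forall x, D x -> 0 <= f x) -> (forall x, D x -> {for x, continuous f}) ->
  (forall x, D x -> has_deriv F x (f x)) ->
  F (a_ n) @[n --> \oo] --> la -> F (b_ n) @[n --> \oo] --> lb ->
  (\int[mu]_(x in D) (f x)%:E = (lb - la)%:E)%E.
Proof.
move=> ab da ib DE f0 cf dF Fa Fb.
have sub n : `[a_ n, b_ n]%classic `<=` D by rewrite DE => x xn; exists n.
have wcf n : {within `[a_ n, b_ n], continuous f}.
  by apply: continuous_in_subspaceT => x /set_mem /sub; exact: cf.
have cF x : D x -> {for x, continuous F}.
  move=> Dx; apply: differentiable_continuous; apply/derivable1_diffP.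
  by have := dF _ Dx; case.
have int n : (\int[mu]_(x in `[a_ n, b_ n]) (f x)%:E = (F (b_ n) - F (a_ n))%:E)%E.
  rewrite (@continuous_FTC2 _ f F)//.
  - split.
    + move=> x; rewrite in_itv/= => /andP[xa xb].
      have /dF : D x by apply: (sub n); rewrite /= in_itv/= !ltW.
      by case.
    + apply: cvg_at_right_filter; apply: cF; apply: (sub n).
      by rewrite /= in_itv/= lexx ltW.
    + apply: cvg_at_left_filter; apply: cF; apply: (sub n).
      by rewrite /= in_itv/= lexx ltW.
  - move=> x; rewrite in_itv/= => /andP[xa xb].
    have /dF dFx : D x by apply: (sub n); rewrite /= in_itv/= !ltW.
    by case: dFx => _ dv; rewrite derive1E.
have c1 : (\int[mu]_(x in `[a_ n, b_ n]) (f x)%:E @[n --> \oo] -->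
          \int[mu]_(x in D) (f x)%:E)%E.
  rewrite DE; apply: ge0_nondecreasing_set_cvg_integral.
  - apply/nondecreasing_seqP => n; rewrite subsetEset => x /=.
    rewrite !in_itv/= => /andP[xa xb].
    by rewrite (le_trans (da n) xa) (le_trans xb (ib n)).
  - by [].
  - move=> n; apply/measurable_EFinP; apply: subspace_continuous_measurable_fun => //.
  - by move=> n x /sub Dx; rewrite lee_fin f0.
have c2 : (\int[mu]_(x in `[a_ n, b_ n]) (f x)%:E @[n --> \oo] --> (lb - la)%:E)%E.
  under eq_fun do rewrite int.
  by apply: cvg_EFin; [near=> n|exact: cvgB].
exact: (cvg_unique _ c1 c2).
Unshelve. all: by end_near. Qed.

Lemma ge0_FTC_oo (f F : R -> R) (a b : R) (la lb : R) : a < b ->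
  (forall x, a < x < b -> 0 <= f x) ->
  (forall x, a < x < b -> {for x, continuous f}) ->
  (forall x, a < x < b -> has_deriv F x (f x)) ->
  F x @[x --> a^'+] --> la -> F x @[x --> b^'-] --> lb ->
  (\int[mu]_(x in `]a, b[) (f x)%:E = (lb - la)%:E)%E.
Proof.
move=> ab f0 cf dF Fa Fb.
(* The shift by 3 gives 2 e_n < b - a already for n = 0, so that every segment is nondegenerate. *)
pose e n : R := (b - a) / n.+3%:R.
have ba : 0 < b - a by rewrite subr_gt0.
have e0 n : 0 < e n by rewrite divr_gt0.
have de n : e n.+1 <= e n.
  by rewrite ler_pM2l// lef_pV2 ?posrE// ler_nat.
have e2 n : e n + e n < b - a.
  have -> : e n + e n = (b - a) * (2 / n.+3%:R) by rewrite /e -!natr1; field; have := ler0n R n; lra.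
  rewrite -[ltRHS]mulr1 ltr_pM2l// ltr_pdivrMr// mul1r ltr_nat//.
have ce : e n @[n --> \oo] --> 0.
  rewrite -[X in _ --> X](mulr0 (b - a)); apply: cvgMl_tmp.
  have -> : (fun n => n.+3%:R^-1 : R) = (fun n => harmonic (n + 2)%N).
    by apply/funext => n; rewrite /harmonic /= addn2.
  by rewrite (cvg_shiftn 2); exact: cvg_harmonic.
apply: (@ge0_FTC_exhaust f F _ (fun n => a + e n) (fun n => b - e n)).
- by move=> n; have := e2 n; lra.
- by move=> n; have := de n; lra.
- by move=> n; have := de n; lra.
- apply/seteqP; split => [x|x [n _]] /=; rewrite !in_itv/= => /andP[x1 x2]; last first.
    by have := e0 n; apply: (fun h => introT andP (conj _ _)); lra.
  have m0 : 0 < Num.min (x - a) (b - x) by rewrite lt_min !subr_gt0 x1.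
  have [n _ /(_ n (leqnn n))] : \forall n \near \oo, e n < Num.min (x - a) (b - x).
    by apply: cvgr_lt m0; exact: ce.
  rewrite lt_min => /andP[h1 h2]; exists n => //=; rewrite in_itv/=.
  by apply/andP; split; lra.
- by move=> x /=; rewrite in_itv/=; exact: f0.
- by move=> x /=; rewrite in_itv/=; exact: cf.
- by move=> x /=; rewrite in_itv/=; exact: dF.

- have /cvg_at_rightP := Fa; apply; split; first by move=> n; rewrite ltrDl.
  by rewrite -[X in _ --> X]addr0; apply: cvgD => //; exact: cvg_cst.
- have /cvg_at_leftP := Fb; apply; split; first by move=> n; rewrite ltrBlDr ltrDl.
  by rewrite -[X in _ --> X]subr0; apply: cvgB => //; exact: cvg_cst.
Qed.

Lemma ge0_FTC_oy (f F : R -> R) (a : R) (la lb : R) :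
  (forall x, a < x -> 0 <= f x) ->
  (forall x, a < x -> {for x, continuous f}) ->
  (forall x, a < x -> has_deriv F x (f x)) ->
  F x @[x --> a^'+] --> la -> F x @[x --> +oo] --> lb ->
  (\int[mu]_(x in `]a, +oo[) (f x)%:E = (lb - la)%:E)%E.
Proof.
move=> f0 cf dF Fa Fb.
have ny : (n%:R : R) @[n --> \oo] --> +oo by exact: cvgr_idn.
(* The offset 2 exceeds 1 / (n + 1), so the segments are nondegenerate from n = 0 on. *)
apply: (@ge0_FTC_exhaust f F _ (fun n => a + n.+1%:R^-1) (fun n => a + 2 + n%:R)).
- move=> n; have : n.+1%:R^-1 <= 1 :> R by rewrite invf_le1// ler1n.
  by move: (n.+1%:R^-1) (ler0n R n) => y h1 h2; lra.
- by move=> n; rewrite lerD2l lef_pV2 ?posrE// ler_nat.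
- by move=> n; rewrite lerD2l ler_nat.
- apply/seteqP; split => [x|x [n _]] /=; rewrite !in_itv/= ?andbT; last first.
    by move=> /andP[+ _]; apply: lt_le_trans; rewrite ltrDl.
  move=> ax; have m0 : 0 < x - a by rewrite subr_gt0.
  have h1 : \forall n \near \oo, n.+1%:R^-1 < x - a.
    by apply: cvgr_lt m0; exact: (@cvg_harmonic R).
  have h2 : \forall n \near \oo, x - a <= n%:R.
    by move/cvgryPge : ny; apply.
  have [n _ /(_ n (leqnn n)) [/= k1 k2]] :
    \forall n \near \oo, n.+1%:R^-1 < x - a /\ x - a <= n%:R.
    by near=> n; split; near: n.
  exists n => //=; rewrite in_itv/=; move: k1 k2.
  by move: (n.+1%:R^-1) (n%:R) => y w k1 k2; apply/andP; split; lra.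
- by move=> x /=; rewrite in_itv/= andbT; exact: f0.
- by move=> x /=; rewrite in_itv/= andbT; exact: cf.

- by move=> x /=; rewrite in_itv/= andbT; exact: dF.
- have /cvg_at_rightP := Fa; apply; split; first by move=> n; rewrite ltrDl.
  rewrite -[X in _ --> X]addr0; apply: cvgD; first exact: cvg_cst.
  exact: (@cvg_harmonic R).
- have /cvg_pinftyP := Fb; apply.
  apply/cvgryPge => A; near=> n.
  have : A - a - 2 <= n%:R by near: n; move/cvgryPge : ny; apply.
  lra.
Unshelve. all: by end_near. Qed.

End real_integrals.

Section power_integrals.
Context {R : realType}.
Notation mu := (@lebesgue_measure R).
Implicit Types (x y z t p a : R).

Lemma cvgr_powRNy p : 0 < p -> x `^ (- p) @[x --> +oo] --> (0 : R).
Proof.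
move=> p0; apply/cvgrPdist_lt => e e0; near=> x.
have x1 : 0 < x by near: x; exact: nbhs_pinfty_gt.
rewrite sub0r normrN ger0_norm ?powR_ge0// powRN.
rewrite -(invrK e) ltf_pV2 ?posrE ?invr_gt0 ?powR_gt0//.
have -> : e^-1 = ((e^-1) `^ (p^-1)) `^ p.
  by rewrite -powRrM mulVf ?gt_eqF// powRr1// invr_ge0 ltW.
by apply: gt0_ltr_powR => //; rewrite ?nnegrE ?powR_ge0 ?ltW//; near: x; apply: nbhs_pinfty_gt.
Unshelve. all: by end_near. Qed.

Lemma integral_powR0 p x : 0 < p -> 0 < x ->
  (\int[mu]_(t in `]0%R, x[) (t `^ (p - 1))%:E = (x `^ p / p)%:E)%E.
Proof.
move=> p0 x0.
rewrite (@ge0_FTC_oo _ _ (fun t => p^-1 * t `^ p) 0 x 0 (p^-1 * x `^ p))//.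
- by rewrite subr0 mulrC.
- by move=> t _; exact: powR_ge0.
- by move=> t /andP[t0 _]; apply: has_deriv_cont; der.
- move=> t /andP[t0 _]; apply: has_deriv_eq; first by der.
  by rewrite /=; field; rewrite gt_eqF.
- by rewrite -[X in _ --> X](mulr0 p^-1); apply: cvgMl_tmp; exact: powR_cvg0.
- apply: cvgMl_tmp; apply: cvg_at_left_filter.
  by apply: (@has_deriv_cont _ (fun y => y `^ p)); der.
Qed.

Lemma integral_powR_diff p t x : 0 < p -> t < x ->
  (\int[mu]_(s in `]t, x[) ((x - s) `^ (p - 1))%:E = ((x - t) `^ p / p)%:E)%E.
Proof.
move=> p0 tx.
rewrite (@ge0_FTC_oo _ _ (fun s => - p^-1 * (x - s) `^ p) t x (- p^-1 * (x - t) `^ p) (- p^-1 * 0))//.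
- by congr EFin; field; rewrite gt_eqF.
- by move=> s _; exact: powR_ge0.
- by move=> s /andP[_ sx]; apply: has_deriv_cont; der; lra.
- move=> s /andP[_ sx]; apply: has_deriv_eq; first by der; lra.
  by rewrite /=; field; rewrite gt_eqF.
- apply: cvgMl_tmp; apply: cvg_at_right_filter.
  by apply: (@has_deriv_cont _ (fun s => (x - s) `^ p)); der; lra.
- apply: cvgMl_tmp; apply/cvg_at_leftP => u [ux cu].
  have h : (x - u n) @[n --> \oo] --> (0 : R).
    by rewrite -(subrr x); apply: cvgB => //; exact: cvg_cst.
  have /cvg_at_rightP := @powR_cvg0 R p p0; apply; split => // n.
  by rewrite subr_gt0.
Qed.

Lemma integral_powR_y p x : 0 < p -> 0 < x ->
  (\int[mu]_(t in `]x, +oo[) (t `^ (- p - 1))%:E = (x `^ (- p) / p)%:E)%E.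
Proof.
move=> p0 x0.
rewrite (@ge0_FTC_oy _ _ (fun t => - p^-1 * t `^ (- p)) x (- p^-1 * x `^ (- p)) (- p^-1 * 0))//.
- by congr EFin; field; rewrite gt_eqF.
- by move=> t _; exact: powR_ge0.
- by move=> t xt; apply: has_deriv_cont; der; lra.
- move=> t xt; apply: has_deriv_eq; first by der; lra.
  by rewrite /=; field; rewrite gt_eqF.
- apply: cvgMl_tmp; apply: cvg_at_right_filter.
  by apply: (@has_deriv_cont _ (fun s => s `^ (- p))); der; lra.
- by apply: cvgMl_tmp; exact: cvgr_powRNy.
Qed.

Lemma integral_powR_shift_y p z x : 0 < p -> 0 < z + x ->
  (\int[mu]_(t in `]x, +oo[) (p * (z + t) `^ (- p - 1))%:E = ((z + x) `^ (- p))%:E)%E.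
Proof.
move=> p0 x0.
rewrite (@ge0_FTC_oy _ _ (fun t => - (z + t) `^ (- p)) x (- (z + x) `^ (- p)) (- 0))//.
- by congr EFin; ring.
- by move=> t _; rewrite mulr_ge0 ?powR_ge0// ltW.
- by move=> t xt; apply: has_deriv_cont; der; lra.
- move=> t xt; apply: has_deriv_eq; first by der; lra.
  by ring.
- apply: cvgN; apply: cvg_at_right_filter.
  by apply: (@has_deriv_cont _ (fun s => (z + s) `^ (- p))); der; lra.
- apply: cvgN; apply/cvg_pinftyP => u uy.
  have /cvg_pinftyP := @cvgr_powRNy p p0; apply.
  apply/cvgryPge => A; near=> n.
  suff : A - z <= u n by lra.
  by near: n; move/cvgryPge : uy; apply.
Unshelve. all: by end_near. Qed.

(** An incomplete beta integral with an elementary primitive: (x - t) / (z + x) has derivative (z +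
    t) / (z + x)^2. It is what turns the transform of an Abel integral into one with the kernel 1 /
    (z + t). *)
Lemma integral_beta1 p z t : 0 < p -> 0 < z + t ->
  (\int[mu]_(x in `]t, +oo[) ((x - t) `^ (p - 1) * (z + x) `^ (- p - 1))%:E =
   ((p * (z + t))^-1)%:E)%E.
Proof.
move=> p0 zt.
pose F x : R := (p * (z + t))^-1 * ((x - t) `^ p * (z + x) `^ (- p)).
rewrite (@ge0_FTC_oy _ _ F t 0 ((p * (z + t))^-1 * 1))//.
- by rewrite mulr1 subr0.
- by move=> x _; rewrite mulr_ge0 ?powR_ge0.
- by move=> x xt; apply: has_deriv_cont; der; lra.
- move=> x xt; apply: has_deriv_eq; first by der; lra.
  have xt0 : x - t != 0 by rewrite gt_eqF// subr_gt0.
  have zx0 : z + x != 0 by apply: lt0r_neq0; lra.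
  have -> : (x - t) `^ p = (x - t) * (x - t) `^ (p - 1).
    by rewrite mulr_powRB1// subr_ge0 ltW.
  have -> : (z + x) `^ (- p) = (z + x) * (z + x) `^ (- p - 1).
    rewrite -[X in X * _]powRr1; last lra.
    by rewrite -powRD; [congr powR; ring|apply/implyP].
  by rewrite /=; field; apply/andP; split; apply: lt0r_neq0; lra.
- rewrite -(mulr0 (p * (z + t))^-1); apply: cvgMl_tmp.
  rewrite -(mul0r ((z + t) `^ (- p))); apply: cvgM; last first.
    apply: cvg_at_right_filter.
    by apply: (@has_deriv_cont _ (fun s => (z + s) `^ (- p))); der; lra.
  apply/cvg_at_rightP => u [ut cu].
  have /cvg_at_rightP := @powR_cvg0 R p p0; apply; split.
    by move=> n; rewrite subr_gt0.
  by rewrite -(subrr t); apply: cvgB => //; exact: cvg_cst.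
- apply: cvgMl_tmp.
  apply/cvg_pinftyP => u uy.
  have iu : (z + u n)^-1 @[n --> \oo] --> (0 : R).
    apply/gtr0_cvgV0.
      near=> n; suff : 1 - z <= u n by lra.
      by near: n; move/cvgryPge : uy; apply.
    apply/cvgryPge => A; near=> n.
    suff : A - z <= u n by lra.
    by near: n; move/cvgryPge : uy; apply.
  (* One power diverges and the other vanishes; their product is the p-th power of (u - t) / (z + u)
     = 1 - (z + t) / (z + u). *)
  have c1 : (1 - (z + t) * (z + u n)^-1) @[n --> \oo] --> (1 : R).
    rewrite -[X in _ --> X](subr0 1); apply: cvgB; first exact: cvg_cst.
    by rewrite -(mulr0 (z + t)); exact: cvgMl_tmp.
  have : (1 - (z + t) * (z + u n)^-1) `^ p @[n --> \oo] --> (1 `^ p : R).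
    apply: (@cvg_comp _ _ _ _ (fun s : R => s `^ p) _ _ _ c1).
    by apply: (@has_deriv_cont _ (fun s => s `^ p)); der.
  rewrite powR1; apply: cvg_trans; apply: near_eq_cvg; near=> n.
  have h : t < u n by near: n; move/cvgryPgt : uy; apply.
  have zu : 0 < z + u n by lra.
  rewrite powRN.
  have -> : 1 - (z + t) / (z + u n) = (u n - t) / (z + u n) by field; lra.
  rewrite powRM ?subr_ge0 ?invr_ge0 ?ltW//; congr (_ * _).
  by rewrite -powR_inv1 ?ltW// -powRrM mulN1r powRN.
Unshelve. all: by end_near. Qed.

(** Uniqueness of Lebesgue measure: c times the image of [mu] under x |-> c x gives each interval
    its length. *)
Lemma ge0_integral_scale (c : R) (f : R -> \bar R) : 0 < c ->
  measurable_fun (`]0%R, +oo[ : set R) f -> (forall x, 0 < x -> (0 <= f x)%E) ->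
  (\int[mu]_(x in `]0%R, +oo[) f x = \int[mu]_(x in `]0%R, +oo[) (c%:E * f (c * x)%R))%E.
Proof.
move=> c0 mf f0.
pose cc : {nonneg R} := NngNum (ltW c0).
have mphi : measurable_fun setT (fun x : measurableTypeR R => c * x : measurableTypeR R).
  by apply: measurable_funM.
pose pf : {measure set (measurableTypeR R) -> \bar R} :=
  measure_function_pushforward__canonical__measure_function_Measure mu mphi.
pose nu : {measure set (measurableTypeR R) -> \bar R} := mscale cc pf.
have nuE A : measurable A -> mu A = nu A.
  apply: lebesgue_measure_unique => _ [[a b] _ <-].
  rewrite /nu /= /mscale /= /pushforward /=.
  have -> : (fun x : R => c * x) @^-1` `]a, b] = `]c^-1 * a, c^-1 * b]%classic.
    apply/seteqP; split => x /=; rewrite !in_itv/= ltr_pdivrMl// ler_pdivlMl//.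
  rewrite !lebesgue_measure_itv/= !lte_fin ltr_pM2l ?invr_gt0//.
  case: ifPn => // _; last by rewrite mule0.
  by rewrite -!EFinB -EFinM -mulrBr mulrA divff ?gt_eqF// mul1r.
rewrite (eq_measure_integral nu) => [|A mA _]; last exact: nuE.
rewrite ge0_integral_mscale//; last first.
  by move=> x /=; rewrite in_itv/= andbT; exact: f0.
rewrite ge0_integral_pushforward//; last first.
  by move=> x /set_mem/=; rewrite in_itv/= andbT; exact: f0.
have -> : (fun x : R => c * x) @^-1` `]0, +oo[ = `]0, +oo[%classic.
  by apply/seteqP; split => x /=; rewrite !in_itv/= !andbT pmulr_rgt0.
rewrite ge0_integralZl//.
- apply: (measurable_comp (F := (`]0, +oo[%classic : set (measurableTypeR R)))
    (f := f) (g := fun x : measurableTypeR R => (c * x : measurableTypeR R))) => //.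
    by move=> _ [x /= + <-]; rewrite !in_itv/= !andbT pmulr_rgt0.
  exact: measurable_funTS.
- by move=> x /=; rewrite in_itv/= andbT => x0; rewrite f0// pmulr_rgt0.
- by rewrite lee_fin ltW.
Qed.

End power_integrals.

(** * Holomorphic functions on a strip *)

Section cauchy_riemann.
Context {R : realType}.

(* [f1 + i f2] is complex differentiable at [v + i phi], with derivative [a + i b]. *)
Definition holo (f1 f2 : R -> R -> R) (v phi a b : R) : Prop :=
  [/\ has_deriv (f1 ^~ phi) v a, has_deriv (f2 ^~ phi) v b,
      has_deriv (f1 v) phi (- b) & has_deriv (f2 v) phi a].

(** [U + i V] is the complex quotient f / g and [A + i B] is f' - (f / g) g', so the derivative is
    (A + i B) / g. In this form a bound on the derivative reduces to bounds on the quotient itself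
    and on 1 / |g|^2. *)
Lemma holo_div (f1 f2 g1 g2 : R -> R -> R) (v phi a b c d : R) :
  g1 v phi ^+ 2 + g2 v phi ^+ 2 != 0 ->
  holo f1 f2 v phi a b -> holo g1 g2 v phi c d ->
  let n := g1 v phi ^+ 2 + g2 v phi ^+ 2 in
  let U v phi := (f1 v phi * g1 v phi + f2 v phi * g2 v phi) /
                 (g1 v phi * g1 v phi + g2 v phi * g2 v phi) in
  let V v phi := (f2 v phi * g1 v phi - f1 v phi * g2 v phi) /
                 (g1 v phi * g1 v phi + g2 v phi * g2 v phi) in
  let A := a - (U v phi * c - V v phi * d) in
  let B := b - (U v phi * d + V v phi * c) in
  holo U V v phi ((A * g1 v phi + B * g2 v phi) / n)
                 ((B * g1 v phi - A * g2 v phi) / n).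
Proof.
move=> g0 [fa fb fc fd] [ga gb gc gd] n U V A B.
have g0' : g1 v phi * g1 v phi + g2 v phi * g2 v phi != 0 by rewrite -!expr2.
split; (apply: has_deriv_eq;
  [rewrite /U /V; apply: derM; [der|apply: derV => //; der] |
   rewrite /A /B /n /U /V /=; field; rewrite ?andbT//]).
Qed.

Lemma holo_exp (f1 f2 : R -> R -> R) (v phi a b : R) :
  holo f1 f2 v phi a b ->
  let M1 v phi := expR (f1 v phi) * cos (f2 v phi) in
  let M2 v phi := expR (f1 v phi) * sin (f2 v phi) in
  holo M1 M2 v phi (M1 v phi * a - M2 v phi * b) (M1 v phi * b + M2 v phi * a).
Proof.
move=> [fa fb fc fd] M1 M2.
by split; (apply: has_deriv_eq; [rewrite /M1 /M2; der | rewrite /M1 /M2 /=; ring]).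
Qed.

End cauchy_riemann.

Section strip.
Context {R : realType}.
Notation mu := (@lebesgue_measure R).
Variables (U V a b : R -> R -> R) (Phi : R) (h k : R -> R).
Hypothesis Phi0 : 0 < Phi.
Hypothesis hol : forall v phi, 0 < phi < Phi -> holo U V v phi (a v phi) (b v phi).
Hypothesis ca : forall phi, 0 < phi < Phi -> continuous (a ^~ phi).
Hypothesis ba : forall (n : nat) (e : R), 0 < e -> exists K : R,
  forall v phi, - n%:R <= v <= n%:R -> e < phi < Phi -> `|a v phi| <= K.
Hypothesis bU : forall v phi, 0 < phi < Phi -> `|U v phi| <= h v.
Hypothesis bV : forall v phi, 0 < phi < Phi -> `|V v phi| <= h v.
Hypothesis ih : mu.-integrable setT (EFin \o h).
Hypothesis hy : h n%:R @[n --> \oo] --> (0 : R).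
Hypothesis hNy : h (- n%:R) @[n --> \oo] --> (0 : R).
Hypothesis bk : forall v phi, v != 0 -> 0 < phi < Phi -> `|V v phi| <= k v * phi.

Let J (n : nat) phi : R := (\int[mu]_(v in `[- n%:R, n%:R]) V v phi)%R.

Let cV phi : 0 < phi < Phi -> continuous (V ^~ phi).
Proof. by move=> hp v; have [_ h1 _ _] := hol v hp; exact: has_deriv_cont h1. Qed.

Let ab n phi : 0 < phi < Phi -> (0 < n)%N ->
  (\int[mu]_(v in `[- n%:R, n%:R]) a v phi)%R = U n%:R phi - U (- n%:R) phi.
Proof.
move=> hp n0; rewrite /Rintegral (@continuous_FTC2 _ (a ^~ phi) (U ^~ phi))//.
- by apply: (@lt_trans _ _ 0); rewrite ?oppr_lt0 ltr0n.
- by apply: continuous_subspaceT; exact: ca.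
- have c x : {for x, continuous (U ^~ phi)}.
    by have [h1 _ _ _] := hol x hp; exact: has_deriv_cont h1.
  split.
  + by move=> x _; have [[h1 _] _ _ _] := hol x hp.
  + exact: cvg_at_right_filter (c _).
  + exact: cvg_at_left_filter (c _).
- by move=> x _; have [[_ h1] _ _ _] := hol x hp; rewrite derive1E.
Qed.

Let iV n phi : 0 < phi < Phi -> mu.-integrable `[- n%:R, n%:R] (EFin \o V ^~ phi).
Proof.
move=> hp; apply: continuous_compact_integrable; first exact: segment_compact.
by apply: continuous_subspaceT; exact: cV.
Qed.

(** The derivative of [V] in the height equals that of [U] in [v], whose integral is a boundary
    term. Differentiation under the integral is dominated on ]phi / 2, Phi[, so [ba] may degenerate
    as the height tends to 0. *)
Let dJ n phi : 0 < phi < Phi -> (0 < n)%N ->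
  has_deriv (J n) phi (U n%:R phi - U (- n%:R) phi).
Proof.
move=> /andP[p0 pP] n0.
have [K HK] := @ba n (phi / 2) (divr_gt0 p0 (ltr0n _ 2)).
pose G := fun _ : R => `|K|.
have in1 : `]phi / 2, Phi[%classic phi.
  by rewrite /= in_itv/= pP andbT; lra.
have sub x : `]phi / 2, Phi[%classic x -> 0 < x < Phi.
  by rewrite /= in_itv/= => /andP[x1 ->]; rewrite andbT; lra.
have i1 x : `]phi / 2, Phi[%classic x ->
    mu.-integrable `[- n%:R, n%:R] (EFin \o (fun v => V v x)).
  by move=> /sub; exact: iV.
have d1 x y : `]phi / 2, Phi[%classic x -> `[- n%:R, n%:R]%classic y ->
    derivable (fun p => V y p) x 1.
  by move=> /sub hx _; have [_ _ _ []] := hol y hx.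
have pE x y : `]phi / 2, Phi[%classic x ->
    partial1of2 (fun p v => V v p) x y = a y x.
  by move=> /sub hx; rewrite partial1of2E; have [_ _ _ []] := hol y hx.
have iG : mu.-integrable `[- n%:R, n%:R] (EFin \o G).
  apply: continuous_compact_integrable; first exact: segment_compact.
  by apply: continuous_subspaceT => x; exact: cst_continuous.
have G0 y : 0 <= G y by exact: normr_ge0.
have bG x y : `]phi / 2, Phi[%classic x -> `[- n%:R, n%:R]%classic y ->
    `|partial1of2 (fun p v => V v p) x y| <= G y.
  move=> hx; rewrite pE// /= in_itv/= => hy1.
  by rewrite (le_trans (HK _ _ hy1 _)) ?ler_norm.
have mD : measurable (`[- n%:R, n%:R]%classic : set R) by [].
have D1 := @derivable_under_integral R _ _ mu (fun p v => V v p) _ mD phi _ _ in1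
  i1 d1 G G0 iG bG.
have D2 := @differentiation_under_integral R _ _ mu (fun p v => V v p) _ mD phi _ _ in1
  i1 d1 G G0 iG bG.
split => //.
rewrite -derive1E D2 -(ab _ n0) ?p0//.
by apply: eq_Rintegral => v _; rewrite pE.
Qed.

(* By the Cauchy-Riemann equations the derivative in [phi] of the integral of
   [V] over [- n, n] is a boundary term; the integral itself tends to 0 with
   [phi]. *)
Lemma strip_integral_eq0 phi0 : 0 < phi0 < Phi ->
  (\int[mu]_(v in `[- n%:R, n%:R]) V v phi0)%R @[n --> \oo] --> (0 : R).
Proof.
move=> /andP[p0 pP].
have e_cvg : (phi0 / n.+2%:R) @[n --> \oo] --> (0 : R).
  rewrite -(mulr0 phi0); apply: cvgMl_tmp.
  have -> : (fun n => n.+2%:R^-1 : R) = (fun n => harmonic (n + 1)%N).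
    by apply/funext => n; rewrite /harmonic /= addn1.
  by rewrite (cvg_shiftn 1); exact: cvg_harmonic.
(* The lower height tends to 0 while the segment grows; the shift by 2 keeps it strictly below
   [phi0]. *)
pose e n : R := phi0 / n.+2%:R.
have e0 n : 0 < e n by rewrite divr_gt0.
have ep n : e n < phi0.
  by rewrite ltr_pdivrMr// ltr_pMr// ltr1n.
have eP n : 0 < e n < Phi by rewrite e0 (lt_trans (ep n)).
(* At the lower height the integrand tends to 0 for every nonzero v by [bk], under the integrable
   bound [h]. *)
have c1 : J n (e n) @[n --> \oo] --> (0 : R).
  pose f_ n := (fun v => (V v (e n))%:E) \_ `[- n%:R, n%:R]%classic.
  have mf n : measurable_fun setT (f_ n).
    apply/(measurable_restrictT _ _).1 => //; apply/measurable_EFinP.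
    by apply: measurable_funTS; apply: continuous_measurable_fun; exact: cV.
  have [] := @dominated_convergence _ _ _ mu setT measurableT f_ (cst 0%E) (EFin \o h).
  - exact: mf.
  - exact: measurable_cst.
  - exists [set 0]; split => //; first exact: lebesgue_measure_set1.
    move=> v /= hv; apply: contrapT => /eqP v0; apply: hv => _.
    apply/cvg_abse0P.
    apply: (@squeeze_cvge _ _ _ _ (cst 0%E) _ (fun n => (k v * e n)%:E)).
    + near=> n; rewrite abse_ge0/= /f_ /patch; case: ifPn => _.
        by rewrite lee_fin bk.
      rewrite abse0 lee_fin (le_trans _ (bk v0 (eP n)))//.
    + exact: cvg_cst.
    + apply: cvg_EFin; first by near=> n.
      by rewrite -(mulr0 (k v)); exact: cvgMl_tmp.
  - exact: ih.
  - apply: aeW => v n _; rewrite /f_ /patch; case: ifPn => _ /=.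
      by rewrite lee_fin bV.
    by rewrite normr0 lee_fin (le_trans (normr_ge0 _) (bV v (eP 0))).
  move=> _ _; rewrite integral0 => hc.
  have -> : (fun n => J n (e n)) = (fun n => fine (\int[mu]_v f_ n v)%E).
    by apply/funext => n; rewrite /J /Rintegral integral_mkcond.
  exact: fine_cvg hc.
(* Mean value theorem in the height: the difference is at most [phi0] times the boundary terms,
   which vanish by [hy] and [hNy]. *)
have c2 : (J n phi0 - J n (e n)) @[n --> \oo] --> (0 : R).
  apply: (@squeeze_cvgr _ _ _ _ (fun n => - (phi0 * (h n%:R + h (- n%:R))))
     (fun n => phi0 * (h n%:R + h (- n%:R)))).
  - near=> n.
    have n0 : (0 < n)%N by near: n; exact: nbhs_infty_gt.
    have D x : x \in `](e n), phi0[%R -> is_derive x 1 (J n) (U n%:R x - U (- n%:R) x).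
      rewrite in_itv/= => /andP[x1 x2]; apply: dJ => //.
      by rewrite (lt_trans (e0 n) x1) (lt_trans x2 pP).
    have CJ : {within `[e n, phi0], continuous (J n)}.
      apply: continuous_in_subspaceT => x /set_mem /=; rewrite in_itv/= => /andP[x1 x2].
      apply: has_deriv_cont; apply: dJ => //.
      by rewrite (lt_le_trans (e0 n) x1) (le_lt_trans x2 pP).
    have [c + ->] := MVT (ep n) D CJ.
    rewrite in_itv/= => /andP[x1 x2].
    have hc : 0 < c < Phi by rewrite (lt_trans (e0 n) x1) (lt_trans x2 pP).
    rewrite -ler_norml normrM mulrC.
    have -> : `|phi0 - e n| = phi0 - e n by rewrite ger0_norm// subr_ge0 ltW.
    apply: ler_pM => //.
    + by rewrite subr_ge0 ltW.
    + by rewrite lerBlDr lerDl ltW.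
    + by rewrite (le_trans (ler_normB _ _))// lerD// bU.
  - rewrite -[X in _ --> X]oppr0; apply: cvgN.
    rewrite -(mulr0 phi0) -[X in _ * X](addr0 0); apply: cvgMl_tmp; exact: cvgD.
  - rewrite -(mulr0 phi0) -[X in _ * X](addr0 0); apply: cvgMl_tmp; exact: cvgD.
have -> : (fun n => (\int[mu]_(v in `[- n%:R, n%:R]) V v phi0)%R) =
          (fun n => (J n phi0 - J n (e n)) + J n (e n)).
  by apply/funext => n; rewrite subrK.
by rewrite -[X in _ --> X](addr0 0); exact: cvgD.
Unshelve. all: by end_near. Qed.

End strip.

(** * Elementary estimates *)

Section elementary_bounds.
Context {R : realType}.
Implicit Types (x y B : R).

Lemma lipschitz_deriv (f df : R -> R) x y :
  (forall z, has_deriv f z (df z)) -> (forall z, `|df z| <= 1) ->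
  `|f x - f y| <= `|x - y|.
Proof.
move=> hf h1; wlog xy : x y / y < x.
  move=> H; have [/H//|xy|->] := ltgtP y x; last by rewrite !subrr normr0.
  by rewrite distrC (distrC x); exact: H.
have D z : z \in `]y, x[%R -> is_derive z 1 f (df z) by move=> _; exact: hf.
have C : {within `[y, x], continuous f}.
  by apply: continuous_subspaceT => z; exact: has_deriv_cont (hf z).
have [c _ ->] := MVT xy D C.
by rewrite normrM ler_piMl.
Qed.

Lemma norm_sin_le x : `|sin x| <= `|x|.
Proof.
have := @lipschitz_deriv sin cos x 0; rewrite sin0 !subr0; apply.
  by move=> z; exact: is_derive_sin.
by move=> z; exact: cos_max.
Qed.

Lemma norm_cosB1_le x : `|cos x - 1| <= `|x|.
Proof.
have := @lipschitz_deriv cos (fun x => - sin x) x 0; rewrite cos0 !subr0; apply.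
  by move=> z; exact: is_derive_cos.
by move=> z; rewrite normrN; exact: sin_max.
Qed.

Lemma norm_expRB_le B x y : x <= B -> y <= B ->
  `|expR x - expR y| <= expR B * `|x - y|.
Proof.
wlog xy : x y / y <= x.
  move=> H; have [/H//|/ltW/H h] := leP y x.
  by move=> xB yB; rewrite distrC (distrC x); exact: h.
move=> xB _; rewrite !ger0_norm ?subr_ge0 ?ler_expR//.
have : expR x * (1 + (y - x)) <= expR y.
  rewrite (_ : expR y = expR x * expR (y - x)); last by rewrite -expRD; congr expR; ring.
  by rewrite ler_pM2l ?expR_gt0// expR_ge1Dx.
have : expR x * (x - y) <= expR B * (x - y).
  by rewrite ler_wpM2r ?subr_ge0// ler_expR.
lra.
Qed.

Lemma norm_lnB_le B x y : 0 < B -> B <= x -> B <= y ->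
  `|ln x - ln y| <= B^-1 * `|x - y|.
Proof.
move=> B0; wlog xy : x y / y <= x.
  move=> H; have [/H//|/ltW/H h] := leP y x.
  by move=> xB yB; rewrite distrC (distrC x); exact: h.
move=> xB yB; have x0 := lt_le_trans B0 xB; have y0 := lt_le_trans B0 yB.
rewrite !ger0_norm ?subr_ge0 ?ler_ln ?posrE//.
rewrite -lnV ?posrE// -lnM ?posrE ?invr_gt0//.
have -> : x / y = 1 + (x - y) / y by field; rewrite gt_eqF.
apply: (le_trans (le_ln1Dx _)).
  by apply: (@lt_le_trans _ _ 0); rewrite ?ltrN10// divr_ge0 ?subr_ge0// ltW.
by rewrite mulrC ler_wpM2r ?subr_ge0// lef_pV2 ?posrE.
Qed.

(** Applied to half a height of the strip, whence the range up to 3 pi / 4. Up to pi / 4 the mean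
    value theorem gives sin x >= cos (pi / 4) x; beyond, |cos x| <= cos (pi / 4) and cos^2 (pi / 4)
    = 1 / 2 give sin x >= cos (pi / 4). Dividing by 1 + pi serves both ranges. *)
Lemma sin_linear_lower x : 0 < x < 3 / 4 * pi ->
  cos (pi / 4) / (1 + pi) * x <= sin x :> R.
Proof.
move=> /andP[x0 x1]; have p0 := pi_gt0 R.
have c0 : 0 < cos (pi / 4 : R) by apply: cos_gt0_pihalf; apply/andP; split; lra.
have pp : 0 < 1 + pi :> R by lra.
have [x4|x4] := leP x (pi / 4).
  have D z : z \in `]0, x[%R -> is_derive z 1 sin (cos z) by move=> _; exact: is_derive_sin.
  have C : {within `[0, x], continuous (@sin R)}.
    by apply: continuous_subspaceT => z; exact: continuous_sin.
  have [c + H] := MVT x0 D C.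
  rewrite in_itv/= => /andP[c1 c2].
  move: H; rewrite sin0 !subr0 => ->; rewrite ler_wpM2r//; first exact: ltW.
  apply: (@le_trans _ _ (cos (pi / 4))).
    rewrite ler_pdivrMr//; have : 0 < cos (pi / 4) * pi :> R by exact: mulr_gt0.
    lra.
  by rewrite leNgt ltr_cos -?leNgt ?in_itv/=; [lra|apply/andP; split; lra|apply/andP; split; lra].
have s0 : 0 <= sin x by apply: sin_ge0_pi; apply/andP; split; lra.
apply: (@le_trans _ _ (cos (pi / 4))).
  rewrite mulrAC ler_pdivrMr// ler_pM2l//; lra.
have c1 : cos x <= cos (pi / 4).
  by rewrite leNgt ltr_cos -?leNgt ?in_itv/=; [lra|apply/andP; split; lra|apply/andP; split; lra].
have c2 : - cos (pi / 4) <= cos x.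
  have -> : - cos (pi / 4) = cos (pi - pi / 4) :> R.
    by rewrite cosB cospi sinpi mul0r addr0 mulN1r.
  by rewrite leNgt ltr_cos -?leNgt ?in_itv/=; [lra|apply/andP; split; lra|apply/andP; split; lra].
rewrite -ler_sqr ?nnegrE ?(ltW c0)// sin2cos2.
have h : cos x ^+ 2 <= cos (pi / 4) ^+ 2.
  rewrite -subr_ge0 (_ : _ - _ = (cos (pi / 4) - cos x) * (cos (pi / 4) + cos x)); last ring.
  by apply: mulr_ge0; lra.
have : cos (pi / 4) ^+ 2 *+ 2 - 1 = 0 :> R.
  by rewrite -cos_mulr2n -cos_pihalf; congr cos; rewrite mulr2n; field.
rewrite mulr2n; lra.
Qed.

Lemma atan_cot x : 0 < x < pi -> atan (cos x / sin x) = pi / 2 - x.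
Proof.
move=> /andP[x0 x1].
have -> : cos x / sin x = tan (pi / 2 - x).
  rewrite /tan sinB cosB sin_pihalf cos_pihalf !mul1r !mul0r subr0 add0r.
  by [].
by rewrite tanK// in_itv/=; apply/andP; split; lra.
Qed.

Lemma sin_atan x : sin (atan x) = x * cos (atan x).
Proof.
have c0 : cos (atan x) != 0.
  by rewrite gt_eqF// cos_gt0_pihalf// atan_gtNpi2 atan_ltpi2.
by rewrite -{2}[x]atanK /tan divfK.
Qed.

Lemma ctM (f g : R -> R) x : {for x, continuous f} -> {for x, continuous g} ->
  {for x, continuous (fun y => f y * g y)}.
Proof. by move=> hf hg; exact: cvgM. Qed.
Lemma ctD (f g : R -> R) x : {for x, continuous f} -> {for x, continuous g} ->
  {for x, continuous (fun y => f y + g y)}.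
Proof. by move=> hf hg; exact: cvgD. Qed.
Lemma ctN (f : R -> R) x : {for x, continuous f} ->
  {for x, continuous (fun y => - f y)}.
Proof. by move=> hf; exact: cvgN. Qed.
Lemma ctV (f : R -> R) x : f x != 0 -> {for x, continuous f} ->
  {for x, continuous (fun y => (f y)^-1)}.
Proof. by move=> f0 hf; exact: cvgV. Qed.
Lemma ctC (c x : R) : {for x, continuous (fun _ : R => c)}.
Proof. exact: cvg_cst. Qed.

End elementary_bounds.

Section bounded_on.
Context {R : realType}.
Variable S : R -> R -> Prop.
Implicit Types f g : R -> R -> R.

Definition bounded_on f := exists K : R, forall v p, S v p -> `|f v p| <= K.

Lemma bdM f g : bounded_on f -> bounded_on g -> bounded_on (fun v p => f v p * g v p).
Proof.
move=> [K hf] [L hg]; exists (K * L) => v p s.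
by rewrite normrM ler_pM ?hf ?hg.
Qed.
Lemma bdD f g : bounded_on f -> bounded_on g -> bounded_on (fun v p => f v p + g v p).
Proof.
move=> [K hf] [L hg]; exists (K + L) => v p s.
by rewrite (le_trans (ler_normD _ _))// lerD ?hf ?hg.
Qed.
Lemma bdN f : bounded_on f -> bounded_on (fun v p => - f v p).
Proof. by move=> [K hf]; exists K => v p s; rewrite normrN hf. Qed.
Lemma bdC (c : R) : bounded_on (fun _ _ => c).
Proof. by exists `|c|. Qed.
Lemma bdV f d : 0 < d -> (forall v p, S v p -> d <= f v p) ->
  bounded_on (fun v p => (f v p)^-1).
Proof.
move=> d0 h; exists d^-1 => v p s; have hs := h _ _ s.
have f0 := lt_le_trans d0 hs.
rewrite ger0_norm; first by rewrite lef_pV2 ?posrE.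
by rewrite invr_ge0 ltW.
Qed.

End bounded_on.

Ltac bd := repeat first [ assumption | apply: bdM | apply: bdD | apply: bdN | apply: bdC ].
Ltac ct := lazymatch goal with
  | |- {for _, continuous (fun w => _ * _)} => apply: ctM; ct
  | |- {for _, continuous (fun w => _ + _)} => apply: ctD; ct
  | |- {for _, continuous (fun w => - _)} => apply: ctN; ct
  | |- _ => first [ apply: ctC | assumption ]
  end.

(** The expression is the derivative [sa] of the quotient studied below, at a fixed height. With
    arbitrary functions for its constituents, continuity is purely structural. *)
Lemma ct_alg {R : realType} (M1 M2 P Q U V D1 D2 E F N : R -> R) (al t k s v : R) :
  {for v, continuous M1} -> {for v, continuous M2} -> {for v, continuous P} ->
  {for v, continuous Q} -> {for v, continuous U} -> {for v, continuous V} ->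
  {for v, continuous D1} -> {for v, continuous D2} -> {for v, continuous E} ->
  {for v, continuous F} -> {for v, continuous N} ->
  {for v, continuous (fun w =>
    ((M1 w * (2^-1 - t * (al * P w)) - M2 w * (- (t * (al * Q w))) -
      (U w * (2^-1 * ((E w + F w) * k)) - V w * (2^-1 * ((E w - F w) * s)))) * D1 w +
     (M1 w * (- (t * (al * Q w))) + M2 w * (2^-1 - t * (al * P w)) -
      (U w * (2^-1 * ((E w - F w) * s)) + V w * (2^-1 * ((E w + F w) * k)))) * D2 w) * N w)}.
Proof. by move=> *; ct. Qed.

(** * The function m(q) = e^(q/2) (1 + c e^(alpha q))^(- theta) on a strip *)

Section kernel_on_strip.
Context {R : realType}.
Notation mu := (@lebesgue_measure R).
Variables (alpha theta c Phi : R).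
Hypotheses (al0 : 0 < alpha) (al1 : alpha < 1) (th0 : 0 < theta) (c0 : 0 < c).
Hypotheses (piPhi : pi < Phi) (Phi1 : Phi < 3 / 2 * pi) (Phi2 : alpha * Phi < pi).

(* With q = v + i p and m(q) = e^(q/2) (1 + c e^(alpha q))^(- theta):
   [srho] and [spsi] are the squared modulus and the argument of
   1 + c e^(alpha q), [sX + i sY] = log m(q), [sX0] = log m(0),
   [sN1 + i sN2] = m(q) - m(0) and [sD1 + i sD2] = 2 sinh(q/2). *)
Definition su (v : R) : R := c * expR (alpha * v).
Definition srho (v p : R) : R :=
  (su v + cos (alpha * p)) * (su v + cos (alpha * p)) +
  sin (alpha * p) * sin (alpha * p).
Definition spsi (v p : R) : R :=
  alpha * p - pi / 2 + atan ((su v + cos (alpha * p)) / sin (alpha * p)).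
Definition sX (v p : R) : R := 2^-1 * v - theta / 2 * ln (srho v p).
Definition sY (v p : R) : R := 2^-1 * p - theta * spsi v p.
Definition sX0 : R := - (theta / 2 * ln ((c + 1) * (c + 1))).
Definition sN1 (v p : R) : R := expR (sX v p) * cos (sY v p) - expR sX0.
Definition sN2 (v p : R) : R := expR (sX v p) * sin (sY v p).
Definition sD1 (v p : R) : R := (expR (2^-1 * v) - expR (- (2^-1 * v))) * cos (2^-1 * p).
Definition sD2 (v p : R) : R := (expR (2^-1 * v) + expR (- (2^-1 * v))) * sin (2^-1 * p).

Implicit Types (v p : R).

Let p0 : 0 < pi :> R. Proof. exact: pi_gt0. Qed.

Lemma su_gt0 v : 0 < su v. Proof. by rewrite mulr_gt0 ?expR_gt0. Qed.

Lemma srhoE v p : srho v p = su v ^+ 2 + 2 * su v * cos (alpha * p) + 1.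
Proof.
by rewrite /srho -!expr2 sqrrD -addrA cos2Dsin2 -mulr_natl mulrA.
Qed.

Lemma sbeta p : 0 < p < Phi -> 0 < alpha * p < pi.
Proof.
move=> /andP[h1 h2]; rewrite mulr_gt0//=.
by apply: lt_trans Phi2; rewrite ltr_pM2l.
Qed.

Lemma ssin_gt0 p : 0 < p < Phi -> 0 < sin (alpha * p).
Proof. by move=> /sbeta; exact: sin_gt0_pi. Qed.

Lemma skappa_gt0 : 0 < sin (alpha * Phi) ^+ 2.
Proof.
rewrite exprn_gt0// sin_gt0_pi// Phi2 andbT mulr_gt0//.
exact: lt_trans piPhi.
Qed.

(** Since the cosine decreases on [0, pi], p may be replaced by [Phi]; then u^2 + 2 u cos b + 1 is
    completed to a square in two ways, as (u + cos b)^2 + sin^2 b and as (1 + u cos b)^2 + u^2 sin^2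
    b. The bounds are uniform in the height; the first serves for v near - oo, the second for v near
    + oo. *)
Lemma srho_ge p v : 0 < p < Phi ->
  sin (alpha * Phi) ^+ 2 <= srho v p /\
  sin (alpha * Phi) ^+ 2 * su v ^+ 2 <= srho v p.
Proof.
move=> hp; rewrite srhoE.
have cc : cos (alpha * Phi) <= cos (alpha * p).
  have /andP[h1 h2] := sbeta hp; have /andP[h3 h4] := hp.
  have h5 : alpha * p < alpha * Phi by rewrite ltr_pM2l.
  have i1 : alpha * p \in `[0, pi] by rewrite in_itv/=; apply/andP; split; lra.
  have i2 : alpha * Phi \in `[0, pi].
    by rewrite in_itv/= (ltW Phi2) andbT (le_trans (ltW h1) (ltW h5)).
  by apply: ltW; rewrite ltr_cos.
have h : su v ^+ 2 + 2 * su v * cos (alpha * Phi) + 1 <=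
         su v ^+ 2 + 2 * su v * cos (alpha * p) + 1.
  by rewrite lerD2r lerD2l ler_wpM2l// mulr_ge0// ltW// su_gt0.
have s2 := sin2cos2 (alpha * Phi).
rewrite s2; split; apply: le_trans h; rewrite -subr_ge0.
  rewrite (_ : _ - _ = (su v + cos (alpha * Phi)) ^+ 2); last ring.
  exact: sqr_ge0.
rewrite (_ : _ - _ = (1 + su v * cos (alpha * Phi)) ^+ 2); last ring.
exact: sqr_ge0.
Qed.

Lemma srho_gt0 v p : 0 < p < Phi -> 0 < srho v p.
Proof. by move=> /(srho_ge v)[h _]; apply: lt_le_trans h; exact: skappa_gt0. Qed.

(* [sP + i sQ] = c e^(alpha q) / (1 + c e^(alpha q)). *)
Definition sP (v p : R) : R := (su v * su v + su v * cos (alpha * p)) / srho v p.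
Definition sQ (v p : R) : R := su v * sin (alpha * p) / srho v p.

(** log m(q) = q / 2 - theta log (1 + c e^(alpha q)) has derivative 1 / 2 - theta alpha (sP + i sQ).
    Taking the arctangent of a cotangent for the argument avoids any distinction of quadrants, as
    sin (alpha p) stays positive. *)
Lemma holo_log v p : 0 < p < Phi ->
  holo sX sY v p (2^-1 - theta * (alpha * sP v p)) (- (theta * (alpha * sQ v p))).
Proof.
move=> hp.
have s0 : sin (alpha * p) != 0 by rewrite gt_eqF// ssin_gt0.
have r0 := srho_gt0 v hp.
have r0' : srho v p != 0 by rewrite gt_eqF.
have e : 1 + ((su v + cos (alpha * p)) / sin (alpha * p)) ^+ 2 =
    srho v p / (sin (alpha * p) * sin (alpha * p)).
  by rewrite /srho; field.
have r1 := r0; have r1' := r0'; rewrite /srho in r1 r1'.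
have du : has_deriv su v (alpha * su v).
  by apply: has_deriv_eq; [rewrite /su; der|rewrite /su /=; ring].
split.
- apply: has_deriv_eq; first by rewrite /sX /srho; der.
  by rewrite /sP /srho /=; field.
- apply: has_deriv_eq; first by rewrite /sY /spsi; der.
  by rewrite /= e /sQ; field; rewrite s0 r0'.
- apply: has_deriv_eq; first by rewrite /sX /srho; der.
  by rewrite /sQ /srho /=; field.
- apply: has_deriv_eq; first by rewrite /sY /spsi; der.
  by rewrite /= e /sP /srho; field; rewrite s0 r1'.
Qed.

Lemma holo_sD v p : holo sD1 sD2 v p
  (2^-1 * ((expR (2^-1 * v) + expR (- (2^-1 * v))) * cos (2^-1 * p)))
  (2^-1 * ((expR (2^-1 * v) - expR (- (2^-1 * v))) * sin (2^-1 * p))).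
Proof.
by split; (apply: has_deriv_eq; [rewrite /sD1 /sD2; der | rewrite /=; ring]).
Qed.

Definition sM1 (v p : R) : R := expR (sX v p) * cos (sY v p).
Definition sM2 (v p : R) : R := expR (sX v p) * sin (sY v p).
Definition sMa v p : R := sM1 v p * (2^-1 - theta * (alpha * sP v p)) -
  sM2 v p * (- (theta * (alpha * sQ v p))).
Definition sMb v p : R := sM1 v p * (- (theta * (alpha * sQ v p))) +
  sM2 v p * (2^-1 - theta * (alpha * sP v p)).

Lemma holo_sN v p : 0 < p < Phi -> holo sN1 sN2 v p (sMa v p) (sMb v p).
Proof.
move=> /(holo_log v) /holo_exp[h1 h2 h3 h4]; rewrite /sN1 /sN2.
split; [| exact: h2 | | exact: h4].
- by apply: has_deriv_eq; [apply: derD; [exact: h1|der]|rewrite ?oppr0 addr0].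
- by apply: has_deriv_eq; [apply: derD; [exact: h3|der]|rewrite ?oppr0 addr0].
Qed.

(** The identity |2 sinh (q / 2)|^2 = 4 sinh^2 (v / 2) + 4 sin^2 (p / 2). Its two terms give lower
    bounds away from v = 0 and away from p = 0. *)
Lemma sDnE v p : sD1 v p ^+ 2 + sD2 v p ^+ 2 =
  (expR (2^-1 * v) - expR (- (2^-1 * v))) ^+ 2 + 4 * sin (2^-1 * p) ^+ 2.
Proof.
have e : expR (2^-1 * v) * expR (- (2^-1 * v)) = 1 by rewrite -expRD subrr expR0.
rewrite /sD1 /sD2 !exprMn cos2sin2.
rewrite [X in _ = X](_ : _ = (expR (2^-1 * v) - expR (- (2^-1 * v))) ^+ 2 +
  4 * (expR (2^-1 * v) * expR (- (2^-1 * v))) * sin (2^-1 * p) ^+ 2); first by ring.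
by rewrite e mulr1.
Qed.

Lemma shalf_sin_gt0 p : 0 < p < Phi -> 0 < sin (2^-1 * p).
Proof.
move=> /andP[h1 h2]; have h3 := Phi1; have h4 := pi_gt0 R.
by apply: sin_gt0_pi; apply/andP; split; lra.
Qed.

Lemma sDn_gt0 v p : 0 < p < Phi -> 0 < sD1 v p ^+ 2 + sD2 v p ^+ 2.
Proof.
move=> hp; rewrite sDnE ltr_wpDl ?sqr_ge0// mulr_gt0// exprn_gt0//.
exact: shalf_sin_gt0.
Qed.

(* [sU + i sV] is the quotient of [sN1 + i sN2] by [sD1 + i sD2], and
   [sa + i sb] is its derivative; subtracting m(0) above removes the pole at
   q = 0. *)
Definition sU (v p : R) : R := (sN1 v p * sD1 v p + sN2 v p * sD2 v p) /
  (sD1 v p * sD1 v p + sD2 v p * sD2 v p).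
Definition sV (v p : R) : R := (sN2 v p * sD1 v p - sN1 v p * sD2 v p) /
  (sD1 v p * sD1 v p + sD2 v p * sD2 v p).
Definition sC (v p : R) : R := 2^-1 * ((expR (2^-1 * v) + expR (- (2^-1 * v))) * cos (2^-1 * p)).
Definition sE (v p : R) : R := 2^-1 * ((expR (2^-1 * v) - expR (- (2^-1 * v))) * sin (2^-1 * p)).
Definition sA (v p : R) : R := sMa v p - (sU v p * sC v p - sV v p * sE v p).
Definition sB (v p : R) : R := sMb v p - (sU v p * sE v p + sV v p * sC v p).
Definition sa (v p : R) : R := (sA v p * sD1 v p + sB v p * sD2 v p) /
  (sD1 v p ^+ 2 + sD2 v p ^+ 2).
Definition sb (v p : R) : R := (sB v p * sD1 v p - sA v p * sD2 v p) /
  (sD1 v p ^+ 2 + sD2 v p ^+ 2).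

Lemma holo_sUV v p : 0 < p < Phi -> holo sU sV v p (sa v p) (sb v p).
Proof.
move=> hp; apply: (holo_div _ (holo_sN v hp) (holo_sD v p)).
by rewrite gt_eqF// sDn_gt0.
Qed.

Lemma continuous_sa p : 0 < p < Phi -> continuous (sa ^~ p).
Proof.
move=> hp v.
have [cX cY _ _] := holo_log v hp.
have [cD1 cD2 _ _] := holo_sD v p.
have [cU cV _ _] := holo_sUV v hp.
move: (has_deriv_cont cD1) (has_deriv_cont cD2) (has_deriv_cont cU) (has_deriv_cont cV).
move=> {}cD1 {}cD2 {}cU {}cV.
have hM1 : {for v, continuous (fun v => sM1 v p)}.
  by apply: has_deriv_cont; rewrite /sM1; der.
have hM2 : {for v, continuous (fun v => sM2 v p)}.
  by apply: has_deriv_cont; rewrite /sM2; der.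
have hE : {for v, continuous (fun v : R => expR (2^-1 * v))} by apply: has_deriv_cont; der.
have hF : {for v, continuous (fun v : R => expR (- (2^-1 * v)))} by apply: has_deriv_cont; der.
have hu : {for v, continuous su} by apply: has_deriv_cont; rewrite /su; der.
have hr : {for v, continuous (fun v => (srho v p)^-1)}.
  by apply: ctV; [rewrite gt_eqF// srho_gt0|rewrite /srho; ct].
have hn : {for v, continuous (fun v => (sD1 v p * sD1 v p + sD2 v p * sD2 v p)^-1)}.
  by apply: ctV; [rewrite -!expr2 gt_eqF// sDn_gt0|ct].
have hP : {for v, continuous (fun v => sP v p)} by rewrite /sP; ct.
have hQ : {for v, continuous (fun v => sQ v p)} by rewrite /sQ; ct.
have -> : sa ^~ p = (fun w => (sA w p * sD1 w p + sB w p * sD2 w p) *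
    (sD1 w p * sD1 w p + sD2 w p * sD2 w p)^-1).
  by apply/funext => w; rewrite /sa !expr2.
have h : {for v, continuous (fun w => (sA w p * sD1 w p + sB w p * sD2 w p) *
    (sD1 w p * sD1 w p + sD2 w p * sD2 w p)^-1)}.
  exact: (@ct_alg _ (sM1 ^~ p) (sM2 ^~ p) (sP ^~ p) (sQ ^~ p) (sU ^~ p) (sV ^~ p)
    (sD1 ^~ p) (sD2 ^~ p) (fun v => expR (2^-1 * v)) (fun v => expR (- (2^-1 * v)))).
exact: h.
Qed.

(** [sa] is polynomial in bounded functions and in the reciprocals of the two squared moduli; the
    one of 1 + c e^(alpha q) is controlled on the whole strip, the one of 2 sinh (q / 2) only for p
    > e. *)
Lemma bounded_sa (n : nat) (e : R) : 0 < e -> exists K : R,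
  forall v p, - n%:R <= v <= n%:R -> e < p < Phi -> `|sa v p| <= K.
Proof.
move=> e0; pose S (v p : R) := - n%:R <= v <= n%:R /\ e < p < Phi.
suff [K HK] : bounded_on S sa by exists K => v p h1 h2; exact: HK.
have Sp v p : S v p -> 0 < p < Phi.
  by move=> [_ /andP[h1 h2]]; rewrite h2 (lt_trans e0).
have bcos (f : R -> R -> R) : bounded_on S (fun v p => cos (f v p)).
  by exists 1 => v p _; exact: cos_max.
have bsin (f : R -> R -> R) : bounded_on S (fun v p => sin (f v p)).
  by exists 1 => v p _; exact: sin_max.
have bexp (a : R) : bounded_on S (fun v p => expR (a * v)).
  exists (expR (`|a| * n%:R)) => v p [/andP[h1 h2] _].
  rewrite ger0_norm ?expR_ge0// ler_expR (le_trans (ler_norm _))// normrM.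
  by rewrite ler_wpM2l// ler_norml h1.
have bE := bexp 2^-1.
have bF : bounded_on S (fun v p => expR (- (2^-1 * v))).
  by have [K h] := bexp (- 2^-1); exists K => v p /h; rewrite mulNr.
have bu : bounded_on S (fun v p => su v) by rewrite /su; bd; exact: bexp.
have br : bounded_on S (fun v p => (srho v p)^-1).
  by apply: (@bdV _ _ _ _ skappa_gt0) => v p /Sp /(srho_ge v)[].
have bX : bounded_on S (fun v p => expR (sX v p)).
  have [K h] := bE; exists (K * expR (- (theta / 2 * ln (sin (alpha * Phi) ^+ 2)))).
  move=> v p s; rewrite /sX expRD normrM.
  apply: ler_pM; [exact: normr_ge0|exact: normr_ge0|exact: h s|].
  rewrite ger0_norm ?expR_ge0// ler_expR lerN2.
  apply: ler_wpM2l; first by rewrite divr_ge0// ltW.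
  have [h1 _] := srho_ge v (Sp _ _ s).
  by rewrite ler_ln ?posrE ?skappa_gt0 ?srho_gt0//; exact: Sp s.
have bM1 : bounded_on S sM1 by rewrite /sM1; bd.
have bM2 : bounded_on S sM2 by rewrite /sM2; bd.
have bN1 : bounded_on S sN1 by rewrite /sN1; bd.
have bN2 : bounded_on S sN2 by rewrite /sN2; bd.
have bD1 : bounded_on S sD1 by rewrite /sD1; bd; exact: bcos.
have bD2 : bounded_on S sD2 by rewrite /sD2; bd; exact: bsin.
have bP : bounded_on S sP by rewrite /sP; bd; exact: bcos.
have bQ : bounded_on S sQ by rewrite /sQ; bd; exact: bsin.
have bn : bounded_on S (fun v p => (sD1 v p * sD1 v p + sD2 v p * sD2 v p)^-1).
  (* The value at p = e of the linear lower bound for sin (p / 2). *)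
  pose k : R := cos (pi / 4) / (1 + pi) * (2^-1 * e).
  have k0 : 0 < k.
    have h4 := pi_gt0 R; apply: mulr_gt0; last lra.
    by apply: divr_gt0; [apply: cos_gt0_pihalf; apply/andP; split; lra|lra].
  apply: (@bdV _ _ _ (k ^+ 2)); first by rewrite exprn_gt0.
  move=> v p s; rewrite -!expr2 sDnE.
  have : k <= sin (2^-1 * p).
    have [_ /andP[h1 h2]] := s; have h3 := Phi1; have h4 := pi_gt0 R.
    apply: le_trans (@sin_linear_lower _ (2^-1 * p) _); last first.
      by apply/andP; split; lra.
    rewrite ler_wpM2l ?divr_ge0//; last lra.
      by apply: ltW; apply: cos_gt0_pihalf; apply/andP; split; lra.
    by have := pi_gt0 R; lra.
  move=> ks; have : k ^+ 2 <= sin (2^-1 * p) ^+ 2.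
    by apply: lerXn2r => //; rewrite nnegrE; lra.
  have := sqr_ge0 (expR (2^-1 * v) - expR (- (2^-1 * v))).
  have := sqr_ge0 k; lra.
have bU : bounded_on S sU by rewrite /sU; bd.
have bV : bounded_on S sV by rewrite /sV; bd.
have bC : bounded_on S sC by rewrite /sC; bd; exact: bcos.
have bE' : bounded_on S sE by rewrite /sE; bd; exact: bsin.
have bMa : bounded_on S sMa by rewrite /sMa; bd.
have bMb : bounded_on S sMb by rewrite /sMb; bd.
have bA : bounded_on S sA by rewrite /sA; bd.
have bB : bounded_on S sB by rewrite /sB; bd.
have [K HK] : bounded_on S (fun v p => (sA v p * sD1 v p + sB v p * sD2 v p) *
  (sD1 v p * sD1 v p + sD2 v p * sD2 v p)^-1) by bd.
by exists K => v p /HK; rewrite /sa -!expr2.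
Qed.

End kernel_on_strip.

(** * Exponential decay of the quotient, uniform in the height *)

Section exp_abs.
Context {R : realType}.
Notation mu := (@lebesgue_measure R).

Lemma integrable_exp_abs (k K : R) : 0 < k ->
  mu.-integrable setT (EFin \o (fun v => K * expR (- (k * `|v|)))).
Proof.
move=> k0.
have ce : continuous (fun v : R => expR (- (k * `|v|))).
  move=> v; apply: (@continuous_comp _ _ _ (fun v => - (k * `|v|)) expR); last exact: continuous_expR.
  apply: (@ctN R (fun v => k * `|v|)); apply: (@ctM R (fun=> k) (fun v => `|v|)).
    exact: cvg_cst.
  exact: norm_continuous.
have -> : EFin \o (fun v : R => K * expR (- (k * `|v|))) = (fun v : R => K%:E * (expR (- (k * `|v|)))%:E)%E.
  by apply/funext => v.
apply: integrableZl => //; apply/integrableP; split.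
  by apply/measurable_EFinP; exact: continuous_measurable_fun.
have -> : (\int[mu]_x `|(expR (- (k * `|x|)))%:E| = \int[mu]_x (expR (- (k * `|x|)))%:E)%E.
  by apply: eq_integral => x _; rewrite gee0_abs// lee_fin expR_ge0.
rewrite ge0_symfun_integralT//; last by move=> x /=; rewrite normrN.
have -> : [set x : R | 0 <= x] = `[0, +oo[%classic.
  by apply/seteqP; split => x /=; rewrite in_itv/= andbT.
rewrite -integral_itv_obnd_cbnd; last first.
  by apply/measurable_EFinP; apply: measurable_funTS; exact: continuous_measurable_fun.
have -> : (\int[mu]_(x in `]0%R, +oo[) (expR (- (k * `|x|)))%:E =
           \int[mu]_(x in `]0%R, +oo[) (expR (- (k * x)))%:E)%E.
  apply: eq_integral => x /set_mem /=; rewrite in_itv/= andbT => x0.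
  by rewrite gtr0_norm.
rewrite (@ge0_FTC_oy _ _ (fun x => - (k^-1 * expR (- (k * x)))) 0 (- (k^-1 * expR (- (k * 0)))) (- (k^-1 * 0)))//.
- by rewrite -EFinM ltry.
- by move=> x _; apply: has_deriv_cont; der.
- move=> x _; apply: has_deriv_eq; first by der.
  by rewrite /=; field; rewrite gt_eqF.
- apply: cvg_at_right_filter.
  by apply: (@has_deriv_cont _ (fun x => - (k^-1 * expR (- (k * x))))); der.
- apply: cvgN; apply: cvgMl_tmp; apply/cvgrPdist_lt => e e0; near=> x.
  rewrite sub0r normrN ger0_norm ?expR_ge0// expRN -(invrK e) ltf_pV2 ?posrE ?invr_gt0 ?expR_gt0//.
  apply: (@lt_le_trans _ _ (1 + k * x)); last exact: expR_ge1Dx.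
  have : e^-1 / k < x by near: x; apply: nbhs_pinfty_gt; exact: num_real.
  by rewrite ltr_pdivrMr// (mulrC x); lra.
Unshelve. all: by end_near. Qed.

Lemma cvg_exp_natN (k : R) : 0 < k -> expR (- (k * n%:R)) @[n --> \oo] --> (0 : R).
Proof.
move=> k0; have -> : (fun n : nat => expR (- (k * n%:R))) = (fun n => expR (- k) ^+ n).
  by apply/funext => n; rewrite -expRM_natl -mulNr mulrC.
by apply: cvg_expr; rewrite ger0_norm ?expR_ge0// expR_lt1 oppr_lt0.
Qed.

End exp_abs.

Section quotient_bounds.
Context {R : realType}.
(** With r the modulus of d1 + i d2, both |d1| and |d2| are at most r, so each part of the complex
    quotient is at most (|n1| + |n2|) / r. *)
Lemma quot_norm_le (n1 n2 d1 d2 d : R) : 0 < d -> d ^+ 2 <= d1 ^+ 2 + d2 ^+ 2 ->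
  `|(n1 * d1 + n2 * d2) / (d1 ^+ 2 + d2 ^+ 2)| <= (`|n1| + `|n2|) / d /\
  `|(n2 * d1 - n1 * d2) / (d1 ^+ 2 + d2 ^+ 2)| <= (`|n1| + `|n2|) / d.
Proof.
move=> d0 dD; set n := d1 ^+ 2 + d2 ^+ 2 in dD *.
have n0 : 0 < n by apply: lt_le_trans dD; rewrite exprn_gt0.
pose r := Num.sqrt n.
have r0 : 0 < r by rewrite sqrtr_gt0.
have rE : n = r * r by rewrite -expr2 sqr_sqrtr// ltW.
have dr : d <= r by rewrite -(ger0_norm (ltW d0)) -sqrtr_sqr ler_wsqrtr.
have l1 : `|d1| <= r by rewrite -sqrtr_sqr ler_wsqrtr// lerDl sqr_ge0.
have l2 : `|d2| <= r by rewrite -sqrtr_sqr ler_wsqrtr// lerDr sqr_ge0.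
have key (x : R) : `|x| <= (`|n1| + `|n2|) * r -> `|x / n| <= (`|n1| + `|n2|) / d.
  move=> hx; rewrite normrM normfV (ger0_norm (ltW n0)) rE invfM mulrA.
  apply: (@le_trans _ _ ((`|n1| + `|n2|) / r)).
    by rewrite ler_pM2r ?invr_gt0// ler_pdivrMr.
  by rewrite ler_wpM2l ?addr_ge0// lef_pV2 ?posrE.
split; apply: key.
  by rewrite (le_trans (ler_normD _ _))// !normrM mulrDl lerD// ler_wpM2l.
by rewrite (le_trans (ler_normB _ _))// !normrM mulrDl addrC lerD// ler_wpM2l.
Qed.

(** The imaginary part of a quotient is of order p when both imaginary parts are, the real parts
    being bounded and the denominator bounded away from 0. *)
Lemma quot_norm_le2 (n1 n2 d1 d2 a1 a2 b1 b2 m p : R) :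
  0 <= p -> 0 < m -> m <= d1 ^+ 2 + d2 ^+ 2 ->
  `|d1| <= b1 -> `|d2| <= b2 * p -> `|n1| <= a1 -> `|n2| <= a2 * p ->
  `|(n2 * d1 - n1 * d2) / (d1 ^+ 2 + d2 ^+ 2)| <= (a2 * b1 + a1 * b2) / m * p.
Proof.
move=> p0 m0; set n := d1 ^+ 2 + d2 ^+ 2 => mn hd1 hd2 hn1 hn2.
have n0 : 0 < n := lt_le_trans m0 mn.
rewrite normrM normfV (ger0_norm (ltW n0)) mulrAC; apply: ler_pM => //.
- by rewrite invr_ge0 ltW.
- apply: (le_trans (ler_normB _ _)); rewrite !normrM mulrDl; apply: lerD.
    by rewrite mulrAC; apply: ler_pM.
  by rewrite -mulrA; apply: ler_pM.
- by rewrite lef_pV2 ?posrE.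
Qed.

End quotient_bounds.

Section strip_bounds.
Context {R : realType}.
Notation mu := (@lebesgue_measure R).
Variables (alpha theta c Phi : R).
Hypotheses (al0 : 0 < alpha) (al1 : alpha < 1) (th0 : 0 < theta) (c0 : 0 < c).
Hypotheses (piPhi : pi < Phi) (Phi1 : Phi < 3 / 2 * pi) (Phi2 : alpha * Phi < pi).
Implicit Types (v p : R).

Notation rho := (srho alpha c).
Notation psi := (spsi alpha c).
Notation X := (sX alpha theta c).
Notation Y := (sY alpha theta c).
Notation N1 := (sN1 alpha theta c).
Notation N2 := (sN2 alpha theta c).
Notation D1 := (@sD1 R).
Notation D2 := (@sD2 R).
Notation U := (sU alpha theta c).
Notation V := (sV alpha theta c).
Notation X0 := (sX0 theta c).
Notation kap := (sin (alpha * Phi) ^+ 2).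
(** [C0] is kap^(- theta / 2), a bound for |1 + c e^(alpha q)|^(- theta) on the strip; [C1] is c^(-
    theta), the constant of its decay in v; [CY] bounds the argument of m by a multiple of the
    height; [m0] is m(0). *)
Let C0 := expR (- (theta / 2 * ln kap)).
Let C1 := expR (- (theta * ln c)).
Let CY := 2^-1 + theta * alpha.
Let m0 := expR X0.
Let kap0 : 0 < kap := skappa_gt0 al0 piPhi Phi2.

Let eX1 v p : 0 < p < Phi -> expR (X v p) <= expR (2^-1 * v) * C0.
Proof.
move=> hp; rewrite /sX expRD ler_pM2l ?expR_gt0// ler_expR lerN2.
apply: ler_wpM2l; first by rewrite divr_ge0// ltW.
have [h1 _] := srho_ge al0 c0 Phi2 v hp.
by rewrite ler_ln ?posrE ?kap0// (srho_gt0 al0 c0 piPhi Phi2).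
Qed.

(** Of order e^((1 / 2 - alpha theta) v), from the lower bound of the squared modulus by [kap] times
    (c e^(alpha v))^2. *)
Let eX2 v p : 0 < p < Phi ->
  expR (X v p) <= expR (2^-1 * v) * C0 * (C1 * expR (- (alpha * theta * v))).
Proof.
move=> hp; rewrite /sX /C0 /C1 -!expRD ler_expR.
have [_ h1] := srho_ge al0 c0 Phi2 v hp.
have u0 := su_gt0 alpha c0 v.
have : ln (kap * su alpha c v ^+ 2) <= ln (rho v p).
  rewrite ler_ln ?posrE; [exact: h1| |exact: (srho_gt0 al0 c0 piPhi Phi2)].
  by rewrite mulr_gt0// exprn_gt0.
have -> : su alpha c v ^+ 2 = expR (2 * (ln c + alpha * v)).
  by rewrite /su -{1}[c]lnK ?posrE// -expRD -expRM_natl.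
rewrite lnM ?posrE ?expR_gt0// expRK => h.
have : theta / 2 * (ln kap + 2 * (ln c + alpha * v)) <= theta / 2 * ln (rho v p).
  by rewrite ler_wpM2l// divr_ge0// ltW.
lra.
Qed.

(** The arctangent lies between atan (cot (alpha p)) = pi / 2 - alpha p, reached in the limit u = 0,
    and pi / 2. *)
Let psi_bnd v p : 0 < p < Phi -> 0 <= psi v p <= alpha * p.
Proof.
move=> hp; have hb := sbeta al0 Phi2 hp.
have s0 : 0 < sin (alpha * p) by exact: sin_gt0_pi.
rewrite /spsi; apply/andP; split; last by have := atan_ltpi2 ((su alpha c v + cos (alpha * p)) / sin (alpha * p)); lra.
have : atan (cos (alpha * p) / sin (alpha * p)) <=
       atan ((su alpha c v + cos (alpha * p)) / sin (alpha * p)).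
  by apply: le_atan; rewrite ler_pM2r ?invr_gt0// lerDr ltW// su_gt0.
rewrite atan_cot//; lra.
Qed.

Let Y_bnd v p : 0 < p < Phi -> `|Y v p| <= CY * p.
Proof.
move=> hp; have /andP[h1 h2] := psi_bnd v hp; have /andP[p0 _] := hp.
rewrite /sY (le_trans (ler_normB _ _))// /CY mulrDl lerD//.
  by rewrite ger0_norm ?mulr_ge0// ltW.
by rewrite -mulrA normrM !ger0_norm ?(ltW th0)// ler_pM2l.
Qed.

Let N1_bnd v p : `|N1 v p| <= expR (X v p) + m0.
Proof.
rewrite /sN1 (le_trans (ler_normB _ _))// (ger0_norm (expR_ge0 X0)) lerD2r.
by rewrite normrM (ger0_norm (expR_ge0 _)) ler_piMr ?expR_ge0// cos_max.
Qed.

Let N2_bnd v p : `|N2 v p| <= expR (X v p).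
Proof. by rewrite /sN2 normrM (ger0_norm (expR_ge0 _)) ler_piMr ?expR_ge0// sin_max. Qed.

Let N2_bnd' v p : 0 < p < Phi -> `|N2 v p| <= expR (X v p) * (CY * p).
Proof.
move=> hp; rewrite /sN2 normrM (ger0_norm (expR_ge0 _)) ler_pM2l ?expR_gt0//.
exact: le_trans (norm_sin_le _) (Y_bnd v hp).
Qed.

Let UV_le v p (d : R) : 0 < d -> d ^+ 2 <= D1 v p ^+ 2 + D2 v p ^+ 2 ->
  `|U v p| <= (`|N1 v p| + `|N2 v p|) / d /\ `|V v p| <= (`|N1 v p| + `|N2 v p|) / d.
Proof. by move=> d0 dD; rewrite /sU /sV -!expr2; exact: quot_norm_le. Qed.

(** For |v| >= 1, e^(|v| / 2) - e^(- |v| / 2) = e^(|v| / 2) (1 - e^(- |v|)) is at least [k1] e^(|v|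
    / 2). *)
Let k1 : R := 1 - expR (- 1).
Let k1_gt0 : 0 < k1. Proof. by rewrite subr_gt0 expR_lt1 oppr_lt0. Qed.

(** The rate of decay of the quotient: after division by sinh, m decays at rate alpha theta near +
    oo, while the subtracted m(0) decays at rate 1 / 2 on both sides. *)
Let kp := Num.min (alpha * theta) (2^-1 : R).
Let kp_gt0 : 0 < kp. Proof. by rewrite lt_min mulr_gt0//= invr_gt0. Qed.
Let kp1 : kp <= alpha * theta. Proof. by rewrite ge_min lexx. Qed.
Let kp2 : kp <= 2^-1. Proof. by rewrite ge_min lexx orbT. Qed.

Let bound_ge1 v p : 1 <= v -> 0 < p < Phi ->
  (`|N1 v p| + `|N2 v p|) / (k1 * expR (2^-1 * v)) <=
  (2 * (C0 * C1) + m0) / k1 * expR (- (kp * `|v|)).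
Proof.
move=> v1 hp; have v0 : 0 <= v by lra.
rewrite (ger0_norm v0).
have h1 := N1_bnd v p; have h2 := N2_bnd v p; have h3 := eX2 v hp.
have E0 := expR_gt0 (2^-1 * v).
set E := expR (2^-1 * v) in h3 E0 *.
rewrite ler_pdivrMr ?mulr_gt0//.
have -> : (2 * (C0 * C1) + m0) / k1 * expR (- (kp * v)) * (k1 * E) =
  (2 * (C0 * C1) + m0) * expR (- (kp * v)) * E by field; rewrite gt_eqF.
have e1 : expR (- (alpha * theta * v)) <= expR (- (kp * v)).
  by rewrite ler_expR lerN2 ler_wpM2r.
have e2 : 1 <= expR (- (kp * v)) * E.
  rewrite /E -expRD -[X in X <= _]expR0 ler_expR.
  by rewrite addrC subr_ge0 ler_wpM2r.
have e3 : m0 <= m0 * (expR (- (kp * v)) * E) by rewrite ler_peMr ?expR_ge0.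
have e4 : E * C0 * (C1 * expR (- (alpha * theta * v))) <= E * C0 * (C1 * expR (- (kp * v))).
  by rewrite ler_wpM2l ?mulr_ge0 ?expR_ge0 ?(ltW E0)// ler_wpM2l ?expR_ge0.
rewrite (_ : (2 * (C0 * C1) + m0) * expR (- (kp * v)) * E =
  2 * (E * C0 * (C1 * expR (- (kp * v)))) + m0 * (expR (- (kp * v)) * E)); last by ring.
lra.
Qed.

Let bound_leN1 v p : v <= - 1 -> 0 < p < Phi ->
  (`|N1 v p| + `|N2 v p|) / (k1 * expR (- (2^-1 * v))) <=
  (2 * C0 + m0) / k1 * expR (- (kp * `|v|)).
Proof.
move=> v1 hp; have v0 : v <= 0 by lra.
rewrite (ler0_norm v0) invfM mulrA mulrN opprK.
have h1 := N1_bnd v p; have h2 := N2_bnd v p; have h3 := eX1 v hp.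
rewrite -(expRN (- (2^-1 * v))) opprK.
rewrite [X in _ <= X]mulrAC [X in X <= _]mulrAC ler_wpM2r ?invr_ge0 ?(ltW k1_gt0)//.
have E0 := expR_gt0 (2^-1 * v).
have e1 : expR (2^-1 * v) <= 1 by rewrite -[X in _ <= X]expR0 ler_expR; lra.
have e2 : expR (2^-1 * v) <= expR (kp * v).
  by rewrite ler_expR ler_wnM2r.
have l0 : `|N1 v p| + `|N2 v p| <= 2 * C0 + m0.
  apply: (@le_trans _ _ (2 * (expR (2^-1 * v) * C0) + m0)); first lra.
  by rewrite lerD2r ler_wpM2l// ler_piMl ?expR_ge0.
by apply: ler_pM => //; rewrite ?addr_ge0 ?expR_ge0.
Qed.

Let cs : R := cos (pi / 4) / (1 + pi).
Let cs0 : 0 < cs.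
Proof.
have h4 := pi_gt0 R; apply: divr_gt0; last lra.
by apply: cos_gt0_pihalf; apply/andP; split; lra.
Qed.
Let mm := Num.min (expR (- 2^-1)) cs.
Let mm0 : 0 < mm. Proof. by rewrite lt_min expR_gt0. Qed.

(** The pole: |2 sinh (q / 2)| is at least a multiple of |v| + p. For |v| <= 1 one has |e^(v/2) -
    e^(- v/2)| >= e^(- 1/2) |v|, the sine has its linear bound, and 4 (x^2 + y^2) >= (x + y)^2 joins
    the two. *)
Let small_D v p : `|v| <= 1 -> 0 < p < Phi ->
  (2^-1 * mm * (`|v| + p)) ^+ 2 <= D1 v p ^+ 2 + D2 v p ^+ 2.
Proof.
move=> v1 hp; rewrite sDnE; have /andP[p0 pP] := hp.
have hs : cs * (2^-1 * p) <= sin (2^-1 * p).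
  apply: sin_linear_lower; have h1 := Phi1; apply/andP; split; lra.
have he : expR (- 2^-1) * `|v| <= `|expR (2^-1 * v) - expR (- (2^-1 * v))|.
  wlog v0 : v v1 / 0 <= v.
    move=> H; have [/H|/ltW v0] := leP 0 v; first exact.
    have := H (- v); rewrite normrN oppr_ge0 => /(_ v1 v0).
    by rewrite mulrN opprK distrC.
  rewrite ger0_norm// in v1 *.
  have h1 : expR (- 2^-1) <= expR (- (2^-1 * v)) by rewrite ler_expR; lra.
  have h2 := expR_ge1Dx v.
  have h3 : expR (2^-1 * v) = expR (- (2^-1 * v)) * expR v.
    by rewrite -expRD; congr expR; field.
  apply: le_trans (ler_norm _); rewrite h3.
  have h4 : expR (- 2^-1) * v <= expR (- (2^-1 * v)) * v by rewrite ler_wpM2r.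
  have h5 : expR (- (2^-1 * v)) * (1 + v) <= expR (- (2^-1 * v)) * expR v.
    by rewrite ler_pM2l ?expR_gt0.
  lra.
have m1 : mm <= expR (- 2^-1) by rewrite ge_min lexx.
have m2 : mm <= cs by rewrite ge_min lexx orbT.
have g1 : (mm * `|v|) ^+ 2 <= (expR (2^-1 * v) - expR (- (2^-1 * v))) ^+ 2.
  rewrite -[X in _ <= X]real_normK ?num_real//.
  apply: lerXn2r; rewrite ?nnegrE ?mulr_ge0 ?(ltW mm0)//.
  by apply: le_trans he; rewrite ler_wpM2r.
have g2 : (mm * (2^-1 * p)) ^+ 2 <= sin (2^-1 * p) ^+ 2.
  apply: lerXn2r; rewrite ?nnegrE.
  - by rewrite mulr_ge0 ?(ltW mm0)//; lra.
  - by apply: le_trans hs; rewrite mulr_ge0 ?(ltW cs0)//; lra.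
  - by apply: le_trans hs; rewrite ler_wpM2r//; lra.
have g3 := sqr_ge0 (mm * `|v| - mm * p).
move: g1 g2 g3; move: (`|v|) => w.
set E := (expR _ - expR _) ^+ 2; set s := sin _ ^+ 2.
move=> g1 g2 g3.
apply: (@le_trans _ _ ((mm * w) ^+ 2 + 4 * (mm * (2^-1 * p)) ^+ 2)); last lra.
rewrite -subr_ge0.
have -> : (mm * w) ^+ 2 + 4 * (mm * (2^-1 * p)) ^+ 2 - (2^-1 * mm * (w + p)) ^+ 2 =
  4^-1 * (mm * w - mm * p) ^+ 2 + 2^-1 * (mm * w) ^+ 2 + 2^-1 * (mm * p) ^+ 2 by field.
by apply: addr_ge0; [apply: addr_ge0|]; (apply: mulr_ge0; [rewrite invr_ge0|exact: sqr_ge0]).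
Qed.

(** The zero of m(q) - m(0) at q = 0 compensates the pole. Lipschitz bounds for cos, ln and exp
    compose to an estimate linear in |v| + p. *)
Let small_N : exists2 CN : R, 0 <= CN & forall v p, `|v| <= 1 -> 0 < p < Phi ->
  `|N1 v p| + `|N2 v p| <= CN * (`|v| + p).
Proof.
have ac1 : alpha <= 1 by exact: ltW.
pose B := expR (2^-1) * C0.
have B0 : 0 <= B by rewrite mulr_ge0 ?expR_ge0.
have CY0 : 0 <= CY by rewrite addr_ge0 ?invr_ge0// mulr_ge0// ltW.
have eXB v p : `|v| <= 1 -> 0 < p < Phi -> expR (X v p) <= B.
  move=> v1 hp; apply: le_trans (eX1 v hp) _; rewrite ler_pM2r ?expR_gt0// ler_expR.
  by have := ler_norm v; lra.
(* A common lower bound of the squared moduli at q and at 0, above which the logarithm is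
   Lipschitz. *)
pose kk := Num.min kap ((c + 1) * (c + 1)).
have kk0 : 0 < kk by rewrite lt_min kap0/= mulr_gt0// addr_gt0.
have [CR CR0 hR] : exists2 CR : R, 0 <= CR & forall v p, `|v| <= 1 -> 0 < p < Phi ->
    `|rho v p - (c + 1) * (c + 1)| <= CR * (`|v| + p).
  pose L := c * (expR 1).
  have L0 : 0 <= L by rewrite mulr_ge0 ?expR_ge0// ltW.
  exists ((L + c) * L + 2 * L + 2 * c) => [|v p v1 hp].
    by rewrite !addr_ge0 ?mulr_ge0 ?addr_ge0// ltW.
  have /andP[p0 _] := hp.
  have av : `|alpha * v| <= `|v| by rewrite normrM (ger0_norm (ltW al0)) ler_piMl.
  have hu : `|su alpha c v - c| <= L * `|v|.
    rewrite /su -{2}[c]mulr1 -mulrBr normrM (ger0_norm (ltW c0)) /L -mulrA ler_pM2l//.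
    rewrite -expR0; apply: le_trans (@norm_expRB_le _ 1 _ _ _ _) _ => //.
      exact: le_trans (ler_norm _) (le_trans av v1).
    by rewrite subr0 expR0 ler_wpM2l ?expR_ge0.
  have u0 := ltW (su_gt0 alpha c0 v).
  have uL : su alpha c v <= L.
    rewrite /su /L ler_pM2l// ler_expR.
    exact: le_trans (ler_norm _) (le_trans av v1).
  have hc : `|cos (alpha * p) - 1| <= p.
    apply: le_trans (norm_cosB1_le _) _.
    by rewrite ger0_norm ?ler_piMl// ?mulr_ge0// ltW.
  rewrite srhoE.
  rewrite (_ : _ - _ = (su alpha c v + c) * (su alpha c v - c) +
    (2 * ((su alpha c v - c) * cos (alpha * p)) + 2 * (c * (cos (alpha * p) - 1)))); last by ring.
  have t1 : `|(su alpha c v + c) * (su alpha c v - c)| <= (L + c) * L * `|v|.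
    rewrite normrM -mulrA; apply: ler_pM => //.
    by rewrite ger0_norm ?addr_ge0 ?(ltW c0)// lerD2r.
  have t2 : `|2 * ((su alpha c v - c) * cos (alpha * p))| <= 2 * L * `|v|.
    rewrite normrM (ger0_norm (ler0n _ 2)) -mulrA ler_pM2l// normrM.
    apply: le_trans hu; rewrite ler_piMr// cos_max//.
  have t3 : `|2 * (c * (cos (alpha * p) - 1))| <= 2 * c * p.
    by rewrite normrM (ger0_norm (ler0n _ 2)) -mulrA ler_pM2l// normrM (ger0_norm (ltW c0)) ler_pM2l.
  have q1 : 0 <= (L + c) * L * p by rewrite !mulr_ge0 ?addr_ge0// ltW.
  have q2 : 0 <= 2 * L * p by rewrite !mulr_ge0// ltW.
  have q3 : 0 <= 2 * c * `|v| by rewrite !mulr_ge0// ltW.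
  apply: (le_trans (ler_normD _ _)).
  apply: (le_trans (lerD t1 (le_trans (ler_normD _ _) (lerD t2 t3)))).
  lra.
(* A common upper bound of [X v p] and [X0], below which the exponential is Lipschitz. *)
pose Bm := Num.max (ln B) X0.
have B0' : 0 < B by rewrite mulr_gt0 ?expR_gt0.
pose CX := 2^-1 + theta / 2 * (kk^-1 * CR).
have CX0 : 0 <= CX by rewrite addr_ge0 ?invr_ge0// !mulr_ge0 ?invr_ge0 ?(ltW kk0) ?(ltW th0).
exists (expR Bm * CX + B * CY + B * CY) => [|v p v1 hp].
  by rewrite !addr_ge0 ?mulr_ge0 ?expR_ge0.
have /andP[p0 _] := hp.
have w0 : 0 <= `|v| + p by rewrite addr_ge0// ltW.
have hX : `|X v p - X0| <= CX * (`|v| + p).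
  have -> : X v p - X0 = 2^-1 * v - theta / 2 * (ln (rho v p) - ln ((c + 1) * (c + 1))).
    by rewrite /sX /sX0; ring.
  apply: (le_trans (ler_normB _ _)).
  have -> : CX * (`|v| + p) = 2^-1 * (`|v| + p) + theta / 2 * (kk^-1 * CR) * (`|v| + p).
    by rewrite /CX; ring.
  apply: lerD.
    by rewrite normrM ger0_norm ?invr_ge0// ler_pM2l ?invr_gt0// lerDl ltW.
  rewrite normrM ger0_norm ?divr_ge0 ?(ltW th0)// -mulrA ler_pM2l ?divr_gt0//.
  apply: le_trans (@norm_lnB_le _ kk _ _ kk0 _ _) _.
  - rewrite ge_min; apply/orP; left; exact: (srho_ge al0 c0 Phi2 v hp).1.
  - by rewrite ge_min lexx orbT.
  - by rewrite -mulrA ler_pM2l ?invr_gt0// hR.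
have n2 : `|N2 v p| <= B * CY * (`|v| + p).
  apply: le_trans (N2_bnd' v hp) _; rewrite -mulrA; apply: ler_pM => //.
  - by rewrite mulr_ge0// ltW.
  - exact: eXB.
  - by rewrite ler_wpM2l// lerDr.
have n1 : `|N1 v p| <= expR Bm * CX * (`|v| + p) + B * CY * (`|v| + p).
  rewrite (_ : N1 v p = (expR (X v p) - expR X0) + expR (X v p) * (cos (Y v p) - 1)); last first.
    by rewrite /sN1; ring.
  rewrite (le_trans (ler_normD _ _))// lerD//.
    rewrite -mulrA; apply: le_trans (@norm_expRB_le _ Bm _ _ _ _) _.
    - by rewrite le_max -ler_expR lnK ?posrE// eXB.
    - by rewrite le_max lexx orbT.
    - by rewrite ler_pM2l ?expR_gt0.
  rewrite normrM (ger0_norm (expR_ge0 _)) -mulrA; apply: ler_pM => //.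
  - exact: eXB.
  - apply: le_trans (norm_cosB1_le _) (le_trans (Y_bnd v hp) _).
    by rewrite ler_wpM2l// lerDr.
by rewrite !mulrDl lerD.
Qed.

(** Three regimes: near q = 0 the zero of the numerator against the pole, and for v > 1 and v < - 1
    the growth of sinh against that of m. *)
Lemma strip_UV_bound : exists2 K : R, 0 <= K & forall v p, 0 < p < Phi ->
  `|U v p| <= K * expR (- (kp * `|v|)) /\ `|V v p| <= K * expR (- (kp * `|v|)).
Proof.
have [CN CN0 hN] := small_N.
(* The factor e^kp compensates e^(- kp |v|), which is at least e^(- kp) for |v| <= 1. *)
pose K1 := CN / (2^-1 * mm) * expR kp.
pose K2 := (2 * (C0 * C1) + m0) / k1.
pose K3 := (2 * C0 + m0) / k1.
have K10 : 0 <= K1.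
  apply: mulr_ge0; last exact: expR_ge0.
  by apply: divr_ge0 => //; apply: mulr_ge0; [rewrite invr_ge0|exact: ltW].
have K20 : 0 <= K2.
  apply: divr_ge0; last exact: ltW.
  by rewrite addr_ge0 ?mulr_ge0 ?expR_ge0.
have K30 : 0 <= K3.
  apply: divr_ge0; last exact: ltW.
  by rewrite addr_ge0 ?mulr_ge0 ?expR_ge0.
exists (K1 + K2 + K3) => [|v p hp]; first by rewrite !addr_ge0.
have e0 := expR_ge0 (- (kp * `|v|)).
have mono (K : R) x : K <= K1 + K2 + K3 -> x <= K * expR (- (kp * `|v|)) ->
    x <= (K1 + K2 + K3) * expR (- (kp * `|v|)).
  by move=> h1 h2; apply: le_trans h2 _; rewrite ler_wpM2r.
have [v1|v1] := leP `|v| 1.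
  have w0 : 0 < `|v| + p by rewrite ltr_wpDl//; case/andP: hp.
  have d0 : 0 < 2^-1 * mm * (`|v| + p) by rewrite !mulr_gt0 ?invr_gt0.
  have [u1 u2] := UV_le d0 (small_D v1 hp).
  have h : (`|N1 v p| + `|N2 v p|) / (2^-1 * mm * (`|v| + p)) <= K1 * expR (- (kp * `|v|)).
    rewrite ler_pdivrMr//; apply: le_trans (hN _ _ v1 hp) _.
    rewrite (_ : K1 * _ * _ = CN * (`|v| + p) * (expR kp * expR (- (kp * `|v|)))); last first.
      rewrite /K1; field; by rewrite gt_eqF.
    rewrite ler_peMr ?mulr_ge0 ?(ltW w0)// -expRD -expR0 ler_expR.
    by rewrite subr_ge0 ler_piMr// ltW.
  by split; apply: (mono K1); [lra|exact: le_trans u1 h|lra|exact: le_trans u2 h].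
have [v0|v0] := leP 0 v.
  rewrite ger0_norm// in v1.
  have d0 : 0 < k1 * expR (2^-1 * v) by rewrite mulr_gt0 ?expR_gt0.
  have dD : (k1 * expR (2^-1 * v)) ^+ 2 <= D1 v p ^+ 2 + D2 v p ^+ 2.
    rewrite sDnE; apply: (@le_trans _ _ ((expR (2^-1 * v) - expR (- (2^-1 * v))) ^+ 2)); last first.
      by rewrite lerDl mulr_ge0// sqr_ge0.
    have h : k1 * expR (2^-1 * v) <= expR (2^-1 * v) - expR (- (2^-1 * v)).
      rewrite /k1 mulrBl mul1r lerD2l lerN2 -expRD ler_expR; lra.
    by apply: lerXn2r; rewrite ?nnegrE ?(ltW d0)// (le_trans (ltW d0)).
  have [u1 u2] := UV_le d0 dD.
  have h := bound_ge1 (ltW v1) hp.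
  by split; apply: (mono K2); [lra|exact: le_trans u1 h|lra|exact: le_trans u2 h].
rewrite ltr0_norm// in v1.
have d0 : 0 < k1 * expR (- (2^-1 * v)) by rewrite mulr_gt0 ?expR_gt0.
have dD : (k1 * expR (- (2^-1 * v))) ^+ 2 <= D1 v p ^+ 2 + D2 v p ^+ 2.
  rewrite sDnE; apply: (@le_trans _ _ ((expR (2^-1 * v) - expR (- (2^-1 * v))) ^+ 2)); last first.
    by rewrite lerDl mulr_ge0// sqr_ge0.
  have h : k1 * expR (- (2^-1 * v)) <= expR (- (2^-1 * v)) - expR (2^-1 * v).
    rewrite /k1 mulrBl mul1r lerD2l lerN2 -expRD ler_expR; lra.
  rewrite -[X in _ <= X]sqrrN opprB.
  by apply: lerXn2r; rewrite ?nnegrE ?(ltW d0)// (le_trans (ltW d0)).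
have [u1 u2] := UV_le d0 dD.
have vN : v <= - 1 by lra.
have h := bound_leN1 vN hp.
by split; apply: (mono K3); [lra|exact: le_trans u1 h|lra|exact: le_trans u2 h].
Qed.

(** The functions are real at height 0, so both imaginary parts are of order p, while |2 sinh (q /
    2)| >= |e^(v/2) - e^(- v/2)| > 0. The constant explodes as v tends to 0, which is harmless for a
    limit taken pointwise in v. *)
Let V_small v p : v != 0 -> 0 < p < Phi ->
  `|V v p| <= ((expR (2^-1 * v) * C0 * CY) * (expR (2^-1 * v) + expR (- (2^-1 * v))) +
    (expR (2^-1 * v) * C0 + m0) * (expR (2^-1 * v) + expR (- (2^-1 * v)))) /
    (expR (2^-1 * v) - expR (- (2^-1 * v))) ^+ 2 * p.
Proof.
move=> v0 hp; have /andP[p0 _] := hp.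
have E0 := expR_gt0 (2^-1 * v); have F0 := expR_gt0 (- (2^-1 * v)).
set E := expR (2^-1 * v) in E0 *; set F := expR (- (2^-1 * v)) in F0 *.
have dn : 0 < (E - F) ^+ 2.
  rewrite lt_neqAle sqr_ge0 andbT eq_sym sqrf_eq0 subr_eq0; apply/eqP => /expR_inj h.
  by move/eqP: v0; apply; lra.
have dd : (E - F) ^+ 2 <= D1 v p ^+ 2 + D2 v p ^+ 2.
  by rewrite sDnE lerDl mulr_ge0// sqr_ge0.
have CY0 : 0 <= CY by rewrite addr_ge0 ?invr_ge0// mulr_ge0// ltW.
have d1 : `|D1 v p| <= E + F.
  rewrite /sD1 normrM; apply: (@le_trans _ _ (`|E - F|)).
    by rewrite ler_piMr// cos_max.
  by rewrite (le_trans (ler_normB _ _))// !ger0_norm// ltW.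
have d2 : `|D2 v p| <= (E + F) * p.
  rewrite /sD2 normrM ger0_norm ?addr_ge0 ?(ltW E0) ?(ltW F0)//.
  rewrite ler_pM2l ?addr_gt0//; apply: le_trans (norm_sin_le _) _.
  rewrite ger0_norm; lra.
have n1 : `|N1 v p| <= E * C0 + m0.
  by apply: le_trans (N1_bnd v p) _; rewrite lerD2r; exact: eX1.
have n2 : `|N2 v p| <= E * C0 * CY * p.
  apply: le_trans (N2_bnd' v hp) _; rewrite mulrA.
  apply: ler_wpM2r; first exact: ltW.
  by apply: ler_wpM2r => //; exact: eX1.
by rewrite /sV -!expr2; apply: quot_norm_le2 => //; exact: ltW.
Qed.

Lemma strip_V_integral p : 0 < p < Phi ->
  (\int[mu]_(v in `[- n%:R, n%:R]) V v p)%R @[n --> \oo] --> (0 : R).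
Proof.
have [K K0 hK] := strip_UV_bound.
apply: (@strip_integral_eq0 _ U V (sa alpha theta c) (sb alpha theta c) Phi
  (fun v => K * expR (- (kp * `|v|)))).
- by move=> v q hq; apply: holo_sUV hq.
- by move=> q hq; apply: continuous_sa hq.
- by move=> n e e0; apply: bounded_sa e0.
- by move=> v q hq; have [] := hK v q hq.
- by move=> v q hq; have [] := hK v q hq.
- exact: integrable_exp_abs.
- rewrite -(mulr0 K); apply: cvgMl_tmp; under eq_fun do rewrite ger0_norm//.
  exact: cvg_exp_natN.
- rewrite -(mulr0 K); apply: cvgMl_tmp; under eq_fun do rewrite normrN ger0_norm//.
  exact: cvg_exp_natN.
- by move=> v q; exact: V_small.
Qed.

End strip_bounds.

(** * The Stieltjes transform of Delta *)

(** The closed form claimed for the cdf of S / S'. The analysis works with it; [cdf_stable_ratio]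
    ties it to the variables. *)
Definition lamperti_cdf {R : realType} (alpha x : R) : R :=
  1 - (pi * alpha)^-1 * acot (cot (pi * alpha) + x `^ alpha / sin (pi * alpha)).

Section delta.
Context {R : realType}.
Notation mu := (@lebesgue_measure R).
Variables (alpha theta : R).
Hypotheses (al0 : 0 < alpha) (al1 : alpha < 1) (th0 : 0 < theta).
Implicit Types (x t z u : R).

Notation s := (sin (pi * alpha)).
Notation k := (cos (pi * alpha)).
Notation F := (lamperti_cdf alpha).
Notation L := (lamperti_poly alpha).
Notation De := (Delta alpha theta F).
Notation de := (d_dens alpha theta F).

Let pa0 : 0 < pi * alpha. Proof. by rewrite mulr_gt0// pi_gt0. Qed.
Let pa1 : pi * alpha < pi. Proof. by rewrite gtr_pMr// pi_gt0. Qed.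
Let s0 : 0 < s. Proof. by apply: sin_gt0_pi; rewrite pa0. Qed.

(* The argument of 1 + x^alpha e^(i pi alpha); thus [De x] is - 1 / pi times the
   imaginary part of (1 + x^alpha e^(i pi alpha))^(- theta). *)
Definition langle x : R := pi * alpha - pi / 2 + atan ((x `^ alpha + k) / s).

Lemma lamperti_angle x : pi * alpha * F x = langle x.
Proof.
rewrite /lamperti_cdf mulrBr mulr1 mulrA divff ?gt_eqF// mul1r /acot /langle /cot.
have -> : k / s + x `^ alpha / s = (x `^ alpha + k) / s by rewrite -mulrDl addrC.
by rewrite opprB addrA addrAC.
Qed.

Lemma lamperti_theta_angle x : pi * theta * alpha * F x = theta * langle x.
Proof. by rewrite -lamperti_angle; ring. Qed.

Lemma lamperti_polyE x : 0 < x -> L x = (x `^ alpha + k) * (x `^ alpha + k) + s * s.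
Proof.
move=> x0; have e := cos2Dsin2 (pi * alpha).
rewrite /lamperti_poly (_ : x `^ (2 * alpha) = x `^ alpha * x `^ alpha); last first.
  by rewrite -powRD ?(gt_eqF x0) ?implybT//; congr powR; ring.
by rewrite -[X in _ + X = _]e; ring.
Qed.

(** Two completions of the square: L - s^2 = (x^alpha + k)^2 and L - s^2 x^(2 alpha) = (k x^alpha +
    1)^2. *)
Lemma lamperti_poly_ge x : 0 < x -> s ^+ 2 <= L x /\ s ^+ 2 * (x `^ alpha) ^+ 2 <= L x.
Proof.
move=> x0; rewrite lamperti_polyE//; split; rewrite -subr_ge0.
  rewrite (_ : _ - _ = (x `^ alpha + k) ^+ 2); last by ring.
  exact: sqr_ge0.
have e : s ^+ 2 = 1 - k ^+ 2 by rewrite sin2cos2.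
rewrite (_ : _ - _ = (x `^ alpha * k + 1) ^+ 2); first exact: sqr_ge0.
by rewrite -(expr2 s) e; ring.
Qed.

Lemma lamperti_poly_gt0 x : 0 < x -> 0 < L x.
Proof. by move=> /lamperti_poly_ge[h _]; apply: lt_le_trans h; rewrite exprn_gt0. Qed.

Let CD : R := pi^-1 * (s ^+ 2) `^ (- (theta / 2)).
Let CD0 : 0 <= CD. Proof. by rewrite mulr_ge0 ?powR_ge0 ?invr_ge0 ?ltW ?pi_gt0. Qed.

Lemma powRN_le p x y : 0 <= p -> 0 < x -> x <= y -> y `^ (- p) <= x `^ (- p).
Proof.
move=> p0 x0 xy; have y0 := lt_le_trans x0 xy.
by rewrite !powRN lef_pV2 ?posrE ?powR_gt0//; apply: ge0_ler_powR => //; rewrite nnegrE ltW.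
Qed.

(** The first lower bound of [L] gives the constant, the second the decay that makes the Stieltjes
    integral converge at infinity. *)
Lemma Delta_bound : exists2 C : R, 0 <= C & forall x, 0 < x ->
  `|De x| <= C /\ `|De x| <= C * x `^ (- (alpha * theta)).
Proof.
exists CD => // x x0; have [h1 h2] := lamperti_poly_ge x0.
have th2 : 0 <= theta / 2 by rewrite divr_ge0// ltW.
have b : `|De x| <= pi^-1 * L x `^ (- (theta / 2)).
  have pv : 0 < pi^-1 :> R by rewrite invr_gt0 pi_gt0.
  rewrite /Delta normrM (gtr0_norm pv) ler_pM2l//.
  by rewrite normrM -powRN [X in _ * X]ger0_norm ?powR_ge0// ler_piMl ?powR_ge0// sin_max.
split; apply: le_trans b _; rewrite /CD.
  by rewrite ler_pM2l ?invr_gt0 ?pi_gt0//; apply: powRN_le => //; rewrite exprn_gt0.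
rewrite -mulrA ler_pM2l ?invr_gt0 ?pi_gt0//.
apply: le_trans (powRN_le th2 _ h2) _.
  by rewrite mulr_gt0 ?exprn_gt0 ?powR_gt0.
rewrite powRM; [|by rewrite exprn_ge0// ltW|by rewrite exprn_ge0// powR_ge0].
rewrite -[(x `^ alpha) ^+ 2]powR_mulrn ?powR_ge0// -!powRrM.
rewrite le_eqVlt; apply/orP; left; apply/eqP; congr (_ * _ `^ _).
by field.
Qed.

Lemma deriv_Delta x : 0 < x -> has_deriv De x (de x).
Proof.
move=> x0; have L0 := lamperti_poly_gt0 x0.
have a0 : x `^ alpha = x * x `^ (alpha - 1) by rewrite mulr_powRB1// ltW.
have F' : has_deriv F x ((pi * alpha)^-1 * (alpha * x `^ (alpha - 1) * s / L x)).
  apply: has_deriv_eq; first by rewrite /lamperti_cdf /acot; der.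
  have L0' := L0; rewrite lamperti_polyE// in L0' *.
  have [P PE] : exists P : R, P = pi by exists pi.
  have P0 : P != 0 by rewrite PE gt_eqF// pi_gt0.
  rewrite /= /cot; move: s0 L0'; rewrite -PE => s0' L0'; field.
  by rewrite (gt_eqF s0') (gt_eqF L0') P0 (gt_eqF al0).
have L' : has_deriv L x (2 * (alpha * x `^ (alpha - 1)) * (x `^ alpha + k)).
  apply: has_deriv_eq; first by rewrite /lamperti_poly; der.
  rewrite /= (_ : x `^ (2 * alpha - 1) = x `^ alpha * x `^ (alpha - 1)); last first.
    by rewrite -powRD ?(gt_eqF x0) ?implybT//; congr powR; ring.
  by ring.
have P' : has_deriv (fun y => (L y `^ (theta / 2))^-1) x
    (- (theta / 2) * (2 * (alpha * x `^ (alpha - 1)) * (x `^ alpha + k)) / L x `^ (theta / 2 + 1)).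
  have -> : (fun y => (L y `^ (theta / 2))^-1) = (fun y => L y `^ (- (theta / 2))).
    by apply/funext => y; rewrite powRN.
  apply: has_deriv_eq; first exact: der_powR L0 L'.
  by rewrite -powRN opprD; ring.
apply: has_deriv_eq; first by rewrite /Delta; der.
rewrite /= /d_dens lamperti_theta_angle.
have -> : pi * alpha * (1 - theta * F x) = pi * alpha - theta * langle x.
  by rewrite -lamperti_angle; ring.
have LE : L x `^ (theta / 2 + 1) = L x `^ (theta / 2) * L x.
  by rewrite powRD ?(gt_eqF L0) ?implybT// powRr1// ltW.
rewrite sinB LE; have := powR_gt0 (theta / 2) L0.
have [P PE] : exists P : R, P = pi by exists pi.
have P0 : P != 0 by rewrite PE gt_eqF// pi_gt0.
have Pa : (pi * alpha) != 0 :> R by rewrite gt_eqF.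
rewrite -PE in Pa *.
move: (L x `^ (theta / 2)) => q q0; field.
by rewrite ?(gt_eqF q0) ?(gt_eqF L0) ?P0 ?(gt_eqF al0).
Qed.

Lemma integrable_Delta_stieltjes z : 0 < z ->
  mu.-integrable `]0, +oo[ (fun t => (De t / (z + t))%:E).
Proof.
move=> z0; have [C C0 hC] := Delta_bound.
have at0 : 0 < alpha * theta by rewrite mulr_gt0.
have sub0 (t : R) : `]0, 1]%classic t -> 0 < t by rewrite /= in_itv/= => /andP[].
have sub1 (t : R) : `]1, +oo[%classic t -> 0 < t by rewrite /= in_itv/= andbT; lra.
have mDz : measurable_fun (`]0, +oo[ : set R) (fun t => De t / (z + t)).
  apply: open_continuous_measurable_fun; first exact: interval_open.
  move=> x /set_mem /=; rewrite in_itv/= andbT => x0; have h := deriv_Delta x0.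
  by apply: has_deriv_cont; der; rewrite gt_eqF// addr_gt0.
have split01 : `]0, +oo[%classic = `]0, 1] `|` `]1, +oo[ :> set R.
  by rewrite -itv_bndbnd_setU// ?bnd_simp.
apply/integrableP; split; first exact/measurable_EFinP.
have mab : measurable_fun (`]0, +oo[ : set R) (fun t => `|(De t / (z + t))%:E|%E).
  by apply: measurableT_comp => //; exact/measurable_EFinP.
rewrite split01 in mab *; rewrite ge0_integral_setU//; last first.
  apply/disj_setPS => x [/=]; rewrite !in_itv/= andbT => /andP[_ h1] h2; lra.
have nE (t : R) : 0 < t -> `|(De t / (z + t))%:E|%E = (`|De t| / (z + t))%:E.
  by move=> t0; rewrite /= normrM normfV [X in _ / X]ger0_norm// addr_ge0// ltW.
have mab1 := measurable_funS _ (@subsetUl _ _ _) mab.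
have mab2 := measurable_funS _ (@subsetUr _ _ _) mab.
apply: lte_add_pinfty.
  apply: (@le_lt_trans _ _ (\int[mu]_(t in `]0%R, 1%R]) (C / z)%:E)%E).
    apply: ge0_le_integral => //.
    - by apply: mab1; rewrite -split01.

    - move=> t /sub0 t0; rewrite nE// lee_fin; apply: ler_pM => //.
      + by rewrite invr_ge0 addr_ge0// ltW.
      + by have [] := hC _ t0.
      + by rewrite lef_pV2 ?posrE ?addr_gt0// lerDl ltW.
  have e : mu (`]0%R, 1%R]%classic : set R) = 1%E.
    by rewrite lebesgue_measure_itv/= lte_fin ltr01 -EFinB subr0.
  rewrite integral_cst//; apply: (@le_lt_trans _ _ ((C / z)%:E * 1)%E); last by rewrite mule1 ltry.
  by rewrite le_eqVlt; apply/orP; left; apply/eqP; congr (_ * _)%E; exact: e.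
apply: (@le_lt_trans _ _ (\int[mu]_(t in `]1%R, +oo[) (C%:E * (t `^ (- (alpha * theta) - 1))%:E))%E).
  apply: ge0_le_integral => //.
  - by apply: mab2; rewrite -split01.

  - by apply: emeasurable_funM => //; apply/measurable_EFinP; exact: measurable_funTS (measurable_powR _).
  - move=> t /sub1 t0; rewrite nE// -EFinM lee_fin.
    apply: (@le_trans _ _ (C * t `^ (- (alpha * theta)) / t)).
      apply: ler_pM => //.
      + by rewrite invr_ge0 addr_ge0// ltW.
      + by have [] := hC _ t0.
      + by rewrite lef_pV2 ?posrE ?addr_gt0// lerDr ltW.
    by rewrite -mulrA ler_wpM2l// powRD ?(gt_eqF t0) ?implybT// powR_inv1// ltW.
rewrite ge0_integralZl//.
- by rewrite integral_powR_y// -EFinM ltry.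
- by apply/measurable_EFinP; exact: measurable_funTS (measurable_powR _).
- by move=> t _; rewrite lee_fin powR_ge0.
Qed.

(** The midpoint of pi and min (3 pi / 2, pi / alpha): below pi / alpha, 1 + c e^(alpha q) has no
    zero, and below 3 pi / 2 the linear bound for sin (p / 2) holds. *)
Let Phi : R := 2^-1 * (pi + Num.min (3 / 2 * pi) (pi / alpha)).
Let PhiP : [/\ pi < Phi, Phi < 3 / 2 * pi & alpha * Phi < pi].
Proof.
have p0 := pi_gt0 R.
have h : pi < Num.min (3 / 2 * pi) (pi / alpha).
  by rewrite lt_min ltr_pdivlMr// pa1 andbT; lra.
have h1 : Num.min (3 / 2 * pi) (pi / alpha) <= 3 / 2 * pi by rewrite ge_min lexx.
have h2 : Num.min (3 / 2 * pi) (pi / alpha) <= pi / alpha by rewrite ge_min lexx orbT.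
rewrite /Phi; move: (Num.min _ _) h h1 h2 => m h h1 h2; split; [lra|lra|].
rewrite ler_pdivlMr// in h2.
have : alpha * pi < pi by rewrite mulrC; exact: pa1.
lra.
Qed.

Let Dexp x : 0 < x ->
  De x = pi^-1 * (expR (- (theta / 2 * ln (L x))) * sin (theta * langle x)).
Proof.
move=> x0; have L0 := lamperti_poly_gt0 x0.
rewrite /Delta lamperti_theta_angle -powRN /powR (gt_eqF L0) mulNr.
by rewrite [X in pi^-1 * X]mulrC.
Qed.

(** At height pi, e^(q/2) = i e^(v/2) and 2 sinh (q/2) = i (e^(v/2) + e^(- v/2)), so the imaginary
    part of the quotient is (m(0) - Re m(q)) / (2 cosh (v/2)). With t = z e^v, Re m(q) = pi e^(v/2)
    Delta(t), and e^(v/2) / (2 cosh (v/2)) = t / (z + t). *)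
Let sV_pi z v : 0 < z -> sV alpha theta (z `^ alpha) v pi =
  expR (sX0 theta (z `^ alpha)) * (expR (2^-1 * v) + expR (- (2^-1 * v)))^-1 -
  pi * (De (z * expR v) / (z + z * expR v)) * (z * expR v).
Proof.
move=> z0; have e0 := expR_gt0 (2^-1 * v); have e1 := expR_gt0 (- (2^-1 * v)).
have x0 : 0 < z * expR v by rewrite mulr_gt0 ?expR_gt0.
have ha : 2^-1 * pi = pi / 2 :> R by rewrite mulrC.
have D1 : sD1 v pi = 0 :> R by rewrite /sD1 ha cos_pihalf mulr0.
have D2 : sD2 v pi = expR (2^-1 * v) + expR (- (2^-1 * v)) :> R by rewrite /sD2 ha sin_pihalf mulr1.
have uE : su alpha (z `^ alpha) v = (z * expR v) `^ alpha.
  by rewrite /su powRM ?expR_ge0 ?(ltW z0)//; congr (_ * _); rewrite (mulrC alpha) expRM.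
have rE : srho alpha (z `^ alpha) v pi = L (z * expR v).
  by rewrite /srho uE lamperti_polyE// (mulrC alpha).
have pE : spsi alpha (z `^ alpha) v pi = langle (z * expR v).
  by rewrite /spsi /langle uE (mulrC alpha).
have cE : cos (sY alpha theta (z `^ alpha) v pi) = sin (theta * langle (z * expR v)).
  by rewrite /sY pE ha cosB cos_pihalf sin_pihalf mul0r add0r mul1r.
have XE : expR (sX alpha theta (z `^ alpha) v pi) =
    expR (2^-1 * v) * expR (- (theta / 2 * ln (L (z * expR v)))).
  by rewrite /sX rE expRD.
have vE : expR v = expR (2^-1 * v) * expR (2^-1 * v).
  by rewrite -expRD; congr expR; field.
have ee : expR (- (2^-1 * v)) = (expR (2^-1 * v))^-1 by rewrite expRN.
rewrite /sV D1 D2 mulr0 add0r mul0r add0r /sN1 cE XE Dexp// [in z + _]vE [X in _ * (z * X)]vE ee.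
rewrite ee in e1.
have [P PE] : exists P : R, P = pi by exists pi.
have P0 : P != 0 by rewrite PE gt_eqF// pi_gt0.
rewrite -PE; move: e0; move: (expR (2^-1 * v)) => E E0; field.
have EE : 0 < E * E by rewrite mulr_gt0.
apply/and4P; split=> //; rewrite gt_eqF//; last by rewrite addr_gt0.
by rewrite addr_gt0// mulr_gt0.
Qed.

(** The vanishing of the integral at height pi equates pi times the Stieltjes integral with pi m(0),
    and m(0) = (1 + z^alpha)^(- theta). *)
Lemma stieltjes_Delta z : 0 < z ->
  (\int[mu]_(t in `]0%R, +oo[) (De t / (z + t))%:E = ((1 + z `^ alpha) `^ (- theta))%:E)%E.
Proof.
move=> z0; have p0 := pi_gt0 R; have [Ph1 Ph2 Ph3] := PhiP.
pose g t : R := De t / (z + t).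
have ig := integrable_Delta_stieltjes z0.
have c0 : 0 < z `^ alpha by exact: powR_gt0.
have hV : (\int[mu]_(v in `[- n%:R, n%:R]) sV alpha theta (z `^ alpha) v pi)%R
    @[n --> \oo] --> (0 : R).
  by apply: (strip_V_integral al0 al1 th0 c0 Ph1 Ph2 Ph3); rewrite p0 Ph1.
have cg t : 0 < t -> {for t, continuous g}.
  move=> t0; have h := deriv_Delta t0.
  by apply: has_deriv_cont; rewrite /g; der; rewrite gt_eqF// addr_gt0.
pose a_ n : R := z * expR (- n%:R); pose b_ n : R := z * expR n%:R.
have sub n t : `[a_ n, b_ n]%classic t -> 0 < t.
  rewrite /= in_itv/= => /andP[+ _]; apply: lt_le_trans.
  by rewrite mulr_gt0 ?expR_gt0.
have nn n : - n%:R <= n%:R :> R by apply: (@le_trans _ _ 0); rewrite ?oppr_le0.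
pose m0 := expR (sX0 theta (z `^ alpha)).
(* substitution t = z e^v *)
have subst n : (\int[mu]_(t in `[a_ n, b_ n]) g t)%R =
   (\int[mu]_(v in `[- n%:R, n%:R]) (g (z * expR v) * (z * expR v)))%R.
  have dE : derive1 (fun v : R => z * expR v) = (fun v => z * expR v).
    apply/funext => v; rewrite derive1E.
    have : has_deriv (fun v : R => z * expR v) v (z * expR v).
      by apply: has_deriv_eq; [der|rewrite /=; ring].
    by case.
  have cE v : {for v, continuous (fun v : R => z * expR v)}.
    by apply: has_deriv_cont; der.
  rewrite /Rintegral (@integration_by_substitution_increasing _ (fun v => z * expR v) g (- n%:R) n%:R)//.
  - by rewrite dE.
  - by move=> x y _ _ xy; rewrite ltr_pM2l// ltr_expR.
  - by rewrite dE => x _; exact: cE.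
  - by rewrite dE; apply/cvg_ex; eexists; exact: cvg_at_right_filter (cE _).
  - by rewrite dE; apply/cvg_ex; eexists; exact: cvg_at_left_filter (cE _).
  - split.
    + move=> x _; have : has_deriv (fun v : R => z * expR v) x (z * expR x).
        by apply: has_deriv_eq; [der|rewrite /=; ring].
      by case.
    + exact: cvg_at_right_filter (cE _).
    + exact: cvg_at_left_filter (cE _).
  - by apply: continuous_in_subspaceT => x /set_mem /sub; exact: cg.
have cinv v : {for v, continuous (fun v : R => (expR (2^-1 * v) + expR (- (2^-1 * v)))^-1)}.
  by apply: has_deriv_cont; der; rewrite gt_eqF// addr_gt0 ?expR_gt0.
have cgE v : {for v, continuous (fun v : R => g (z * expR v) * (z * expR v))}.
  apply: ctM; last by apply: has_deriv_cont; der.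
  apply: (@continuous_comp _ _ _ (fun v => z * expR v) g).
    by apply: has_deriv_cont; der.
  by apply: cg; rewrite mulr_gt0 ?expR_gt0.
have icpt (f : R -> R) n : (forall v, {for v, continuous f}) ->
    mu.-integrable `[- n%:R, n%:R] (EFin \o f).
  move=> cf; apply: continuous_compact_integrable; first exact: segment_compact.
  exact: continuous_subspaceT.
have VE n : (\int[mu]_(v in `[- n%:R, n%:R]) sV alpha theta (z `^ alpha) v pi)%R =
    m0 * (\int[mu]_(v in `[- n%:R, n%:R]) (expR (2^-1 * v) + expR (- (2^-1 * v)))^-1)%R -
    pi * (\int[mu]_(t in `[a_ n, b_ n]) g t)%R.
  rewrite subst -!RintegralZl//; [|exact: icpt|exact: icpt].
  rewrite -RintegralB//.
  - by apply: eq_Rintegral => v _; rewrite sV_pi// /g /= -(mulrA pi).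
  - by apply: icpt => v; apply: ctM; [exact: ctC|exact: cinv].
  - by apply: icpt => v; apply: ctM; [exact: ctC|exact: cgE].
(* The integral of 1 / (2 cosh (v/2)), with primitive 2 atan (e^(v/2)); it tends to pi. *)
have atE n : (0 < n)%N ->
  (\int[mu]_(v in `[- n%:R, n%:R]) (expR (2^-1 * v) + expR (- (2^-1 * v)))^-1)%R =
  2 * atan (expR (2^-1 * n%:R)) - 2 * atan (expR (2^-1 * - n%:R)).
  move=> n0; have dA v : has_deriv (fun v : R => 2 * atan (expR (2^-1 * v))) v
      (expR (2^-1 * v) + expR (- (2^-1 * v)))^-1.
    apply: has_deriv_eq; first by der.
    rewrite /= expRN; have e0 := expR_gt0 (2^-1 * v); field.
    by rewrite (gt_eqF e0)/= -expr2 gt_eqF// addr_gt0// exprn_gt0.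
  rewrite /Rintegral (@continuous_FTC2 _ _ (fun v => 2 * atan (expR (2^-1 * v)))).
  - by [].
  - by apply: (@lt_trans _ _ 0); rewrite ?oppr_lt0 ltr0n.
  - by apply: continuous_subspaceT => v; exact: cinv.
  - split.
    + by move=> x _; have [] := dA x.
    + exact: cvg_at_right_filter (has_deriv_cont (dA _)).
    + exact: cvg_at_left_filter (has_deriv_cont (dA _)).
  - by move=> x _; rewrite derive1E; have [] := dA x.
have at1 : atan (expR (2^-1 * n%:R)) @[n --> \oo] --> (pi / 2 : R).
  have /cvg_pinftyP h := @cvgy_atan R.
  apply: (h (fun n => expR (2^-1 * n%:R))).
  apply/cvgryPge => A; near=> n.
  apply: le_trans (expR_ge1Dx _).
  have : 2 * A <= n%:R by near: n; move/cvgryPge : (@cvgr_idn R); apply.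
  lra.
have at2 : atan (expR (2^-1 * - n%:R)) @[n --> \oo] --> (0 : R).
  rewrite -[X in _ --> X](@atan0 R).
  have := @cvg_exp_natN R 2^-1; rewrite invr_gt0 => /(_ (ltr0n _ 2)) h.
  under eq_fun do rewrite mulrN.
  apply: (@cvg_comp _ _ _ _ (@atan R) _ _ _ h).
  exact: continuous_atan.
have lim1 : (pi * (\int[mu]_(t in `[a_ n, b_ n]) g t)%R) @[n --> \oo] --> pi * m0.
  have h : (m0 * (2 * atan (expR (2^-1 * n%:R)) - 2 * atan (expR (2^-1 * - n%:R))) -
     (\int[mu]_(v in `[- n%:R, n%:R]) sV alpha theta (z `^ alpha) v pi)%R) @[n --> \oo] -->
     m0 * (2 * (pi / 2) - 2 * 0) - 0.
    by apply: cvgB => //; apply: cvgMl_tmp; apply: cvgB; exact: cvgMl_tmp.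
  have -> : pi * m0 = m0 * (2 * (pi / 2) - 2 * 0) - 0 by field.
  apply: cvg_trans h; apply: near_eq_cvg; near=> n.
  have n0 : (0 < n)%N by near: n; exact: nbhs_infty_gt.
  by rewrite VE -atE//; ring.
have lim2 : (\int[mu]_(t in `[a_ n, b_ n]) g t)%R @[n --> \oo] --> m0.
  have : pi^-1 * (pi * (\int[mu]_(t in `[a_ n, b_ n]) g t)%R) @[n --> \oo] --> pi^-1 * (pi * m0).
    exact: cvgMl_tmp.
  rewrite mulKf ?gt_eqF//; apply: cvg_trans; apply: near_eq_cvg; near=> n.
  by rewrite mulKf ?gt_eqF.
have mE : m0 = (1 + z `^ alpha) `^ (- theta).
  have e (y p : R) : 0 < y -> y `^ p = expR (p * ln y) by move=> y0; rewrite /powR gt_eqF.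
  rewrite (e _ (- theta)) ?addr_gt0// /m0 /sX0 -expr2 lnXn ?addr_gt0// addrC.
  by congr expR; rewrite -mulr_natl; field.
rewrite -mE.
(* The limit along the segments is the integral over the half-line, by the integrability of [g]. *)
pose f_ n := (fun t => (g t)%:E) \_ `[a_ n, b_ n]%classic.
have mg : measurable_fun (`]0, +oo[ : set R) (EFin \o g).
  by have /integrableP[] := ig.
have subE n : `[a_ n, b_ n] `<=` `]0, +oo[%classic.
  by move=> t /sub t0; rewrite /= in_itv/= t0.
have [] := @dominated_convergence _ _ _ mu `]0, +oo[%classic _ f_ (EFin \o g) (fun t => `|(g t)%:E|%E).
- by [].
- move=> n; apply/(measurable_restrict (EFin \o g)) => //.
  apply: measurable_funS mg => //.
- exact: mg.
- apply: aeW => t /=; rewrite in_itv/= andbT => t0.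
  apply: cvg_near_cst; near=> n; rewrite /f_ /patch ifT//.
  rewrite inE/= in_itv/=; apply/andP; split.
    rewrite /a_ expRN ler_pdivrMr ?expR_gt0// -ler_pdivrMl//.
    apply: le_trans (expR_ge1Dx _).
    have : t^-1 * z <= n%:R by near: n; move/cvgryPge : (@cvgr_idn R); apply.
    lra.
  rewrite /b_ -ler_pdivrMl//.
  apply: le_trans (expR_ge1Dx _).
  have : z^-1 * t <= n%:R by near: n; move/cvgryPge : (@cvgr_idn R); apply.
  lra.
- exact: integrable_abse ig.
- apply: aeW => t n _; rewrite /f_ /patch; case: ifPn => // _.
  by rewrite abse0.
move=> _ _ h.
have fin : (\int[mu]_(t in `]0%R, +oo[) (g t)%:E \is a fin_num)%E by exact: integrable_fin_num.
rewrite -[LHS]fineK//; congr EFin.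
have h2 : (\int[mu]_(t in `[a_ n, b_ n]) g t)%R @[n --> \oo] --> fine (\int[mu]_(t in `]0%R, +oo[) (g t)%:E)%E.
  have -> : (fun n => (\int[mu]_(t in `[a_ n, b_ n]) g t)%R) =
     (fun n => fine (\int[mu]_(t in `]0%R, +oo[) f_ n t)%E).
    apply/funext => n; rewrite /Rintegral /f_ -integral_mkcondr.
    by congr (fine (integral _ _ _)); apply/esym/setIidPr; exact: subE.
  apply: fine_cvg; rewrite fineK//; exact: h.
exact: (cvg_unique _ h2 lim2).
Unshelve. all: by end_near. Qed.

End delta.

(** * Uniqueness of generalized Stieltjes transforms *)

Section indicator_approximation.
Context {R : realType}.
Implicit Types (c y t : R).

Lemma bernoulli_onem t m : 0 <= t <= 1 -> 1 - m%:R * t <= (1 - t) ^+ m.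
Proof.
move=> /andP[t0 t1]; elim: m => [|m IH]; first by rewrite mul0r subr0 expr0.
rewrite exprS -natr1.
have h : (1 - t) * (1 - m%:R * t) <= (1 - t) * (1 - t) ^+ m by rewrite ler_wpM2l// subr_ge0.
apply: le_trans h; have : 0 <= m%:R * (t * t) by rewrite !mulr_ge0.
lra.
Qed.

(* Polynomials in [y] tending to the indicator of [0, c[. *)
Definition step_exp c N : nat := (Num.truncn ((c ^+ N)^-1)).+1.
Definition step_poly c N y : R := (1 - y ^+ N) ^+ step_exp c N.

Lemma step_exp_bounds c N : 0 < c ->
  (c ^+ N)^-1 <= (step_exp c N)%:R <= (c ^+ N)^-1 + 1.
Proof.
move=> c0; have h : 0 <= (c ^+ N)^-1 by rewrite invr_ge0 exprn_ge0// ltW.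
rewrite /step_exp; apply/andP; split; first by rewrite ltW// truncnS_gt.
by rewrite -natr1 lerD2r truncn_le.
Qed.

Lemma step_poly_bound c N y : 0 <= y <= 1 -> 0 <= step_poly c N y <= 1.
Proof.
move=> /andP[y0 y1]; rewrite /step_poly.
have h1 : 0 <= y ^+ N by rewrite exprn_ge0.
have h2 : y ^+ N <= 1 by rewrite exprn_ile1.
by rewrite exprn_ge0 ?exprn_ile1//; lra.
Qed.

(** The exponent m is within 1 of c^(- N), so Bernoulli gives 1 - (1 - y^N)^m <= m y^N <= (y / c)^N
    + y^N. *)
Lemma step_poly_cvg1 c y : 0 < c < 1 -> 0 <= y < c ->
  step_poly c N y @[N --> \oo] --> (1 : R).
Proof.
move=> /andP[c0 c1] /andP[y0 yc].
have y1 : y < 1 by exact: lt_trans yc c1.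
have cv : (1 - ((y / c) ^+ N + y ^+ N)) @[N --> \oo] --> (1 : R).
  rewrite -[X in _ --> X](subr0 1); apply: cvgB; first exact: cvg_cst.
  rewrite -[X in _ --> X](addr0 0); apply: cvgD; apply: cvg_expr.
    by rewrite ger0_norm ?divr_ge0 ?(ltW c0)// ltr_pdivrMr// mul1r.
  by rewrite ger0_norm.
apply: (@squeeze_cvgr _ _ _ _ (fun N => 1 - ((y / c) ^+ N + y ^+ N)) (fun=> 1)) => //; last exact: cvg_cst.
near=> N.
have /andP[_ h] : 0 <= step_poly c N y <= 1.
  by apply: step_poly_bound; rewrite y0 ltW.
rewrite h andbT /step_poly.
have yN0 : 0 <= y ^+ N by rewrite exprn_ge0.
apply: le_trans (@bernoulli_onem _ _ _); last by rewrite yN0 exprn_ile1// ltW.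
rewrite lerD2l lerN2.
have /andP[_ h2] := step_exp_bounds N c0.
apply: le_trans (ler_wpM2r yN0 h2) _.
by rewrite mulrDl mul1r expr_div_n mulrC.
Unshelve. all: by end_near. Qed.

(** (1 - y^N)^m <= e^(- m y^N) <= 1 / (1 + m y^N) <= (c / y)^N. *)
Lemma step_poly_cvg0 c y : 0 < c -> c < y <= 1 ->
  step_poly c N y @[N --> \oo] --> (0 : R).
Proof.
move=> c0 /andP[cy y1]; have y0 : 0 < y := lt_trans c0 cy.
have cv : ((y / c) ^- N) @[N --> \oo] --> (0 : R).
  under eq_fun do rewrite -exprVn; apply: cvg_expr.
  have h : 1 < y / c by rewrite ltr_pdivlMr// mul1r.
  by rewrite ger0_norm ?invr_ge0 ?divr_ge0 ?ltW// invf_lt1// (lt_trans ltr01).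
apply: (@squeeze_cvgr _ _ _ _ (fun=> 0) (fun N => (y / c) ^- N)) => //; last exact: cvg_cst.
near=> N.
have /andP[-> _] /= : 0 <= step_poly c N y <= 1.
  by apply: step_poly_bound; rewrite (ltW y0).
have yN0 : 0 <= y ^+ N by rewrite exprn_ge0// ltW.
have yN1 : y ^+ N <= 1 by rewrite exprn_ile1// ltW.
apply: (@le_trans _ _ (expR (- y ^+ N) ^+ step_exp c N)).
  rewrite /step_poly; apply: lerXn2r; rewrite ?nnegrE ?expR_ge0 ?subr_ge0//.
  exact: expR_ge1Dx.
rewrite -expRM_natl mulrN expRN lef_pV2 ?posrE ?expR_gt0 ?exprn_gt0 ?divr_gt0//.
apply: (@le_trans _ _ (1 + (step_exp c N)%:R * y ^+ N)); last exact: expR_ge1Dx.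
have /andP[h2 _] := step_exp_bounds N c0.
have h3 := ler_wpM2r yN0 h2; rewrite expr_div_n mulrC.
by apply: le_trans h3 _; rewrite lerDr.
Unshelve. all: by end_near. Qed.

End indicator_approximation.

Section stieltjes_uniqueness.
Context {R : realType}.
Notation mu := (@lebesgue_measure R).
Implicit Types (x z b : R) (u w : R -> R).

Let I : set R := `]0, +oo[%classic.
Let mI : measurable I. Proof. exact: measurable_itv. Qed.

Lemma measurable_shift_powR z p : measurable_fun (I : set R) (fun x : R => (z + x) `^ p).
Proof.
apply: measurable_funTS; apply: (measurableT_comp (measurable_powR p)).
exact: measurable_funD.
Qed.

Lemma integrable_stieltjes_mono u b b' z : 0 <= b -> b <= b' -> 1 <= z ->
  measurable_fun I u ->
  mu.-integrable I (fun x => (u x * (1 + x) `^ (- b))%:E) ->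
  mu.-integrable I (fun x => (u x * (z + x) `^ (- b'))%:E).
Proof.
move=> b0 bb z1 mu_ iu; apply: le_integrable iu => //.
  apply/measurable_EFinP; apply: measurable_funM => //; exact: measurable_shift_powR.
move=> x; rewrite /I /= in_itv/= andbT => x0.
rewrite lee_fin !normrM ler_wpM2l// !ger0_norm ?powR_ge0//.
apply: (@le_trans _ _ ((z + x) `^ (- b))); last by apply: powRN_le => //; lra.
by apply: ler_powR; [lra|rewrite lerN2].
Qed.

(** Differentiating in z multiplies the integral by - b and raises the exponent. The range z > 1
    lets the integrable function at z = 1 dominate the derivatives. *)
Lemma stieltjes_raise u b : 0 < b -> measurable_fun I u ->
  mu.-integrable I (fun x => (u x * (1 + x) `^ (- b))%:E) ->
  (forall z, 1 < z -> (\int[mu]_(x in I) (u x * (z + x) `^ (- b)))%R = 0) ->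
  forall z, 1 < z -> (\int[mu]_(x in I) (u x * (z + x) `^ (- (b + 1))))%R = 0.
Proof.
move=> b0 mu_ iu hu z z1.
pose f z x : R := u x * (z + x) `^ (- b).
have in1 : `]1, z + 1[%classic z by rewrite /= in_itv/= z1 ltrDl ltr01.
have gt1 y : `]1, z + 1[%classic y -> 1 < y by rewrite /= in_itv/= => /andP[].
have i1 y : `]1, z + 1[%classic y -> mu.-integrable I (EFin \o f y).
  move=> /gt1 y1; apply: (@integrable_stieltjes_mono u b b) => //; exact: ltW.
have dfE y x : 1 < y -> 0 < x ->
    has_deriv (fun y => f y x) y (- b * (u x * (y + x) `^ (- (b + 1)))).
  move=> y1 x0; apply: has_deriv_eq; first by rewrite /f; der; lra.
  by rewrite /= opprD; ring.
have d1 y x : `]1, z + 1[%classic y -> I x -> derivable (f ^~ x) y 1.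
  move=> /gt1 y1; rewrite /I /= in_itv/= andbT => x0.
  by have [] := dfE y x y1 x0.
have pE y x : 1 < y -> I x -> partial1of2 f y x = - b * (u x * (y + x) `^ (- (b + 1))).
  move=> y1; rewrite /I /= in_itv/= andbT => x0; rewrite partial1of2E.
  by have [] := dfE y x y1 x0.
pose G x := b * `|u x * (1 + x) `^ (- b)|.
have G0 x : 0 <= G x by rewrite mulr_ge0// ltW.
have iG : mu.-integrable I (EFin \o G).
  exact: (integrableZl _ b (integrable_abse iu)).
have bG y x : `]1, z + 1[%classic y -> I x -> `|partial1of2 f y x| <= G x.
  move=> /gt1 y1 Ix; rewrite pE// normrM normrN (gtr0_norm b0) ler_pM2l// !normrM ler_wpM2l//.
  move: Ix; rewrite /I /= in_itv/= andbT => x0.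
  rewrite !ger0_norm ?powR_ge0//.
  apply: (@le_trans _ _ ((y + x) `^ (- b))); last by apply: powRN_le; lra.
  by apply: ler_powR; lra.
have D := @differentiation_under_integral R _ _ mu f I mI z 1 (z + 1) in1 i1 d1 G G0 iG bG.
have : derive1 (fun y => (\int[mu]_(x in I) f y x)%R) z = 0.
  rewrite derive1E.
  have e : \forall y \near z, (\int[mu]_(x in I) f y x)%R = cst 0 y.
    near=> y; rewrite /f hu//; near: y; exact: lt_nbhsr.
  by rewrite (near_eq_derive _ e) ?oner_neq0// derive_cst.
rewrite D => h.
have : (- b * \int[mu]_(x in I) (u x * (z + x) `^ (- (b + 1))))%R = 0.
  rewrite -RintegralZl//; last first.
    by apply: (@integrable_stieltjes_mono u b) => //; lra.
  rewrite -h; apply: eq_Rintegral => x /set_mem Ix; rewrite pE//.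
by move/eqP; rewrite mulf_eq0 oppr_eq0 (gt_eqF b0)/= => /eqP.
Unshelve. all: by end_near. Qed.

Lemma stieltjes_raise_n u b n : 0 < b -> measurable_fun I u ->
  mu.-integrable I (fun x => (u x * (1 + x) `^ (- b))%:E) ->
  (forall z, 1 < z -> (\int[mu]_(x in I) (u x * (z + x) `^ (- b)))%R = 0) ->
  forall z, 1 < z -> (\int[mu]_(x in I) (u x * (z + x) `^ (- (b + n%:R))))%R = 0.
Proof.
move=> b0 mu_ iu hu; elim: n => [|n IH] z z1; first by rewrite addr0 hu.
rewrite -natr1 addrA; apply: stieltjes_raise => //; first by rewrite ltr_wpDr.
by apply: (@integrable_stieltjes_mono u b) => //; [exact: ltW|rewrite lerDl].
Qed.

Variables (u : R -> R) (b : R).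
Hypotheses (b0 : 0 < b) (mu_ : measurable_fun I u).
Hypothesis iu : mu.-integrable I (fun x => (u x * (1 + x) `^ (- b))%:E).
Hypothesis hu : forall z, 1 < z ->
  (\int[mu]_(x in I) (u x * (z + x) `^ (- b)))%R = 0.

(** The kernel is frozen at z = 2, and the raised exponents b + j become the powers y^j of y = 1 /
    (2 + x), which lies in ]0, 1/2[. *)
Let w x := u x * (2 + x) `^ (- b).
Let y_ x : R := (2 + x)^-1.
Let iw : mu.-integrable I (EFin \o w).
Proof. by apply: (@integrable_stieltjes_mono u b b) => //; [exact: ltW|lra]. Qed.
Let y01 x : I x -> 0 < y_ x < 2^-1.
Proof.
rewrite /I /= in_itv/= andbT => x0; rewrite /y_ invr_gt0 ltf_pV2 ?posrE; [|lra|lra].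
by apply/andP; split; lra.
Qed.
Let my : measurable_fun I y_.
Proof.
have -> : y_ = fun x => (2 + x)^-1 by [].
apply: open_continuous_measurable_fun; first exact: interval_open.
move=> x /set_mem; rewrite /I /= in_itv/= andbT => x0.
by apply: has_deriv_cont; der; rewrite gt_eqF//; lra.
Qed.

Let iwq (q : R -> R) : measurable_fun I q -> (forall x, I x -> `|q x| <= 1) ->
  mu.-integrable I (EFin \o (fun x => w x * q x)).
Proof.
move=> mq q1; apply: le_integrable iw => //.
  apply/measurable_EFinP; apply: measurable_funM => //.
  by have /integrableP[/measurable_EFinP] := iw.
by move=> x Ix; rewrite /= lee_fin normrM ler_piMr// q1.
Qed.

Let norm_y j x : I x -> `|y_ x ^+ j| <= 1.
Proof.
move=> /y01 /andP[h1 h2]; have h3 : 0 <= y_ x by exact: ltW.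
by rewrite ger0_norm ?exprn_ge0// exprn_ile1//; lra.
Qed.

Let norm_y1 N m x : I x -> `|(1 - y_ x ^+ N) ^+ m| <= 1.
Proof.
move=> Ix; have /andP[h1 h2] := y01 Ix; have := norm_y N Ix.
have h3 : 0 <= y_ x ^+ N by rewrite exprn_ge0// ltW.
rewrite ger0_norm// => h4.
by rewrite ger0_norm ?exprn_ge0 ?exprn_ile1//; lra.
Qed.

(* In terms of y = 1 / (2 + x), raising the exponent gives the vanishing of all
   the moments of [w]. *)
Let poly0 N m j : (\int[mu]_(x in I) (w x * (y_ x ^+ j * (1 - y_ x ^+ N) ^+ m)))%R = 0.
Proof.
elim: m j => [|m IH] j.
  rewrite -(@stieltjes_raise_n u b j b0 mu_ iu hu 2); last lra.
  apply: eq_Rintegral => x /set_mem; rewrite /I /= in_itv/= andbT => x0.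
  rewrite /w expr0 mulr1 -mulrA; congr (_ * _).
  rewrite opprD powRD; last by apply/implyP => _; rewrite gt_eqF//; lra.
  by congr (_ * _); rewrite /y_ powR_invn; [rewrite exprVn|lra].
have m1 j' : measurable_fun I (fun x => y_ x ^+ j' * (1 - y_ x ^+ N) ^+ m).
  apply: measurable_funM; first exact: measurable_funX.
  apply: measurable_funX; apply: measurable_funB => //; exact: measurable_funX.
have b1 j' x : I x -> `|y_ x ^+ j' * (1 - y_ x ^+ N) ^+ m| <= 1.
  by move=> Ix; rewrite normrM mulr_ile1// ?norm_y ?norm_y1.
rewrite -[RHS](subrr 0) -{1}(IH j) -(IH (j + N)%N) -RintegralB//; last 2 first.
  exact: (iwq (m1 j) (b1 j)).
  exact: (iwq (m1 (j + N)%N) (b1 (j + N)%N)).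
by apply: eq_Rintegral => x _; rewrite exprS exprD; ring.
Qed.

(** The condition x > x0 reads y < c with c = 1 / (2 + x0); the step polynomials in y tend boundedly
    to its indicator, except at x = x0. *)
Let tail0 x0 : 0 < x0 -> (\int[mu]_(x in `]x0, +oo[) w x)%R = 0.
Proof.
move=> x00; pose c := (2 + x0)^-1.
have c01 : 0 < c < 1.
  by rewrite invr_gt0 invf_lt1; [apply/andP; split; lra|lra].
pose f_ N := (fun x => (w x * step_poly c N (y_ x))%:E).
have mf N : measurable_fun I (fun x => step_poly c N (y_ x)).
  by apply: measurable_funX; apply: measurable_funB => //; exact: measurable_funX.
have sub : `]x0, +oo[ `<=` I.
  by move=> x; rewrite /I /= !in_itv/= !andbT; exact: lt_trans.
have mw : measurable_fun I w by have /integrableP[/measurable_EFinP] := iw.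
have [] := @dominated_convergence _ _ _ mu I mI f_ ((EFin \o w) \_ `]x0, +oo[%classic)
   (fun x => `|(w x)%:E|%E).
- move=> N; have h : measurable_fun I (fun x => w x * step_poly c N (y_ x)).
    exact: measurable_funM.
  exact/measurable_EFinP.
- apply/(measurable_restrict (EFin \o w)) => //.
  by apply/measurable_EFinP; apply: measurable_funS mw => // x [].
- exists [set x0]; split => //; first exact: lebesgue_measure_set1.
  move=> x /= hx; apply: contrapT => /eqP xx; apply: hx => Ix.
  have Ix' := Ix; rewrite /I /= in_itv/= andbT in Ix'.
  have /andP[y1 y2] := y01 Ix.
  rewrite /f_ /patch; case: ifPn; rewrite ?notin_setE ?inE /= in_itv/= andbT => hx.
    apply: cvg_EFin; first by near=> n.
    rewrite -[X in _ --> X]mulr1; apply: cvgMl_tmp; apply: step_poly_cvg1 => //.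
    by rewrite (ltW y1) /c /y_ ltf_pV2 ?posrE; lra.
  apply: cvg_EFin; first by near=> n.
  rewrite -[X in _ --> X](mulr0 (w x)); apply: cvgMl_tmp; apply: step_poly_cvg0.
    by case/andP: c01.
  rewrite /c /y_ ltf_pV2 ?posrE; [|lra|lra].
  have : x < x0 by rewrite lt_neqAle xx leNgt; exact/negP.
  by move=> h; apply/andP; split; [lra|rewrite -/(y_ x); lra].
- exact: integrable_abse iw.
- apply: aeW => x N Ix; rewrite /f_ /= lee_fin normrM ler_piMr//.
  have /andP[y1 y2] := y01 Ix.
  have /andP[h1 h2] : 0 <= step_poly c N (y_ x) <= 1.
    by apply: step_poly_bound; apply/andP; split; lra.
  by rewrite ger0_norm.
move=> _ _ h.
have h0 N : (\int[mu]_(x in I) f_ N x = 0)%E.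
  have e : (\int[mu]_(x in I) (w x * (y_ x ^+ 0 * (1 - y_ x ^+ N) ^+ step_exp c N)))%R = 0.
    exact: poly0.
  rewrite -[LHS]fineK.
    congr EFin; rewrite -[RHS]e; apply: eq_Rintegral => x _.
    by rewrite expr0 mul1r.
  apply: integrable_fin_num => //; apply: iwq => // x Ix; exact: norm_y1.
have h1 : (\int[mu]_(x in I) f_ N x @[N --> \oo] --> (0%E : \bar R))%E.
  by under eq_fun do rewrite h0; exact: cvg_cst.
have e := cvg_unique _ h h1.
rewrite /Rintegral -[X in integral _ X](setIidr sub) integral_mkcondr.
by rewrite e.
Unshelve. all: by end_near. Qed.

(** Two tails differ by the integral over ]x, x1], which is therefore 0; if u x were nonzero, right
    continuity would keep [u x * w] above a positive constant there. *)
Lemma stieltjes_unique x : 0 < x -> u y @[y --> x^'+] --> u x -> u x = 0.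
Proof.
move=> x0 rc.
have [//|ux] := eqVneq (u x) 0; exfalso.
have e0 : 0 < `|u x| / 2 by rewrite divr_gt0 ?normr_gt0.
have /cvgrPdist_lt /(_ _ e0) := rc.
case => /= d d0 hd.
pose x1 := x + d / 2.
have xx1 : x < x1 by rewrite ltrDl divr_gt0.
have close y : x < y <= x1 -> `|u x - u y| < `|u x| / 2.
  move=> /andP[y1 y2]; apply: hd => //=.
  rewrite distrC ger0_norm ?subr_ge0 ?ltW//; rewrite /x1 in y2; lra.
have sub : `]x, +oo[ `<=` I.
  by move=> t; rewrite /I /= !in_itv/= !andbT; exact: lt_trans.
have iwx : mu.-integrable `]x, +oo[ (EFin \o w) by exact: integrableS iw.
have e : `]x, +oo[%classic = `]x, x1] `|` `]x1, +oo[ :> set R.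
  by rewrite -itv_bndbnd_setU// ?bnd_simp// ltW.
have z0 : (\int[mu]_(t in `]x, x1]) w t)%R = 0.
  have := tail0 x0; rewrite e Rintegral_setU//.
  - by rewrite (tail0 (lt_trans x0 xx1)) addr0.
  - by rewrite -e.
  - by apply/disj_setPS => t [/=]; rewrite !in_itv/= andbT => /andP[_ h1] h2; lra.
have iw1 : mu.-integrable `]x, x1] (EFin \o w).
  by apply: integrableS iwx => //; rewrite e; exact: subsetUl.
(* |u x - u t| < |u x| / 2 gives u x u t >= u(x)^2 / 2, and the weight is smallest at the right
   end. *)
pose kk := u x ^+ 2 / 2 * (2 + x1) `^ (- b).
have k0 : 0 < kk.
  rewrite mulr_gt0 ?powR_gt0//; last lra.
  by rewrite divr_gt0// exprn_even_gt0.
have ik : mu.-integrable `]x, x1] (EFin \o (fun=> kk)).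
  apply: (@integrableS _ _ _ mu `[x, x1]%classic) => //; first exact: subset_itv_oc_cc.
  apply: continuous_compact_integrable; first exact: segment_compact.
  by apply: continuous_subspaceT => y; exact: cst_continuous.
have iuw : mu.-integrable `]x, x1] (EFin \o (fun t => u x * w t)).
  exact: (integrableZl _ (u x) iw1).
have low t : `]x, x1]%classic t -> kk <= u x * w t.
  rewrite /= in_itv/= => tx; have /andP[t1 t2] := tx.
  have h := close t tx.
  rewrite /w mulrA /kk; apply: ler_pM.
  - by rewrite divr_ge0// sqr_ge0.
  - exact: powR_ge0.
  - have h2 : u x * (u x - u t) <= `|u x| * (`|u x| / 2).
      by apply: le_trans (ler_norm _) _; rewrite normrM ler_wpM2l// ltW.
    have h3 : `|u x| * `|u x| = u x ^+ 2 by rewrite -expr2 real_normK ?num_real.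
    rewrite mulrA h3 in h2; lra.
  - by apply: powRN_le; [exact: ltW b0|lra|lra].
have := @le_Rintegral _ _ _ mu `]x, x1]%classic _ _ _ ik iuw low.
have mJ : (0 : R) < fine (mu `]x, x1]).
  by rewrite lebesgue_measure_itv/= lte_fin xx1 -EFinB/= subr_gt0.
have z1 : Rintegral mu `]x, x1] (fun t => u x * w t) = 0.
  by rewrite RintegralZl ?z0 ?mulr0//.
have z2 : Rintegral mu `]x, x1] (fun=> kk) = kk * fine (mu `]x, x1]).
  by rewrite Rintegral_cst.
by rewrite z1 z2 leNgt (mulr_gt0 k0 mJ) => /(_ (measurable_itv _)).
Qed.

End stieltjes_uniqueness.

(** * Abel integrals *)

Section abel_integrals.
Context {R : realType}.
Notation mu := (@lebesgue_measure R).
Implicit Types (x t z p q : R).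

(** The sum of the two endpoint values covers increasing and decreasing powers alike. *)
Lemma powR_le_max p x y t : 0 < x -> x <= t <= y -> t `^ p <= x `^ p + y `^ p.
Proof.
move=> x0 /andP[xt ty]; have t0 := lt_le_trans x0 xt; have y0 := lt_le_trans t0 ty.
have [p0|p0] := leP 0 p.
  apply: (@le_trans _ _ (y `^ p)); last by rewrite lerDr powR_ge0.
  by apply: ge0_ler_powR => //; rewrite nnegrE ltW.
apply: (@le_trans _ _ (x `^ p)); last by rewrite lerDl powR_ge0.
by rewrite -(opprK p); apply: powRN_le => //; rewrite oppr_ge0 ltW.
Qed.

(** On each half of ]0, x[ one of the two factors is bounded. The integrability of the beta kernel
    thus reduces to that of two single powers. *)
Lemma beta_dominated p q x : 0 < x -> exists2 K : R, 0 <= K &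
  forall t, 0 < t < x -> (x - t) `^ p * t `^ q <= K * ((x - t) `^ p + t `^ q).
Proof.
move=> x0; have h0 : 0 < x / 2 by rewrite divr_gt0.
exists ((x / 2) `^ p + x `^ p + ((x / 2) `^ q + x `^ q)) => [|t /andP[t0 tx]].
  by rewrite !addr_ge0 ?powR_ge0.
have [th|th] := leP t (x / 2).
  have h : (x - t) `^ p <= (x / 2) `^ p + x `^ p.
    by apply: powR_le_max => //; apply/andP; split; lra.
  apply: (@le_trans _ _ (((x / 2) `^ p + x `^ p) * t `^ q)).
    by rewrite ler_wpM2r ?powR_ge0.
  by apply: ler_pM; rewrite ?addr_ge0 ?powR_ge0 ?lerDl ?lerDr ?addr_ge0 ?powR_ge0.
have h : t `^ q <= (x / 2) `^ q + x `^ q.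
  by apply: powR_le_max => //; apply/andP; split; lra.
apply: (@le_trans _ _ (((x / 2) `^ q + x `^ q) * (x - t) `^ p)).
  by rewrite mulrC ler_wpM2r ?powR_ge0.
by apply: ler_pM; rewrite ?addr_ge0 ?powR_ge0 ?lerDl ?lerDr ?addr_ge0 ?powR_ge0.
Qed.

Lemma measurable_powR_sub p x (D : set R) : measurable D ->
  measurable_fun D (fun t : R => (x - t) `^ p).
Proof.
move=> mD; apply: measurable_funTS; apply: (measurableT_comp (measurable_powR p)).
exact: measurable_funB.
Qed.

Lemma integrable_beta p q x : 0 < p -> 0 < q -> 0 < x ->
  mu.-integrable `]0, x[ (fun t => ((x - t) `^ (p - 1) * t `^ (q - 1))%:E).
Proof.
move=> p0 q0 x0; have [K K0 hK] := beta_dominated (p - 1) (q - 1) x0.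
have mp : measurable_fun (`]0, x[ : set R) (fun t : R => (x - t) `^ (p - 1)).
  exact: measurable_powR_sub.
have mq : measurable_fun (`]0, x[ : set R) (fun t : R => t `^ (q - 1)).
  by apply: measurable_funTS; exact: measurable_powR.
have i1 : mu.-integrable `]0, x[ (fun t => ((x - t) `^ (p - 1))%:E).
  apply/integrableP; split; first exact/measurable_EFinP.
  under eq_integral do rewrite gee0_abs ?lee_fin ?powR_ge0//.
  by rewrite integral_powR_diff// ltry.
have i2 : mu.-integrable `]0, x[ (fun t => (t `^ (q - 1))%:E).
  apply/integrableP; split; first exact/measurable_EFinP.
  under eq_integral do rewrite gee0_abs ?lee_fin ?powR_ge0//.
  by rewrite integral_powR0// ltry.
apply: le_integrable (integrableZl _ K (integrableD _ i1 i2)) => //.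
  by apply/measurable_EFinP; exact: measurable_funM.
move=> t; rewrite /= in_itv/= => tx; rewrite lee_fin.
rewrite ger0_norm ?mulr_ge0 ?powR_ge0//.
exact: le_trans (hK _ tx) (ler_norm _).
Qed.

Lemma integral_scale (c : R) (f : R -> \bar R) : 0 < c ->
  measurable_fun (`]0%R, +oo[ : set R) f ->
  (\int[mu]_(x in `]0%R, +oo[) f x = \int[mu]_(x in `]0%R, +oo[) (c%:E * f (c * x)%R))%E.
Proof.
move=> c0 mf; rewrite integralE [RHS]integralE; congr (_ - _)%E.
  rewrite (ge0_integral_scale c0) //; last exact: measurable_funepos.
  apply: eq_integral => x _; rewrite !funeposE.
  by rewrite maxe_pMr ?lee_fin ?(ltW c0)// mule0.
rewrite (ge0_integral_scale c0) //; last exact: measurable_funeneg.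
apply: eq_integral => x _; rewrite !funenegE.
by rewrite maxe_pMr ?lee_fin ?(ltW c0)// mule0 muleN.
Qed.

Section dominated_kernel.
(** The bound C t^(q - 1) covers [Delta] with q = 1, and [d_dens] and [varrho] with q = alpha. *)
Variables (p q C : R) (h : R -> R).
Hypotheses (p0 : 0 < p) (q0 : 0 < q).
Hypothesis ch : forall t, 0 < t -> {for t, continuous h}.
Hypothesis hC : forall t, 0 < t -> `|h t| <= C * t `^ (q - 1).

Lemma measurable_integrand : measurable_fun (`]0, +oo[ : set R) h.
Proof.
apply: open_continuous_measurable_fun; first exact: interval_open.
by move=> t /set_mem; rewrite /= in_itv/= andbT => t0; exact: ch.
Qed.

Lemma integrable_abel x : 0 < x ->
  mu.-integrable `]0, x[ (fun t => ((x - t) `^ (p - 1) * h t)%:E).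
Proof.
move=> x0; have i1 := integrable_beta p0 q0 x0.
apply: le_integrable (integrableZl _ C i1) => //.
  apply/measurable_EFinP; apply: measurable_funM; first exact: measurable_powR_sub.
  by apply: measurable_funS measurable_integrand => // t /=; rewrite !in_itv/= => /andP[->].
move=> t; rewrite /= in_itv/= => /andP[t0 tx]; rewrite lee_fin normrM.
rewrite (ger0_norm (powR_ge0 _ _)); apply: le_trans (ler_norm _).
by rewrite mulrCA ler_wpM2l ?powR_ge0// hC.
Qed.

(** The substitution t = x s moves x out of the domain and of the singular kernel into [h], where
    continuity under the integral applies. *)
Lemma abel_scale x : 0 < x ->
  abel p h x = x `^ p * (\int[mu]_(s in `]0%R, 1%R[) ((1 - s) `^ (p - 1) * h (x * s)))%R.
Proof.
move=> x0; rewrite /abel.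
have sub y : (`]0, y[%classic : set R) `<=` (`]0, +oo[%classic : set R).
  by move=> t /=; rewrite !in_itv/= => /andP[->].
have mh1 : measurable_fun (`]0%R, +oo[ : set R)
    ((fun t => ((x - t) `^ (p - 1) * h t)%:E) \_ `]0, x[%classic).
  apply/(measurable_restrict (fun t => ((x - t) `^ (p - 1) * h t)%:E)) => //.
  apply/measurable_EFinP; apply: measurable_funM.
    by apply: measurable_powR_sub; exact: measurableI.
  by apply: measurable_funS measurable_integrand => // t [].
have i1 : mu.-integrable `]0, 1[ (fun s => ((1 - s) `^ (p - 1) * h (x * s))%:E).
  apply: le_integrable (integrableZl _ (C * x `^ (q - 1)) (integrable_beta p0 q0 ltr01)) => //.
    apply/measurable_EFinP; apply: measurable_funM; first exact: measurable_powR_sub.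
    apply: open_continuous_measurable_fun; first exact: interval_open.
    move=> t /set_mem; rewrite /= in_itv/= => /andP[t0 _].
    apply: (@continuous_comp _ _ _ (fun s => x * s) h).
      by apply: has_deriv_cont; der.
    by apply: ch; rewrite mulr_gt0.
  move=> t; rewrite /= in_itv/= => /andP[t0 tx]; rewrite lee_fin normrM.
  rewrite (ger0_norm (powR_ge0 _ _)); apply: le_trans (ler_norm _).
  rewrite mulrCA ler_wpM2l ?powR_ge0//; apply: le_trans (hC _) _; first by rewrite mulr_gt0.
  by rewrite (powRM _ (ltW x0) (ltW t0)) mulrA.
rewrite -RintegralZl//; congr fine.
rewrite -[X in integral _ X](setIidr (sub x)) integral_mkcondr (integral_scale x0)//.
rewrite -[X in _ = integral _ X _](setIidr (sub 1)) integral_mkcondr.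
apply: eq_integral => s /set_mem; rewrite /= in_itv/= andbT => s0.
rewrite /patch; have -> : (x * s \in `]0, x[%classic) = (s \in `]0, 1[%classic).
  apply/idP/idP; rewrite !inE/= !in_itv/= s0 mulr_gt0//= -{2}(mulr1 x).
    by rewrite ltr_pM2l.
  by rewrite ltr_pM2l.
case: ifPn => [|_]; last by rewrite mule0.
rewrite inE/= in_itv/= => /andP[_ s1]; rewrite -EFinM; congr EFin.
have -> : x - x * s = x * (1 - s) by ring.
rewrite powRM ?subr_ge0 ?(ltW x0) ?(ltW s1)//.
by rewrite -[in RHS](mulr_powRB1 (ltW x0) p0); ring.
Qed.

Lemma continuous_abel x : 0 < x -> {for x, continuous (abel p h)}.
Proof.
move=> x0.
pose f (l s : R) : R := (1 - s) `^ (p - 1) * h (l * s).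
pose F (l : R) : R := (\int[mu]_(s in `]0%R, 1%R[) f l s)%R.
have sub1 t : `]0, 1[%classic t -> 0 < t < 1 by rewrite /= in_itv.
have cf (l s : R) : 0 < l -> 0 < s -> {for l, continuous (fun l : R => f l s)}.
  move=> l0 s0; rewrite /f; apply: cvgMl_tmp.
  have c : {for l, continuous (h \o (fun l : R => l * s))}.
    apply: continuous_comp; first by apply: has_deriv_cont; der.
    by apply: ch; rewrite mulr_gt0.
  exact: c.
have C0 : 0 <= C.
  have := hC ltr01; rewrite powR1 mulr1; exact: le_trans.
pose g s : R := C * ((x / 2) `^ (q - 1) + (2 * x) `^ (q - 1)) * ((1 - s) `^ (p - 1) * s `^ (q - 1)).
have ig : mu.-integrable `]0, 1[ (EFin \o g).
  exact: (integrableZl _ (C * ((x / 2) `^ (q - 1) + (2 * x) `^ (q - 1)))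
    (integrable_beta p0 q0 ltr01)).
have bnd l s : x / 2 < l < 2 * x -> 0 < s < 1 -> `|f l s| <= g s.
  move=> /andP[l1 l2] /andP[s0 s1]; have l0 : 0 < l by lra.
  rewrite /f /g normrM (ger0_norm (powR_ge0 _ _)) [X in _ <= X]mulrCA ler_wpM2l ?powR_ge0//.
  apply: le_trans (hC _) _; first by rewrite mulr_gt0.
  rewrite (powRM _ (ltW l0) (ltW s0)) -mulrA ler_wpM2l// ler_wpM2r ?powR_ge0//.
  by apply: powR_le_max; [lra|apply/andP; split; lra].
have mf l : 0 < l -> measurable_fun (`]0, 1[ : set R) (f l).
  move=> l0; apply: measurable_funM; first exact: measurable_powR_sub.
  apply: open_continuous_measurable_fun; first exact: interval_open.
  move=> t /set_mem /sub1 /andP[t0 _].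
  apply: (@continuous_comp _ _ _ (fun s => l * s) h).
    by apply: has_deriv_cont; der.
  by apply: ch; rewrite mulr_gt0.
have in_ : `](x / 2), (2 * x)[%classic x by rewrite /= in_itv/=; apply/andP; split; lra.
have CF : {for x, continuous F}.
  have := @continuity_under_integral R _ _ mu f `]0, 1[%classic _ (x / 2) (2 * x) _ _ g ig.
  apply.
  - exact: measurable_itv.
  - move=> l; rewrite /= in_itv/= => hl; apply: le_integrable ig => //.
      by apply/measurable_EFinP; apply: mf; case/andP: hl; lra.
    move=> s /sub1 hs; rewrite /= lee_fin.
    exact: le_trans (bnd _ _ hl hs) (ler_norm _).
  - apply: aeW => s /sub1 /andP[s0 _] l /set_mem; rewrite /= in_itv/= => /andP[l1 _].
    by apply: cf => //; lra.
  - move=> l; rewrite /= in_itv/= => hl; apply: aeW => s /sub1 hs; exact: bnd.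
  - exact: mem_set.
have e : \forall l \near x, abel p h l = l `^ p * F l.
  near=> l; rewrite abel_scale//; near: l; exact: lt_nbhsr.
have c : (fun l => l `^ p * F l) @ x --> abel p h x.
  have -> : abel p h x = x `^ p * F x by exact: abel_scale.
  have c1 : {for x, continuous (fun l : R => l `^ p)} by apply: has_deriv_cont; der.
  exact: cvgM c1 CF.
rewrite /prop_for /continuous_at.
apply: cvg_trans c; apply: near_eq_cvg; near=> l.
by apply/esym; near: l.
Unshelve. all: by end_near. Qed.

Lemma measurable_abel : measurable_fun (`]0, +oo[ : set R) (abel p h).
Proof.
apply: open_continuous_measurable_fun; first exact: interval_open.
by move=> t /set_mem; rewrite /= in_itv/= andbT => t0; exact: continuous_abel.
Qed.

End dominated_kernel.

Lemma measurable_ltr_set d (T : measurableType d) (f g : T -> R) :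
  measurable_fun setT f -> measurable_fun setT g -> measurable [set w | f w < g w].
Proof.
move=> mf mg; have -> : [set w | f w < g w] = (fun w => g w - f w) @^-1` `]0, +oo[%classic.
  by apply/seteqP; split => w /=; rewrite in_itv/= andbT subr_gt0.
rewrite -[X in measurable X]setTI; exact: (measurable_funB mg mf).
Qed.

Section stieltjes_of_abel.
Variables (p q C : R) (h : R -> R) (z : R).
Hypotheses (p0 : 0 < p) (q0 : 0 < q) (z0 : 0 < z).
Hypothesis ch : forall t, 0 < t -> {for t, continuous h}.
Hypothesis hC : forall t, 0 < t -> `|h t| <= C * t `^ (q - 1).
Hypothesis ih : mu.-integrable `]0, +oo[ (fun t => (h t / (z + t))%:E).

Let E : set (measurableTypeR R * measurableTypeR R) := [set r | 0 < r.1 < r.2].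
Let mE : measurable E.
Proof.
have -> : E = [set r | (0 : R) < r.1] `&` [set r | r.1 < r.2].
  by apply/seteqP; split => r /=; [move=> /andP[]|move=> [h1 h2]; apply/andP].
by apply: measurableI; apply: measurable_ltr_set => //.
Qed.

Let f (r : measurableTypeR R * measurableTypeR R) : \bar R :=
  ((r.2 - r.1) `^ (p - 1) * h r.1 * (p * (z + r.2) `^ (- p - 1)))%:E.
Let mf : measurable_fun E f.
Proof.
apply/measurable_EFinP; apply: measurable_funM; first apply: measurable_funM.
- apply: measurable_funTS; apply: (measurableT_comp (measurable_powR _)).
  by apply: measurable_funB; [exact: measurable_snd|exact: measurable_fst].
- have sub : [set r.1 | r in E] `<=` (`]0, +oo[%classic : set R).
    by move=> _ [r /= /andP[r0 _] <-]; rewrite /= in_itv/= r0.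
  have m1 : measurable_fun E (fun r : measurableTypeR R * measurableTypeR R => r.1).
    by apply: measurable_funTS; exact: measurable_fst.
  exact: measurable_comp (measurable_itv _) sub (measurable_integrand ch) m1.
- apply: measurable_funTS; apply: measurable_funM => //.
  apply: (measurableT_comp (measurable_powR _)).
  by apply: measurable_funD => //; exact: measurable_snd.
Qed.

Let ibeta t : 0 < t ->
  mu.-integrable `]t, +oo[ (fun x => ((x - t) `^ (p - 1) * (z + x) `^ (- p - 1))%:E).
Proof.
move=> t0; apply/integrableP; split.
  apply/measurable_EFinP; apply: measurable_funM.
    apply: measurable_funTS; apply: (measurableT_comp (measurable_powR _)).
    exact: measurable_funB.
  apply: measurable_funTS; apply: (measurableT_comp (measurable_powR _)).
  exact: measurable_funD.
under eq_integral do rewrite gee0_abs ?lee_fin ?mulr_ge0 ?powR_ge0//.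
by rewrite integral_beta1 ?addr_gt0// ltry.
Qed.

Let inner_x t : 0 < t -> (\int[mu]_(x in `]t, +oo[) f (t, x) = (h t / (z + t))%:E)%E.
Proof.
move=> t0; rewrite [LHS](_ : _ = \int[mu]_(x in `]t, +oo[)
    ((h t * p)%:E * ((x - t) `^ (p - 1) * (z + x) `^ (- p - 1))%:E))%E; last first.
  by apply: eq_integral => x _; rewrite -EFinM /f /=; congr EFin; ring.
rewrite integralZl//; last exact: ibeta.
rewrite integral_beta1 ?addr_gt0// -EFinM; congr EFin.
by field; rewrite !gt_eqF// addr_gt0.
Qed.

Let inner_x_norm t : 0 < t ->
  (\int[mu]_(x in `]t, +oo[) `|f (t, x)| = `|h t / (z + t)|%:E)%E.
Proof.
move=> t0; rewrite [LHS](_ : _ = \int[mu]_(x in `]t, +oo[)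
    ((`|h t| * p)%:E * ((x - t) `^ (p - 1) * (z + x) `^ (- p - 1))%:E))%E; last first.
  apply: eq_integral => x _; rewrite -EFinM /f abse_EFin !normrM /=.
  by rewrite !(ger0_norm (powR_ge0 _ _)) (gtr0_norm p0); congr EFin; ring.
rewrite integralZl//; last exact: ibeta.
rewrite integral_beta1 ?addr_gt0// -EFinM normrM normfV (@gtr0_norm _ (z + t)) ?addr_gt0//.
by congr EFin; field; rewrite !gt_eqF// addr_gt0.
Qed.

Let inner_t x : 0 < x ->
  (\int[mu]_(t in `]0%R, x[) f (t, x) = (abel p h x * (p * (z + x) `^ (- p - 1)))%:E)%E.
Proof.
move=> x0; have i := integrable_abel p0 q0 ch hC x0.
rewrite [LHS](_ : _ = \int[mu]_(t in `]0%R, x[)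
    ((p * (z + x) `^ (- p - 1))%:E * ((x - t) `^ (p - 1) * h t)%:E))%E; last first.
  by apply: eq_integral => t _; rewrite -EFinM /f /=; congr EFin; ring.
rewrite integralZl//.
have a : (\int[mu]_(t in `]0%R, x[) ((x - t) `^ (p - 1) * h t)%:E = (abel p h x)%:E)%E.
  by rewrite /abel /Rintegral fineK//; exact: integrable_fin_num.
rewrite [RHS]EFinM -a muleC; congr (_ * _)%E.
Qed.

(** Fubini on 0 < t < x: by [integral_beta1] the inner integral in x is 1 / (p (z + t)), and the
    factor p cancels. *)
Lemma stieltjes_abel : (\int[mu]_(x in `]0%R, +oo[)
    (abel p h x * (p * (z + x) `^ (- p - 1)))%:E =
  \int[mu]_(t in `]0%R, +oo[) (h t / (z + t))%:E)%E.
Proof.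
have := @fubini_dom _ _ (measurableTypeR R) (measurableTypeR R) R mu mu E (`]0, +oo[ : set R) (fun t => `]t, +oo[%classic)
  (`]0, +oo[ : set R) (fun x => `]0, x[%classic).
move=> /(_ mE _ _ f mf) F.
transitivity (\int[mu]_(x in `]0%R, +oo[) \int[mu]_(t in `]0%R, x[) f (t, x))%E.
  by apply: eq_integral => x /set_mem; rewrite /= in_itv/= andbT => x0; rewrite inner_t.
rewrite -F.
- by apply: eq_integral => t /set_mem; rewrite /= in_itv/= andbT => t0; rewrite inner_x.
- by move=> t x; rewrite /E /= !in_itv/= !andbT; split => [/andP//|H]; apply/andP.
- move=> t x; rewrite /E /= !in_itv/= !andbT; split => [/andP[h1 h2]|[_ //]].
  by split; [exact: lt_trans h1 h2|rewrite h1 h2].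
- have /integrableP[_] := ih; apply: le_lt_trans.
  rewrite le_eqVlt; apply/orP; left; apply/eqP; apply: eq_integral => t /set_mem.
  by rewrite /= in_itv/= andbT => t0; rewrite inner_x_norm.
Qed.

End stieltjes_of_abel.

(** [stieltjes_abel] for |h| gives a finite integral, and the Abel transform of |h| dominates that
    of h. *)
Lemma integrable_stieltjes_abel p q C (h : R -> R) z : 0 < p -> 0 < q -> 0 < z ->
  (forall t, 0 < t -> {for t, continuous h}) ->
  (forall t, 0 < t -> `|h t| <= C * t `^ (q - 1)) ->
  mu.-integrable `]0, +oo[ (fun t => (h t / (z + t))%:E) ->
  mu.-integrable `]0, +oo[ (fun x => (abel p h x * (p * (z + x) `^ (- p - 1)))%:E).
Proof.
move=> p0 q0 z0 ch hC ih.
have ch' t : 0 < t -> {for t, continuous (fun t => `|h t|)}.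
  by move=> t0; have := @continuous_comp _ _ _ h Num.norm t (ch t t0) (@norm_continuous _ _ _).
have hC' t : 0 < t -> `| `|h t| | <= C * t `^ (q - 1) by rewrite normr_id; exact: hC.
have ih' : mu.-integrable `]0, +oo[ (fun t => (`|h t| / (z + t))%:E).
  apply: eq_integrable (integrable_abse ih) => // t /set_mem; rewrite /= in_itv/= andbT => t0.
  by rewrite normrM normfV (@gtr0_norm _ (z + t)) ?addr_gt0.
have mz : measurable_fun (`]0, +oo[ : set R) (fun x : R => p * (z + x) `^ (- p - 1)).
  by apply: measurable_funM => //; exact: measurable_shift_powR.
have e := stieltjes_abel p0 q0 z0 ch' hC' ih'.
have ab0 x : 0 <= abel p (fun t => `|h t|) x.
  by apply: Rintegral_ge0 => t _; rewrite mulr_ge0// powR_ge0.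
have pz0 x : 0 <= p * (z + x) `^ (- p - 1) by rewrite mulr_ge0 ?powR_ge0// ltW.
have i : mu.-integrable `]0, +oo[
    (fun x => (abel p (fun t => `|h t|) x * (p * (z + x) `^ (- p - 1)))%:E).
  apply/integrableP; split.
    by apply/measurable_EFinP; apply: measurable_funM => //; exact: measurable_abel p0 q0 ch' hC'.
  under eq_integral do rewrite abse_EFin (ger0_norm (mulr_ge0 (ab0 _) (pz0 _))).
  have /integrableP[_] := ih'; apply: le_lt_trans; rewrite e.
  apply: ge0_le_integral => //.
  - move=> t; rewrite /= in_itv/= andbT => t0.
    by rewrite lee_fin divr_ge0// ltW// addr_gt0.
  - by have /integrableP[] := ih'.

  - by apply: measurableT_comp => //; have /integrableP[] := ih'.
  - by move=> t _; exact: lee_abs.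
apply: le_integrable i => //.
  by apply/measurable_EFinP; apply: measurable_funM => //; exact: measurable_abel p0 q0 ch hC.
move=> x; rewrite /= in_itv/= andbT => x0; rewrite lee_fin normrM [in leRHS]normrM ler_wpM2r//.
rewrite [in leRHS]ger0_norm//; apply: le_trans (le_normr_Rintegral _ _) _ => //.
  have i2 := integrable_abel p0 q0 ch hC x0; exact i2.
rewrite /abel le_eqVlt; apply/orP; left; apply/eqP; apply: eq_Rintegral => t _.
by rewrite normrM (ger0_norm (powR_ge0 _ _)).
Qed.

End abel_integrals.

(** * Primitives of Abel transforms, and [Delta] as the primitive of [d_dens] *)

Section primitive_of_abel.
Context {R : realType}.
Notation mu := (@lebesgue_measure R).
Variables (p q C : R) (h : R -> R) (H : R -> R).
Hypotheses (p0 : 0 < p) (q0 : 0 < q).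
Hypothesis ch : forall t, 0 < t -> {for t, continuous h}.
Hypothesis hC : forall t, 0 < t -> `|h t| <= C * t `^ (q - 1).
Hypothesis hH : forall t, 0 < t -> (\int[mu]_(s in `]0%R, t[) (h s)%:E = (H t)%:E)%E.
Variable x : R.
Hypothesis x0 : 0 < x.

Lemma integral_powR_shift s : s < x ->
  (\int[mu]_(y in `]s, x[) ((y - s) `^ (p - 1))%:E = ((x - s) `^ p / p)%:E)%E.
Proof.
move=> sx.
rewrite (@ge0_FTC_oo _ _ (fun y => p^-1 * (y - s) `^ p) s x (p^-1 * 0) (p^-1 * (x - s) `^ p))//.
- by rewrite mulr0 subr0 mulrC.
- by move=> y _; exact: powR_ge0.
- by move=> y /andP[sy _]; apply: has_deriv_cont; der; rewrite subr_gt0.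
- move=> y /andP[sy _]; apply: has_deriv_eq; first by der; rewrite subr_gt0.
  by rewrite /=; field; rewrite gt_eqF.
- apply: cvgMl_tmp; have := powR_cvg0 p0.
  move=> /cvg_at_rightP hp; apply/cvg_at_rightP => u [us cu].
  apply: (hp (fun n => u n - s)); split; first by move=> n; rewrite subr_gt0.
  by rewrite -(subrr s); apply: cvgB => //; exact: cvg_cst.
- apply: cvgMl_tmp; apply: cvg_at_left_filter.
  by apply: (@has_deriv_cont _ (fun y => (y - s) `^ p)); der; rewrite subr_gt0.
Qed.

Let E : set (measurableTypeR R * measurableTypeR R) := [set r | 0 < r.1 < r.2 /\ r.2 < x].
Let mE : measurable E.
Proof.
have -> : E = ([set r | (0 : R) < r.1] `&` [set r | r.1 < r.2]) `&` [set r | r.2 < x].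
  apply/seteqP; split => r /=; first by move=> [/andP[]].
  by move=> [[h1 h2] h3]; split => //; apply/andP.
by apply: measurableI; first apply: measurableI; apply: measurable_ltr_set => //.
Qed.

(** The right-hand side depends on [k] only through its mass over ]s, x[. Both (y - s)^(p - 1) and
    (x - y)^(p - 1) have the mass (x - s)^p / p, which is how an Abel transform is exchanged with a
    primitive. *)
Lemma integral_triangle (k : R -> R -> R) :
  (forall s y, 0 <= k s y) ->
  measurable_fun setT (fun r : measurableTypeR R * measurableTypeR R => k r.1 r.2) ->
  (forall s, 0 < s < x -> (\int[mu]_(y in `]s, x[) (k s y)%:E = ((x - s) `^ p / p)%:E)%E) ->
  (\int[mu]_(y in `]0%R, x[) \int[mu]_(s in `]0%R, y[) (k s y * h s)%:E =
   \int[mu]_(s in `]0%R, x[) (h s * ((x - s) `^ p / p))%:E)%E.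
Proof.
move=> k0 mk ik.
pose f (r : measurableTypeR R * measurableTypeR R) : \bar R := (k r.1 r.2 * h r.1)%:E.
have mf : measurable_fun E f.
  apply/measurable_EFinP; apply: measurable_funM; first exact: measurable_funTS.
  have sub : [set r.1 | r in E] `<=` (`]0, +oo[%classic : set R).
    by move=> _ [r /= [/andP[r0 _] _] <-]; rewrite /= in_itv/= r0.
  have m1 : measurable_fun E (fun r : measurableTypeR R * measurableTypeR R => r.1).
    by apply: measurable_funTS; exact: measurable_fst.
  exact: measurable_comp (measurable_itv _) sub (measurable_integrand ch) m1.
have iki s : 0 < s < x -> mu.-integrable `]s, x[ (fun y => (k s y)%:E).
  move=> sx; apply/integrableP; split.
    apply/measurable_EFinP; apply: measurable_funTS.
    apply: (measurableT_comp mk (measurable_pair1 s)).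
  by under eq_integral do rewrite abse_EFin ger0_norm//; rewrite ik// ltry.
have F := @fubini_dom _ _ (measurableTypeR R) (measurableTypeR R) R mu mu E
  (`]0, x[ : set R) (fun s => `]s, x[%classic) (`]0, x[ : set R) (fun y => `]0, y[%classic)
  mE _ _ f mf.
rewrite -[LHS]F; clear F.
- apply: eq_integral => s /set_mem; rewrite /= in_itv/= => sx.
  rewrite EFinM -(ik s sx) -integralZl//; last exact: iki.
  by apply: eq_integral => y _; rewrite -EFinM /f /= mulrC.
- move=> s y; rewrite /E /= !in_itv/=; split.
    move=> [/andP[h1 h2] h3]; split; first by rewrite h1 (lt_trans h2 h3).
    by rewrite h2 h3.
  by move=> [/andP[h1 h2] /andP[h3 h4]]; split => //; rewrite h1 h3.
- move=> s y; rewrite /E /= !in_itv/=; split.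
    move=> [/andP[h1 h2] h3]; split; first by rewrite h3 (lt_trans h1 h2).
    by rewrite h1 h2.
  by move=> [/andP[h1 h2] /andP[h3 h4]]; split => //; rewrite h3 h4.
rewrite (_ : integral _ _ _ = \int[mu]_(s in `]0%R, x[) (`|h s| * ((x - s) `^ p / p))%:E)%E; last first.
  apply: eq_integral => s /set_mem; rewrite /= in_itv/= => sx.
  rewrite EFinM -(ik s sx) -integralZl//; last exact: iki.
  by apply: eq_integral => y _; rewrite -EFinM /f /= normrM (ger0_norm (k0 _ _)) mulrC.
have : mu.-integrable `]0, x[ (fun s => (C * x `^ p / p)%:E * (s `^ (q - 1))%:E)%E.
  apply: integrableZl => //; apply/integrableP; split.
    by apply/measurable_EFinP; apply: measurable_funTS; exact: measurable_powR.
  under eq_integral do rewrite abse_EFin (ger0_norm (powR_ge0 _ _)).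
  by rewrite integral_powR0// ltry.
move=> /integrableP[mi]; apply: le_lt_trans; apply: ge0_le_integral => //.
- by move=> s _; rewrite lee_fin mulr_ge0// divr_ge0 ?powR_ge0// ltW.
- apply/measurable_EFinP; apply: measurable_funM.
    apply: measurableT_comp => //.
    by apply: measurable_funS (measurable_integrand ch) => // t /=; rewrite !in_itv/= => /andP[->].
  apply: measurable_funM => //.
  exact: measurable_powR_sub.
- exact: measurableT_comp.
- move=> s; rewrite /= in_itv/= => /andP[s0 sx]; rewrite lee_fin; apply: le_trans (ler_norm _).
  rewrite (_ : C * _ / p * _ = C * s `^ (q - 1) * (x `^ p / p)); last by ring.
  apply: ler_pM => //; first by rewrite divr_ge0 ?powR_ge0// ltW.
    exact: hC.
  rewrite ler_pM2r ?invr_gt0//; apply: ge0_ler_powR; rewrite ?nnegrE ?subr_ge0.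
  - exact: ltW.
  - exact: ltW.
  - exact: ltW.
  - by rewrite lerBlDr lerDl ltW.
Qed.

Let mker (g : R -> R -> R) : measurable_fun setT (fun r : measurableTypeR R * measurableTypeR R => g r.1 r.2) ->
  measurable_fun setT (fun r : measurableTypeR R * measurableTypeR R => (g r.1 r.2) `^ (p - 1)).
Proof. by move=> mg; apply: (measurableT_comp (measurable_powR _)). Qed.

(** Both sides are the integral of h(s) (x - s)^p / p, by Fubini on the triangle with the two
    kernels. *)
Lemma abel_primitive :
  (\int[mu]_(y in `]0%R, x[) (abel p h y)%:E = \int[mu]_(t in `]0%R, x[) ((x - t) `^ (p - 1) * H t)%:E)%E.
Proof.
transitivity (\int[mu]_(s in `]0%R, x[) (h s * ((x - s) `^ p / p))%:E)%E.
  rewrite -(@integral_triangle (fun s y => (y - s) `^ (p - 1))).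
  - apply: eq_integral => y /set_mem; rewrite /= in_itv/= => /andP[y0 _].
    rewrite /abel /Rintegral fineK//; apply: integrable_fin_num => //.
    have i := integrable_abel p0 q0 ch hC y0; exact i.
  - by move=> s y; exact: powR_ge0.
  - by apply: (mker (g := fun s y => y - s)); apply: measurable_funB.
  - by move=> s /andP[_ sx]; exact: integral_powR_shift.
rewrite -(@integral_triangle (fun s y => (x - y) `^ (p - 1))).
- apply: eq_integral => y /set_mem; rewrite /= in_itv/= => /andP[y0 _].
  rewrite EFinM -hH// -integralZl//.
  apply/integrableP; split.
    apply/measurable_EFinP.
    by apply: measurable_funS (measurable_integrand ch) => // t /=; rewrite !in_itv/= => /andP[->].
  have : mu.-integrable `]0, y[ (fun s => C%:E * (s `^ (q - 1))%:E)%E.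
    apply: integrableZl => //; apply/integrableP; split.
      by apply/measurable_EFinP; apply: measurable_funTS; exact: measurable_powR.
    under eq_integral do rewrite abse_EFin (ger0_norm (powR_ge0 _ _)).
    by rewrite integral_powR0// ltry.
  move=> /integrableP[mi]; apply: le_lt_trans; apply: ge0_le_integral => //.
  + apply: measurableT_comp => //; apply/measurable_EFinP.
    by apply: measurable_funS (measurable_integrand ch) => // t /=; rewrite !in_itv/= => /andP[->].
  + exact: measurableT_comp.
  + move=> s; rewrite /= in_itv/= => /andP[s0 _]; rewrite lee_fin; apply: le_trans (ler_norm _).
    exact: hC.
- by move=> s y; exact: powR_ge0.
- by apply: (mker (g := fun s y => x - y)); apply: measurable_funB.
- by move=> s /andP[_ sx]; exact: integral_powR_diff.
Qed.

End primitive_of_abel.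

Section delta_primitive.
Context {R : realType}.
Notation mu := (@lebesgue_measure R).
Variables (alpha theta : R).
Hypotheses (al0 : 0 < alpha) (al1 : alpha < 1) (th0 : 0 < theta).

Implicit Types (x t u : R).
Notation s := (sin (pi * alpha)).
Notation k := (cos (pi * alpha)).
Notation F := (lamperti_cdf alpha).
Notation L := (lamperti_poly alpha).
Notation De := (Delta alpha theta F).
Notation de := (d_dens alpha theta F).

Let pa0 : 0 < pi * alpha. Proof. by rewrite mulr_gt0// pi_gt0. Qed.
Let pa1 : pi * alpha < pi. Proof. by rewrite gtr_pMr// pi_gt0. Qed.
Let s0 : 0 < s. Proof. by apply: sin_gt0_pi; rewrite pa0. Qed.

Lemma continuous_Delta x : 0 < x -> {for x, continuous De}.
Proof. by move=> x0; exact: has_deriv_cont (deriv_Delta theta al0 al1 x0). Qed.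

Lemma continuous_d_dens x : 0 < x -> {for x, continuous de}.
Proof.
move=> x0; have L0 := lamperti_poly_gt0 al0 al1 x0; rewrite /lamperti_poly in L0.
have L1 : (x `^ (2 * alpha) + 2 * x `^ alpha * cos (pi * alpha) + 1) `^ (theta / 2 + 1) != 0.
  by rewrite gt_eqF// powR_gt0.
by apply: has_deriv_cont; rewrite /d_dens /F /lamperti_cdf /acot /lamperti_poly; der.
Qed.

Lemma d_dens_bound : exists2 C : R, 0 <= C & forall x, 0 < x ->
  `|de x| <= C * x `^ (alpha - 1).
Proof.
(* The numerator is at most 1 + u, with u = x^alpha, and (1 + u) s^2 <= 3 L follows from L >= s^2
   and L >= s^2 u^2. *)
pose c := alpha * theta / pi * (3 / s ^+ 2) * (s ^+ 2) `^ (- (theta / 2)).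
have th2 : 0 <= theta / 2 by rewrite divr_ge0// ltW.
have c0 : 0 <= alpha * theta / pi by rewrite divr_ge0 ?pi_ge0// mulr_ge0// ltW.
have s20 : 0 < s ^+ 2 by rewrite exprn_gt0.
exists c => [|x x0].
  by rewrite /c !mulr_ge0 ?powR_ge0 ?(ltW al0) ?(ltW th0) ?invr_ge0 ?(ltW s20) ?pi_ge0.
have [h1 h2] := lamperti_poly_ge alpha x0; have L0 := lamperti_poly_gt0 al0 al1 x0.
set u := x `^ alpha in h2; have u0 : 0 <= u by exact: powR_ge0.
rewrite /d_dens -/u.
rewrite (_ : _ * _ / pi * _ = alpha * theta / pi * x `^ (alpha - 1) *
  ((sin (pi * alpha * (1 - theta * F x)) - u * sin (pi * theta * alpha * F x)) / L x `^ (theta / 2 + 1))); last by ring.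
rewrite normrM ger0_norm; last first.
  by rewrite mulr_ge0 ?powR_ge0.
rewrite (_ : c * _ = alpha * theta / pi * x `^ (alpha - 1) * (3 / s ^+ 2 * (s ^+ 2) `^ (- (theta / 2)))); last by rewrite /c; ring.
apply: ler_wpM2l; first by rewrite mulr_ge0 ?powR_ge0.
rewrite normrM normfV (ger0_norm (powR_ge0 _ _)).
have LE : (L x `^ (theta / 2 + 1))^-1 = (L x)^-1 * L x `^ (- (theta / 2)).
  rewrite -powRN opprD powRD ?(gt_eqF L0) ?implybT//.
  by rewrite mulrC powR_inv1// ltW.
rewrite LE mulrA; apply: ler_pM; rewrite ?powR_ge0 ?mulr_ge0 ?invr_ge0 ?(ltW L0)//.
  rewrite ler_pdivrMr// [leRHS]mulrAC ler_pdivlMr//.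
  apply: (@le_trans _ _ ((1 + u) * s ^+ 2)).
    rewrite ler_wpM2r ?(ltW s20)//; apply: le_trans (ler_normB _ _) _.
    rewrite lerD// ?norm_sin_le1//; last first.
      rewrite normrM (ger0_norm u0) -[leRHS]mulr1 ler_wpM2l// ler_norml.
      by rewrite sin_geN1 sin_le1.
    by rewrite ler_norml sin_geN1 sin_le1.
  have : 0 <= (u - 1) ^+ 2 * s ^+ 2 by rewrite mulr_ge0 ?sqr_ge0.
  have : 0 <= u ^+ 2 * s ^+ 2 by rewrite mulr_ge0 ?sqr_ge0.
  lra.
by apply: powRN_le.
Qed.

(** As a function of u = x^alpha, [Delta] is smooth at u = 0, where the angle is pi alpha - pi / 2 +
    atan (cot (pi alpha)) = 0. *)
Lemma Delta_cvg0 : De x @[x --> 0^'+] --> (0 : R).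
Proof.
pose H (u : R) : R := pi^-1 * (sin (theta * (pi * alpha - pi / 2 + atan ((u + k) / s))) /
   ((u + k) * (u + k) + s * s) `^ (theta / 2)).
have q0 : 0 < (0 + k) * (0 + k) + s * s.
  by rewrite add0r -!expr2 ltr_wpDl ?sqr_ge0 ?exprn_gt0.
have cH : {for 0, continuous H}.
  apply: has_deriv_cont; rewrite /H; der => //.
  by rewrite gt_eqF// powR_gt0.
have H0 : H 0 = 0.
  rewrite /H add0r atan_cot ?pa0//.
  by rewrite (_ : _ + _ = 0); [rewrite mulr0 sin0 mul0r mulr0|ring].
have c : H (x `^ alpha) @[x --> 0^'+] --> (0 : R).
  by rewrite -[X in _ --> X]H0; exact: (cvg_comp _ _ (powR_cvg0 al0) cH).
apply: cvg_trans c; apply: near_eq_cvg; near=> x.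
have x0 : 0 < x by near: x; exact: nbhs_right_gt.
by rewrite /= /Delta /H (lamperti_theta_angle _ al0) lamperti_polyE.
Unshelve. all: by end_near. Qed.

(** [d_dens] may change sign, so the fundamental theorem for nonnegative functions is applied to C
    t^(alpha - 1) + d(t), and the integral of the power is subtracted. *)
Lemma integral_d_dens x : 0 < x ->
  (\int[mu]_(t in `]0%R, x[) (de t)%:E = (De x)%:E)%E.
Proof.
move=> x0; have [C C0 hC] := d_dens_bound.
have i1 := integral_powR0 al0 x0.
have m1 : mu.-integrable `]0, x[ (fun t => C%:E * (t `^ (alpha - 1))%:E)%E.
  apply: integrableZl => //; apply/integrableP; split.
    by apply/measurable_EFinP; apply: measurable_funTS; exact: measurable_powR.
  under eq_integral do rewrite abse_EFin (ger0_norm (powR_ge0 _ _)).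
  by rewrite i1 ltry.
have m2 : mu.-integrable `]0, x[ (fun t => (de t)%:E).
  apply: le_integrable m1 => //.
    apply/measurable_EFinP; apply: open_continuous_measurable_fun; first exact: interval_open.
    by move=> t /set_mem; rewrite /= in_itv/= => /andP[t0 _]; exact: continuous_d_dens.
  move=> t; rewrite /= in_itv/= => /andP[t0 _]; rewrite lee_fin.
  exact: le_trans (hC _ t0) (ler_norm _).
have e : (\int[mu]_(t in `]0%R, x[) (C * t `^ (alpha - 1) + de t)%:E = (C * (x `^ alpha / alpha) + De x)%:E)%E.
  rewrite (@ge0_FTC_oo _ _ (fun t => C * (alpha^-1 * t `^ alpha) + De t) 0 x (C * (alpha^-1 * 0) + 0)
     (C * (alpha^-1 * x `^ alpha) + De x))//.
  - by congr EFin; ring.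
  - by move=> t /andP[t0 _]; have := hC t t0; rewrite ler_norml => /andP[]; lra.
  - move=> t /andP[t0 _]; apply: cvgD; last exact: continuous_d_dens.
    by apply: (@has_deriv_cont _ (fun t => C * t `^ (alpha - 1))); der.
  - move=> t /andP[t0 _]; have dD := deriv_Delta theta al0 al1 t0.
    apply: has_deriv_eq; first by apply: derD; [der|exact: dD].
    by rewrite /=; congr (_ + _); field; rewrite gt_eqF.
  - apply: cvgD; last exact: Delta_cvg0.
    by apply: cvgMl_tmp; apply: cvgMl_tmp; exact: powR_cvg0.
  - apply: cvg_at_left_filter; apply: cvgD; last exact: continuous_Delta.
    by apply: (@has_deriv_cont _ (fun t => C * (alpha^-1 * t `^ alpha))); der.
move: (De x) e m2 => y; move: (de) => g e m2.
have : (\int[mu]_(t in `]0%R, x[) (C%:E * (t `^ (alpha - 1))%:E + (g t)%:E) = (C * (x `^ alpha / alpha) + y)%:E)%E.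
  by rewrite -e; apply: eq_integral => t _; rewrite -EFinM -EFinD.
rewrite integralD// integralZl//; last first.
  by apply/integrableP; split; [apply/measurable_EFinP; apply: measurable_funTS; exact: measurable_powR|under eq_integral do rewrite abse_EFin (ger0_norm (powR_ge0 _ _)); rewrite i1 ltry].
have f2 : (\int[mu]_(t in `]0%R, x[) (g t)%:E)%E \is a fin_num by exact: integrable_fin_num.
by rewrite i1 -EFinM -(fineK f2) -EFinD => -[/addrI ->].
Qed.

End delta_primitive.

Section abel_of_delta.
Context {R : realType}.
Notation mu := (@lebesgue_measure R).
Variables (alpha theta : R).
Hypotheses (al0 : 0 < alpha) (al1 : alpha < 1) (th0 : 0 < theta).
Implicit Types (x y t z : R).
Notation F := (lamperti_cdf alpha).
Notation De := (Delta alpha theta F).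
Notation de := (d_dens alpha theta F).
Notation a := (alpha * theta).

Let a0 : 0 < a. Proof. exact: mulr_gt0. Qed.
Let cDe := @continuous_Delta R alpha theta al0 al1.
Let cde := @continuous_d_dens R alpha theta al0 al1.

Lemma Delta_kernel_bound : exists C : R, forall t, 0 < t -> `|De t| <= C * t `^ (1 - 1).
Proof.
have [C C0 hC] := Delta_bound al0 al1 th0; exists C => t t0.
by rewrite subrr powRr0 mulr1; have [] := hC t t0.
Qed.

Lemma continuous_abel_d_dens x : 0 < x -> {for x, continuous (abel a de)}.
Proof.
have [C C0 hC] := d_dens_bound al0 al1 th0.
exact: (continuous_abel a0 al0 cde hC).
Qed.

Lemma integral_abel_d_dens x : 0 < x ->
  (\int[mu]_(y in `]0%R, x[) (abel a de y)%:E = (abel a De x)%:E)%E.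
Proof.
move=> x0; have [C C0 hC] := d_dens_bound al0 al1 th0.
rewrite (abel_primitive a0 al0 cde hC (integral_d_dens al0 al1 th0) x0).
have [C' hC'] := Delta_kernel_bound.
rewrite [in RHS]/abel /Rintegral fineK//; apply: integrable_fin_num => //.
have i := integrable_abel a0 ltr01 cDe hC' x0; exact i.
Qed.

Lemma measurable_abel_d_dens : measurable_fun (`]0, +oo[ : set R) (abel a de).
Proof.
apply: open_continuous_measurable_fun; first exact: interval_open.
by move=> t /set_mem; rewrite /= in_itv/= andbT => t0; exact: continuous_abel_d_dens.
Qed.

(** The integral is the difference of those of the positive and negative parts; being finite, it
    forces both to be finite. *)
Lemma integrable_abel_d_dens x : 0 < x -> mu.-integrable `]0, x[ (EFin \o abel a de).
Proof.
move=> x0; have m : measurable_fun (`]0, x[ : set R) (EFin \o abel a de).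
  apply/measurable_EFinP; apply: measurable_funS measurable_abel_d_dens => //.
  by move=> t /=; rewrite !in_itv/= => /andP[->].
have := integral_abel_d_dens x0.
rewrite integralE => h; have : ((\int[mu]_(y in `]0%R, x[) (EFin \o abel a de)^\+ y) -
  (\int[mu]_(y in `]0%R, x[) (EFin \o abel a de)^\- y))%E \is a fin_num.
  by rewrite [X in X \is a fin_num](_ : _ = (abel a De x)%:E).
rewrite fin_numD fin_numN => /andP[h1 h2].
apply/integrableP; split => //.
rewrite (_ : integral _ _ _ = \int[mu]_(y in `]0%R, x[) ((EFin \o abel a de)^\+ y + (EFin \o abel a de)^\- y))%E; last first.
  apply: eq_integral => y _; have := fune_abse (EFin \o abel a de).
  by move=> /(congr1 (fun g => g y)).
rewrite ge0_integralD//; first by rewrite lte_add_pinfty// ltey_eq ?h1 ?h2.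
- exact: measurable_funepos.
- exact: measurable_funeneg.
Qed.

End abel_of_delta.

(** * Random variables determined by a Stieltjes transform *)

Section weighted_measure.
Context {R : realType} {d : measure_display} {T : measurableType d}.
Variables (m : {sigma_finite_measure set T -> \bar R}) (w : T -> \bar R).
Hypotheses (w0 : forall x, (0 <= w x)%E) (mw : measurable_fun setT w).

(** The two conditions on [w] are arguments, so that the structure of a measure can be attached to
    the definition. *)
Definition mweight (_ : forall x, (0 <= w x)%E) (_ : measurable_fun setT w) (A : set T) : \bar R :=
  (\int[m]_(x in A) w x)%E.

Let mweight0 : mweight w0 mw set0 = 0%E.
Proof. by rewrite /mweight integral_set0. Qed.

Let mweight_ge0 A : (0 <= mweight w0 mw A)%E.
Proof. by apply: integral_ge0 => x _. Qed.

Let mweight_sigma_additive : semi_sigma_additive (mweight w0 mw).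
Proof.
move=> F mF tF mUF; rewrite /mweight ge0_integral_bigcup//; last exact: measurable_funTS.
by apply: is_cvg_ereal_nneg_natsum => n _; apply: integral_ge0.
Qed.

HB.instance Definition _ := isMeasure.Build _ _ _ (mweight w0 mw)
  mweight0 mweight_ge0 mweight_sigma_additive.

End weighted_measure.

Section layer_cake.
Context {R : realType}.
Notation mu := (@lebesgue_measure R).

Lemma lebesgue_itv0 (c : R) : 0 <= c -> mu `]0, c[%classic = c%:E.
Proof.
move=> c0; rewrite lebesgue_measure_itv/= lte_fin; case: ltP => h.
  by rewrite -EFinB subr0.
by congr EFin; apply/eqP; rewrite eq_le c0 h.
Qed.

(** Tonelli, with g(x) as the length of ]0, g(x)[. It lets identities between measures of sets be
    transferred to integrals. *)
Lemma layer_cake d (T : measurableType d) (m : {sigma_finite_measure set T -> \bar R})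
    (g H : T -> R) : measurable_fun setT g -> measurable_fun setT H ->
  (forall x, 0 <= g x) -> (forall x, 0 <= H x) ->
  (\int[m]_x (g x * H x)%:E =
   \int[mu]_(t in `]0%R, +oo[) \int[m]_(x in [set x | (t < g x)%R]) (H x)%:E)%E.
Proof.
move=> mg mH g0 H0.
pose E : set (T * measurableTypeR R) := [set r | 0 < r.2 < g r.1].
have mE : measurable E.
  have -> : E = [set r | (0 : R) < r.2] `&` [set r | r.2 < g r.1].
    by apply/seteqP; split => r /=; [move=> /andP[]|move=> [h1 h2]; apply/andP].
  apply: measurableI; apply: measurable_ltr_set => //.
  by apply: (measurableT_comp mg); exact: measurable_fst.
pose f (r : T * measurableTypeR R) := (H r.1)%:E.
have mf : measurable_fun E f.
  apply: measurable_funTS; apply/measurable_EFinP; apply: (measurableT_comp mH).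
  exact: measurable_fst.
have := @tonelli_dom _ _ T (measurableTypeR R) R m mu E setT (fun x => `]0, g x[%classic)
  (`]0, +oo[%classic : set R) (fun t => [set x | t < g x]) mE _ _ f mf.
move=> <-.
- apply: eq_integral => x _; rewrite /f /= (@integral_cst _ _ _ mu `]0, g x[%classic) //.
  transitivity ((H x)%:E * (g x)%:E)%E; first by rewrite -EFinM mulrC.
  by congr (_ * _)%E; exact: esym (lebesgue_itv0 (g0 x)).
- by move=> x t; rewrite /E /= in_itv/=; split => [|[]].
- by move=> x t; rewrite /E /= in_itv/= andbT; split => [/andP|[h1 h2]]; [|rewrite h1 h2].
- by move=> r _; rewrite lee_fin.
Qed.

(** The layer-cake formula on both sides. The sigma-finiteness that it asks for is carried by [nu],
    which agrees with the weighted measure. *)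
Lemma ge0_integral_mweight d (T : measurableType d) (m : {sigma_finite_measure set T -> \bar R})
    (w : T -> R) (w0 : forall x, (0 <= (w x)%:E)%E) (mw : measurable_fun setT (EFin \o w))
    (g : T -> R) : measurable_fun setT g -> (forall x, 0 <= g x) ->
  forall nu : {sigma_finite_measure set T -> \bar R},
  (forall A, measurable A -> nu A = mweight m w0 mw A) ->
  (\int[nu]_x (g x)%:E = \int[m]_x (g x * w x)%:E)%E.
Proof.
move=> mg g0 nu hnu.
rewrite [in RHS]layer_cake//; last exact/measurable_EFinP.
rewrite [LHS](_ : _ = \int[nu]_x (g x * 1)%:E)%E; last by apply: eq_integral => x _; rewrite mulr1.
rewrite layer_cake//; apply: eq_integral => t _.
have mA : measurable [set x | t < g x] by apply: measurable_ltr_set.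
transitivity (nu [set x | t < g x]); last exact: hnu.
transitivity (1 * nu [set x | (t < g x)%R])%E; first exact: integral_cst.
exact: mul1e.
Qed.

Lemma measure_unique_rays (m1 m2 : {measure set (measurableTypeR R) -> \bar R}) :
  (forall x : R, m1 `]-oo, x]%classic = m2 `]-oo, x]%classic) ->
  (forall x : R, (m1 `]-oo, x]%classic < +oo)%E) ->
  forall A, measurable A -> m1 A = m2 A.
Proof.
move=> e fin A mA.
pose G : set (set (measurableTypeR R)) := [set A | exists x : R, A = `]-oo, x]%classic].
apply: (@measure_unique _ R (measurableTypeR R) G (fun n => `]-oo, n%:R]%classic)) => //.
- apply/seteqP; split.
    rewrite [X in X `<=` _]RGenOInfty.measurableE.
    apply: smallest_sub; first exact: smallest_sigma_algebra.
    move=> _ [x ->]; rewrite -setCitvl.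
    have [_ h _] := smallest_sigma_algebra setT G.
    by rewrite -setTD; apply: h; apply: sub_sigma_algebra; exists x.
  apply: smallest_sub; first exact: sigma_algebra_measurable.
  by move=> _ [x ->]; exact: measurable_itv.
- move=> _ _ [x ->] [y ->]; exists (Num.min x y); apply/seteqP; split => t /=.
    by rewrite !in_itv/= => -[h1 h2]; rewrite le_min h1 h2.
  by rewrite !in_itv/= le_min => /andP[].
- by move=> n; exists n%:R.
- apply/seteqP; split => // x _; exists (Num.truncn `|x|).+1 => //=; rewrite in_itv/=.
  by apply: le_trans (ler_norm _) _; rewrite ltW// truncnS_gt.
- by move=> _ [x ->]; exact: e.
Qed.

End layer_cake.

Section integrals_of_random_variables.
Context {R : realType} {d : measure_display} {Omega : measurableType d}.
Variable P : probability Omega R.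
Notation mu := (@lebesgue_measure R).

(* [R] itself and [measurableTypeR R] carry the same sigma-algebra, but with
   different displays. *)
Lemma measurable_RV (X : {RV P >-> R}) :
  measurable_fun setT (X : Omega -> measurableTypeR R).
Proof. by move=> _ Y mY; have := @measurable_funPT _ _ _ _ X; exact. Qed.

Definition law (X : {RV P >-> R}) (A : set (measurableTypeR R)) : \bar R := P (X @^-1` A).

Section law_measure.
Variable X : {RV P >-> R}.
Let m := measure_function_pushforward__canonical__measure_function_Measure P (measurable_RV X).
HB.instance Definition _ := isMeasure.Build _ _ _ (law X)
  (measure0 m) (measure_ge0 m) (@measure_semi_sigma_additive _ _ _ m).
Let law_setT : law X setT = 1%E.
Proof. by rewrite /law preimage_setT probability_setT. Qed.
HB.instance Definition _ := Measure_isProbability.Build _ _ _ (law X) law_setT.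
End law_measure.

Lemma lawE (X : {RV P >-> R}) A : law X A = P (X @^-1` A).
Proof. by []. Qed.

Lemma ge0_integral_law (X : {RV P >-> R}) (g : measurableTypeR R -> \bar R) :
  measurable_fun setT g -> (forall x, (0 <= g x)%E) ->
  (\int[law X]_x g x = \int[P]_w g (X w))%E.
Proof.
move=> mg g0; rewrite [LHS](ge0_integral_pushforward (measurable_RV X))//.
Qed.

Lemma ge0_integral_density (X : {RV P >-> R}) (f g : R -> R) :
  has_pos_density P X f -> measurable_fun setT g -> (forall x, 0 <= g x) ->
  (\int[P]_w (g (X w))%:E = \int[mu]_(x in `]0%R, +oo[) (g x * f x)%:E)%E.
Proof.
move=> [mf f0 hf] mg g0.
pose I : set R := `]0, +oo[%classic.
have mI : measurable I by exact: measurable_itv.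
pose w := f \_ I.
have w0 x : (0 <= (w x)%:E)%E.
  by rewrite lee_fin /w /patch; case: ifPn => // /set_mem; rewrite /I /= in_itv/= andbT => /f0.
have mw : measurable_fun setT (EFin \o w).
  by apply/measurable_EFinP; exact/(measurable_restrictT f mI).
have mg' : measurable_fun (setT : set (measurableTypeR R)) g by exact: mg.
transitivity (\int[law X]_x (g x)%:E)%E.
  rewrite ge0_integral_law//; first exact/measurable_EFinP.
transitivity (\int[mu]_x (g x * w x)%:E)%E; last first.
  rewrite [RHS]integral_mkcond; apply: eq_integral => x _.
  by rewrite /w /patch; case: ifPn => // _; rewrite mulr0.
have mw' : measurable_fun (setT : set (measurableTypeR R)) (EFin \o w) by exact: mw.
apply: (@ge0_integral_mweight _ _ (measurableTypeR R) mu w w0 mw' g mg' g0 (law X)).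
move=> A mA; rewrite [LHS]hf// /mweight /density_measure integral_mkcondr.
by apply: eq_integral => x _; rewrite /w /patch; case: ifPn.
Qed.

(** The joint law is the product law, by uniqueness on rectangles. Both integrations take place on
    Omega, so no independent copy has to be built. *)
Lemma ge0_integral_decouple (X Y : {RV P >-> R}) (k : measurableTypeR R * measurableTypeR R -> \bar R) :
  indep_rv P X Y -> measurable_fun setT k -> (forall r, (0 <= k r)%E) ->
  (\int[P]_w k (X w, Y w) = \int[P]_w \int[P]_w' k (X w, Y w'))%E.
Proof.
move=> iXY mk k0.
pose XY (w : Omega) : measurableTypeR R * measurableTypeR R := (X w, Y w).
have mXY : measurable_fun setT XY.
  by apply: measurable_fun_pair; exact: measurable_RV.
pose PXY := measure_function_pushforward__canonical__measure_function_Measure P mXY.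
have e := @product_measure_unique _ _ (measurableTypeR R) (measurableTypeR R) R
  (law X) (law Y) PXY _.
rewrite -[LHS](@ge0_integral_pushforward _ _ _ _ _ XY mXY P setT k)//.
rewrite (eq_measure_integral (law X \x law Y)%E); last first.
  move=> A mA _; apply/esym; apply: e => // B C mB mC.
  by apply: iXY; [exists B|exists C].
rewrite fubini_tonelli1// -[LHS]/(\int[_]_x (fubini_F _ _) x)%E.
rewrite ge0_integral_law//.
- apply: eq_integral => w _ /=; rewrite /fubini_F.
  rewrite ge0_integral_law//.
  exact: measurableT_comp mk (measurable_pair1 _).
- exact: measurable_fun_fubini_tonelli_F.
- by move=> x; apply: integral_ge0.
Qed.

End integrals_of_random_variables.

Section cdf_of_stieltjes.
Context {R : realType} {d : measure_display} {Omega : measurableType d}.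
Variable P : probability Omega R.
Notation mu := (@lebesgue_measure R).
Variable X : {RV P >-> R}.
Hypothesis X0 : P [set w | X w < 0] = 0%E.

Let mX : measurable_fun setT (X : Omega -> measurableTypeR R).
Proof. exact: measurable_RV. Qed.

Lemma measurable_rv_lt x : measurable [set w | X w < x].
Proof. exact: measurable_ltr_set. Qed.
Lemma measurable_rv_le x : measurable [set w | X w <= x].
Proof.
rewrite (_ : mkset _ = ~` [set w | x < X w]).
  by apply: measurableC; exact: measurable_ltr_set.
by apply/seteqP; split => w /=; rewrite leNgt => /negP.
Qed.

Lemma measurable_rv_itv x : measurable [set w | 0 <= X w <= x].
Proof.
rewrite (_ : mkset _ = [set w | X w <= x] `\` [set w | X w < 0]).
  by apply: measurableD; [exact: measurable_rv_le|exact: measurable_rv_lt].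
apply/seteqP; split => w /=; first by move=> /andP[h1 h2]; rewrite ltNge h1.
by move=> [h1 /negP]; rewrite -leNgt h1 => ->.
Qed.

Lemma cdfP x : cdf X x = P [set w | X w <= x].
Proof.
by rewrite /cdf; congr (P _); apply/seteqP; split => w /=; rewrite in_itv.
Qed.

Let cdfE x : P [set w | 0 <= X w <= x] = P [set w | X w <= x].
Proof.
apply/eqP; rewrite eq_le; apply/andP; split.
  apply: le_measure; rewrite ?inE.
  - exact: measurable_rv_itv.
  - exact: measurable_rv_le.
  - by move=> w /= /andP[].
have m1 := measurable_rv_itv x.
apply: (@le_trans _ _ (P ([set w | 0 <= X w <= x] `|` [set w | X w < 0]))).
  apply: le_measure; rewrite ?inE.
  - exact: measurable_rv_le.
  - by apply: measurableU => //; exact: measurable_rv_lt.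
  - by move=> w /= h; have [h0|h0] := leP 0 (X w); [left; apply/andP|right].
have h : (P ([set w | (0 <= X w <= x)%R] `|` [set w | (X w < 0)%R]) <=
    P [set w | (0 <= X w <= x)%R] + P [set w | (X w < 0)%R])%E.
  by apply: measureU2 => //; exact: measurable_rv_lt.
by apply: le_trans h _; rewrite X0 adde0.
Qed.

(** Tonelli on 0 <= X <= x, as (z + X)^(- p) is the integral of p (z + x)^(- p - 1) over x > X. *)
Lemma stieltjes_cdf (p z : R) : 0 < p -> 0 < z ->
  (\int[mu]_(x in `]0%R, +oo[) ((p * (z + x) `^ (- p - 1))%:E * P [set w | (X w <= x)%R]) =
   \int[P]_(w in [set w | (0 <= X w)%R]) ((z + X w) `^ (- p))%:E)%E.
Proof.
move=> p0 z0.
pose E : set (Omega * measurableTypeR R) := [set r | 0 <= X r.1 <= r.2].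
have mX1 : measurable_fun setT (fun r : Omega * measurableTypeR R => X r.1).
  by apply: (measurableT_comp mX); exact: measurable_fst.
have mE : measurable E.
  have -> : E = ~` ([set r | X r.1 < 0] `|` [set r | r.2 < X r.1]).
    apply/seteqP; split => r /=.
      by move=> /andP[h1 h2] [|]; rewrite ltNge ?h1 ?h2.
    by move=> /not_orP[h1 h2]; apply/andP; split; rewrite leNgt; exact/negP.
  by apply: measurableC; apply: measurableU; apply: measurable_ltr_set.
pose f (r : Omega * measurableTypeR R) : \bar R := (p * (z + r.2) `^ (- p - 1))%:E.
have mp : measurable_fun setT (fun x : measurableTypeR R => p * (z + x) `^ (- p - 1)).
  apply: measurable_funM => //; apply: (measurableT_comp (measurable_powR _)).
  exact: measurable_funD.
have mf : measurable_fun E f.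
  apply: measurable_funTS; apply/measurable_EFinP; apply: (measurableT_comp mp).
  exact: measurable_snd.
have pz0 x : 0 <= p * (z + x) `^ (- p - 1) by rewrite mulr_ge0 ?powR_ge0// ltW.
have := @tonelli_dom _ _ Omega (measurableTypeR R) R P mu E [set w | 0 <= X w]
  (fun w => `[X w, +oo[%classic) (`[0, +oo[%classic : set R) (fun x => [set w | 0 <= X w <= x]) mE.
move=> /(_ _ _ f mf _) F.
have e1 x : (\int[P]_(w in [set w | (0 <= X w <= x)%R]) f (w, x) =
    (p * (z + x) `^ (- p - 1))%:E * P [set w | (X w <= x)%R])%E.
  rewrite -cdfE /f /=; apply: integral_cst; exact: measurable_rv_itv.
transitivity (\int[mu]_(x in `[0%R, +oo[) \int[P]_(w in [set w | (0 <= X w <= x)%R]) f (w, x))%E.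
  rewrite -integral_itv_obnd_cbnd.
    by apply: eq_integral => x _; rewrite e1.
  apply/measurable_funTS; apply: eq_measurable_fun (fun x _ => esym (e1 x)) _.
  apply: emeasurable_funM; first exact/measurable_EFinP.
  apply: eq_measurable_fun (fun x _ => cdfP x) _; exact: (@cdf_measurable _ _ _ P X).
rewrite -F.
- apply: eq_integral => w /set_mem /= w0; rewrite /f /=.
  rewrite -integral_itv_obnd_cbnd; last by apply: measurable_funTS; exact/measurable_EFinP.
  by rewrite integral_powR_shift_y// ltr_wpDr.
- by move=> w x; rewrite /E /= in_itv/= andbT; split => [/andP[]|[h1 h2]]//; rewrite h1 h2.
- move=> w x; rewrite /E /= in_itv/= andbT; split => [h|[]//]; split => //.
  by case/andP: h; exact: le_trans.
- by move=> r _; rewrite lee_fin.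
Qed.

(* The cdf and [abel p h] have the same generalized Stieltjes transform, which
   determines right-continuous functions. *)
Lemma cdf_abel (p q C : R) (h : R -> R) : 0 < p -> 0 < q ->
  (forall t, 0 < t -> {for t, continuous h}) ->
  (forall t, 0 < t -> `|h t| <= C * t `^ (q - 1)) ->
  (forall z, 0 < z -> mu.-integrable `]0, +oo[ (fun t => (h t / (z + t))%:E)) ->
  (forall z, 1 < z -> (\int[P]_w ((z + X w) `^ (- p))%:E =
     \int[mu]_(t in `]0%R, +oo[) (h t / (z + t))%:E)%E) ->
  forall x, 0 < x -> P [set w | X w <= x] = (abel p h x)%:E.
Proof.
move=> p0 q0 ch hC ih hz x x0.
pose c x := fine (P [set w | X w <= x]).
have cfin y : P [set w | X w <= y] = (c y)%:E.
  by rewrite fineK// fin_num_measure//; exact: measurable_rv_le.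
have c01 y : 0 <= c y <= 1.
  by rewrite -!lee_fin -cfin measure_ge0 probability_le1//; exact: measurable_rv_le.
have mc : measurable_fun (`]0, +oo[ : set R) c.
  apply: measurable_funTS; apply/measurable_EFinP.
  apply: (eq_measurable_fun (cdf X)) => [y _|]; first by rewrite cdfP cfin.
  exact: (@cdf_measurable _ _ _ P X).
pose u y := c y - abel p h y.
(* In terms of the cdf, the transform of exponent p has the kernel (z + x)^(- p - 1). *)
pose b := p + 1.
have b0 : 0 < b by rewrite addr_gt0.
have mz (z : R) : measurable_fun (`]0, +oo[ : set R) (fun x : R => (z + x) `^ (- b)).
  exact: measurable_shift_powR.
have ic z : 0 < z -> mu.-integrable `]0, +oo[ (fun y => (c y * (z + y) `^ (- b))%:E).
  move=> z0; have i : mu.-integrable `]0, +oo[ (fun y => ((z + y) `^ (- b))%:E).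
    apply/integrableP; split; first by apply/measurable_EFinP; exact: mz.
    under eq_integral do rewrite abse_EFin (ger0_norm (powR_ge0 _ _)).
    have := @integral_powR_shift_y R p z 0 p0; rewrite addr0 => /(_ z0) e.
    have : (p%:E * \int[mu]_(t in `]0%R, +oo[) ((z + t) `^ (- b))%:E < +oo)%E.
      rewrite -ge0_integralZl//; [|by apply/measurable_EFinP; exact: mz|by move=> y _; rewrite lee_fin powR_ge0|by rewrite lee_fin ltW].
      rewrite (_ : integral _ _ _ = (z `^ (- p))%:E) ?ltry//.
      by rewrite -e; apply: eq_integral => t _; rewrite -EFinM /b opprD.
    by rewrite !ltey; apply: contra_neq => ->; rewrite gt0_muley.
  apply: le_integrable i => //.
    by apply/measurable_EFinP; apply: measurable_funM; [exact: mc|exact: mz].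
  move=> y _; rewrite lee_fin normrM ler_piMl//; have /andP[h1 h2] := c01 y.
  by rewrite ger0_norm.
have ia z : 0 < z -> mu.-integrable `]0, +oo[ (fun y => (abel p h y * (z + y) `^ (- b))%:E).
  move=> z0; have i := integrable_stieltjes_abel p0 q0 z0 ch hC (ih z z0).
  have j := integrableZl _ p^-1 i; apply: eq_integrable (j _) => // y _.
  by rewrite -EFinM; congr EFin; rewrite /b opprD; field; rewrite gt_eqF.
have mu_ : measurable_fun (`]0, +oo[ : set R) u.
  apply: measurable_funB => //; exact: measurable_abel p0 q0 ch hC.
have iu z : 0 < z -> mu.-integrable `]0, +oo[ (fun y => (u y * (z + y) `^ (- b))%:E).
  move=> z0; have := integrableB _ (ic z z0) (ia z z0).
  move=> j; apply: eq_integrable (j _) => // y _; rewrite /u -EFinB mulrBl//.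
have hu z : 1 < z -> (\int[mu]_(y in `]0%R, +oo[) (u y * (z + y) `^ (- b)))%R = 0.
  move=> z1; have z0 : 0 < z := lt_trans ltr01 z1.
  under eq_Rintegral do rewrite /u mulrBl.
  rewrite RintegralB//; [|exact: ic|exact: ia].
  apply/eqP; rewrite subr_eq0; apply/eqP; congr fine.
  have cancel (I J : \bar R) : (p%:E * I = p%:E * J -> I = J)%E.
    move=> /(congr1 (mule p^-1%:E)); rewrite !muleA -!EFinM mulVf ?gt_eqF//.
    by rewrite !mul1e.
  apply: cancel; rewrite -!integralZl//; [|exact: ia|exact: ic].
  transitivity (\int[P]_w ((z + X w) `^ (- p))%:E)%E; last first.
    rewrite hz// -(stieltjes_abel p0 q0 z0 ch hC (ih z z0)).
    by apply: eq_integral => y _; rewrite -EFinM /b opprD; congr EFin; ring.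
  have mzX : measurable_fun setT (fun w => ((z + X w) `^ (- p))%:E).
    apply/measurable_EFinP; apply: (measurableT_comp (measurable_powR _)).
    exact: measurable_funD.
  have mX0 : measurable [set w | 0 <= X w].
    rewrite (_ : mkset _ = ~` [set w | X w < 0]); first by apply: measurableC; exact: measurable_rv_lt.
    by apply/seteqP; split => w /=; rewrite leNgt => /negP.
  rewrite -(setUv [set w | 0 <= X w]) ge0_integral_setU//.
  - rewrite -(stieltjes_cdf p0 z0) [X in (_ + X)%E](_ : _ = 0%E) ?adde0.
      by apply: eq_integral => y _; rewrite cfin -!EFinM /b opprD; congr EFin; ring.
    rewrite (_ : ~` _ = [set w | X w < 0]); last first.
      by apply/seteqP; split => w /=; rewrite ltNge => /negP.
    apply: null_set_integral => //; first exact: measurable_rv_lt.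
    exact: measurable_funTS.
  - exact: measurableC.
  - by rewrite setUv.
  - by move=> w _; rewrite lee_fin powR_ge0.
  - exact/disj_setPCl.
have rc : u y @[y --> x^'+] --> u x.
  apply: cvgB; last first.
    by apply: cvg_at_right_filter; exact: (continuous_abel p0 q0 ch hC x0).
  have := @cdf_right_continuous _ _ _ P X x; rewrite /continuous_at.
  rewrite cdfP cfin => h1.
  have h2 : fine (cdf X y) @[y --> x^'+] --> c x by exact: fine_cvg h1.
  have e : (fun y => fine (cdf X y)) = c by apply/funext => y; rewrite cdfP.
  by rewrite e in h2.
have i1 : mu.-integrable `]0, +oo[ (fun y => (u y * (1 + y) `^ (- b))%:E) by exact: iu.
have := @stieltjes_unique R u b b0 mu_ i1 hu x x0 rc.
by move=> /eqP; rewrite subr_eq0 => /eqP <-.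
Unshelve. all: by end_near. Qed.

(* The density of a primitive: rays generate the Borel sets. *)
Lemma pos_density_of_cdf (g G : R -> R) (C q : R) : 0 < q ->
  measurable_fun (`]0, +oo[ : set R) g ->
  (forall x, 0 < x -> 0 <= g x) ->
  (forall x, 0 < x -> (\int[mu]_(t in `]0%R, x[) (g t)%:E = (G x)%:E)%E) ->
  (forall x, 0 < x -> P [set w | X w <= x] = (G x)%:E) ->
  (forall x, 0 < x -> G x <= C * x `^ q) ->
  has_pos_density P X g.
Proof.
move=> q0 mg g0 hG hX hC; split => //.
pose I : set R := `]0, +oo[%classic.
have mI : measurable I by exact: measurable_itv.
pose w := g \_ I.
have w0 x : (0 <= (w x)%:E)%E.
  by rewrite lee_fin /w /patch; case: ifPn => // /set_mem; rewrite /I /= in_itv/= andbT => /g0.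
have mw : measurable_fun (setT : set (measurableTypeR R)) (EFin \o w).
  by apply/measurable_EFinP; exact/(measurable_restrictT g mI).
have dE A : measurable (A : set (measurableTypeR R)) -> mweight mu w0 mw A = density_measure g A.
  move=> mA; rewrite /mweight /density_measure integral_mkcondr.
  by apply: eq_integral => x _; rewrite /w /patch; case: ifPn.
have ray x : P (X @^-1` `]-oo, x]%classic) = P [set w | X w <= x].
  by congr (P _); apply/seteqP; split => v /=; rewrite in_itv.
(* The power bound on [G] leaves no mass at or below 0, in particular no atom at 0. *)
have cdf0 : P [set w | X w <= 0] = 0%E.
  apply/eqP; rewrite eq_le measure_ge0 andbT.
  have h x : 0 < x -> (P [set w | (X w <= 0)%R] <= (C * x `^ q)%:E)%E.
    move=> x0; apply: (@le_trans _ _ (P [set w | X w <= x])).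
      apply: le_measure; rewrite ?inE; [exact: measurable_rv_le|exact: measurable_rv_le|].
      by move=> v /= /le_trans; apply; exact: ltW.
    by rewrite hX// lee_fin hC.
  have fin : P [set w | X w <= 0] \is a fin_num.
    by rewrite fin_num_measure//; exact: measurable_rv_le.
  rewrite -(fineK fin) lee_fin.
  have cv : C * x `^ q @[x --> 0^'+] --> (0 : R).
    by rewrite -[X in _ --> X](mulr0 C); apply: cvgMl_tmp; exact: powR_cvg0.
  apply: (cvgr_to_ge cv); near=> x; rewrite -lee_fin (fineK fin).
  by apply: h; near: x; exact: nbhs_right_gt.
move=> A mA; rewrite -dE// -[LHS](lawE X A).
apply: (@measure_unique_rays R (law X) _ _ _ A mA).
  move=> x; rewrite [RHS](dE _ (measurable_itv _)).
  rewrite [LHS]ray /density_measure.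
  have [x0|x0] := ltP 0 x; last first.
    rewrite (_ : _ `&` _ = set0) ?integral_set0.
      apply/eqP; rewrite eq_le measure_ge0 andbT -cdf0; apply: le_measure; rewrite ?inE.
      - exact: measurable_rv_le.
      - exact: measurable_rv_le.
      - by move=> v /= /le_trans; apply.
    by apply/seteqP; split => // t /= []; rewrite !in_itv/= andbT => h1 h2; have := le_lt_trans x0 h2; rewrite ltNge h1.
  rewrite hX// -hG//.
  rewrite (_ : _ `&` _ = `]0, x]%classic); last first.
    apply/seteqP; split => t /=; rewrite !in_itv/= ?andbT; first by move=> [-> ->].
    by move=> /andP[-> ->].
  rewrite integral_itv_bndo_bndc//.
  apply/measurable_EFinP; apply: measurable_funS mg => // t /=.
  by rewrite !in_itv/= => /andP[->].
move=> x; rewrite [X in (X < _)%E]ray; apply: le_lt_trans (probability_le1 P _) _.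
  exact: measurable_rv_le.
exact: ltry.
Unshelve. all: by end_near. Qed.

End cdf_of_stieltjes.

(** * The density of S / S' *)

Lemma cvgr_powRy {R : realType} (p : R) : 0 < p -> x `^ p @[x --> +oo] --> +oo.
Proof.
move=> p0; apply/cvgryPge => A; pose B := Num.max A 1.
have B0 : 0 < B by rewrite lt_max ltr01 orbT.
exists (B `^ p^-1); split; first exact: num_real.
move=> x xB; apply: (@le_trans _ _ B); first by rewrite le_max lexx.
rewrite [leLHS](_ : B = (B `^ p^-1) `^ p); last by rewrite -powRrM mulVf ?powRr1 ?gt_eqF// ltW.
apply: ge0_ler_powR; rewrite ?nnegrE ?powR_ge0 ?(ltW p0)//; last exact: ltW.
by apply: le_trans (ltW xB); exact: powR_ge0.
Qed.

Section lamperti_law.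
Context {R : realType}.
Notation mu := (@lebesgue_measure R).
Variable alpha : R.
Hypotheses (al0 : 0 < alpha) (al1 : alpha < 1).
Implicit Types (x t z u : R).
Notation s := (sin (pi * alpha)).
Notation k := (cos (pi * alpha)).
Notation F := (lamperti_cdf alpha).
Notation L := (lamperti_poly alpha).
Notation rho := (varrho alpha).

Let pa0 : 0 < pi * alpha. Proof. by rewrite mulr_gt0// pi_gt0. Qed.
Let pa1 : pi * alpha < pi. Proof. by rewrite gtr_pMr// pi_gt0. Qed.
Let s0 : 0 < s. Proof. by apply: sin_gt0_pi; rewrite pa0. Qed.

Lemma deriv_lamperti_cdf x : 0 < x -> has_deriv F x (rho x).
Proof.
move=> x0; have L0 := lamperti_poly_gt0 al0 al1 x0.
apply: has_deriv_eq; first by rewrite /lamperti_cdf /acot; der.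
have L0' := L0; rewrite lamperti_polyE// in L0' *.
have [P PE] : exists P : R, P = pi by exists pi.
have P0 : P != 0 by rewrite PE gt_eqF// pi_gt0.
rewrite /= /cot /varrho lamperti_polyE//; move: s0 L0'; rewrite -PE => s0' L0'; field.
by rewrite (gt_eqF s0') (gt_eqF L0') P0 (gt_eqF al0).
Qed.

Lemma varrho_ge0 x : 0 < x -> 0 <= rho x.
Proof.
move=> x0; have L0 := lamperti_poly_gt0 al0 al1 x0.
by rewrite /varrho mulr_ge0// ?divr_ge0 ?powR_ge0 ?pi_ge0 ?(ltW s0) ?(ltW L0).
Qed.

Lemma continuous_varrho x : 0 < x -> {for x, continuous rho}.
Proof.
move=> x0; have L0 := lamperti_poly_gt0 al0 al1 x0; rewrite /lamperti_poly in L0.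
apply: has_deriv_cont; rewrite /varrho /lamperti_poly; der.
by rewrite gt_eqF.
Qed.

Lemma varrho_bound x : 0 < x -> `|rho x| <= (pi^-1 / s) * x `^ (alpha - 1).
Proof.
move=> x0; rewrite ger0_norm ?varrho_ge0//.
have L0 := lamperti_poly_gt0 al0 al1 x0; have [h _] := lamperti_poly_ge alpha x0.
rewrite /varrho (_ : s / pi * _ = pi^-1 * x `^ (alpha - 1) * (s / L x)); last by ring.
rewrite [leRHS]mulrAC ler_wpM2l ?mulr_ge0 ?powR_ge0 ?invr_ge0 ?pi_ge0//.
by rewrite ler_pdivrMr// [leRHS]mulrC ler_pdivlMr// -expr2.
Qed.

Lemma lamperti_cdf_cvg0 : F x @[x --> 0^'+] --> (0 : R).
Proof.
pose H (u : R) : R := (pi * alpha)^-1 * (pi * alpha - pi / 2 + atan ((u + k) / s)).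
have cH : {for 0, continuous H} by apply: has_deriv_cont; rewrite /H; der.
have H0 : H 0 = 0.
  rewrite /H add0r atan_cot ?pa0//.
  by rewrite (_ : _ + _ = 0); [rewrite mulr0|ring].
have c : H (x `^ alpha) @[x --> 0^'+] --> (0 : R).
  by rewrite -[X in _ --> X]H0; exact: (cvg_comp _ _ (powR_cvg0 al0) cH).
apply: cvg_trans c; apply: near_eq_cvg; near=> x.
by rewrite /= /H -/(langle alpha x) -lamperti_angle// mulKf// gt_eqF.
Unshelve. all: by end_near. Qed.

Lemma lamperti_cdf_cvg1 : F x @[x --> +oo] --> (1 : R).
Proof.
have c1 : (x `^ alpha + k) / s @[x --> +oo] --> +oo.
  apply/cvgryPge => A; near=> x; rewrite ler_pdivlMr// -lerBlDr.
  by near: x; have /cvgryPge := cvgr_powRy al0; apply.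
have c2 : atan ((x `^ alpha + k) / s) @[x --> +oo] --> (pi / 2 : R).
  exact: (cvg_comp _ _ c1 (@cvgy_atan R)).
have e : F = fun x => (pi * alpha)^-1 * (pi * alpha - pi / 2 + atan ((x `^ alpha + k) / s)).
  by apply/funext => x; rewrite -/(langle alpha x) -lamperti_angle// mulKf// gt_eqF.
have e1 : (pi * alpha)^-1 * (pi * alpha - pi / 2 + pi / 2) = 1.
  by rewrite subrK mulVf// gt_eqF.
rewrite e -[X in _ --> X]e1.
by apply: cvgMl_tmp; apply: cvgD c2; exact: cvg_cst.
Unshelve. all: by end_near. Qed.

Lemma integral_varrho x : 0 < x -> (\int[mu]_(t in `]0%R, x[) (rho t)%:E = (F x)%:E)%E.
Proof.
move=> x0; rewrite (@ge0_FTC_oo _ _ F 0 x 0 (F x)).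
- by rewrite subr0.
- exact: x0.
- by move=> t /andP[t0 _]; exact: varrho_ge0.
- by move=> t /andP[t0 _]; exact: continuous_varrho.
- by move=> t /andP[t0 _]; exact: deriv_lamperti_cdf.
- exact: lamperti_cdf_cvg0.
- by apply: cvg_at_left_filter; exact: has_deriv_cont (deriv_lamperti_cdf x0).
Qed.

Lemma integral_varrho1 : (\int[mu]_(t in `]0%R, +oo[) (rho t)%:E = 1%:E)%E.
Proof.
rewrite (@ge0_FTC_oy _ _ F 0 0 1).
- by rewrite subr0.
- by move=> t t0; exact: varrho_ge0.
- by move=> t t0; exact: continuous_varrho.
- by move=> t t0; exact: deriv_lamperti_cdf.
- exact: lamperti_cdf_cvg0.
- exact: lamperti_cdf_cvg1.
Qed.

Lemma measurable_varrho : measurable_fun (`]0, +oo[ : set R) rho.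
Proof.
apply: open_continuous_measurable_fun; first exact: interval_open.
by move=> t /set_mem; rewrite /= in_itv/= andbT => t0; exact: continuous_varrho.
Qed.

Lemma integrable_varrho : mu.-integrable `]0, +oo[ (EFin \o rho).
Proof.
apply/integrableP; split; first by apply/measurable_EFinP; exact: measurable_varrho.
rewrite (_ : integral _ _ _ = 1%:E) ?ltry// -integral_varrho1.
apply: eq_integral => t /set_mem; rewrite /= in_itv/= andbT => t0.
by rewrite ger0_norm// varrho_ge0.
Qed.

(** For theta = 1 the sine is that of the argument of 1 + x^alpha e^(i pi alpha), namely s x^alpha /
    sqrt L. The transform of x rho(x) is thus a case of that of [Delta]. *)
Lemma Delta1E x : 0 < x -> Delta alpha 1 F x = x * rho x.
Proof.
move=> x0; have L0 := lamperti_poly_gt0 al0 al1 x0.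
rewrite /Delta /varrho mulr1 lamperti_angle// /langle.
have xa : x `^ alpha = x * x `^ (alpha - 1) by rewrite mulr_powRB1// ltW.
have Le := lamperti_polyE alpha x0.
have ss0 := s0.
set v := (_ + k) / s.
have ev : 1 + v ^+ 2 = L x / s ^+ 2 by rewrite Le /v; field; rewrite gt_eqF.
have es : sin (pi * alpha - pi / 2 + atan v) = s * x `^ alpha / Num.sqrt (L x).
  rewrite sinD sinB cosB sin_pihalf cos_pihalf sin_atan cos_atan ev.
  rewrite sqrtrM ?(ltW L0)// sqrtrV ?sqr_ge0// sqrtr_sqr (gtr0_norm s0).
  have q0 : Num.sqrt (L x) != 0 by rewrite gt_eqF// sqrtr_gt0.
  rewrite /v; field.
  by rewrite q0 gt_eqF.
have sq : L x = Num.sqrt (L x) * Num.sqrt (L x) by rewrite -expr2 sqr_sqrtr// ltW.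
rewrite es mul1r powR12_sqrt ?(ltW L0)// [in RHS]sq xa.
have q0 : Num.sqrt (L x) != 0 by rewrite gt_eqF// sqrtr_gt0.
have [P PE] : exists P : R, P = pi by exists pi.
have P0 : P != 0 by rewrite PE gt_eqF// pi_gt0.
rewrite -PE; field.
by rewrite q0 P0.
Qed.

Lemma stieltjes_varrho_mul z : 0 < z ->
  (\int[mu]_(t in `]0%R, +oo[) (t * rho t / (z + t))%:E = ((1 + z `^ alpha)^-1)%:E)%E.
Proof.
move=> z0; have h : 0 <= 1 + z `^ alpha by rewrite addr_ge0 ?powR_ge0.
rewrite -powR_inv1// -(stieltjes_Delta al0 al1 ltr01 z0).
by apply: eq_integral => t /set_mem; rewrite /= in_itv/= andbT => t0; rewrite Delta1E.
Qed.

Lemma integrable_stieltjes_varrho z : 0 < z ->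
  mu.-integrable `]0, +oo[ (fun t => (rho t / (z + t))%:E).
Proof.
move=> z0; have i := integrableZl _ z^-1 integrable_varrho.
have mz : measurable_fun (`]0, +oo[ : set R) (fun t : R => (z + t)^-1).
  apply: open_continuous_measurable_fun; first exact: interval_open.
  move=> t /set_mem; rewrite /= in_itv/= andbT => t0.
  by apply: has_deriv_cont; der; rewrite gt_eqF// addr_gt0.
apply: le_integrable (i _) => //.
  by apply/measurable_EFinP; apply: measurable_funM => //; exact: measurable_varrho.
move=> t; rewrite /= in_itv/= andbT => t0; rewrite lee_fin !normrM mulrC.
rewrite ler_wpM2r// !normfV lef_pV2 ?posrE ?normr_gt0 ?gt_eqF ?addr_gt0//.
by rewrite !gtr0_norm ?addr_gt0// lerDl ltW.
Qed.

(** t / (z + t) = 1 - z / (z + t) together with the total mass 1 gives z I = 1 - 1 / (1 + z^alpha)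
    for the integral I. *)
Lemma stieltjes_varrho z : 0 < z ->
  (\int[mu]_(t in `]0%R, +oo[) (rho t / (z + t))%:E = (z `^ (alpha - 1) / (1 + z `^ alpha))%:E)%E.
Proof.
move=> z0; have i := integrable_stieltjes_varrho z0.
have f1 : (\int[mu]_(t in `]0%R, +oo[) (rho t / (z + t))%:E)%E \is a fin_num.
  exact: integrable_fin_num.
have := stieltjes_varrho_mul z0.
rewrite (_ : integral _ _ _ = \int[mu]_(t in `]0%R, +oo[) ((rho t)%:E - z%:E * (rho t / (z + t))%:E))%E; last first.
  apply: eq_integral => t /set_mem; rewrite /= in_itv/= andbT => t0.
  by rewrite -EFinD; congr EFin; field; rewrite gt_eqF// addr_gt0.
rewrite integralB//; [|exact: integrable_varrho|exact: integrableZl].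
rewrite integral_varrho1 integralZl// -(fineK f1) -EFinM -EFinB => -[h].
congr EFin; have h1 : 1 + z `^ alpha != 0 by rewrite gt_eqF// ltr_pwDl// powR_ge0.
have za : z `^ alpha = z * z `^ (alpha - 1) by rewrite mulr_powRB1// ltW.
set I := fine _ in h *; rewrite za in h1 h *.
have zn : z != 0 by rewrite gt_eqF.
apply: (mulfI zn).
have -> : z * I = 1 - (1 + z * z `^ (alpha - 1))^-1 by rewrite -h; ring.
by field.
Qed.

End lamperti_law.

(** * Stable and tilted stable variables *)

Section gamma_integrals.
Context {R : realType}.

Lemma measurable_expR_comp d (T : measurableType d) (D : set T) (f : T -> R) :
  measurable_fun D f -> measurable_fun D (fun x => expR (f x)).
Proof. by move=> mf; exact: (measurableT_comp (@measurable_expR R)). Qed.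

Lemma measurable_powR_comp d (T : measurableType d) (D : set T) (f : T -> R) p :
  measurable_fun D f -> measurable_fun D (fun x => f x `^ p).
Proof. by move=> mf; exact: (measurableT_comp (@measurable_powR R p)). Qed.

Lemma measurable_oppr_comp d (T : measurableType d) (D : set T) (f : T -> R) :
  measurable_fun D f -> measurable_fun D (fun x => - f x).
Proof. by move=> mf; exact: measurableT_comp. Qed.

Lemma measurable_fst_comp d d' (T : measurableType d) (T' : measurableType d') (f : T -> R) :
  measurable_fun setT f -> measurable_fun setT (fun x : T * T' => f x.1).
Proof. by move=> mf; apply: (measurableT_comp mf); exact: measurable_fst. Qed.

Lemma measurable_snd_comp d d' (T : measurableType d) (T' : measurableType d') (f : T' -> R) :
  measurable_fun setT f -> measurable_fun setT (fun x : T * T' => f x.2).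
Proof. by move=> mf; apply: (measurableT_comp mf); exact: measurable_snd. Qed.

Lemma measurable_id_typeR : measurable_fun setT (fun x : measurableTypeR R => x : R).
Proof. exact: measurable_id. Qed.

Notation mu := (@lebesgue_measure R).

Lemma measurable_invr : measurable_fun (setT : set R) (fun x : R => x^-1).
Proof.
have -> : (fun x : R => x^-1) = fun x => x * (x ^+ 2) `^ (- 1).
  apply/funext => x; rewrite powR_inv1 ?sqr_ge0//.
  have [->|x0] := eqVneq x 0; first by rewrite invr0 mul0r.
  by rewrite expr2 invfM mulrA divff// mul1r.
apply: measurable_funM => //; apply: (measurableT_comp (measurable_powR _)).
exact: measurable_funX.
Qed.

(** Kept in the extended reals: that it is finite comes from [gamma_normalization], and the scaling
    rules hold in either case. *)
Definition egamma (a : R) : \bar R :=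
  (\int[mu]_(t in `]0%R, +oo[) (t `^ (a - 1) * expR (- t))%:E)%E.

Lemma measurable_gamma_fun (a c : R) (D : set R) : measurable D ->
  measurable_fun D (fun t : R => t `^ (a - 1) * expR (- (t * c))).
Proof.
move=> mD; apply: measurable_funTS; apply: measurable_funM; first exact: measurable_powR.
apply: measurable_expR_comp; apply: measurableT_comp => //.
exact: measurable_funM.
Qed.

Lemma egamma_scale (a c : R) : 0 < a -> 0 < c ->
  (\int[mu]_(t in `]0%R, +oo[) (t `^ (a - 1) * expR (- (t * c)))%:E =
   (c `^ (- a))%:E * egamma a)%E.
Proof.
move=> a0 c0.
have mg : measurable_fun (`]0, +oo[ : set R) (fun t : R => (t `^ (a - 1) * expR (- t))%:E).
  apply/measurable_EFinP; have := @measurable_gamma_fun a 1 (`]0, +oo[ : set R) (measurable_itv _).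
  by apply: eq_measurable_fun => t _; rewrite mulr1.
rewrite /egamma (ge0_integral_scale c0 mg); last by move=> x _; rewrite lee_fin mulr_ge0 ?powR_ge0 ?expR_ge0.
rewrite -ge0_integralZl//; last 3 first.
- apply: measurable_funeM.
  have sub : [set c * t | t in `]0, +oo[%classic] `<=` (`]0, +oo[%classic : set R).
    by move=> _ [t h <-]; move: h; rewrite /= !in_itv/= !andbT => t0; rewrite mulr_gt0.
  by apply: measurable_comp (measurable_itv _) sub mg _; exact: measurable_funM.
- by move=> t _; rewrite mule_ge0 ?lee_fin ?(ltW c0)// mulr_ge0 ?powR_ge0 ?expR_ge0.
- by rewrite lee_fin powR_ge0.
- apply: eq_integral => t /set_mem; rewrite /= in_itv/= andbT => t0.
  rewrite -!EFinM; congr EFin; rewrite powRM ?ltW// (mulrC t c).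
  have -> : c `^ (- a) * (c * (c `^ (a - 1) * t `^ (a - 1) * expR (- (c * t)))) =
     (c `^ (- a) * (c * c `^ (a - 1))) * (t `^ (a - 1) * expR (- (c * t))) by ring.
  by rewrite mulr_powRB1 ?(ltW c0)// powRN mulVf ?mul1r// gt_eqF// powR_gt0.
Qed.

(** Scaling by q^(1 / al). The remaining integral is left unevaluated; it cancels against the
    normalization of the tilted law. *)
Lemma integral_weibull (a al q : R) : 0 < a -> 0 < al -> 0 < q ->
  (\int[mu]_(t in `]0%R, +oo[) (t `^ (a - 1) * expR (- (q * t `^ al)))%:E =
   (q `^ (- (a / al)))%:E * \int[mu]_(t in `]0%R, +oo[) (t `^ (a - 1) * expR (- (t `^ al)))%:E)%E.
Proof.
move=> a0 al0 q0; pose c := q `^ al^-1; have c0 : 0 < c by exact: powR_gt0.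
have mg (r : R) : measurable_fun (`]0, +oo[ : set R) (fun t : R => (t `^ (a - 1) * expR (- (r * t `^ al)))%:E).
  apply/measurable_EFinP; apply: measurable_funTS; apply: measurable_funM; first exact: measurable_powR.
  apply: measurable_expR_comp; apply: measurableT_comp => //.
  by apply: measurable_funM => //; exact: measurable_powR.
rewrite [X in (_ * X)%E](_ : _ = \int[mu]_(t in `]0%R, +oo[) (t `^ (a - 1) * expR (- (1 * t `^ al)))%:E)%E; last first.
  by apply: eq_integral => t _; rewrite mul1r.
rewrite [X in (_ * X)%E](ge0_integral_scale c0 (mg 1)); last by move=> x _; rewrite lee_fin mulr_ge0 ?powR_ge0 ?expR_ge0.
have e : c `^ al = q by rewrite /c -powRrM mulVf ?powRr1 ?gt_eqF// ltW.
have ea : c `^ (- a) = q `^ (- (a / al)) by rewrite /c -powRrM; congr powR; ring.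
rewrite (_ : integral _ _ (fun x => c%:E * _)%E = integral mu `]0%R, +oo[%classic
   (fun t => (c `^ a)%:E * (t `^ (a - 1) * expR (- (q * t `^ al)))%:E)%E); last first.
  apply: eq_integral => t /set_mem; rewrite /= in_itv/= andbT => t0.
  rewrite -!EFinM; congr EFin; rewrite !powRM ?(ltW c0) ?(ltW t0)// e mul1r.
  by rewrite -(mulr_powRB1 (ltW c0) a0); ring.
rewrite ge0_integralZl ?lee_fin ?powR_ge0//; [|exact: mg|by move=> t _; rewrite lee_fin mulr_ge0 ?powR_ge0 ?expR_ge0].
by rewrite muleA -EFinM -ea powRN mulVf ?mul1e// gt_eqF// powR_gt0.
Qed.

Lemma integral_exp_shape (al c : R) : 0 < al -> 0 < c ->
  (\int[mu]_(v in `]0%R, +oo[) (al * v `^ (al - 1) *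
      (expR (- (v `^ al)) - expR (- ((1 + c) * v `^ al))))%:E = (c / (1 + c))%:E)%E.
Proof.
move=> al0 c0; have c1 : 0 < 1 + c by rewrite addr_gt0.
pose H (v : R) : R := - expR (- (v `^ al)) + (1 + c)^-1 * expR (- ((1 + c) * v `^ al)).
rewrite (@ge0_FTC_oy _ _ H 0 (- expR (- 0) + (1 + c)^-1 * expR (- ((1 + c) * 0))) 0).
- by rewrite mulr0 oppr0 expR0 mulr1; congr EFin; field; rewrite gt_eqF.
- move=> v v0; rewrite !mulr_ge0 ?powR_ge0 ?(ltW al0)// subr_ge0 ler_expR lerN2.
  by rewrite ler_peMl ?powR_ge0// lerDl ltW.
- by move=> v v0; apply: has_deriv_cont; der.
- move=> v v0; apply: has_deriv_eq; first by rewrite /H; der.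
  by rewrite /=; field; rewrite gt_eqF.
- have h := powR_cvg0 al0.
  have cH : {for 0, continuous (fun u : R => - expR (- u) + (1 + c)^-1 * expR (- ((1 + c) * u)))}.
    by apply: has_deriv_cont; der.
  exact: (cvg_comp _ _ h cH).
- have cy : v `^ al @[v --> +oo] --> +oo.
    exact: cvgr_powRy.
  have ce : (- expR (- u) + (1 + c)^-1 * expR (- ((1 + c) * u))) @[u --> +oo] --> (0 : R).
    rewrite -[X in _ --> X](_ : - 0 + (1 + c)^-1 * 0 = 0); last by ring.
    have e1 := @cvgr_expR R.
    apply: cvgD; first exact: cvgN.
    apply: cvgMl_tmp; apply: (@squeeze_cvgr _ _ _ _ (fun=> 0) (fun u : R => expR (- u))).
    - exists 0; split => [|u u0]; first exact: num_real.
      by rewrite expR_ge0/= ler_expR lerN2 ler_peMl ?lerDl ?(ltW c0) ?(ltW u0).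
    - exact: cvg_cst.
    - exact: e1.
  exact: (cvg_comp _ _ cy ce).
Qed.

End gamma_integrals.

Ltac ms := repeat first
  [ eassumption | exact: measurable_cst | exact: measurable_id | exact: measurable_id_typeR
  | apply: measurable_funM | apply: measurable_expR_comp | apply: measurable_powR_comp
  | apply: measurable_oppr_comp | apply: measurable_funD
  | apply: (measurable_fst_comp (f := id)) | apply: (measurable_snd_comp (f := id))
  | apply: measurable_fst_comp | apply: measurable_snd_comp ].

Section half_line_integrals.
Context {R : realType}.
Notation mu := (@lebesgue_measure R).

Lemma integral_expN (c : R) : 0 < c ->
  (\int[mu]_(s in `]0%R, +oo[) (expR (- (s * c)))%:E = (c^-1)%:E)%E.
Proof.
move=> c0.
rewrite (@ge0_FTC_oy _ _ (fun s => - c^-1 * expR (- (s * c))) 0 (- c^-1 * expR (- (0 * c))) (- c^-1 * 0)).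
- by rewrite mul0r oppr0 expR0; congr EFin; ring.
- by move=> s _; exact: expR_ge0.
- by move=> s _; apply: has_deriv_cont; der.
- by move=> s _; apply: has_deriv_eq; [der|rewrite /=; field; rewrite gt_eqF].
- apply: cvg_at_right_filter.
  by apply: (@has_deriv_cont _ (fun s => - c^-1 * expR (- (s * c)))); der.
- apply: cvgMl_tmp.
  have h : s * c @[s --> +oo] --> +oo.
    apply/cvgryPge => A; exists (A / c); split => [|s sA]; first exact: num_real.
    by rewrite -ler_pdivrMr// ltW.
  exact: (cvg_comp _ _ h (@cvgr_expR R)).
Qed.

Lemma ge0_integralM d (T : measurableType d) (m : {measure set T -> \bar R}) (D : set T)
    (c : R) (f : T -> R) : measurable D -> measurable_fun D f ->
  (forall x, D x -> 0 <= f x) -> 0 <= c ->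
  (\int[m]_(x in D) (c * f x)%:E = c%:E * \int[m]_(x in D) (f x)%:E)%E.
Proof.
by move=> mD mf f0 c0; rewrite -ge0_integralZl//; exact/measurable_EFinP.
Qed.

Lemma tonelli_half d (T : measurableType d) (m : {sigma_finite_measure set T -> \bar R})
    (f : T -> R -> R) :
  measurable_fun setT (fun r : T * measurableTypeR R => f r.1 r.2) ->
  (forall x t, 0 < t -> 0 <= f x t) ->
  (\int[m]_x \int[mu]_(t in `]0%R, +oo[) (f x t)%:E =
   \int[mu]_(t in `]0%R, +oo[) \int[m]_x (f x t)%:E)%E.
Proof.
move=> mf f0.
pose E : set (T * measurableTypeR R) := [set r | (0 : R) < r.2].
have mE : measurable E.
  by apply: measurable_ltr_set => //; exact: measurable_snd.
have mf' : measurable_fun E (fun r : T * measurableTypeR R => (f r.1 r.2)%:E).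
  by apply: measurable_funTS; exact/measurable_EFinP.
have F := @tonelli_dom _ _ T (measurableTypeR R) R m mu E setT (fun=> `]0, +oo[%classic)
  (`]0, +oo[%classic : set R) (fun=> setT) mE _ _ (fun r => (f r.1 r.2)%:E) mf'.
apply: F.
- by move=> x t; rewrite /E /= in_itv/= andbT; split => [|[]].
- by move=> x t; rewrite /E /= in_itv/= andbT; split => [|[]].
- by move=> [x t] t0; rewrite lee_fin; exact: f0.
Qed.

Variable alpha : R.
Hypothesis al0 : 0 < alpha.
Let k v : R := alpha * v `^ (alpha - 1) * expR (- (v `^ alpha)).

Lemma integral_weibull_tail s : 0 < s ->
  (\int[mu]_(v in `]s, +oo[) (k v)%:E = (expR (- (s `^ alpha)))%:E)%E.
Proof.
move=> s0; rewrite (@ge0_FTC_oy _ _ (fun v => - expR (- (v `^ alpha))) s (- expR (- (s `^ alpha))) (- 0)).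
- by congr EFin; ring.
- by move=> v _; rewrite /k !mulr_ge0 ?powR_ge0 ?expR_ge0// ltW.
- by move=> v sv; have v0 := lt_trans s0 sv; apply: has_deriv_cont; rewrite /k; der.
- move=> v sv; have v0 := lt_trans s0 sv; apply: has_deriv_eq; first by der.
  by rewrite /= /k; ring.
- apply: cvg_at_right_filter.
  by apply: (@has_deriv_cont _ (fun v => - expR (- (v `^ alpha)))); der.
- by apply: cvgN; exact: (cvg_comp _ _ (cvgr_powRy al0) (@cvgr_expR R)).
Qed.

(** Integration by parts through Tonelli: e^(- s^alpha) is the integral of its Weibull density [k]
    over v > s, and b e^(- s b) integrates over ]0, v[ to 1 - e^(- v b). The factor b in front
    disappears. *)
Lemma laplace_by_parts b : 0 < b ->
  (\int[mu]_(s in `]0%R, +oo[) (b * expR (- (s * b)) * expR (- (s `^ alpha)))%:E =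
   \int[mu]_(v in `]0%R, +oo[) (k v * (1 - expR (- (v * b))))%:E)%E.
Proof.
move=> b0.
pose E : set (measurableTypeR R * measurableTypeR R) := [set r | 0 < r.1 < r.2].
have mE : measurable E.
  have -> : E = [set r | (0 : R) < r.1] `&` [set r | r.1 < r.2].
    by apply/seteqP; split => r /=; [move=> /andP[]|move=> [h1 h2]; apply/andP].
  by apply: measurableI; apply: measurable_ltr_set.
pose f (r : measurableTypeR R * measurableTypeR R) : \bar R := (b * expR (- (r.1 * b)) * k r.2)%:E.
have mf : measurable_fun E f.
  by apply: measurable_funTS; apply/measurable_EFinP; rewrite /k; ms.
have k0 v : 0 <= k v by rewrite /k !mulr_ge0 ?powR_ge0 ?expR_ge0// ltW.
have be0 s : 0 <= b * expR (- (s * b)) by rewrite mulr_ge0 ?expR_ge0// ltW.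
have mk (D : set R) : measurable D -> measurable_fun D k.
  by move=> mD; apply: measurable_funTS; rewrite /k; ms.
transitivity (\int[mu]_(s in `]0%R, +oo[) \int[mu]_(v in `]s, +oo[) f (s, v))%E.
  apply: eq_integral => s /set_mem; rewrite /= in_itv/= andbT => s0.
  rewrite EFinM -(integral_weibull_tail s0) -ge0_integralM.
  - by [].
  - exact: measurable_itv.
  - exact: mk.
  - by move=> v _; exact: k0.
  - exact: be0.
have F := @tonelli_dom _ _ (measurableTypeR R) (measurableTypeR R) R mu mu E
  (`]0, +oo[ : set R) (fun s => `]s, +oo[%classic) (`]0, +oo[ : set R) (fun v => `]0, v[%classic)
  mE _ _ f mf.
rewrite F; clear F.
- apply: eq_integral => v /set_mem; rewrite /= in_itv/= andbT => v0; rewrite /f /=.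
  rewrite [LHS](_ : _ = \int[mu]_(s in `]0%R, v[) (k v * (b * expR (- (s * b))))%:E)%E; last first.
    by apply: eq_integral => s _; rewrite mulrC.
  rewrite ge0_integralM.
  + rewrite [RHS]EFinM; congr (_ * _)%E.
    rewrite (@ge0_FTC_oo _ _ (fun s => - expR (- (s * b))) 0 v (- expR (- (0 * b))) (- expR (- (v * b)))).
    * by rewrite mul0r oppr0 expR0; congr EFin; ring.
    * exact: v0.
    * by move=> s _.
    * by move=> s _; apply: has_deriv_cont; der.
    * by move=> s _; apply: has_deriv_eq; [der|rewrite /=; ring].
    * apply: cvg_at_right_filter.
      by apply: (@has_deriv_cont _ (fun s => - expR (- (s * b)))); der.
    * apply: cvg_at_left_filter.
      by apply: (@has_deriv_cont _ (fun s => - expR (- (s * b)))); der.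
  + exact: measurable_itv.
  + by apply: measurable_funTS; ms.
  + by move=> s _.
  + exact: k0.
- by move=> s v; rewrite /E /= !in_itv/= !andbT; split => [/andP//|H]; apply/andP.
- move=> s v; rewrite /E /= !in_itv/= !andbT; split => [/andP[h1 h2]|[_ //]].
  by split; [exact: lt_trans h1 h2|rewrite h1 h2].
- by move=> r _; rewrite lee_fin mulr_ge0.
Qed.

End half_line_integrals.

Section stable_laws.
Context {R : realType} {d : measure_display} {Omega : measurableType d}.
Variable P : probability Omega R.
Notation mu := (@lebesgue_measure R).
Variables (alpha : R) (S : {RV P >-> R}).
Hypotheses (al0 : 0 < alpha) (al1 : alpha < 1) (hS : is_pos_stable P alpha S).

Let mRV (X : {RV P >-> R}) : measurable_fun setT (X : Omega -> measurableTypeR R).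
Proof. exact: measurable_RV. Qed.

Lemma stable_laplace (c : R) : 0 <= c ->
  (\int[P]_w (expR (- (c * S w)))%:E = (expR (- (c `^ alpha)))%:E)%E.
Proof.
rewrite le_eqVlt => /orP[/eqP <-|c0].
  rewrite powR0 ?gt_eqF// oppr0 expR0 (_ : integral _ _ _ = integral P setT (cst 1%E)).
    by rewrite integral_cst// mul1e; exact: probability_setT.
  by apply: eq_integral => w _; rewrite mul0r oppr0 expR0.
have [_ /(_ _ c0)] := hS; rewrite unlock => <-.
by apply: eq_integral => w _; rewrite mulNr.
Qed.

Let mabs (X : {RV P >-> R}) : measurable_fun setT (fun w => `|X w|).
Proof. by apply: measurableT_comp => //; exact: mRV. Qed.

(* [`|x|] instead of [x] makes all the integrands nonnegative. *)
Let abs_ae (X : {RV P >-> R}) (g : R -> R) : positive_rv P X -> measurable_fun setT g ->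
  (forall x, 0 <= g x) -> (\int[P]_w (g `|X w|)%:E = \int[P]_w (g (X w))%:E)%E.
Proof.
move=> X0 mg g0; apply: ge0_ae_eq_integral => //.
- by apply/measurable_EFinP; apply: (measurableT_comp mg); exact: mabs.
- by apply/measurable_EFinP; apply: (measurableT_comp mg); exact: mRV.
- by move=> w _; rewrite lee_fin.
- by move=> w _; rewrite lee_fin.
- have X0' : {ae P, forall w, 0 < X w} := X0.
  by apply: filterS X0' => w w0 _; rewrite gtr0_norm.
Qed.

Lemma stable_laplace_abs (c : R) : 0 <= c ->
  (\int[P]_w (expR (- (c * `|S w|)))%:E = (expR (- (c `^ alpha)))%:E)%E.
Proof.
move=> c0; rewrite (@abs_ae S (fun x => expR (- (c * x)))) ?stable_laplace//.
- by case: hS.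
- by ms.
Qed.

(* Decoupling the independent variables replaces [expR (- s S)] by its mean. *)
Let decouple_laplace (T : {RV P >-> R}) (g : R -> R) (c : R) : indep_rv P S T -> 0 <= c ->
  measurable_fun setT g -> (forall x, 0 <= x -> 0 <= g x) ->
  (\int[P]_w (g `|T w| * expR (- (c * `|S w|)))%:E =
   \int[P]_w (g `|T w| * expR (- (c `^ alpha)))%:E)%E.
Proof.
move=> iST c0 mg g0.
have mg' : measurable_fun setT (fun w => g `|T w|) by apply: (measurableT_comp mg); exact: mabs.
have mn : measurable_fun (setT : set (measurableTypeR R)) (fun x : R => `|x|).
  by apply: measurableT_comp => //; exact: measurable_id_typeR.
have mg2 : measurable_fun (setT : set (measurableTypeR R)) (fun x : R => g `|x|).
  exact: (measurableT_comp mg mn).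
pose k (r : measurableTypeR R * measurableTypeR R) : \bar R := (g `|r.2| * expR (- (c * `|r.1|)))%:E.
have mk : measurable_fun setT k.
  apply/measurable_EFinP; apply: measurable_funM.
    exact: (measurable_snd_comp mg2).
  apply: measurable_expR_comp; apply: measurable_oppr_comp; apply: measurable_funM => //.
  exact: (measurable_fst_comp mn).
rewrite [LHS](@ge0_integral_decouple _ _ _ P S T k iST mk); last first.
  by move=> r; rewrite lee_fin mulr_ge0 ?expR_ge0 ?g0.
pose I := (\int[P]_w (g `|T w|)%:E)%E.
transitivity (\int[P]_w (I * (expR (- (c * `|S w|)))%:E))%E.
  apply: eq_integral => w _; rewrite /k /= muleC -ge0_integralZl ?lee_fin ?expR_ge0//.
  - by apply: eq_integral => w' _; rewrite -EFinM mulrC.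
  - exact/measurable_EFinP.
  - by move=> w' _; rewrite lee_fin g0.
have I0 : (0 <= I)%E by apply: integral_ge0 => w _; rewrite lee_fin g0.
have mexp : measurable_fun setT (fun w => expR (- (c * `|S w|))).
  apply: measurable_expR_comp; apply: measurable_oppr_comp; apply: measurable_funM => //.
rewrite ge0_integralZl//; last exact/measurable_EFinP.
rewrite stable_laplace_abs// muleC -ge0_integralZl ?lee_fin ?expR_ge0//.
- by apply: eq_integral => w' _; rewrite -EFinM mulrC.
- exact/measurable_EFinP.
- by move=> w' _; rewrite lee_fin g0.
Qed.

Section ratio.
Variable S' : {RV P >-> R}.
Hypotheses (hS' : is_pos_stable P alpha S') (iSS' : indep_rv P S S').
Hypothesis laplace_abs' : forall c : R, 0 <= c ->
  (\int[P]_w (expR (- (c * `|S' w|)))%:E = (expR (- (c `^ alpha)))%:E)%E.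

(** 1 / (z + S / S') = S' / (z S' + S) is the integral of S' e^(- s z S') e^(- s S) over s.
    Averaging S, then S', leaves z^(- 1) times the integral of alpha v^(alpha - 1) (e^(- v^alpha) -
    e^(- (1 + z^alpha) v^alpha)), which is elementary. *)
Lemma stieltjes_stable_ratio (z : R) : 0 < z ->
  (\int[P]_w ((z + S w / S' w) `^ (- 1))%:E = (z `^ (alpha - 1) / (1 + z `^ alpha))%:E)%E.
Proof.
move=> z0.
have [S0 _] := hS; have [S'0 _] := hS'.
pose k v : R := alpha * v `^ (alpha - 1) * expR (- (v `^ alpha)).
have k0 v : 0 <= k v by rewrite !mulr_ge0 ?powR_ge0 ?expR_ge0 ?ltW.
have mA := mabs S; have mB := mabs S'.
have mS := mRV S; have mS' := mRV S'.
have mS'' : measurable_fun setT (fun w => (S' w)^-1) by apply: (measurableT_comp measurable_invr).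
have mAB : measurable_fun setT (fun w => (z * `|S' w| + `|S w|)^-1).
  by apply: (measurableT_comp measurable_invr); ms.
have mA1 : measurable_fun setT (fun r : Omega * measurableTypeR R => `|S r.1|).
  exact: (measurable_fst_comp mA).
have mB1 : measurable_fun setT (fun r : Omega * measurableTypeR R => `|S' r.1|).
  exact: (measurable_fst_comp mB).
transitivity (\int[P]_w (`|S' w| * (z * `|S' w| + `|S w|)^-1)%:E)%E.
  apply: ge0_ae_eq_integral => //.
  - by apply/measurable_EFinP; ms.
  - by apply/measurable_EFinP; ms.
  - by move=> w _; rewrite lee_fin powR_ge0.
  - by move=> w _; rewrite lee_fin mulr_ge0 ?invr_ge0 ?addr_ge0 ?mulr_ge0// ltW.
  - have S0' : {ae P, forall w, 0 < S w} := S0; have S'0' : {ae P, forall w, 0 < S' w} := S'0.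
    apply: filterS2 S0' S'0' => w Sw S'w _; rewrite !gtr0_norm//.
    have q0 : 0 < z * S' w + S w by rewrite addr_gt0// mulr_gt0.
    rewrite powR_inv1 ?addr_ge0 ?divr_ge0 ?(ltW z0) ?(ltW Sw) ?(ltW S'w)//.
    by congr EFin; field; rewrite !gt_eqF.
transitivity (\int[P]_w \int[mu]_(s in `]0%R, +oo[)
    (`|S' w| * expR (- (s * z * `|S' w|)) * expR (- (s * `|S w|)))%:E)%E.
  apply: eq_integral => w _; have := normr_ge0 (S' w); rewrite le_eqVlt => /orP[/eqP <-|B0].
    by rewrite mul0r integral0_eq// => s _; rewrite !mul0r.
  have q0 : 0 < z * `|S' w| + `|S w| by rewrite ltr_pwDl// mulr_gt0.
  rewrite EFinM -(integral_expN q0) -ge0_integralM.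
  - by apply: eq_integral => s _; rewrite -mulrA -expRD; congr (_ * expR _)%:E; ring.
  - exact: measurable_itv.
  - by apply: measurable_funTS; ms.
  - by move=> s _; exact: expR_ge0.
  - exact: ltW.
rewrite (@tonelli_half _ _ _ P (fun w s => `|S' w| * expR (- (s * z * `|S' w|)) * expR (- (s * `|S w|)))); last 2 first.
  - by ms.
  - by move=> w s _; rewrite !mulr_ge0 ?expR_ge0.
transitivity (\int[mu]_(s in `]0%R, +oo[) \int[P]_w
    (`|S' w| * expR (- (s * z * `|S' w|)) * expR (- (s `^ alpha)))%:E)%E.
  apply: eq_integral => s /set_mem; rewrite /= in_itv/= andbT => s0.
  rewrite (@decouple_laplace S' (fun x => x * expR (- (s * z * x))) s iSS' (ltW s0))//.
    by ms.
  by move=> x x0; rewrite mulr_ge0 ?expR_ge0.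
rewrite -(@tonelli_half _ _ _ P (fun w s => `|S' w| * expR (- (s * z * `|S' w|)) * expR (- (s `^ alpha)))); last 2 first.
  - by ms.
  - by move=> w s _; rewrite !mulr_ge0 ?expR_ge0.
(* Integration by parts with b = z S' removes the factor S', whose average against e^(- s z S')
   would call for the derivative of the Laplace transform. *)
transitivity (\int[P]_w \int[mu]_(v in `]0%R, +oo[)
    (z^-1 * (k v * (1 - expR (- (v * z * `|S' w|)))))%:E)%E.
  apply: eq_integral => w _; have := normr_ge0 (S' w); rewrite le_eqVlt => /orP[/eqP <-|B0].
    rewrite integral0_eq => [|s _]; last by rewrite !mul0r.
    by rewrite integral0_eq// => s _; rewrite mulr0 oppr0 expR0 subrr !mulr0.
  have b0 : 0 < z * `|S' w| by rewrite mulr_gt0.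
  have e := laplace_by_parts al0 b0.
  transitivity (z^-1%:E * \int[mu]_(s in `]0%R, +oo[)
     (z * `|S' w| * expR (- (s * (z * `|S' w|))) * expR (- (s `^ alpha)))%:E)%E.
    rewrite -ge0_integralM.
    - apply: eq_integral => s _; congr EFin.
      by rewrite (mulrA s) !mulrA mulVf ?mul1r// gt_eqF.
    - exact: measurable_itv.
    - by apply: measurable_funTS; ms.
    - by move=> s _; rewrite !mulr_ge0 ?expR_ge0// ltW.
    - by rewrite invr_ge0 ltW.
  rewrite e -ge0_integralM.
  - by apply: eq_integral => v _; rewrite (mulrA v).
  - exact: measurable_itv.
  - by apply: measurable_funTS; ms.
  - move=> v; rewrite /= in_itv/= andbT => v0; apply: mulr_ge0; first exact: k0.
    by rewrite subr_ge0 expR_le1 oppr_le0 mulr_ge0// ltW.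
  - by rewrite invr_ge0 ltW.
rewrite (@tonelli_half _ _ _ P (fun w v => z^-1 * (k v * (1 - expR (- (v * z * `|S' w|)))))); last 2 first.
  - by rewrite /k; ms.
  - move=> w v v0; apply: mulr_ge0; first by rewrite invr_ge0 ltW.
    apply: mulr_ge0; first exact: k0.
    by rewrite subr_ge0 expR_le1 oppr_le0 !mulr_ge0// ltW.
have c0 : 0 < z `^ alpha by exact: powR_gt0.
transitivity (z^-1%:E * (z `^ alpha / (1 + z `^ alpha))%:E)%E; last first.
  rewrite -EFinM; congr EFin; rewrite -{1}(mulr_powRB1 (ltW z0) al0).
  by field; rewrite !gt_eqF// addr_gt0.
rewrite -(integral_exp_shape al0 c0) -ge0_integralM.
- apply: eq_integral => v /set_mem; rewrite /= in_itv/= andbT => v0.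
  have e : (\int[P]_w (expR (- (v * z * `|S' w|)))%:E = (expR (- ((v * z) `^ alpha)))%:E)%E.
    by rewrite laplace_abs'// mulr_ge0// ltW.
  have me : measurable_fun setT (fun w => expR (- (v * z * `|S' w|))) by ms.
  have me1 : measurable_fun setT (fun w => 1 - expR (- (v * z * `|S' w|))) by ms.
  have p1 w : 0 <= 1 - expR (- (v * z * `|S' w|)).
    by rewrite subr_ge0 expR_le1 oppr_le0 !mulr_ge0// ltW.
  have e1 : (\int[P]_w (1 - expR (- (v * z * `|S' w|)))%:E = (1 - expR (- ((v * z) `^ alpha)))%:E)%E.
    have : (\int[P]_w ((1 - expR (- (v * z * `|S' w|)))%:E + (expR (- (v * z * `|S' w|)))%:E) = 1%:E)%E.
      rewrite (_ : integral _ _ _ = integral P setT (cst 1%E)).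
        by rewrite integral_cst// mul1e; exact: probability_setT.
      by apply: eq_integral => w _; rewrite -EFinD subrK.
    rewrite ge0_integralD//; last 3 first.
    - by move=> w _; rewrite lee_fin.
    - exact/measurable_EFinP.
    - exact/measurable_EFinP.
    rewrite e; case: (integral _ _ _) => [r| |]//.
    by rewrite -EFinD => -[<-]; rewrite addrK.
  rewrite (eq_integral (fun w => ((z^-1 * k v) * (1 - expR (- (v * z * `|S' w|))))%:E)); last first.
    by move=> w _; rewrite mulrA.
  rewrite (ge0_integralM P measurableT me1 (fun w _ => p1 w)); last first.
    by rewrite mulr_ge0 ?invr_ge0// ltW.
  rewrite e1 -EFinM; congr EFin; rewrite /k (powRM _ (ltW v0) (ltW z0)).
  rewrite (_ : - ((1 + z `^ alpha) * v `^ alpha) = - (v `^ alpha) + - (v `^ alpha * z `^ alpha)); last by ring.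
  by rewrite expRD; ring.
- exact: measurable_itv.
- by apply: measurable_funTS; ms.
- move=> v _; rewrite !mulr_ge0 ?powR_ge0 ?(ltW al0)// subr_ge0 ler_expR lerN2.
  by rewrite ler_peMl ?powR_ge0// lerDl ltW.
- by rewrite invr_ge0 ltW.
Qed.

End ratio.

Section tilted_ratio.
Variables (a gam : R) (T : {RV P >-> R}) (f : R -> R).
Hypotheses (a0 : 0 < a) (hf : has_pos_density P S f) (hT : is_neg_power_tilt P a f T).
Hypotheses (iST : indep_rv P S T) (hgam : egamma a = gam%:E) (gam0 : 0 < gam).

Let T0 : positive_rv P T.
Proof.
have [c _ [_ _ hTA]] := hT.
exists (T @^-1` `]-oo, 0]%classic); split.
- by rewrite -[X in measurable X]setTI; exact: (mRV T).
- rewrite hTA// /density_measure (_ : _ `&` _ = set0) ?integral_set0//.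
  by apply/seteqP; split => // x /= []; rewrite !in_itv/= andbT leNgt => /negP.
- by move=> w /= h; rewrite in_itv/= leNgt; exact/negP.
Qed.

(** The factor T^a cancels the tilt t^(- a) and leaves the Laplace transform of S, up to the
    normalizing constant c of the tilt. *)
Lemma tilt_laplace : exists2 c : R, 0 < c & forall u, 0 <= u ->
  (\int[P]_w (`|T w| `^ a * expR (- (u * `|T w|)))%:E = (c * expR (- (u `^ alpha)))%:E)%E.
Proof.
have [c c0 dT] := hT; exists c => // u u0.
have mg : measurable_fun (setT : set R) (fun x : R => `|x| `^ a * expR (- (u * `|x|))).
  have mn : measurable_fun (setT : set R) (fun x : R => `|x|) by exact: measurableT_comp.
  by ms.
rewrite (ge0_integral_density dT mg); last by move=> x; rewrite mulr_ge0 ?powR_ge0 ?expR_ge0.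
have me : measurable_fun (setT : set R) (fun x : R => expR (- (u * x))) by ms.
have [mf f0 _] := hf.
rewrite EFinM -stable_laplace// (ge0_integral_density hf me); last by move=> x; exact: expR_ge0.
rewrite -ge0_integralM.
- apply: eq_integral => x /set_mem; rewrite /= in_itv/= andbT => x0; congr EFin.
  rewrite (gtr0_norm x0) powRN; field.
  by rewrite gt_eqF// powR_gt0.
- exact: measurable_itv.
- by apply: measurable_funM => //; apply: measurable_funTS.
- by move=> x; rewrite /= in_itv/= andbT => x0; rewrite mulr_ge0 ?expR_ge0 ?f0.
- exact: ltW.
Qed.

Let J := (\int[mu]_(t in `]0%R, +oo[) (t `^ (a - 1) * expR (- (t `^ alpha)))%:E)%E.

Let gamma_powN y : 0 < y ->
  (gam%:E * (y `^ (- a))%:E = \int[mu]_(s in `]0%R, +oo[) (s `^ (a - 1) * expR (- (s * y)))%:E)%E.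
Proof. by move=> y0; rewrite egamma_scale// hgam muleC. Qed.

(** (z + S / T)^(- a) = T^a (z T + S)^(- a), and the gamma integral has the integrand s^(a - 1) T^a
    e^(- s z T) e^(- s S). Its average is c s^(a - 1) e^(- (1 + z^alpha) s^alpha), whose integral
    scales as (1 + z^alpha)^(- a / alpha). *)
Lemma stieltjes_tilted_ratio z : 0 < z ->
  (\int[P]_w ((z + S w / T w) `^ (- a))%:E = ((1 + z `^ alpha) `^ (- (a / alpha)))%:E)%E.
Proof.
move=> z0; have [c c0 hc] := tilt_laplace.
have [S0 _] := hS.
have mA := mabs S; have mB := mabs T; have mS := mRV S; have mT := mRV T.
have mT' : measurable_fun setT (fun w => (T w)^-1) by apply: (measurableT_comp measurable_invr).
(* Used twice: with A = 0 and y = q = 1 to eliminate the constants c and J, and with A = |S|, y = z,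
   q = 1 + z^alpha. *)
have main (A : Omega -> R) (y q : R) : measurable_fun setT A -> (forall w, 0 <= A w) -> 0 < y ->
    (forall s, 0 < s -> (\int[P]_w (`|T w| `^ a * expR (- (s * y * `|T w|)) * expR (- (s * A w)))%:E
       = (c * expR (- (q * s `^ alpha)))%:E)%E) -> 0 < q ->
    (gam%:E * \int[P]_w (`|T w| `^ a * (y * `|T w| + A w) `^ (- a))%:E =
     c%:E * ((q `^ (- (a / alpha)))%:E * J))%E.
  move=> mA' A0 y0 hA q0.
  have mA1 : measurable_fun setT (fun r : Omega * measurableTypeR R => A r.1).
    exact: (measurable_fst_comp mA').
  have mB1 : measurable_fun setT (fun r : Omega * measurableTypeR R => `|T r.1|).
    exact: (measurable_fst_comp mB).
  rewrite -(ge0_integralM P measurableT _ _ (ltW gam0)); last 2 first.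
    by ms.
    by move=> w _; rewrite mulr_ge0 ?powR_ge0.
  transitivity (\int[P]_w \int[mu]_(s in `]0%R, +oo[)
      (s `^ (a - 1) * (`|T w| `^ a * expR (- (s * y * `|T w|)) * expR (- (s * A w))))%:E)%E.
    apply: eq_integral => w _; have := normr_ge0 (T w); rewrite le_eqVlt => /orP[/eqP <-|B0].
      by rewrite powR0 ?gt_eqF// mul0r mulr0 integral0_eq// => s _; rewrite !mul0r mulr0.
    have r0 : 0 < y * `|T w| + A w by rewrite ltr_pwDl// mulr_gt0.
    rewrite mulrCA EFinM EFinM gamma_powN// -ge0_integralM.
    - apply: eq_integral => s _; rewrite mulrDr opprD expRD; congr EFin; rewrite (mulrA s); ring.
    - exact: measurable_itv.
    - by apply: measurable_funTS; ms.
    - by move=> s _; rewrite mulr_ge0 ?powR_ge0 ?expR_ge0.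
    - exact: powR_ge0.
  rewrite (@tonelli_half _ _ _ P (fun w s => s `^ (a - 1) * (`|T w| `^ a * expR (- (s * y * `|T w|)) * expR (- (s * A w))))); last 2 first.
    - by ms.
    - by move=> w s _; rewrite !mulr_ge0 ?expR_ge0 ?powR_ge0.
  rewrite /J -integral_weibull// -ge0_integralM.
  - apply: eq_integral => s /set_mem; rewrite /= in_itv/= andbT => s0.
    rewrite (ge0_integralM P measurableT _ _ (powR_ge0 _ _)); last 2 first.
      by ms.
      by move=> w _; rewrite !mulr_ge0 ?expR_ge0 ?powR_ge0.
    by rewrite hA// -EFinM mulrCA.
  - exact: measurable_itv.
  - by apply: measurable_funTS; ms.
  - by move=> s _; rewrite mulr_ge0 ?powR_ge0 ?expR_ge0.
  - exact: ltW.
(* For A = 0 the expectation is that of T^a T^(- a) = 1. *)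
have norm : (gam%:E = c%:E * J)%E.
  have := main (fun=> 0) 1 1 _ _ ltr01 _ ltr01.
  rewrite powR1 mul1e => <-; last 3 first.
  - by ms.
  - by [].
  - move=> s s0; rewrite mul1r mulr1 -hc ?(ltW s0)//; apply: eq_integral => w _.
    by rewrite mulr0 oppr0 expR0 mulr1.
  rewrite (_ : integral _ _ _ = 1%E) ?mule1//.
  transitivity (\int[P]_w cst 1%E w)%E; last by rewrite integral_cst// mul1e; exact: probability_setT.
  apply: ge0_ae_eq_integral => //.
  - by apply/measurable_EFinP; ms.
  - have T0' : {ae P, forall w, 0 < T w} := T0.
    apply: filterS T0' => w w0 _; rewrite (gtr0_norm w0) mul1r addr0 powRN divff// gt_eqF//.
    exact: powR_gt0.
have q0 : 0 < 1 + z `^ alpha by rewrite ltr_pwDl// powR_ge0.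
have := main (fun w => `|S w|) z (1 + z `^ alpha) mA (fun w => normr_ge0 _) z0 _ q0.
have -> : (c%:E * (((1 + z `^ alpha) `^ (- (a / alpha)))%:E * J) =
  gam%:E * ((1 + z `^ alpha) `^ (- (a / alpha)))%:E)%E by rewrite norm muleCA muleC.
move=> h; have {}h := h _.
transitivity (\int[P]_w (`|T w| `^ a * (z * `|T w| + `|S w|) `^ (- a))%:E)%E.
  apply: ge0_ae_eq_integral => //.
  - by apply/measurable_EFinP; ms.
  - by apply/measurable_EFinP; ms.
  - by move=> w _; rewrite lee_fin powR_ge0.
  - by move=> w _; rewrite lee_fin mulr_ge0 ?powR_ge0.
  - have S0' : {ae P, forall w, 0 < S w} := S0; have T0' : {ae P, forall w, 0 < T w} := T0.
    apply: filterS2 S0' T0' => w Sw Tw _; rewrite !gtr0_norm//.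
    have -> : z * T w + S w = T w * (z + S w / T w) by field; rewrite gt_eqF.
    have r0 : 0 <= z + S w / T w by rewrite addr_ge0 ?divr_ge0 ?(ltW z0) ?(ltW Sw) ?(ltW Tw).
    by rewrite powRM ?(ltW Tw)// mulrA (powRN (T w)) mulfV ?mul1r// gt_eqF// powR_gt0.
have g1 : (gam^-1%:E * gam%:E = 1)%E by rewrite -EFinM mulVf// gt_eqF.
rewrite -[LHS]mul1e -[RHS]mul1e -g1 -!muleA h// => s s0.
rewrite (@decouple_laplace T (fun x => x `^ a * expR (- (s * z * x))) s iST (ltW s0)).
- rewrite (eq_integral (fun w => (expR (- (s `^ alpha)) * (`|T w| `^ a * expR (- (s * z * `|T w|))))%:E)); last first.
    by move=> w _; rewrite mulrC.
  rewrite (ge0_integralM P measurableT _ _ (expR_ge0 _)); last 2 first.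
    by ms.
    by move=> w _; rewrite mulr_ge0 ?powR_ge0 ?expR_ge0.
  rewrite hc ?mulr_ge0 ?(ltW s0) ?(ltW z0)// -EFinM; congr EFin.
  rewrite (powRM _ (ltW s0) (ltW z0)).
  rewrite (_ : - ((1 + z `^ alpha) * s `^ alpha) = - (s `^ alpha) + - (s `^ alpha * z `^ alpha)); last by ring.
  by rewrite expRD; ring.
- by ms.
- by move=> x _; rewrite mulr_ge0 ?powR_ge0 ?expR_ge0.
Qed.

End tilted_ratio.

End stable_laws.

(** * Dirichlet vectors *)

Section inverse_gamma.
Context {R : realType}.
Notation mu := (@lebesgue_measure R).
Notation RR := (measurableTypeR R * measurableTypeR R)%type.

Lemma integral_expN_tail (v : R) :
  (\int[mu]_(u in `]v, +oo[) (expR (- u))%:E = (expR (- v))%:E)%E.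
Proof.
rewrite (@ge0_FTC_oy _ _ (fun u => - expR (- u)) v (- expR (- v)) (- 0)).
- by congr EFin; ring.
- by move=> s _; exact: expR_ge0.
- by move=> s _; apply: has_deriv_cont; der.
- by move=> s _; apply: has_deriv_eq; [der|rewrite /=; ring].
- by apply: cvg_at_right_filter; apply: (@has_deriv_cont _ (fun u => - expR (- u))); der.
- by apply: cvgN; exact: cvgr_expR.
Qed.

(* Writing exp(- c / r) as the integral of exp(- u) over u > c / r. *)
Lemma egamma_inv (A c : R) : 0 < A -> 0 < c ->
  (\int[mu]_(r in `]0%R, +oo[) (r `^ (- A - 1) * expR (- (c / r)))%:E =
   (c `^ (- A))%:E * egamma A)%E.
Proof.
move=> A0 c0.
pose J := (\int[mu]_(u in `]0%R, +oo[) (expR (- u) * (u `^ A / A))%:E)%E.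
have mexp (D : set R) : measurable D -> measurable_fun D (fun u : R => expR (- u)).
  by move=> mD; apply: measurable_funTS; ms.
have mpow (p : R) (D : set R) : measurable D -> measurable_fun D (fun u : R => u `^ p).
  by move=> mD; apply: measurable_funTS; ms.
(* The functional equation Gamma(A) = Gamma(A + 1) / A, again by Tonelli on a triangle. *)
have gE : egamma A = J.
  pose E : set RR := [set r | 0 < r.1 < r.2].
  have mE : measurable E.
    have -> : E = [set r | (0 : R) < r.1] `&` [set r | r.1 < r.2].
      by apply/seteqP; split => r /=; [move=> /andP[]|move=> [h1 h2]; apply/andP].
    by apply: measurableI; apply: measurable_ltr_set.
  pose f (r : RR) : \bar R := (r.1 `^ (A - 1) * expR (- r.2))%:E.
  have mf : measurable_fun E f.
    by apply: measurable_funTS; apply/measurable_EFinP; ms.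
  transitivity (\int[mu]_(v in `]0%R, +oo[) \int[mu]_(u in `]v, +oo[) f (v, u))%E.
    apply: eq_integral => v _; rewrite EFinM -integral_expN_tail -ge0_integralM.
    - by [].
    - exact: measurable_itv.
    - by apply: mexp; exact: measurable_itv.
    - by move=> u _; exact: expR_ge0.
    - exact: powR_ge0.
  have F := @tonelli_dom _ _ (measurableTypeR R) (measurableTypeR R) R mu mu E
    (`]0, +oo[ : set R) (fun s => `]s, +oo[%classic) (`]0, +oo[ : set R) (fun v => `]0, v[%classic)
    mE _ _ f mf.
  rewrite F; clear F.
  - apply: eq_integral => u /set_mem; rewrite /= in_itv/= andbT => u0.
    rewrite EFinM -(integral_powR0 A0 u0) -ge0_integralM.
    + by apply: eq_integral => v _; rewrite /f /= mulrC.
    + exact: measurable_itv.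
    + by apply: mpow; exact: measurable_itv.
    + by move=> v _; exact: powR_ge0.
    + exact: expR_ge0.
  - by move=> s v; rewrite /E /= !in_itv/= !andbT; split => [/andP//|H]; apply/andP.
  - move=> s v; rewrite /E /= !in_itv/= !andbT; split => [/andP[h1 h2]|[_ //]].
    by split; [exact: lt_trans h1 h2|rewrite h1 h2].
  - by move=> r _; rewrite lee_fin mulr_ge0 ?powR_ge0 ?expR_ge0.
rewrite gE.
pose E : set RR := [set r | 0 < r.1 /\ c < r.1 * r.2].
have mE : measurable E.
  have -> : E = [set r | (0 : R) < r.1] `&` [set r | c < r.1 * r.2] by [].
  apply: measurableI; apply: measurable_ltr_set => //.
  by apply: measurable_funM.
pose f (r : RR) : \bar R := (r.1 `^ (- A - 1) * expR (- r.2))%:E.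
have mf : measurable_fun E f.
  by apply: measurable_funTS; apply/measurable_EFinP; ms.
transitivity (\int[mu]_(r in `]0%R, +oo[) \int[mu]_(u in `](c / r)%R, +oo[) f (r, u))%E.
  apply: eq_integral => r _; rewrite EFinM -integral_expN_tail -ge0_integralM.
  - by [].
  - exact: measurable_itv.
  - by apply: mexp; exact: measurable_itv.
  - by move=> u _; exact: expR_ge0.
  - exact: powR_ge0.
have F := @tonelli_dom _ _ (measurableTypeR R) (measurableTypeR R) R mu mu E
  (`]0, +oo[ : set R) (fun r => `]c / r, +oo[%classic) (`]0, +oo[ : set R)
  (fun u => `]c / u, +oo[%classic) mE _ _ f mf.
rewrite F; clear F.
- rewrite /J -ge0_integralM.
  + apply: eq_integral => u /set_mem; rewrite /= in_itv/= andbT => u0.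
    have cu0 : 0 < c / u by rewrite divr_gt0.
    have -> : c `^ (- A) * (expR (- u) * (u `^ A / A)) = expR (- u) * ((c / u) `^ (- A) / A).
      rewrite powRM ?(ltW c0) ?invr_ge0 ?(ltW u0)// -(powR_inv1 (ltW u0)) -powRrM mulN1r opprK.
      by ring.
    rewrite EFinM -(integral_powR_y A0 cu0) -ge0_integralM.
    * by apply: eq_integral => v _; rewrite /f /= mulrC.
    * exact: measurable_itv.
    * by apply: mpow; exact: measurable_itv.
    * by move=> v _; exact: powR_ge0.
    * exact: expR_ge0.
  + exact: measurable_itv.
  + apply: measurable_funTS; ms.
  + by move=> u _; rewrite mulr_ge0 ?expR_ge0 ?divr_ge0 ?powR_ge0 ?(ltW A0).
  + exact: powR_ge0.
- move=> r u; rewrite /E /= !in_itv/= !andbT; split => -[r0 h]; split => //.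
    by rewrite ltr_pdivrMr// mulrC.
  by move: h; rewrite ltr_pdivrMr// mulrC.
- move=> r u; rewrite /E /= !in_itv/= !andbT; split => [[r0 h]|[u0 h]].
    have u0 : 0 < u by rewrite -(pmulr_rgt0 _ r0); exact: lt_trans c0 h.
    by split => //; rewrite ltr_pdivrMr.
  have r0 : 0 < r by apply: lt_trans h; rewrite divr_gt0.
  by split => //; move: h; rewrite ltr_pdivrMr.
- by move=> r _; rewrite lee_fin mulr_ge0 ?powR_ge0 ?expR_ge0.
Qed.

End inverse_gamma.

(** * Independent coordinates and laws of random vectors *)

Section products_of_independent_variables.
Context {R : realType} {d : measure_display} {Omega : measurableType d}.
Variable Q : probability Omega R.
Notation mu := (@lebesgue_measure R).
Variables (n : nat) (G : 'I_n -> {RV Q >-> R}).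
Hypothesis iG : mutually_indep Q (fun i => G i : Omega -> R).

Let mG i : measurable_fun setT (G i : Omega -> measurableTypeR R).
Proof. exact: measurable_RV. Qed.

(** Independence is given for sets, that is, for indicators. The induction frees one factor at a
    time: the factors of index at least k are indicators, and the layer-cake formula replaces the
    factor of index k by the indicators of {phi > t}. *)
Let partial_prod (k : nat) (phi : 'I_n -> R -> R) (e : 'I_n -> R) :
  (forall i, measurable_fun (setT : set R) (phi i)) -> (forall i x, 0 <= phi i x) ->
  (forall i, (\int[Q]_w (phi i (G i w))%:E = (e i)%:E)%E) ->
  (forall i : 'I_n, (k <= i)%N -> exists2 B : set R, measurable B & phi i = \1_B) ->
  (\int[Q]_w (\prod_(i < n) phi i (G i w))%:E = (\prod_(i < n) e i)%:E)%E.
Proof.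
elim: k phi e => [|k IH] phi e mphi phi0 he hB.
  have hB' (i : 'I_n) : exists B : set R, measurable B /\ phi i = \1_B.
    by have [B mB eB] := hB i isT; exists B.
  have /choice[B HB] := hB'.
  have mB i := (HB i).1; have eB i := (HB i).2.
  have mpre : measurable [set w | forall i, B i (G i w)].
    rewrite (_ : mkset _ = \bigcap_(i in [set: 'I_n]) (G i @^-1` B i)).
      apply: fin_bigcap_measurable; first exact: finite_finset.
      by move=> i _; rewrite -[X in measurable X]setTI; apply: mG => //; exact: mB.
    by apply/seteqP; split => w h i; [move=> _; exact: h|exact: h].
  have eQ i : e i = fine (Q (G i @^-1` B i)).
    have := he i; rewrite eB (_ : integral _ _ _ = \int[Q]_w (\1_(G i @^-1` B i) w)%:E)%E//.
    rewrite integral_indic//; last by rewrite -[X in measurable X]setTI; apply: mG => //; exact: mB.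
    by rewrite setIT => ->.
  rewrite (eq_bigr _ (fun i _ => eQ i)) -(iG mB).
  rewrite (_ : integral _ _ _ = \int[Q]_w (\1_[set w | forall i, B i (G i w)] w)%:E)%E.
    by rewrite integral_indic// setIT fineK// fin_num_measure.
  apply: eq_integral => w _; congr EFin; rewrite indicE.
  have [/set_mem h|/negP h] := boolP (w \in _).
    by rewrite big1// => i _; rewrite eB indicE mem_set.
  have [i hi] : exists i, ~ B i (G i w).
    by apply/existsNP => h'; apply: h; exact/mem_set.
  rewrite (bigD1 i)//= eB indicE (_ : (G i w \in B i) = false) ?mul0r//.
  by apply/negbTE/negP => /set_mem.
have [kn|kn] := ltnP k n; last first.
  by apply: IH => // i ki; exfalso; have := leq_trans kn ki; rewrite leqNgt ltn_ord.
pose i0 := Ordinal kn.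
pose H w := \prod_(i < n | i != i0) phi i (G i w).
pose g w := phi i0 (G i0 w).
have mphiG i : measurable_fun setT (fun w => phi i (G i w)).
  exact: (measurableT_comp (mphi i) (mG i)).
have mH : measurable_fun setT H.
  have -> : H = fun w => \prod_(i < n) (if i != i0 then phi i (G i w) else 1).
    by apply/funext => w; exact: big_mkcond.
  by apply: measurable_prod => i _; case: (i != i0) => //; exact: mphiG.
have H0 w : 0 <= H w by apply: prodr_ge0.
have mg : measurable_fun setT g by exact: mphiG.
pose c := \prod_(i < n | i != i0) e i.
have e0 i : 0 <= e i by rewrite -lee_fin -he; apply: integral_ge0 => w _; rewrite lee_fin.
have c0 : 0 <= c by apply: prodr_ge0.
rewrite (bigD1 i0)//= -/c.
rewrite (_ : integral _ _ _ = \int[Q]_w (g w * H w)%:E)%E; last first.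
  by apply: eq_integral => w _; rewrite (bigD1 i0).
rewrite layer_cake//; last by move=> w; exact: phi0.
have mt (t : R) : measurable [set w | t < g w] by exact: measurable_ltr_set.
transitivity (\int[mu]_(t in `]0%R, +oo[) (c%:E * \int[Q]_(w in [set w | (t < g w)%R]) 1))%E.
  apply: eq_integral => t _.
  pose Bt : set R := [set x | t < phi i0 x].
  have mBt : measurable Bt.
    have := @measurable_ltr_set R _ (measurableTypeR R) (cst t) (phi i0) (measurable_cst _) (mphi i0).
    exact.
  pose phit i := if i == i0 then \1_Bt else phi i.
  pose et i := if i == i0 then fine (Q [set w | t < g w]) else e i.
  have eP : \prod_(i < n) et i = c * fine (Q [set w | t < g w]).
    rewrite (bigD1 i0)//= mulrC /et eqxx; congr (_ * _).
    by apply: eq_bigr => i /negbTE ->.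
  have := IH phit et; rewrite eP => IHt.
  transitivity (c * fine (Q [set w | (t < g w)%R]))%:E; last first.
    rewrite EFinM fineK ?fin_num_measure//; congr (_ * _)%E; apply/esym.
    transitivity (1 * Q [set w | (t < g w)%R])%E; [exact: integral_cst|exact: mul1e].
  rewrite -IHt.
  - rewrite [LHS]integral_mkcond; apply: eq_integral => w _.
    rewrite (bigD1 i0)//= /phit eqxx patchE indicE.
    rewrite (eq_bigr (fun i => phi i (G i w))); last by move=> i /negbTE ->.
    rewrite (_ : (w \in [set w | t < g w]) = (G i0 w \in Bt)); last first.
      by apply/idP/idP => /set_mem h; exact/mem_set.
    by case: ifPn => _; rewrite ?mul1r ?mul0r.
  - move=> i; rewrite /phit; case: ifPn => // _; exact: measurable_indic.
  - by move=> i x; rewrite /phit; case: ifPn => // _; rewrite indicE.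
  - move=> i; rewrite /phit /et; case: ifPn => [/eqP ->|_]; last exact: he.
    rewrite (_ : integral _ _ _ = \int[Q]_w (\1_[set w | t < g w] w)%:E)%E//.
    by rewrite integral_indic// setIT fineK// fin_num_measure.
  - move=> i ki; rewrite /phit; case: ifPn => [_|ii0]; first by exists Bt.
    apply: hB; rewrite ltn_neqAle ki andbT; apply: contra ii0 => /eqP ki0.
    by apply/eqP/val_inj.
rewrite ge0_integralZl//; last 2 first.
- have mF : measurable_fun (setT : set R) (fun t => - fine (Q [set w | t < g w])).
    apply: nondecreasing_measurable => // t t' tt'; rewrite lerN2 fine_le ?fin_num_measure//.
    by apply: le_measure; rewrite ?inE// => w /=; exact: le_lt_trans.
  have mF' : measurable_fun (`]0, +oo[ : set R) (fun t => (fine (Q [set w | t < g w]))%:E).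
    apply/measurable_EFinP; apply: measurable_funTS.
    by rewrite (_ : (fun t => _) = fun t => - (- fine (Q [set w | t < g w]))); [exact: measurable_oppr_comp|apply/funext => t; rewrite opprK].
  apply: eq_measurable_fun mF' => t _.
  rewrite fineK ?fin_num_measure//; apply/esym.
  transitivity (1 * Q [set w | (t < g w)%R])%E; [exact: integral_cst|exact: mul1e].
- by move=> t _; apply: integral_ge0.
rewrite -layer_cake//; last by move=> w; exact: phi0.
rewrite (_ : integral _ _ _ = (e i0)%:E); first by rewrite -EFinM mulrC.
by rewrite -he; apply: eq_integral => w _; rewrite mulr1.
Qed.

Lemma expectation_prod (phi : 'I_n -> R -> R) (e : 'I_n -> R) :
  (forall i, measurable_fun (setT : set R) (phi i)) -> (forall i x, 0 <= phi i x) ->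
  (forall i, (\int[Q]_w (phi i (G i w))%:E = (e i)%:E)%E) ->
  (\int[Q]_w (\prod_(i < n) phi i (G i w))%:E = (\prod_(i < n) e i)%:E)%E.
Proof.
move=> mphi phi0 he; apply: (@partial_prod n) => // i.
by rewrite leqNgt ltn_ord.
Qed.

End products_of_independent_variables.

Section laws_of_vectors.
Context {R : realType} (n : nat).

(** They generate the product sigma-algebra of R^n, and are the sets on which a Dirichlet law is
    specified. *)
Definition boxes : set (set ('I_n -> R)) :=
  [set A | exists2 B : 'I_n -> set R, (forall i, measurable (B i)) &
    A = [set v | forall i, B i (v i)]].

Notation V := (g_sigma_algebraType boxes).

Lemma measurable_vector d (T : measurableType d) (U : 'I_n -> T -> R) :
  (forall i, measurable_fun setT (U i : T -> measurableTypeR R)) ->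
  measurable_fun setT ((fun w i => U i w) : T -> V).
Proof.
move=> mU; apply: (@measurability _ _ T V setT _ boxes erefl) => _ [_ [B mB ->] <-].
rewrite setTI.
rewrite (_ : _ @^-1` _ = \bigcap_(i in [set: 'I_n]) (U i @^-1` B i)).
  apply: fin_bigcap_measurable; first exact: finite_finset.
  by move=> i _; rewrite -[X in measurable X]setTI; apply: mU => //; exact: mB.
by apply/seteqP; split => w h i; [move=> _; exact: h|exact: h].
Qed.

Lemma measurable_coord i : measurable_fun setT ((fun v : V => v i) : V -> measurableTypeR R).
Proof.
move=> _ B mB; rewrite setTI; apply: sub_sigma_algebra.
exists (fun j => if j == i then B else setT).
  by move=> j; case: ifPn.
apply/seteqP; split => v /=; first by move=> Bv j; case: ifPn => [/eqP ->|].
by move=> /(_ i); rewrite eqxx.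
Qed.

(** The law of U is that of W reweighted by [rho]; boxes form a pi-system, so agreement there
    suffices, and the layer-cake formula passes to integrals. It serves with rho = 1 for an equality
    of laws, and with an exponential [rho] for scaled gamma vectors. *)
Lemma vector_transfer d (T : measurableType d) d' (T' : measurableType d')
    (P : probability T R) (Q : probability T' R)
    (U : 'I_n -> T -> R) (W : 'I_n -> T' -> R) (rho : T' -> R) :
  (forall i, measurable_fun setT (U i : T -> measurableTypeR R)) ->
  (forall i, measurable_fun setT (W i : T' -> measurableTypeR R)) ->
  measurable_fun setT rho -> (forall w, 0 <= rho w) ->
  (forall B : 'I_n -> set R, (forall i, measurable (B i)) ->
    P [set w | forall i, B i (U i w)] =
    (\int[Q]_(w in [set w | forall i, B i (W i w)]) (rho w)%:E)%E) ->
  forall psi : V -> R, measurable_fun setT psi -> (forall v, 0 <= psi v) ->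
  (\int[P]_w (psi (fun i => U i w))%:E = \int[Q]_w (psi (fun i => W i w) * rho w)%:E)%E.
Proof.
move=> mU mW mrho rho0 hB psi mpsi psi0.
pose u (w : T) : V := fun i => U i w; pose v (w : T') : V := fun i => W i w.
have mu_ : measurable_fun setT u by exact: measurable_vector.
have mv : measurable_fun setT v by exact: measurable_vector.
have rho0' w : (0 <= (rho w)%:E)%E by rewrite lee_fin.
have mrho' : measurable_fun setT (EFin \o rho) by exact/measurable_EFinP.
pose m1 := measure_function_pushforward__canonical__measure_function_Measure P mu_.
pose m2 := measure_function_pushforward__canonical__measure_function_Measure
  (mweight Q rho0' mrho') mv.
have e : forall A : set V, measurable A -> m1 A = m2 A.
  apply: (@measure_unique _ R V boxes (fun=> setT)).
  - by [].
  - move=> _ _ [B mB ->] [C mC ->]; exists (fun i => B i `&` C i).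
      by move=> i; exact: measurableI.
    by apply/seteqP; split => x /=; [move=> [h1 h2] i; split|move=> h; split => i; have [] := h i].
  - by move=> _; exists (fun=> setT) => //; apply/seteqP; split.
  - by apply/seteqP; split => // x _; exists 0.
  - by move=> _ [B mB ->]; exact: hB.
  - by move=> _; change (P (u @^-1` setT) < +oo)%E; rewrite preimage_setT probability_setT ltry.
have mpu : measurable_fun setT (fun w => psi (u w)) by exact: measurableT_comp.
have mpv : measurable_fun setT (fun w => psi (v w)) by exact: measurableT_comp.
transitivity (\int[P]_w (psi (u w) * 1)%:E)%E.
  by apply: eq_integral => w _; rewrite mulr1.
rewrite !layer_cake//; apply: eq_integral => t _.
have mt : measurable [set w | t < psi (u w)] by exact: measurable_ltr_set.
transitivity (P [set w | t < psi (u w)]).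
  transitivity (1 * P [set w | (t < psi (u w))%R])%E; [exact: integral_cst|exact: mul1e].
apply: (e [set x | t < psi x]).
exact: (@measurable_ltr_set R _ V (cst t) psi).
Qed.

End laws_of_vectors.

Section gamma_variables.
Context {R : realType} {d : measure_display} {Omega : measurableType d}.
Variable Q : probability Omega R.
Notation mu := (@lebesgue_measure R).

(** Total mass 1 forbids [Gamma_fun a] = 0; since [fine] sends an infinite value to 0, this also
    excludes a divergent integral. *)
Lemma gamma_normalization (X : {RV Q >-> R}) (a : R) : a != 0 -> is_gamma Q X a ->
  egamma a = (Gamma_fun a)%:E /\ 0 < Gamma_fun a.
Proof.
move=> a0; rewrite /is_gamma (negbTE a0) => -[_ _ hX].
have gE : Gamma_fun a = fine (egamma a) by [].
have ge0 : (0 <= egamma a)%E.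
  by apply: integral_ge0 => t _; rewrite lee_fin mulr_ge0 ?powR_ge0 ?expR_ge0.
have g0 : Gamma_fun a != 0.
  apply/eqP => g0; have := hX setT measurableT.
  rewrite preimage_setT probability_setT /density_measure integral0_eq => [/eqP|x _].
    by rewrite eqe oner_eq0.
  by rewrite g0 invr0 mulr0.
have gp : 0 < Gamma_fun a by rewrite lt_neqAle eq_sym g0 gE fine_ge0.
split=> //; rewrite gE fineK//.
by move: g0 ge0; rewrite gE; case: (egamma a) => //=; rewrite eqxx.
Qed.

(** The density of s X is that of X tilted by e^(- (1 / s - 1) x), up to s^(- a). For a = 0 both
    sides live at the point 0, and s^0 = 1. *)
Lemma gamma_scale (X : {RV Q >-> R}) (a s : R) (B : set R) : 0 <= a -> is_gamma Q X a -> 0 < s ->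
  measurable B ->
  (\int[Q]_w (\1_B (X w) * expR (- ((s^-1 - 1) * `|X w|)))%:E =
   (s `^ a * fine (Q [set w | B (s * X w)]))%:E)%E.
Proof.
move=> a0 hX s0 mB.
have mX := measurable_RV X.
have mabs : measurable_fun (setT : set R) (fun x : R => `|x|) by exact: measurableT_comp.
have mphi : measurable_fun (setT : set R) (fun x : R => \1_B x * expR (- ((s^-1 - 1) * `|x|))).
  by apply: measurable_funM; [exact: measurable_indic|ms].
have phi0 (x : R) : 0 <= \1_B x * expR (- ((s^-1 - 1) * `|x|)).
  by rewrite mulr_ge0 ?expR_ge0// indicE.
have msx : measurable_fun (setT : set R) (fun x : R => s * x) by ms.
have m1 : measurable_fun (setT : set R) (fun x : R => (\1_B (s * x) : R)).
  by apply: (measurableT_comp _ msx); exact: measurable_indic.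
have mS : measurable [set w | B (s * X w)].
  have := measurableT_comp msx mX; move=> /(_ measurableT B mB); rewrite setTI; exact.
have QE : (fine (Q [set w | B (s * X w)]))%:E = (\int[Q]_w (\1_B (s * X w))%:E)%E.
  rewrite fineK ?fin_num_measure//.
  rewrite (_ : integral _ _ _ = \int[Q]_w (\1_[set w | B (s * X w)] w)%:E)%E//.
  by rewrite integral_indic// setIT.
have [az|az] := eqVneq a 0.
  move: hX; rewrite /is_gamma az eqxx => hX.
  rewrite powRr0 mul1r QE; apply: ge0_ae_eq_integral => //.
  - by apply/measurable_EFinP; exact: (measurableT_comp mphi mX).
  - by apply/measurable_EFinP; exact: (measurableT_comp m1 mX).
  - by apply: filterS hX => w -> _; rewrite normr0 !mulr0 oppr0 expR0 mulr1.
have ap : 0 < a by rewrite lt_neqAle eq_sym az.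
have [gE gp] := gamma_normalization az hX.
move: hX; rewrite /is_gamma (negbTE az) => hX.
rewrite EFinM QE (ge0_integral_density hX mphi phi0) (ge0_integral_density hX m1); last first.
  by move=> x; rewrite indicE.
pose f (x : R) : R := \1_B x * (x `^ (a - 1) * expR (- (x / s))) / Gamma_fun a.
have mf : measurable_fun (`]0, +oo[ : set R) (EFin \o f).
  apply/measurable_EFinP; apply: measurable_funTS; rewrite /f.
  apply: measurable_funM => //; apply: measurable_funM; [exact: measurable_indic|ms].
transitivity (\int[mu]_(x in `]0%R, +oo[) (f x)%:E)%E.
  apply: eq_integral => x /set_mem; rewrite /= in_itv/= andbT => x0; congr EFin.
  rewrite (gtr0_norm x0) /f -!mulrA; congr (_ * _).
  rewrite mulrCA; congr (_ * _); rewrite !mulrA -expRD; congr (expR _ / _).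
  by field; rewrite gt_eqF.
rewrite (ge0_integral_scale s0 mf); last first.
  by move=> x _; rewrite lee_fin /f divr_ge0 ?(ltW gp)// mulr_ge0 ?mulr_ge0 ?powR_ge0 ?expR_ge0// indicE.
rewrite -ge0_integralM.
- apply: eq_integral => x /set_mem; rewrite /= in_itv/= andbT => x0.
  rewrite -EFinM; congr EFin; rewrite /f (powRM _ (ltW s0) (ltW x0)).
  rewrite (mulrC s x) mulfK ?gt_eqF// -(mulr_powRB1 (ltW s0) ap); ring.
- exact: measurable_itv.
- apply: measurable_funTS; apply: measurable_funM => //.
  by apply: measurable_funM => //; ms.
- by move=> x _; rewrite mulr_ge0// ?divr_ge0 ?mulr_ge0 ?powR_ge0 ?expR_ge0 ?(ltW gp).
- exact: powR_ge0.
Qed.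

(** The full set in [gamma_scale], with s = 1 / k. Values k < 1 are included, where the exponential
    grows. *)
Lemma gamma_laplace (X : {RV Q >-> R}) (a k : R) : 0 <= a -> is_gamma Q X a -> 0 < k ->
  (\int[Q]_w (expR (- ((k - 1) * `|X w|)))%:E = (k `^ (- a))%:E)%E.
Proof.
move=> a0 hX k0; have ki : 0 < k^-1 by rewrite invr_gt0.
have := gamma_scale a0 hX ki (@measurableT _ R).
rewrite (_ : [set w | _] = setT); last by apply/seteqP; split.
rewrite probability_setT mulr1 invrK -powR_inv1 ?(ltW k0)// -powRrM mulN1r => <-.
by apply: eq_integral => w _; rewrite indicE mem_set// mul1r.
Qed.

Lemma gamma_ge0 (X : {RV Q >-> R}) (a : R) : is_gamma Q X a -> {ae Q, forall w, 0 <= X w}.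
Proof.
rewrite /is_gamma; case: ifPn => _; first by apply: filterS => w ->.
move=> [_ _ hX]; exists (X @^-1` `]-oo, 0[%classic); split.
- by rewrite -[X in measurable X]setTI; apply: measurable_RV => //; exact: measurable_itv.
- rewrite hX// /density_measure (_ : _ `&` _ = set0) ?integral_set0//.
  apply/seteqP; split => // x /= []; rewrite !in_itv/= andbT => h1 h2.
  by have := lt_trans h1 h2; rewrite ltxx.
- by move=> w /= h; rewrite in_itv/= ltNge; exact/negP.
Qed.

Lemma gamma_gt0 (X : {RV Q >-> R}) (a : R) : a != 0 -> is_gamma Q X a ->
  {ae Q, forall w, 0 < X w}.
Proof.
rewrite /is_gamma => /negbTE -> [_ _ hX]; exists (X @^-1` `]-oo, 0]%classic); split.
- by rewrite -[X in measurable X]setTI; apply: measurable_RV => //; exact: measurable_itv.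
- rewrite hX// /density_measure (_ : _ `&` _ = set0) ?integral_set0//.
  by apply/seteqP; split => // x /= []; rewrite !in_itv/= andbT leNgt => /negP.
- by move=> w /= h; rewrite in_itv/= leNgt; exact/negP.
Qed.

End gamma_variables.

Section dirichlet_mean.
Context {R : realType} {d : measure_display} {Omega : measurableType d}.
Variable P : probability Omega R.
Notation mu := (@lebesgue_measure R).
Variables (n : nat) (V : 'I_n -> Omega -> R) (a kap : 'I_n -> R) (gam : R).
Hypothesis mV : forall i, measurable_fun setT (V i : Omega -> measurableTypeR R).
Hypotheses (a0 : forall i, 0 <= a i) (kap0 : forall i, 0 < kap i).
Notation A := (\sum_(i < n) a i).
Hypotheses (A0 : 0 < A) (hgam : egamma A = gam%:E) (gam0 : 0 < gam).

Section gamma_representation.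
Context {d' : measure_display} {Omega' : measurableType d'}.
Variables (Q : probability Omega' R) (G : 'I_n -> {RV Q >-> R}).
Hypotheses (iG : mutually_indep Q (fun i => G i : Omega' -> R))
  (hG : forall i, is_gamma Q (G i) (a i)).
Notation W := (g_sigma_algebraType (@boxes R n)).

(** Absolute values make the integrands nonnegative everywhere; almost surely they change
    nothing. *)
Let N w := \sum_(i < n) `|G i w|.
Let Z w := \sum_(i < n) kap i * `|G i w|.

Let mG i : measurable_fun setT (G i : Omega' -> measurableTypeR R).
Proof. exact: measurable_RV. Qed.
Let mabs i : measurable_fun setT (fun w => `|G i w|).
Proof. by apply: measurableT_comp => //; exact: mG. Qed.
Let mN : measurable_fun setT N.
Proof. by apply: measurable_sum => i; exact: mabs. Qed.
Let mZ : measurable_fun setT Z.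
Proof. by apply: measurable_sum => i; apply: measurable_funM. Qed.
Let N0 w : 0 <= N w. Proof. exact: sumr_ge0. Qed.
Let Z0 w : 0 <= Z w.
Proof. by apply: sumr_ge0 => i _; rewrite mulr_ge0// ltW. Qed.

Let G_ge0 : {ae Q, forall w, forall i, 0 <= G i w}.
Proof. by apply: filter_forall => i; exact: gamma_ge0 (hG i). Qed.

Let exists_gt0 : exists i, a i != 0.
Proof.
apply: contrapT => /forallNP h; move: A0; rewrite big1 ?ltxx// => i _.
by have /negP := h i; rewrite negbK => /eqP.
Qed.

Let N_gt0 : {ae Q, forall w, 0 < N w}.
Proof.
have [i ai] := exists_gt0; apply: filterS (gamma_gt0 ai (hG i)) => w w0.
by rewrite /N (bigD1 i)//= ltr_pwDl ?normr_gt0 ?gt_eqF// sumr_ge0.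
Qed.

(** The product of the one-dimensional scalings: the exponents add up to A and the tilts to one
    exponential in N. *)
Let tilt_box s (B : 'I_n -> set R) : 0 < s -> (forall i, measurable (B i)) ->
  Q [set w | forall i, B i (s * G i w)] =
  (\int[Q]_(w in [set w | forall i, B i (G i w)])
     (s `^ (- A) * expR (- ((s^-1 - 1) * N w)))%:E)%E.
Proof.
move=> s0 mB.
have mphi i : measurable_fun (setT : set R) (fun x : R => \1_(B i) x * expR (- ((s^-1 - 1) * `|x|))).
  have ma : measurable_fun (setT : set R) (fun x : R => `|x|) by exact: measurableT_comp.
  by apply: measurable_funM; [exact: measurable_indic|ms].
have phi0 i (x : R) : 0 <= \1_(B i) x * expR (- ((s^-1 - 1) * `|x|)).
  by rewrite mulr_ge0 ?expR_ge0// indicE.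
have e := expectation_prod iG mphi phi0 (fun i => gamma_scale (a0 i) (hG i) s0 (mB i)).
have msB i : measurable [set x : R | B i (s * x)].
  have ms' : measurable_fun (setT : set R) (fun x : R => s * x) by ms.
  by have := ms' measurableT (B i) (mB i); rewrite setTI.
have mpre (C : 'I_n -> set R) : (forall i, measurable (C i)) -> measurable [set w | forall i, C i (G i w)].
  move=> mC; rewrite (_ : mkset _ = \bigcap_(i in [set: 'I_n]) (G i @^-1` C i)).
    apply: fin_bigcap_measurable; first exact: finite_finset.
    by move=> i _; rewrite -[X in measurable X]setTI; apply: mG => //; exact: mC.
  by apply/seteqP; split => w h i; [move=> _; exact: h|exact: h].
have sA : s `^ A = \prod_(i < n) s `^ a i.
  elim: (index_enum _) => [|i l IH]; first by rewrite !big_nil powRr0.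
  by rewrite !big_cons powRD ?IH// (gt_eqF s0) implybT.
have := iG msB => /= iB.
rewrite -(fineK (fin_num_measure Q _ (mpre _ msB))) [in LHS]iB.
transitivity ((s `^ (- A))%:E * \int[Q]_w (\prod_(i < n) (\1_(B i) (G i w) * expR (- ((s^-1 - 1) * `|G i w|))))%:E)%E.
  rewrite e -EFinM big_split/= -sA mulrA; congr EFin.
  by rewrite powRN mulVf ?mul1r// gt_eqF// powR_gt0.
rewrite -ge0_integralM//; last 3 first.
- by apply: measurable_prod => i _; exact: (measurableT_comp (mphi i) (mG i)).
- by move=> w _; apply: prodr_ge0 => i _; exact: phi0.
- exact: powR_ge0.
rewrite [RHS]integral_mkcond; apply: eq_integral => w _.
rewrite big_split/= patchE -expR_sum.
have -> : \sum_(i < n) - ((s^-1 - 1) * `|G i w|) = - ((s^-1 - 1) * N w).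
  by rewrite /N mulr_sumr sumrN.
case: ifPn => [/set_mem h|/negP h].
  have -> : \prod_(i < n) (\1_(B i) (G i w) : R) = 1.
    by apply: big1 => i _; rewrite indicE mem_set.
  by rewrite mul1r.
have [i hi] : exists i, ~ B i (G i w).
  by apply/existsNP => h'; apply: h; exact/mem_set.
have -> : \prod_(i < n) (\1_(B i) (G i w) : R) = 0.
  rewrite (bigD1 i)//= indicE (_ : (G i w \in B i) = false) ?mul0r//.
  by apply/negbTE/negP => /set_mem.
by rewrite mul0r mulr0.
Qed.

(** The change of law of [tilt_box] for N^A e^(- Z), which at s G equals s^A N^A e^(- s Z); both
    sides are then divided by s. *)
Let tilted s : 0 < s ->
  (\int[Q]_w (s `^ (A - 1) * (N w `^ A * expR (- (s * Z w))))%:E =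
   \int[Q]_w (s `^ (- A - 1) * (N w `^ A * expR (- Z w) * expR (- ((s^-1 - 1) * N w))))%:E)%E.
Proof.
move=> s0.
pose psi (v : W) : R := (\sum_(i < n) `|v i|) `^ A * expR (- \sum_(i < n) kap i * `|v i|).
have mc i : measurable_fun setT (fun v : W => `|v i|).
  by apply: measurableT_comp => //; exact: measurable_coord.
have mpsi : measurable_fun setT psi.
  apply: measurable_funM.
    by apply: measurable_powR_comp; apply: measurable_sum => i; exact: mc.
  apply: measurable_expR_comp; apply: measurable_oppr_comp.
  by apply: measurable_sum => i; apply: measurable_funM.
have psi0 v : 0 <= psi v by rewrite mulr_ge0 ?powR_ge0 ?expR_ge0.
have mrho : measurable_fun setT (fun w => s `^ (- A) * expR (- ((s^-1 - 1) * N w))) by ms.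
have rho0 w : 0 <= s `^ (- A) * expR (- ((s^-1 - 1) * N w)) by rewrite mulr_ge0 ?powR_ge0 ?expR_ge0.
have msG i : measurable_fun setT ((fun w => s * G i w) : Omega' -> measurableTypeR R).
  by apply: measurable_funM => //; exact: mG.
have tb (B : 'I_n -> set R) mB := @tilt_box s B s0 mB.
have e := @vector_transfer R n _ _ _ _ Q Q (fun i w => s * G i w) (fun i w => G i w)
   _ msG mG mrho rho0 tb psi mpsi psi0.
have sn i w : `|s * G i w| = s * `|G i w| by rewrite normrM gtr0_norm.
transitivity (s^-1%:E * \int[Q]_w (psi (fun i => s * G i w)%R)%:E)%E.
  rewrite -ge0_integralM.
  - apply: eq_integral => w _; rewrite /psi.
    have -> : \sum_(i < n) `|s * G i w| = s * N w.
      by rewrite /N mulr_sumr; apply: eq_bigr => i _; rewrite sn.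
    have -> : \sum_(i < n) kap i * `|s * G i w| = s * Z w.
      by rewrite /Z mulr_sumr; apply: eq_bigr => i _; rewrite sn mulrCA.
    rewrite (powRM _ (ltW s0) (N0 w)); congr EFin.
    rewrite powRD ?(gt_eqF s0) ?implybT// powR_inv1 ?(ltW s0)//; ring.
  - exact: measurableT.
  - exact: (measurableT_comp mpsi (measurable_vector msG)).
  - by move=> w _; exact: psi0.
  - by rewrite invr_ge0 ltW.
rewrite e -ge0_integralM.
- apply: eq_integral => w _; rewrite /psi -/(N w) -/(Z w); congr EFin.
  rewrite powRD ?(gt_eqF s0) ?implybT// powR_inv1 ?(ltW s0)//; ring.
- exact: measurableT.
- apply: measurable_funM; last exact: mrho.
  exact: (measurableT_comp mpsi (measurable_vector mG)).
- by move=> w _; rewrite mulr_ge0.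
- by rewrite invr_ge0 ltW.
Qed.

(* Writing N^A Z^(- A) as an integral of N^A e^(- s Z) s^(A - 1) over s, the
   change of law [tilted] moves the scaling by s onto N, and the integral over s
   then only leaves E e^(N - Z). *)
Lemma gamma_ratio :
  (\int[Q]_w (N w `^ A * Z w `^ (- A))%:E = (\prod_(i < n) kap i `^ (- a i))%:E)%E.
Proof.
have [i0 ai0] := exists_gt0.
(* It makes Z positive where N is; the neutral element 1 of the minimum covers an empty index
   set. *)
have kmin : exists2 k, 0 < k & forall w, k * N w <= Z w.
  pose k := \big[Num.min/1]_(i < n) kap i.
  exists k; first by rewrite /k; elim/big_ind: _ => // x y x0 y0; rewrite lt_min x0.
  move=> w; rewrite /N mulr_sumr; apply: ler_sum => i _; rewrite ler_wpM2r//.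
  by rewrite /k (bigD1 i)//= ge_min lexx.
have [k k0 hk] := kmin.
have mN1 : measurable_fun setT (fun r : Omega' * measurableTypeR R => N r.1) by exact: (measurable_fst_comp mN).
have mZ1 : measurable_fun setT (fun r : Omega' * measurableTypeR R => Z r.1) by exact: (measurable_fst_comp mZ).
have minv : measurable_fun setT (fun r : Omega' * measurableTypeR R => (r.2)^-1 : R).
  by apply: (measurableT_comp measurable_invr); exact: measurable_snd.
have main : (gam%:E * \int[Q]_w (N w `^ A * Z w `^ (- A))%:E =
    gam%:E * \int[Q]_w (expR (- (Z w - N w)))%:E)%E.
  rewrite -[LHS]ge0_integralM//; [|by ms|by move=> w _; rewrite mulr_ge0 ?powR_ge0|exact: ltW].
  transitivity (\int[Q]_w \int[mu]_(s in `]0%R, +oo[) (s `^ (A - 1) * (N w `^ A * expR (- (s * Z w))))%:E)%E.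
    apply: eq_integral => w _; have := N0 w; rewrite le_eqVlt => /orP[/eqP <-|w0].
      rewrite powR0 ?gt_eqF// mul0r mulr0 integral0_eq// => s _.
      by rewrite mul0r mulr0.
    have z0 : 0 < Z w by apply: lt_le_trans (hk w); rewrite mulr_gt0.
    rewrite mulrCA EFinM (mulrC gam) EFinM -hgam -(egamma_scale A0 z0) -ge0_integralM.
    - by apply: eq_integral => s _; rewrite mulrCA.
    - exact: measurable_itv.
    - by apply: measurable_funTS; ms.
    - by move=> s _; rewrite mulr_ge0 ?powR_ge0 ?expR_ge0.
    - exact: powR_ge0.
  rewrite (@tonelli_half _ _ _ Q (fun w s => s `^ (A - 1) * (N w `^ A * expR (- (s * Z w))))); last 2 first.
  - by ms.
  - by move=> w s _; rewrite !mulr_ge0 ?expR_ge0 ?powR_ge0.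
  transitivity (\int[mu]_(s in `]0%R, +oo[) \int[Q]_w
     (s `^ (- A - 1) * (N w `^ A * expR (- Z w) * expR (- ((s^-1 - 1) * N w))))%:E)%E.
    by apply: eq_integral => s /set_mem; rewrite /= in_itv/= andbT => s0; exact: tilted.
  rewrite -(@tonelli_half _ _ _ Q (fun w s => s `^ (- A - 1) * (N w `^ A * expR (- Z w) * expR (- ((s^-1 - 1) * N w))))); last 2 first.
  - by ms.
  - by move=> w s _; rewrite !mulr_ge0 ?expR_ge0 ?powR_ge0.
  rewrite -[RHS]ge0_integralM; [|exact: measurableT|by ms|by move=> w _; exact: expR_ge0|exact: ltW gam0].
  transitivity (\int[Q]_w (gam * (N w `^ A * N w `^ (- A) * expR (- (Z w - N w))))%:E)%E; last first.
    apply: ge0_ae_eq_integral => //.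
    - by apply/measurable_EFinP; ms.
    - by apply/measurable_EFinP; ms.
    - by move=> w _; rewrite lee_fin !mulr_ge0 ?expR_ge0 ?powR_ge0// ltW.
    - by move=> w _; rewrite lee_fin mulr_ge0 ?expR_ge0// ltW.
    apply: filterS N_gt0 => w w0 _; rewrite powRN mulfV ?mul1r//.
    by rewrite gt_eqF// powR_gt0.
  apply: eq_integral => w _; have := N0 w; rewrite le_eqVlt => /orP[/eqP <-|w0].
    rewrite powR0 ?gt_eqF// !mul0r mulr0 integral0_eq// => s _.
    by rewrite !mul0r mulr0.
  (* By [egamma_inv] the integral of s^(- A - 1) e^(- N / s) is N^(- A) Gamma(A), while the tilt
     leaves the factor e^N. *)
  rewrite (_ : (gam * (N w `^ A * N w `^ (- A) * expR (- (Z w - N w))))%:E =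
      (N w `^ A * expR (- (Z w - N w)))%:E * ((N w `^ (- A))%:E * egamma A))%E; last first.
    by rewrite hgam -!EFinM; congr EFin; ring.
  rewrite -(egamma_inv A0 w0) -ge0_integralM.
  - apply: eq_integral => s _; congr EFin.
    rewrite (_ : - (Z w - N w) = - Z w + N w); last by ring.
    rewrite (_ : - ((s^-1 - 1) * N w) = - (N w / s) + N w); last by ring.
    by rewrite !expRD; ring.
  - exact: measurable_itv.
  - have mi : measurable_fun (setT : set R) (fun s : R => s^-1) by exact: measurable_invr.
    by apply: measurable_funTS; ms.
  - by move=> s _; rewrite mulr_ge0 ?powR_ge0 ?expR_ge0.
  - by rewrite mulr_ge0 ?powR_ge0 ?expR_ge0.
have g1 : (gam^-1%:E * gam%:E = 1)%E by rewrite -EFinM mulVf// gt_eqF.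
rewrite -[LHS]mul1e -g1 -muleA main muleA g1 mul1e.
have mphi i : measurable_fun (setT : set R) (fun x : R => expR (- ((kap i - 1) * `|x|))).
  have ma : measurable_fun (setT : set R) (fun x : R => `|x|) by exact: measurableT_comp.
  by ms.
have phi0 i (x : R) : 0 <= expR (- ((kap i - 1) * `|x|)) by exact: expR_ge0.
rewrite -(expectation_prod iG mphi phi0 (fun i => gamma_laplace (a0 i) (hG i) (kap0 i))).
apply: eq_integral => w _; rewrite -expR_sum; congr (expR _)%:E.
by rewrite /Z /N -sumrB -sumrN; apply: eq_bigr => i _; ring.
Qed.

End gamma_representation.

(** For V_i = G_i / N the combination is Z / N, and (Z / N)^(- A) = N^A Z^(- A). *)
Lemma dirichlet_stieltjes : is_dirichlet P V a ->
  (\int[P]_w ((\sum_(i < n) kap i * V i w) `^ (- A))%:E = (\prod_(i < n) kap i `^ (- a i))%:E)%E.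
Proof.
case=> d'; case=> Omega'; case=> Q; case=> G; case=> iG hG hV.
have mG i : measurable_fun setT (G i : Omega' -> measurableTypeR R) by exact: measurable_RV.
pose W i w := G i w / \sum_(j < n) G j w.
have mS : measurable_fun setT (fun w => (\sum_(j < n) G j w)^-1).
  apply: (measurableT_comp measurable_invr); by apply: measurable_sum => i; exact: mG.
have mW i : measurable_fun setT (W i : Omega' -> measurableTypeR R).
  by apply: measurable_funM => //; exact: mG.
pose psi (v : g_sigma_algebraType (@boxes R n)) : R := (\sum_(i < n) kap i * v i) `^ (- A).
have mpsi : measurable_fun setT psi.
  apply: measurable_powR_comp; apply: measurable_sum => i; apply: measurable_funM => //.
  exact: measurable_coord.
have psi0 v : 0 <= psi v by exact: powR_ge0.
have box (B : 'I_n -> set R) : (forall i, measurable (B i)) -> P [set w | forall i, B i (V i w)] =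
    (\int[Q]_(w in [set w | forall i, B i (W i w)]) (1 : R)%:E)%E.
  move=> mB; rewrite hV// integral_cst ?mul1e//.
  rewrite (_ : mkset _ = \bigcap_(i in [set: 'I_n]) (W i @^-1` B i)).
    apply: fin_bigcap_measurable; first exact: finite_finset.
    by move=> i _; rewrite -[X in measurable X]setTI; apply: mW => //; exact: mB.
  by apply/seteqP; split => w h i; [move=> _; exact: h|exact: h].
have := @vector_transfer R n _ _ _ _ P Q V W (fun=> 1) mV mW (measurable_cst _) (fun=> ler01) box psi mpsi psi0.
rewrite /psi => ->; rewrite -(gamma_ratio iG hG).
have ma i : measurable_fun setT (fun w => `|G i w|).
  by apply: measurableT_comp => //; exact: mG.
have mN : measurable_fun setT (fun w => \sum_(i < n) `|G i w|) by apply: measurable_sum => i; exact: ma.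
have mZ : measurable_fun setT (fun w => \sum_(i < n) kap i * `|G i w|).
  by apply: measurable_sum => i; apply: measurable_funM.
apply: ge0_ae_eq_integral => //.
- apply/measurable_EFinP; apply: measurable_funM => //; apply: measurable_powR_comp.
  by apply: measurable_sum => i; apply: measurable_funM => //; exact: mW.
- by apply/measurable_EFinP; ms.
- by move=> w _; rewrite lee_fin mulr_ge0 ?powR_ge0.
- by move=> w _; rewrite lee_fin mulr_ge0 ?powR_ge0.
have [i0 ai0] : exists i, a i != 0.
  apply: contrapT => /forallNP h; move: A0; rewrite big1 ?ltxx// => i _.
  by have /negP := h i; rewrite negbK => /eqP.
have g0 : {ae Q, forall w, forall i, 0 <= G i w}.
  by apply: filter_forall => i; exact: gamma_ge0 (hG i).
apply: filterS2 g0 (gamma_gt0 ai0 (hG i0)) => w w0 wi0 _; congr EFin; rewrite mulr1.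
have eN : \sum_(i < n) `|G i w| = \sum_(i < n) G i w by apply: eq_bigr => i _; rewrite ger0_norm.
have eZ : \sum_(i < n) kap i * `|G i w| = \sum_(i < n) kap i * G i w.
  by apply: eq_bigr => i _; rewrite ger0_norm.
rewrite eN eZ /W.
under eq_bigr do rewrite mulrA; rewrite -mulr_suml.
have N0 : 0 < \sum_(i < n) G i w.
  by rewrite (bigD1 i0)//= ltr_pwDl// sumr_ge0.
have Z0 : 0 <= \sum_(i < n) kap i * G i w.
  by apply: sumr_ge0 => i _; rewrite mulr_ge0// ltW.
rewrite powRM ?invr_ge0 ?(ltW N0)// mulrC; congr (_ * _).
by rewrite -(powR_inv1 (ltW N0)) -powRrM mulN1r opprK.
Qed.

End dirichlet_mean.

(** * The random mean *)

Section simple_functions.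
Context {R : realType} {d : measure_display} {T : measurableType d}.
Variable h : {nnsfun T >-> R}.

Definition svalues : seq R := fset_set (range h).
Notation s := svalues.
Definition sfiber (i : 'I_(size s)) : set T := h @^-1` [set s`_i].

Lemma measurable_sfiber i : measurable (sfiber i).
Proof. exact: measurable_sfunP. Qed.

Lemma svaluesP x : exists i : 'I_(size s), h x = s`_i.
Proof.
have xs : h x \in s.
  by rewrite /s in_fset_set ?inE//; exists x.
have lt : (index (h x) s < size s)%N by rewrite index_mem.
by exists (Ordinal lt); rewrite /= nth_index.
Qed.

Lemma svalues_ge0 (i : 'I_(size s)) : 0 <= s`_i.
Proof.
have : s`_i \in s by rewrite mem_nth.
by rewrite /s in_fset_set// => /set_mem[x _ <-].
Qed.

Lemma sfiber_disjoint x (i j : 'I_(size s)) : h x = s`_i -> h x = s`_j -> i = j.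
Proof.
move=> -> /eqP; rewrite nth_uniq ?fset_uniq// => /eqP e; exact: val_inj.
Qed.

Lemma trivIset_sfiber : trivIset setT sfiber.
Proof. by move=> i j _ _ [x [/= h1 h2]]; exact: sfiber_disjoint h1 h2. Qed.

Lemma bigcup_sfiber : \bigcup_i sfiber i = setT.
Proof. by apply/seteqP; split => // x _; have [i e] := svaluesP x; exists i. Qed.

Lemma integral_simple (m : {measure set T -> \bar R}) (g : R -> R) :
  (forall x, 0 <= x -> 0 <= g x) ->
  (\int[m]_x (g (h x))%:E = \sum_(i < size s) (g s`_i)%:E * m (sfiber i))%E.
Proof.
move=> g0.
transitivity (\int[m]_x \sum_(i < size s) (g s`_i * \1_(sfiber i) x)%:E)%E.
  apply: eq_integral => x _; have [i e] := svaluesP x.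
  rewrite (bigD1 i)//= big1 ?adde0.
    by rewrite indicE mem_set ?mulr1 ?e.
  move=> j ji; rewrite indicE (_ : (x \in sfiber j) = false) ?mulr0//.
  apply/negbTE/negP => /set_mem e'; move/eqP: ji; apply; exact: sfiber_disjoint e' e.
rewrite ge0_integral_sum//; last 2 first.
- move=> i; apply/measurable_EFinP; apply: measurable_funM => //.
  by apply: measurable_indic; exact: measurable_sfiber.
- by move=> i x _; rewrite lee_fin mulr_ge0 ?g0 ?svalues_ge0// indicE.
apply: eq_bigr => i _; rewrite ge0_integralM.
- by rewrite integral_indic// ?setIT//; exact: measurable_sfiber.
- exact: measurableT.
- by apply: measurable_indic; exact: measurable_sfiber.
- by move=> x _; rewrite indicE.
- by rewrite g0 ?svalues_ge0.
Qed.

End simple_functions.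

(** * The base measure of the Dirichlet process *)

Section lamperti_log.
Context {R : realType}.
Notation mu := (@lebesgue_measure R).
Variable alpha : R.
Hypotheses (al0 : 0 < alpha) (al1 : alpha < 1).
Notation rho := (varrho alpha).

(* log(z + x) = log z + int_z^oo x / (v (v + x)) dv reduces this to the
   Stieltjes transform of x rho(x). *)
Lemma integral_ln_varrho z : 1 < z ->
  (\int[mu]_(x in `]0%R, +oo[) (ln (z + x) * rho x)%:E = (alpha^-1 * ln (1 + z `^ alpha))%:E)%E.
Proof.
move=> z1; have z0 : 0 < z := lt_trans ltr01 z1.
have lnz : 0 <= ln z by rewrite ln_ge0// ltW.
pose f (x v : R) : R := (v^-1 - (v + x)^-1) * rho x.
have mrho := @measurable_varrho R alpha al0 al1.
have inner x : 0 < x -> (\int[mu]_(v in `]z, +oo[) (f x v)%:E = ((ln (z + x) - ln z) * rho x)%:E)%E.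
  move=> x0; have r0 := varrho_ge0 al0 al1 x0.
  transitivity (\int[mu]_(v in `]z, +oo[) (rho x * (v^-1 - (v + x)^-1))%:E)%E.
    by apply: eq_integral => v _; rewrite mulrC.
  rewrite ge0_integralM.
  - rewrite [RHS]EFinM [RHS]muleC; congr (_ * _)%E.
    rewrite (@ge0_FTC_oy _ _ (fun v => ln v - ln (v + x)) z (ln z - ln (z + x)) 0).
    + by congr EFin; ring.
    + move=> v zv; have v0 := lt_trans z0 zv.
      by rewrite subr_ge0 lef_pV2 ?posrE ?addr_gt0// lerDl ltW.
    + move=> v zv; have v0 := lt_trans z0 zv; apply: has_deriv_cont; der; rewrite gt_eqF ?addr_gt0//.
    + move=> v zv; have v0 := lt_trans z0 zv; apply: has_deriv_eq; first by der; rewrite addr_gt0.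
      by rewrite /=; ring.
    + apply: cvg_at_right_filter.
      by apply: (@has_deriv_cont _ (fun v => ln v - ln (v + x))); der; rewrite addr_gt0.
    + have e : \forall v \near +oo, - ln (1 + x * v^-1) = ln v - ln (v + x).
        exists 0; split => [|v v0]; first exact: num_real.
        rewrite -ln_div ?posrE ?addr_gt0// -lnV ?posrE; last by rewrite ltr_pwDl// divr_ge0 ?(ltW x0) ?(ltW v0).
        congr ln; field; rewrite !gt_eqF ?addr_gt0//.
      have c0 : v^-1 @[v --> +oo] --> (0 : R).
        have h := @cvgr_powRNy R 1 ltr01.
        apply: cvg_trans h; apply: near_eq_cvg; exists 0; split => [|v v0]; first exact: num_real.
        by rewrite powR_inv1// ltW.
      have cH : {for 0, continuous (fun u : R => - ln (1 + x * u))}.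
        by apply: has_deriv_cont; der; rewrite mulr0 addr0.
      have c1 : - ln (1 + x * v^-1) @[v --> +oo] --> (0 : R).
        have -> : (0 : R) = - ln (1 + x * 0) by rewrite mulr0 addr0 ln1 oppr0.
        exact: (cvg_comp _ _ c0 cH).
      by apply: cvg_trans c1; apply: near_eq_cvg.
  - exact: measurable_itv.
  - apply: open_continuous_measurable_fun; first exact: interval_open.
    move=> v /set_mem; rewrite /= in_itv/= andbT => zv; have v0 := lt_trans z0 zv.
    by apply: has_deriv_cont; der; rewrite gt_eqF ?addr_gt0.
  - move=> v; rewrite /= in_itv/= andbT => zv; have v0 := lt_trans z0 zv.
    by rewrite subr_ge0 lef_pV2 ?posrE ?addr_gt0// lerDl ltW.
  - exact: r0.
have mln : measurable_fun (`]0, +oo[ : set R) (fun x : R => ln (z + x) - ln z).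
  apply: open_continuous_measurable_fun; first exact: interval_open.
  move=> v /set_mem; rewrite /= in_itv/= andbT => v0.
  by apply: has_deriv_cont; der; rewrite addr_gt0.
have lnge x : 0 < x -> 0 <= ln (z + x) - ln z.
  by move=> x0; rewrite subr_ge0 ler_ln ?posrE ?addr_gt0// lerDl ltW.
transitivity (\int[mu]_(x in `]0%R, +oo[) ((ln z * rho x)%:E + ((ln (z + x) - ln z) * rho x)%:E))%E.
  by apply: eq_integral => x _; rewrite -[RHS]EFinD; congr EFin; ring.
rewrite ge0_integralD//; last 4 first.
- by move=> x; rewrite /= in_itv/= andbT => x0; rewrite lee_fin mulr_ge0// varrho_ge0.
- by apply/measurable_EFinP; exact: measurable_funM.
- by move=> x; rewrite /= in_itv/= andbT => x0; rewrite lee_fin mulr_ge0 ?lnge// varrho_ge0.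
- by apply/measurable_EFinP; exact: measurable_funM.
rewrite ge0_integralM//; last by move=> x; rewrite /= in_itv/= andbT => x0; rewrite varrho_ge0.
rewrite integral_varrho1// mule1.
have -> : (\int[mu]_(x in `]0%R, +oo[) ((ln (z + x) - ln z) * rho x)%:E =
    (alpha^-1 * ln (1 + z `^ (- alpha)))%:E)%E.
  transitivity (\int[mu]_(x in `]0%R, +oo[) \int[mu]_(v in `]z, +oo[) (f x v)%:E)%E.
    by apply: eq_integral => x /set_mem; rewrite /= in_itv/= andbT => x0; rewrite inner.
  pose E : set (measurableTypeR R * measurableTypeR R) := [set r | 0 < r.1 /\ z < r.2].
  have mE : measurable E.
    have -> : E = [set r | (0 : R) < r.1] `&` [set r | z < r.2] by [].
    by apply: measurableI; apply: measurable_ltr_set.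
  have mf : measurable_fun E (fun r : measurableTypeR R * measurableTypeR R => (f r.1 r.2)%:E).
    apply/measurable_EFinP; apply: measurable_funM.
      apply: measurable_funTS; apply: measurable_funB; apply: (measurableT_comp measurable_invr).
        exact: measurable_snd.
      by apply: measurable_funD; [exact: measurable_snd|exact: measurable_fst].
    have sub : [set r.1 | r in E] `<=` (`]0, +oo[%classic : set R).
      by move=> _ [r /= [r0 _] <-]; rewrite /= in_itv/= r0.
    have m1 : measurable_fun E (fun r : measurableTypeR R * measurableTypeR R => r.1).
      by apply: measurable_funTS; exact: measurable_fst.
    exact: measurable_comp (measurable_itv _) sub mrho m1.
  have F := @tonelli_dom _ _ (measurableTypeR R) (measurableTypeR R) R mu mu E
    (`]0, +oo[ : set R) (fun=> `]z, +oo[%classic) (`]z, +oo[ : set R)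
    (fun=> `]0, +oo[%classic) mE _ _ _ mf.
  rewrite F; clear F.
  (* The transform of x rho(x) at v leaves 1 / (v (1 + v^alpha)), which has the primitive - log (1 +
     v^(- alpha)) / alpha. *)
  - transitivity (\int[mu]_(v in `]z, +oo[) (v^-1 * (1 + v `^ alpha)^-1)%:E)%E.
      apply: eq_integral => v /set_mem; rewrite /= in_itv/= andbT => zv; have v0 := lt_trans z0 zv.
      rewrite EFinM -(stieltjes_varrho_mul al0 al1 v0) -ge0_integralM.
      - apply: eq_integral => x /set_mem; rewrite /= in_itv/= andbT => x0; congr EFin.
        by rewrite /f; field; rewrite !gt_eqF ?addr_gt0.
      - exact: measurable_itv.
      - apply: measurable_funM.
          by apply: measurable_funM.
        apply: measurable_funTS; apply: (measurableT_comp measurable_invr).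
        exact: measurable_funD.
      - move=> x; rewrite /= in_itv/= andbT => x0.
        have r0 := varrho_ge0 al0 al1 x0.
        by apply: divr_ge0; [exact: mulr_ge0 (ltW x0) r0|exact: addr_ge0 (ltW v0) (ltW x0)].
      - by rewrite invr_ge0 ltW.
    rewrite (@ge0_FTC_oy _ _ (fun v => - alpha^-1 * ln (1 + v `^ (- alpha))) z
      (- alpha^-1 * ln (1 + z `^ (- alpha))) 0).
    + by congr EFin; ring.
    + move=> v zv; have v0 := lt_trans z0 zv.
      by rewrite mulr_ge0 ?invr_ge0 ?addr_ge0 ?powR_ge0// ltW.
    + move=> v zv; have v0 := lt_trans z0 zv; apply: has_deriv_cont; der; rewrite gt_eqF//.
      by rewrite ltr_pwDl// powR_ge0.
    + move=> v zv; have v0 := lt_trans z0 zv.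
      have q0 : 0 < 1 + v `^ (- alpha) by rewrite ltr_pwDl// powR_ge0.
      apply: has_deriv_eq; first by der.
      have p0 := powR_gt0 alpha v0.
      rewrite /= powRN; have -> : v `^ (- alpha - 1) = (v `^ alpha)^-1 / v.
        by rewrite powRD ?(gt_eqF v0) ?implybT// powR_inv1 ?(ltW v0)// powRN.
      rewrite powRN in q0.
      by field; rewrite !gt_eqF//= addrC ltr_pwDl// ltW.
    + apply: cvg_at_right_filter.
      apply: (@has_deriv_cont _ (fun v => - alpha^-1 * ln (1 + v `^ (- alpha)))); der.
      by rewrite ltr_pwDl// powR_ge0.
    + have cH : {for 0, continuous (fun u : R => - alpha^-1 * ln (1 + u))}.
        by apply: has_deriv_cont; der; rewrite addr0.
      have -> : (0 : R) = - alpha^-1 * ln (1 + 0) by rewrite addr0 ln1 mulr0.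
      exact: (cvg_comp _ _ (@cvgr_powRNy R alpha al0) cH).
  - by move=> x v; rewrite /E /= !in_itv/= !andbT.
  - by move=> x v; rewrite /E /= !in_itv/= !andbT; split => -[].
  - move=> [x v] [/= x0 zv]; have v0 := lt_trans z0 zv.
    by rewrite lee_fin /f mulr_ge0 ?varrho_ge0// subr_ge0 lef_pV2 ?posrE ?addr_gt0// lerDl ltW.
rewrite -EFinD; congr EFin.
have p0 := powR_gt0 alpha z0.
have -> : 1 + z `^ alpha = z `^ alpha * (1 + z `^ (- alpha)).
  by rewrite powRN mulrDr mulr1 mulfV ?gt_eqF// addrC.
rewrite lnM ?posrE//; last by rewrite ltr_pwDl// powR_ge0.
by rewrite ln_powR mulrDr mulrA mulVf ?mul1r// gt_eqF.
Qed.

End lamperti_log.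

Section lamperti_probability.
Context {R : realType}.
Notation mu := (@lebesgue_measure R).
Notation TR := (measurableTypeR R).
Variable alpha : R.
Hypotheses (al0 : 0 < alpha) (al1 : alpha < 1).
Notation rho := (varrho alpha).

Let I : set R := `]0, +oo[%classic.
Let mI : measurable I. Proof. exact: measurable_itv. Qed.
Let w (x : R) : R := (rho \_ I) x.
Let w0 x : (0 <= (w x)%:E)%E.
Proof.
rewrite lee_fin /w /patch; case: ifPn => // /set_mem; rewrite /I /= in_itv/= andbT.
exact: varrho_ge0.
Qed.
Let mw : measurable_fun (setT : set TR) (EFin \o w).
Proof.
apply/measurable_EFinP; have mr := measurable_varrho al0 al1.
by apply/(measurable_restrictT rho mI).
Qed.
Let m : {measure set TR -> \bar R} := mweight mu w0 mw.

Definition lamperti_law (A : set TR) : \bar R := mweight mu w0 mw A.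

HB.instance Definition _ := isMeasure.Build _ _ _ lamperti_law
  (measure0 m) (measure_ge0 m) (@measure_semi_sigma_additive _ _ _ m).

Lemma lamperti_lawE (A : set TR) : measurable A ->
  lamperti_law A = (\int[mu]_(x in A `&` `]0%R, +oo[) (rho x)%:E)%E.
Proof.
move=> mA; rewrite /lamperti_law /mweight integral_mkcondr; apply: eq_integral => x _.
by rewrite /w /patch; case: ifPn.
Qed.

Lemma lamperti_law_setT : lamperti_law setT = 1%E.
Proof. by rewrite lamperti_lawE// setTI integral_varrho1. Qed.

HB.instance Definition _ := Measure_isProbability.Build _ _ _ lamperti_law lamperti_law_setT.

Lemma ge0_integral_lamperti (g : R -> R) : measurable_fun (setT : set TR) g ->
  (forall x, 0 <= g x) ->
  (\int[lamperti_law]_x (g x)%:E = \int[mu]_(x in `]0%R, +oo[) (g x * rho x)%:E)%E.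
Proof.
move=> mg g0; transitivity (\int[mu]_x (g x * w x)%:E)%E.
  exact: (@ge0_integral_mweight _ _ TR mu w w0 mw g mg g0 lamperti_law).
rewrite [RHS]integral_mkcond; apply: eq_integral => x _.
by rewrite /w /patch; case: ifPn => // _; rewrite mulr0.
Qed.

Lemma density_measure_lamperti (c : R) (A : set TR) : 0 <= c -> measurable A ->
  density_measure (fun x => c * rho x) A = (c%:E * lamperti_law A)%E.
Proof.
move=> c0 mA; rewrite lamperti_lawE// /density_measure ge0_integralM.
- by [].
- exact: measurableI.
- by apply: measurable_funS (measurable_varrho al0 al1) => // x [].
- by move=> x [_]; rewrite /= in_itv/= andbT; exact: varrho_ge0.
- exact: c0.
Qed.

End lamperti_probability.

Section random_mean_law.
Context {R : realType} {d : measure_display} {Omega : measurableType d}.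
Variable P : probability Omega R.
Notation mu := (@lebesgue_measure R).
Notation TR := (measurableTypeR R).
Variables (alpha theta : R) (D : R.-pker Omega ~> TR).
Hypotheses (al0 : 0 < alpha) (al1 : alpha < 1) (th0 : 0 < theta).
Notation rho := (varrho alpha).
Notation a := (alpha * theta).
Notation nu := (lamperti_law al0 al1).
Hypothesis hD : is_dirichlet_process P D (density_measure (fun x => a * rho x)).

Let a0 : 0 < a. Proof. exact: mulr_gt0. Qed.

Let densE (A : set TR) : measurable A ->
  density_measure (fun x => a * rho x) A = (a%:E * nu A)%E.
Proof. exact/density_measure_lamperti/ltW. Qed.

Let nu1 : nu setT = 1%E. Proof. exact: lamperti_law_setT. Qed.

Let nu_fin (A : set TR) : measurable A -> nu A \is a fin_num.
Proof. exact: fin_num_measure. Qed.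

Let D_fin v (A : set TR) : measurable A -> D v A \is a fin_num.
Proof.
move=> mA; rewrite ge0_fin_numE//; apply: le_lt_trans (ltry 1).
have <- : D v setT = 1%E by exact: prob_kernel.
by apply: le_measure; rewrite ?inE.
Qed.

(** For the partition into the single block R, the definition of a Dirichlet process supplies a
    gamma variable of shape a. *)
Lemma egamma_dirichlet : exists2 gam, egamma a = gam%:E & 0 < gam.
Proof.
have := hD (n := 1) (A := fun=> setT) (fun=> measurableT).
case.
- by move=> i j _ _ _; rewrite !ord1.
- by apply/seteqP; split => // x _; exists ord0.
move=> d'; case=> Omega'; case=> Q; case=> G; case=> _ /(_ ord0) hG _.
have e : fine (density_measure (fun x => a * rho x) setT) = a by rewrite densE// nu1 mule1.
rewrite e in hG; have [h1 h2] := gamma_normalization (lt0r_neq0 a0) hG.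
by exists (Gamma_fun a).
Qed.

(** In the partition into ]-oo, 0] and ]0, +oo[ the first block has parameter 0, so its gamma
    variable, and with it the ratio, is almost surely 0. *)
Lemma dirichlet_negative : {ae P, forall v, D v `]-oo, 0]%classic = 0%E}.
Proof.
pose A (i : 'I_2) : set TR := if i == ord0 then `]-oo, 0]%classic else `]0, +oo[%classic.
have mA i : measurable (A i) by rewrite /A; case: ifPn => _; exact: measurable_itv.
have tA : trivIset setT A.
  apply/trivIsetP => i j _ _ ij; apply/seteqP; split => // x [].
  rewrite /A; case: ifPn => [/eqP i0|i0]; case: ifPn => [/eqP j0|j0] /=.
  - by move: ij; rewrite i0 j0 eqxx.
  - by rewrite !in_itv/= andbT leNgt => /negP.
  - by rewrite !in_itv/= andbT => h; rewrite leNgt h.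
  - by case/negP: ij; apply/eqP/val_inj; case: (i) i0 => -[|[|]]//; case: (j) j0 => -[|[|]].
have cA : \bigcup_i A i = setT.
  apply/seteqP; split => // x _; have [x0|x0] := leP x 0.
    by exists ord0 => //; rewrite /A eqxx /= in_itv.
  by exists ord_max => //; rewrite /A /= in_itv/= x0.
have := hD mA tA cA; case=> d'; case=> Omega'; case=> Q; case=> G; case=> _ hG hV.
pose B (i : 'I_2) : set R := if i == ord0 then [set 0] else setT.
have mB i : measurable (B i).
  by rewrite /B; case: ifPn => _; [exact: measurable_set1|exact: measurableT].
have e0 : fine (density_measure (fun x => a * rho x) (A ord0)) = 0.
  rewrite densE// lamperti_lawE// (_ : _ `&` _ = set0) ?integral_set0 ?mule0//.
  by apply/seteqP; split => // x []; rewrite /A /= !in_itv/= andbT leNgt => /negP.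
have := hG ord0; rewrite /is_gamma e0 eqxx => hG0.
have mS : measurable [set v | D v (A ord0) = 0%E].
  have := measurable_kernel D (A ord0) (mA ord0).
  move=> /(_ measurableT [set 0%E]); rewrite setTI; apply; exact: emeasurable_set1.
have P1 : P [set v | D v (A ord0) = 0%E] = 1%E.
  rewrite (_ : mkset _ = [set v | forall i, B i (fine (D v (A i)))]); last first.
    apply/seteqP; split => v /=.
      by move=> h i; rewrite /B; case: ifPn => // /eqP -> /=; rewrite h.
    move=> /(_ ord0); rewrite /B eqxx /= => h.
    by rewrite -(fineK (D_fin v (mA ord0))) h.
  rewrite hV//; pose N := [set v | forall i, B i (G i v / \sum_(j < 2) G j v)].
  have mN : measurable N.
    rewrite (_ : N = (fun v => G ord0 v / \sum_(j < 2) G j v) @^-1` [set 0]); last first.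
      apply/seteqP; split => v /=; first by move=> /(_ ord0); rewrite /B eqxx.
      by move=> h i; rewrite /B; case: ifPn => // /eqP ->.
    have mq : measurable_fun setT (fun v => G ord0 v / \sum_(j < 2) G j v : TR).
      apply: measurable_funM; first exact: measurable_RV.
      apply: (measurableT_comp measurable_invr); apply: measurable_sum => i.
      exact: measurable_RV.
    by have := mq measurableT [set 0] (measurable_set1 0); rewrite setTI.
  have [K [mK QK sK]] := hG0.
  apply/eqP; rewrite eq_le probability_le1//= -[leLHS](_ : Q (~` K) = 1%E); last first.
    by rewrite probability_setC// QK sube0.
  apply: le_measure; rewrite ?inE//; first exact: measurableC.
  move=> v /= Kv i; rewrite /B; case: ifPn => // /eqP -> /=.
  have -> : G ord0 v = 0 by apply: contrapT => h; apply: Kv; exact: sK.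
  by rewrite mul0r.
exists (~` [set v | D v (A ord0) = 0%E]); split.
- exact: measurableC.
- by rewrite probability_setC// P1 subee.
- by move=> v /= h1 h2; apply: h1; rewrite /A eqxx in h2.
Qed.

(** On the partition into level sets of h, z plus the mean of h is the combination of the D(A_i)
    with coefficients z + s_i, as the D(A_i) sum to 1; the product of the (z + s_i)^(- a nu(A_i)) is
    the exponential of the logarithmic integral. *)
Lemma simple_stieltjes (h : {nnsfun TR >-> R}) (z : R) : 1 < z ->
  (\int[P]_v ((z + fine (\int[D v]_x (h x)%:E)) `^ (- a))%:E =
   (expR (- (a * fine (\int[nu]_x (ln (z + h x))%:E)))) %:E)%E.
Proof.
move=> z1; have z0 : 0 < z := lt_trans ltr01 z1.
have [gam hgam gam0] := egamma_dirichlet.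
pose s := svalues h; pose n := size s.
pose kap (i : 'I_n) : R := z + s`_i.
pose ai (i : 'I_n) : R := fine (density_measure (fun x => a * rho x) (sfiber i)).
have msf (i : 'I_n) : measurable (sfiber i) by exact: measurable_sfiber.
have aiE i : ai i = a * fine (nu (sfiber i)).
  by rewrite /ai densE// fineM// nu_fin.
have ai0 i : 0 <= ai i by rewrite aiE mulr_ge0 ?fine_ge0// ltW.
have kap0 i : 0 < kap i by rewrite ltr_pwDl// svalues_ge0.
have sum1 (m : {measure set TR -> \bar R}) : m setT = 1%E ->
    (\sum_(i < n) m (sfiber i) = 1)%E.
  move=> m1; have := @integral_simple _ _ _ h m (fun=> 1) (fun _ _ => ler01).
  rewrite (eq_bigr (fun i : 'I_n => m (sfiber i))); last by move=> i _; rewrite mul1e.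
  move=> <-; rewrite -[RHS]m1.
  transitivity (1 * m setT)%E; [exact: integral_cst|exact: mul1e].
have sumfine (m : {measure set TR -> \bar R}) (g : 'I_n -> R) : m setT = 1%E ->
    (\sum_(i < n) (g i)%:E * m (sfiber i) = (\sum_(i < n) g i * fine (m (sfiber i)))%:E)%E.
  move=> m1; rewrite -sumEFin; apply: eq_bigr => i _; rewrite EFinM fineK//.
  rewrite ge0_fin_numE//; apply: le_lt_trans (ltry 1); rewrite -m1.
  by apply: le_measure; rewrite ?inE.
have A1 : \sum_(i < n) ai i = a.
  rewrite (eq_bigr (fun i : 'I_n => a * (1 * fine (nu (sfiber i))))); last first.
    by move=> i _; rewrite aiE mul1r.
  rewrite -mulr_sumr; have := sumfine nu (fun=> 1) nu1.
  rewrite (eq_bigr (fun i : 'I_n => nu (sfiber i))); last by move=> i _; rewrite mul1e.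
  by rewrite sum1// => -[<-]; rewrite mulr1.
have mV (i : 'I_n) : measurable_fun setT ((fun v => fine (D v (sfiber i))) : Omega -> TR).
  have mk := measurable_kernel D (sfiber i) (msf i).
  by apply: (measurableT_comp _ mk); exact: fine_measurable.
have A0' : 0 < \sum_(i < n) ai i by rewrite A1.
have hgam' : egamma (\sum_(i < n) ai i) = gam%:E by rewrite A1.
have := hD msf (@trivIset_sfiber _ _ _ h) (@bigcup_sfiber _ _ _ h).
move=> /(dirichlet_stieltjes mV ai0 kap0 A0' hgam' gam0); rewrite A1 => e.
transitivity (\int[P]_v ((\sum_(i < n) kap i * fine (D v (sfiber i))) `^ (- a))%:E)%E.
  apply: eq_integral => v _; congr (_ `^ _)%:E.
  have D1 : D v setT = 1%E by exact: prob_kernel.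
  rewrite (integral_simple h (D v) (g := id))//.
  rewrite (sumfine (D v) _ D1) /=.
  have := sumfine (D v) (fun=> 1) D1.
  rewrite (eq_bigr (fun i : 'I_n => D v (sfiber i))); last by move=> i _; rewrite mul1e.
  rewrite sum1// => -[s1]; rewrite -[z in z + _]mulr1 s1 mulr_sumr -big_split/=.
  by apply: eq_bigr => i _; rewrite /kap mulrDl mul1r.
rewrite e; congr EFin.
have lnk0 x : 0 <= x -> 0 <= ln (z + x) by move=> x0; rewrite ln_ge0//; lra.
rewrite (integral_simple h nu (g := fun x => ln (z + x)))// (sumfine nu _ nu1) /=.
rewrite mulr_sumr -sumrN expR_sum; apply: eq_bigr => i _.
by rewrite /powR gt_eqF// aiE /kap; congr expR; ring.
Qed.

End random_mean_law.

Lemma integral_simple_fin {R : realType} {d : measure_display} {T : measurableType d}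
    (h : {nnsfun T >-> R}) (m : {measure set T -> \bar R}) (g : R -> R) :
  (m setT < +oo)%E -> (forall x, 0 <= x -> 0 <= g x) ->
  (\int[m]_x (g (h x))%:E)%E \is a fin_num.
Proof.
move=> m1 g0; rewrite (integral_simple h m g0); apply/sum_fin_numP => i _ _.
have mf : m (sfiber i) \is a fin_num.
  rewrite ge0_fin_numE//; apply: le_lt_trans m1.
  by apply: le_measure; rewrite ?inE//; exact: measurable_sfiber.
exact: fin_numM.
Qed.

Section random_mean.
Context {R : realType} {d : measure_display} {Omega : measurableType d}.
Variable P : probability Omega R.
Notation mu := (@lebesgue_measure R).
Notation TR := (measurableTypeR R).
Variables (alpha theta : R) (D : R.-pker Omega ~> TR).
Hypotheses (al0 : 0 < alpha) (al1 : alpha < 1) (th0 : 0 < theta).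
Notation rho := (varrho alpha).
Notation a := (alpha * theta).
Notation nu := (lamperti_law al0 al1).
Hypothesis hD : is_dirichlet_process P D (density_measure (fun x => a * rho x)).

Let a0 : 0 < a. Proof. exact: mulr_gt0. Qed.
Let D1 v : D v setT = 1%E. Proof. exact: prob_kernel. Qed.

(** [D v] almost surely charges only ]0, +oo[. The positive part has an integral in [0, +oo] for
    every v, and this integral is a monotone limit over simple functions. *)
Let pos (x : TR) : R := Num.max x 0.
Let pos0 x : 0 <= pos x. Proof. by rewrite /pos le_max lexx orbT. Qed.
Let mpos : measurable_fun (setT : set TR) pos.
Proof.
apply/measurable_EFinP; rewrite (_ : _ \o _ = fun x : TR => maxe x%:E 0%E); last first.
  by apply/funext => x /=; rewrite EFin_max.
by apply: measurable_maxe => //; exact/measurable_EFinP.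
Qed.
Let mposE : measurable_fun (setT : set TR) (fun x => (pos x)%:E).
Proof. exact/measurable_EFinP. Qed.
Let hk (k : nat) : {nnsfun TR >-> R} := nnsfun_approx measurableT mposE k.
Let hk_cvg x : (hk k x)%:E @[k --> \oo] --> (pos x)%:E.
Proof.
by apply: (@cvg_nnsfun_approx _ _ _ _ measurableT _ mposE) => // y _; rewrite lee_fin.
Qed.
Let hk_nd x : {homo (fun k => hk k x) : m n / (m <= n)%N >-> m <= n}.
Proof. by move=> m n mn; have := @nd_nnsfun_approx _ _ _ _ measurableT _ mposE _ _ mn => /lefP; exact. Qed.
Let hk_cvgR x : hk k x @[k --> \oo] --> pos x.
Proof. have h := @hk_cvg x; exact: fine_cvg h. Qed.

Let J v : \bar R := (\int[D v]_x (pos x)%:E)%E.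
Let I k v : \bar R := (\int[D v]_x (hk k x)%:E)%E.
Let J0 v : (0 <= J v)%E. Proof. by apply: integral_ge0 => x _; rewrite lee_fin. Qed.
Let I0 k v : (0 <= I k v)%E. Proof. by apply: integral_ge0 => x _; rewrite lee_fin. Qed.

Let Ifin k v : I k v \is a fin_num.
Proof. by apply: (@integral_simple_fin _ _ _ (hk k) (D v) id) => //; rewrite D1 ltry. Qed.

Let I_cvg v : I k v @[k --> \oo] --> J v.
Proof.
have -> : J v = (\int[D v]_x limn (fun k => (hk k x)%:E))%E.
  by apply: eq_integral => x _; apply/esym/cvg_lim => //; exact: hk_cvg.
apply: (cvg_monotone_convergence (D := setT)) => //.
- by move=> n; apply/measurable_EFinP.
- by move=> n x _; rewrite lee_fin.
- by move=> x _ m n mn; rewrite lee_fin hk_nd.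
Qed.

Let mkern (k : TR -> \bar R) : measurable_fun setT k -> (forall x, (0 <= k x)%E) ->
  measurable_fun setT (fun v => (\int[D v]_x k x)%E).
Proof.
move=> mk k0; apply: (measurable_fun_integral_kernel (l := D)) => // U mU.
exact: measurable_kernel.
Qed.

Let mI k : measurable_fun setT (I k). Proof. by apply: mkern => [|x]; [exact/measurable_EFinP|rewrite lee_fin]. Qed.
Let mJ : measurable_fun setT J. Proof. by apply: mkern => // x; rewrite lee_fin. Qed.

(** The continuous extension of (z + y)^(- a) to [0, +oo], with value 0 at +oo: a priori the mean
    may be infinite. *)
Let Gf (z : R) (y : \bar R) : R := if y is r%:E then (z + r) `^ (- a) else 0.

Let Gf_cvg z v : 0 < z -> Gf z (I k v) @[k --> \oo] --> Gf z (J v).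
Proof.
move=> z0; have IE k : I k v = (fine (I k v))%:E by rewrite fineK.
have -> : (fun k => Gf z (I k v)) = (fun k => (z + fine (I k v)) `^ (- a)).
  by apply/funext => k; rewrite IE.
have := @I_cvg v; have := J0 v; case: (J v) => [r| |]//= r0 cI.
- have cr : fine (I k v) @[k --> \oo] --> r by exact: fine_cvg.
  have cp : {for r, continuous (fun u : R => (z + u) `^ (- a))}.
    by apply: has_deriv_cont; der; rewrite ltr_wpDr.
  exact: (cvg_comp _ _ cr cp).
- have cr : fine (I k v) @[k --> \oo] --> +oo.
    apply/cvgeryP; have -> : (fun k => (fine (I k v))%:E) = I ^~ v by apply/funext => k; rewrite -IE.
    exact: cI.
  have cz : z + fine (I k v) @[k --> \oo] --> +oo.
    apply/cvgryPge => A; have /cvgryPge/(_ (A - z)) := cr.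
    by apply: filterS => k; rewrite lerBlDl.
  exact: (cvg_comp _ _ cz (@cvgr_powRNy R a a0)).
Qed.

Let GfI z k v : Gf z (I k v) = (z + fine (I k v)) `^ (- a).
Proof. by rewrite -[in LHS](fineK (Ifin k v)). Qed.

Let mGfI z k : measurable_fun setT (fun v => (Gf z (I k v))%:E).
Proof.
apply/measurable_EFinP.
apply: (eq_measurable_fun (fun v => (z + fine (I k v)) `^ (- a))) => [v _|].
  by rewrite GfI.
apply: (measurableT_comp (measurable_powR _)); apply: measurable_funD => //.
by apply: (measurableT_comp _ (mI k)); exact: fine_measurable.
Qed.

Let Gf_ge0 z y : 0 <= Gf z y.
Proof. by rewrite /Gf; case: y => // r; exact: powR_ge0. Qed.

Let Gf_le z y : 0 < z -> (0 <= y)%E -> Gf z y <= z `^ (- a).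
Proof.
move=> z0; case: y => [r r0| |]//=; rewrite ?powR_ge0//.
by apply: powRN_le; rewrite ?(ltW a0)// lerDl -lee_fin.
Qed.

Let mGfJ z : 0 < z -> measurable_fun setT (fun v => (Gf z (J v))%:E).
Proof.
move=> z0; apply: (@emeasurable_fun_cvg _ _ _ _ (fun k v => (Gf z (I k v))%:E)).
  by move=> k; exact: mGfI.
move=> v _; apply: cvg_EFin; last exact: Gf_cvg.
by apply: nearW => k.
Qed.

Let ln_cvg z x : 1 < z -> ln (z + hk k x) @[k --> \oo] --> ln (z + pos x).
Proof.
move=> z1; have c : {for pos x, continuous (fun u : R => ln (z + u))}.
  by apply: has_deriv_cont; der; rewrite ltr_wpDr// (lt_trans _ z1).
exact: (cvg_comp _ _ (hk_cvgR (x := x)) c).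
Qed.

Let integral_ln_pos z : 1 < z ->
  (\int[nu]_x (ln (z + pos x))%:E = (alpha^-1 * ln (1 + z `^ alpha))%:E)%E.
Proof.
move=> z1; rewrite (@ge0_integral_lamperti _ _ al0 al1 (fun x => ln (z + pos x))).
- rewrite -(integral_ln_varrho al0 al1 z1); apply: eq_integral => x /set_mem.
  by rewrite /= in_itv/= andbT => x0; rewrite /pos max_l// ltW.
- by apply: (measurableT_comp (@measurable_ln R)); apply: measurable_funD.
- by move=> x; rewrite ln_ge0// ler_wpDr// ltW.
Qed.

(** Passage to the limit in [simple_stieltjes]: bounded convergence on the side of P, monotone
    convergence for the logarithms. *)
Let stieltjes_GfJ z : 1 < z ->
  (\int[P]_v (Gf z (J v))%:E = ((1 + z `^ alpha) `^ (- theta))%:E)%E.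
Proof.
move=> z1; have z0 : 0 < z := lt_trans ltr01 z1.
have l1 : (\int[P]_v (Gf z (I k v))%:E)%E @[k --> \oo] --> (\int[P]_v (Gf z (J v))%:E)%E.
  apply: (@dominated_cvg _ _ _ P setT measurableT (fun k v => (Gf z (I k v))%:E)
    (fun v => (Gf z (J v))%:E) (fun=> (z `^ (- a))%:E)) => //.
  - by move=> v _; apply: cvg_EFin; [exact: nearW|exact: Gf_cvg].
  - exact: finite_measure_integrable_cst.
  - by move=> k v _; rewrite gee0_abs ?lee_fin// Gf_le.
have e k : (\int[P]_v (Gf z (I k v))%:E =
    (expR (- (a * fine (\int[nu]_x (ln (z + hk k x))%:E))))%:E)%E.
  rewrite -(simple_stieltjes al0 al1 th0 hD (hk k) z1).
  by apply: eq_integral => v _; rewrite GfI.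
have l2 : (\int[nu]_x (ln (z + hk k x))%:E)%E @[k --> \oo] --> (alpha^-1 * ln (1 + z `^ alpha))%:E.
  rewrite -(integral_ln_pos z1).
  have -> : (\int[nu]_x (ln (z + pos x))%:E = \int[nu]_x limn (fun k => (ln (z + hk k x))%:E))%E.
    apply: eq_integral => x _; apply/esym/cvg_lim => //.
    by apply: cvg_EFin; [exact: nearW|exact: ln_cvg].
  apply: (cvg_monotone_convergence (D := setT)) => //.
  - move=> n; apply/measurable_EFinP; apply: (measurableT_comp (@measurable_ln R)).
    by apply: measurable_funD.
  - by move=> n x _; rewrite lee_fin ln_ge0// ler_wpDr// ltW.
  - move=> x _ m n mn; rewrite lee_fin ler_ln ?posrE ?ltr_wpDr//.
    by rewrite lerD2l hk_nd.
have l3 : fine (\int[nu]_x (ln (z + hk k x))%:E)%E @[k --> \oo] --> alpha^-1 * ln (1 + z `^ alpha).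
  exact: fine_cvg.
have c : {for alpha^-1 * ln (1 + z `^ alpha), continuous (fun u : R => expR (- (a * u)))}.
  by apply: has_deriv_cont; der.
have l4 := cvg_comp _ _ l3 c.
have l5 : (\int[P]_v (Gf z (I k v))%:E)%E @[k --> \oo] -->
    (expR (- (a * (alpha^-1 * ln (1 + z `^ alpha)))))%:E.
  have -> : (fun k => \int[P]_v (Gf z (I k v))%:E)%E =
     (fun k => (expR (- (a * fine (\int[nu]_x (ln (z + hk k x))%:E))))%:E)%E.
    by apply/funext => k; exact: e.
  by apply: cvg_EFin; [exact: nearW|exact: l4].
rewrite (cvg_unique _ l1 l5)//; congr EFin.
have q0 : 0 < 1 + z `^ alpha by rewrite ltr_wpDr// powR_ge0.
set q := 1 + z `^ alpha in q0 *; rewrite /powR (gt_eqF q0).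
by congr expR; field; rewrite gt_eqF.
Qed.

Let mJoo : measurable [set v | J v = +oo%E].
Proof. by have := mJ measurableT (emeasurable_set1 +oo%E); rewrite setTI. Qed.

(** [Gf] vanishes where J is infinite and is at most z^(- a) elsewhere, so z^a (1 + z^alpha)^(-
    theta) <= P(J < +oo). The left side tends to 1 as z tends to infinity. *)
Let J_finite : {ae P, forall v, J v \is a fin_num}.
Proof.
pose N := [set v | J v = +oo%E]; have mN : measurable N := mJoo.
exists N; split=> //; last first.
  by move=> v /= h; apply: contrapT => /eqP h'; apply: h; rewrite ge0_fin_numE// ltey.
pose q := fine (P (~` N)).
have qE : P (~` N) = q%:E by rewrite fineK// fin_num_measure//; exact: measurableC.
have hq z : 1 < z -> (1 + z `^ (- alpha)) `^ (- theta) <= q.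
  move=> z1; have z0 : 0 < z := lt_trans ltr01 z1.
  have p0 := powR_gt0 alpha z0.
  have h : (((1 + z `^ alpha) `^ (- theta))%:E <= (z `^ (- a) * q)%:E)%E.
    rewrite -(stieltjes_GfJ z1) EFinM -qE.
    rewrite -(setIT (~` N)) -integral_indic; [|exact: measurableT|exact: measurableC].
    rewrite -ge0_integralZl//; last 2 first.
    - by apply/measurable_EFinP; apply: measurable_indic; exact: measurableC.
    - by rewrite lee_fin powR_ge0.
    apply: ge0_le_integral => //.
    - by move=> v _; rewrite lee_fin.
    - exact: mGfJ.
    - apply: measurable_funeM; apply/measurable_EFinP; apply: measurable_indic; exact: measurableC.
    - move=> v _; rewrite -EFinM lee_fin indicE.
      have [h|h] := eqVneq (J v) +oo%E.
        by rewrite h /= mulr_ge0 ?powR_ge0.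
      by rewrite mem_set ?mulr1 ?Gf_le//; exact/eqP.
  rewrite lee_fin in h.
  have -> : (1 + z `^ (- alpha)) `^ (- theta) = z `^ a * (1 + z `^ alpha) `^ (- theta).
    have -> : z `^ a = (z `^ (- alpha)) `^ (- theta) by rewrite -powRrM mulrNN.
    rewrite -powRM ?powR_ge0// ?addr_ge0// ?(ltW p0)//; congr (_ `^ _).
    by rewrite powRN mulrDr mulr1 mulVf ?gt_eqF// addrC.
  apply: le_trans (ler_wpM2l (powR_ge0 _ _) h) _.
  by rewrite mulrA -powRD ?subrr ?powRr0 ?mul1r//; rewrite (gt_eqF z0) implybT.
have q1 : 1 <= q.
  have c : {for 0, continuous (fun u : R => (1 + u) `^ (- theta))}.
    by apply: has_deriv_cont; der; rewrite addr0.
  have := cvg_comp _ _ (@cvgr_powRNy R alpha al0) c; rewrite /= addr0 powR1 => cv.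
  apply: (cvgr_to_le cv); exists 1; split => [|z z1]; first exact: num_real.
  exact: hq.
have : (1 <= P (~` N))%E by rewrite qE lee_fin.
rewrite probability_setC// => h.
have fN : P N \is a fin_num by rewrite fin_num_measure.
move: h; rewrite -(fineK fN) -EFinB lee_fin lerBrDl gerDr => h.
by apply/eqP; rewrite eqe eq_le h fine_ge0.
Qed.

Let random_mean_ae : {ae P, forall v, random_mean D v = fine (J v)}.
Proof.
apply: filterS (dirichlet_negative al0 al1 th0 hD) => v Dv0.
rewrite /random_mean /Rintegral integralE.
have -> : (\int[D v]_x (EFin \o id)^\- x = 0)%E.
  have mJ0 : measurable (`]-oo, 0]%classic : set TR) by exact: measurable_itv.
  have mid : measurable_fun (setT : set TR) (EFin \o id) by exact/measurable_EFinP.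
  rewrite -(setUv (`]-oo, 0]%classic : set TR)) ge0_integral_setU.
  - rewrite null_set_integral//; last by apply: measurable_funTS; exact: measurable_funeneg.
    rewrite add0e; apply: integral0_eq => x /=; rewrite in_itv/= => /negP.
    by rewrite -ltNge => x0; rewrite funenegE/= max_r// lee_fin oppr_le0 ltW.
  - exact: mJ0.
  - exact: measurableC.
  - by rewrite setUv; exact: measurable_funeneg.
  - by move=> x _; exact: funeneg_ge0.
  - exact/disj_setPCl.
rewrite sube0; congr fine; apply: eq_integral => x _.
by rewrite funeposE /pos EFin_max.
Qed.

Lemma measurable_random_mean : measurable_fun setT (random_mean D : Omega -> TR).
Proof.
have mid : measurable_fun (setT : set TR) (EFin \o id) by exact/measurable_EFinP.
have -> : random_mean D = (fun v => fine (\int[D v]_x (EFin \o id)^\+ x - \int[D v]_x (EFin \o id)^\- x)%E).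
  by apply/funext => v; rewrite /random_mean /Rintegral integralE.
apply: (measurableT_comp (@fine_measurable R setT measurableT)).
apply: emeasurable_funB; apply: mkern => //.
  exact: measurable_funepos.
exact: measurable_funeneg.
Qed.

Lemma random_mean_ge0 : P [set v | random_mean D v < 0] = 0%E.
Proof.
have [N [mN N0 sN]] := random_mean_ae.
apply: (@subset_measure0 _ _ _ P _ N) => //.
  by apply: measurable_ltr_set => //; exact: measurable_random_mean.
by move=> v /= h; apply: sN => /= e; move: h; rewrite e ltNge fine_ge0.
Qed.

Lemma random_mean_stieltjes z : 1 < z ->
  (\int[P]_v ((z + random_mean D v) `^ (- a))%:E = ((1 + z `^ alpha) `^ (- theta))%:E)%E.
Proof.
move=> z1; have z0 : 0 < z := lt_trans ltr01 z1.
rewrite -stieltjes_GfJ//; apply: ge0_ae_eq_integral => //.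
- apply/measurable_EFinP; apply: (measurableT_comp (measurable_powR _)).
  by apply: measurable_funD => //; exact: measurable_random_mean.
- exact: mGfJ.
- by move=> v _; rewrite lee_fin powR_ge0.
- by move=> v _; rewrite lee_fin.
- apply: filterS2 random_mean_ae J_finite => v -> fJ _.
  by rewrite -[in RHS](fineK fJ).
Qed.

End random_mean.

(** * Identification of the laws *)

Section laws_of_random_variables.
Context {R : realType} {d : measure_display} {Omega : measurableType d}.
Variable P : probability Omega R.
Notation TR := (measurableTypeR R).

Lemma rv_of_measurable (X : Omega -> R) : measurable_fun setT (X : Omega -> TR) ->
  exists Y : {RV P >-> R}, (Y : Omega -> R) = X.
Proof.
move=> mX; have mX' : measurable_fun setT X by move=> _ A mA; exact: mX.
by exists (mfun_Sub (mem_set mX')).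
Qed.

Lemma probability_ae_eq (A B : set Omega) : measurable A -> measurable B ->
  {ae P, forall w, A w <-> B w} -> P A = P B.
Proof.
move=> mA mB AB; rewrite -(setIT A) -(setIT B) -!integral_indic//.
apply: ge0_ae_eq_integral => //.
- by apply/measurable_EFinP; exact: measurable_indic.
- by apply/measurable_EFinP; exact: measurable_indic.
- apply: filterS AB => w [h1 h2] _; rewrite !indicE; congr (_%:R%:E).
  by apply: congr1; apply/idP/idP => /set_mem h; apply/mem_set; [exact: h1|exact: h2].
Qed.

Lemma pos_density_positive (X : {RV P >-> R}) (f : R -> R) :
  has_pos_density P X f -> positive_rv P X.
Proof.
move=> [_ _ h]; exists [set w | X w <= 0]; split.
- exact: measurable_rv_le.
- rewrite (_ : mkset _ = X @^-1` `]-oo, 0]%classic); last first.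
    by apply/seteqP; split => w /=; rewrite in_itv.
  rewrite h; last exact: measurable_itv.
  rewrite /density_measure (_ : _ `&` _ = set0) ?integral_set0//.
  by apply/seteqP; split => x []; rewrite /= !in_itv/= andbT leNgt => /negP.
- by move=> w /= h'; rewrite leNgt; exact/negP.
Qed.

Lemma measurable_rv_ratio (S T : {RV P >-> R}) : measurable_fun setT ((fun w => S w / T w) : Omega -> TR).
Proof.
apply: measurable_funM; first exact: measurable_RV.
by apply: (measurableT_comp measurable_invr); exact: measurable_RV.
Qed.

Lemma rv_ratio_ge0 (S T : {RV P >-> R}) : positive_rv P S -> positive_rv P T ->
  P [set w | S w / T w < 0] = 0%E.
Proof.
move=> S0 T0; have S0' : {ae P, forall w, 0 < S w} by [].
have T0' : {ae P, forall w, 0 < T w} by [].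
have [N [mN N0 sN]] : {ae P, forall w, 0 < S w /\ 0 < T w}.
  by apply: filterS2 S0' T0' => w.
apply: (@subset_measure0 _ _ _ P _ N) => //.
  by apply: measurable_ltr_set => //; exact: measurable_rv_ratio.
by move=> w /= h; apply: sN => /= -[s0 t0]; move: h; rewrite ltNge divr_ge0// ltW.
Qed.

End laws_of_random_variables.

Section law_of_stieltjes.
Context {R : realType} {d : measure_display} {Omega : measurableType d}.
Variable P : probability Omega R.
Notation mu := (@lebesgue_measure R).
Notation TR := (measurableTypeR R).
Variables (alpha theta : R).
Hypotheses (al0 : 0 < alpha) (al1 : alpha < 1) (th0 : 0 < theta).
Notation F := (lamperti_cdf alpha).
Notation a := (alpha * theta).
Notation De := (Delta alpha theta F).
Notation de := (d_dens alpha theta F).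
Let a0 : 0 < a. Proof. exact: mulr_gt0. Qed.

(** It supplies the power bound with which [pos_density_of_cdf] excludes mass on ]-oo, 0]. *)
Lemma abel_Delta_le : exists C : R, forall x, 0 < x -> abel a De x <= C * x `^ a.
Proof.
have [C hC] := Delta_kernel_bound al0 al1 th0; exists (C / a) => x x0.
have cD t (t0 : 0 < t) : {for t, continuous De} by apply: continuous_Delta.
have iD := integrable_abel a0 ltr01 cD hC x0.
have c1 (t : R) : 0 < t -> {for t, continuous (fun=> 1 : R)} by move=> _; exact: cvg_cst.
have h1 (t : R) : 0 < t -> `|1| <= (1 : R) * t `^ (1 - 1) by move=> _; rewrite subrr powRr0 normr1 mulr1.
have i1 := integrable_abel a0 ltr01 c1 h1 x0.
apply: (@le_trans _ _ (\int[mu]_(t in `]0, x[) (C * ((x - t) `^ (a - 1) * 1)))%R).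
  apply: le_Rintegral => //.
    by have := integrableZl _ C i1; apply.
  move=> t; rewrite /= in_itv/= => /andP[t0 tx].
  rewrite mulr1 mulrC ler_wpM2r ?powR_ge0//; apply: le_trans (ler_norm _) _.
  by have := hC t t0; rewrite subrr powRr0 mulr1.
rewrite RintegralZl// /Rintegral.
rewrite (_ : (integral _ _ _) = (x `^ a / a)%:E) /=.
  by rewrite mulrAC mulrA.
have := integral_powR_diff a0 x0; rewrite subr0 => <-; apply: eq_integral => t _.
by rewrite mulr1.
Qed.

(** The cdf comes from the uniqueness of the transform, the density from its being the derivative of
    the cdf; the sign of the density is deduced from the monotonicity of the cdf. *)
Lemma stieltjes_law (X : {RV P >-> R}) : P [set w | X w < 0] = 0%E ->
  (forall z, 1 < z -> (\int[P]_w ((z + X w) `^ (- a))%:E = ((1 + z `^ alpha) `^ (- theta))%:E)%E) ->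
  (forall x, 0 < x -> P [set w | X w <= x] = (abel a De x)%:E) /\
  has_pos_density P X (abel a de).
Proof.
move=> X0 hX.
have cdf x : 0 < x -> P [set w | X w <= x] = (abel a De x)%:E.
  have [C hC] := Delta_kernel_bound al0 al1 th0.
  apply: (cdf_abel X0 a0 ltr01 _ hC).
  - by move=> t t0; exact: continuous_Delta.
  - by move=> z z0; exact: integrable_Delta_stieltjes.
  - by move=> z z1; rewrite hX// stieltjes_Delta// (lt_trans ltr01 z1).
split => //; have [C hC] := abel_Delta_le.
apply: (pos_density_of_cdf a0 (measurable_abel_d_dens al0 al1 th0) _ (integral_abel_d_dens al0 al1 th0) cdf hC).
(* If the density were negative at x, by continuity it would stay below half that value just to the
   right of x, and the cdf would decrease there. *)
move=> x x0; rewrite leNgt; apply/negP => g0.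
set g := abel a de in g0 *.
have cg : {for x, continuous g} := continuous_abel_d_dens al0 al1 th0 x0.
have [e /= e0 he] : \forall y \near x, g y < g x / 2.
  have gx : g x < g x / 2 by rewrite ltr_pdivlMr// mulr_natr mulr2n gtrDl.
  exact: (@cvgr_lt _ _ (nbhs x) _ g (g x) cg (g x / 2) gx).
pose y := x + e / 2; have xy : x < y by rewrite ltrDl divr_gt0.
have y0 := lt_trans x0 xy.
have ig z : 0 < z -> mu.-integrable `]0, z[ (EFin \o g) by move=> z0; exact: integrable_abel_d_dens.
have Ge z : 0 < z -> abel a De z = (\int[mu]_(t in `]0%R, z[) g t)%R.
  by move=> z0; rewrite /Rintegral integral_abel_d_dens.
have mono : abel a De x <= abel a De y.
  rewrite -lee_fin -(cdf x x0) -(cdf y y0); clear - xy.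
  apply: le_measure; rewrite ?inE; [exact: measurable_rv_le|exact: measurable_rv_le|].
  by move=> w /= h; rewrite (le_trans h)// ltW.
have := @Rintegral_itvB R g (BRight 0) (BLeft y) x (ig y y0).
rewrite bnd_simp => /(_ (ltW x0)); rewrite bnd_simp => /(_ xy).
rewrite -(Rintegral_itv_bndo_bndc (ig x x0)) -!Ge// => h.
have ixy : mu.-integrable `]x, y[ (EFin \o g).
  apply: integrableS (ig y y0) => //; apply: subset_itvr.
  by rewrite bnd_simp ltW.
have muxy : mu `]x, y[%classic = (y - x)%:E by rewrite lebesgue_measure_itv/= lte_fin xy -EFinB.
have ic : mu.-integrable `]x, y[ (EFin \o (fun=> g x / 2)).
  apply/integrableP; split; first exact/measurable_EFinP.
  rewrite (_ : integral _ _ _ = (`|g x / 2|%:E * (y - x)%:E)%E) ?ltry//.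
  by rewrite -muxy -[RHS]integral_cst.
have : (\int[mu]_(t in `]x, y[) g t <= \int[mu]_(t in `]x, y[) (g x / 2))%R.
  apply: le_Rintegral => // t; rewrite /= in_itv/= => /andP[xt ty]; apply: ltW.
  apply: he => /=; rewrite ltr0_norm ?subr_lt0// opprB ltrBlDl.
  by apply: lt_trans ty _; rewrite /y ltrD2l ltr_pdivrMr// ltr_pMr// ltr1n.
rewrite [leRHS](_ : _ = (g x / 2) * (y - x)); last first.
  by rewrite /Rintegral (_ : (\int[_]_(_ in _) _)%E = ((g x / 2)%:E * (y - x)%:E)%E)// -muxy -[RHS]integral_cst.
rewrite -h => h2.
have : g x / 2 * (y - x) < 0 by rewrite pmulr_llt0 ?subr_gt0// ltr_pdivrMr// mul0r.
by rewrite ltNge => /negP; apply; apply: le_trans h2; rewrite subr_ge0.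
Qed.

End law_of_stieltjes.

Section lamperti_ratio.
Context {R : realType} {d : measure_display} {Omega : measurableType d}.
Variable P : probability Omega R.
Notation mu := (@lebesgue_measure R).
Variables (alpha : R) (S S' : {RV P >-> R}).
Hypotheses (al0 : 0 < alpha) (al1 : alpha < 1).
Hypotheses (hS : is_pos_stable P alpha S) (hS' : is_pos_stable P alpha S').
Hypothesis iSS' : indep_rv P S S'.

(** The case p = 1 of [cdf_abel], with q = alpha: the Abel transform is then the plain primitive of
    [varrho]. *)
Lemma cdf_stable_ratio x : 0 < x ->
  real_cdf P (fun w => S w / S' w) x = lamperti_cdf alpha x.
Proof.
have [S0 _] := hS; have [S'0 _] := hS'.
have [X XE] := rv_of_measurable P (measurable_rv_ratio S S').
have X0 : P [set w | X w < 0] = 0%E by rewrite XE rv_ratio_ge0.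
move=> x0; rewrite /real_cdf.
rewrite (_ : [set w | _] = [set w | X w <= x]); last by rewrite XE.
rewrite (@cdf_abel _ _ _ P X X0 1 alpha _ (varrho alpha) ltr01 al0 _ (varrho_bound al0 al1))//.
- rewrite -[LHS]/(abel 1 (varrho alpha) x) /abel /Rintegral -[RHS]/(fine (lamperti_cdf alpha x)%:E) -(integral_varrho al0 al1 x0).
  congr fine; apply: eq_integral => t _.
  by rewrite subrr powRr0 mul1r.
- by move=> t t0; exact: continuous_varrho.
- by move=> z z0; exact: integrable_stieltjes_varrho.
- move=> z z1; have z0 := lt_trans ltr01 z1; rewrite stieltjes_varrho// XE.
  exact: (stieltjes_stable_ratio al0 hS hS' iSS' (stable_laplace_abs al0 hS') z0).
Qed.

End lamperti_ratio.

Section local_time.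
Context {R : realType} {d : measure_display} {Omega : measurableType d}.
Variable P : probability Omega R.
Variables (alpha : R) (S T : {RV P >-> R}) (ell : R -> Omega -> R).
Hypothesis al0 : 0 < alpha.
Hypotheses (S0 : positive_rv P S) (T0 : positive_rv P T) (iST : indep_rv P S T).
Hypotheses (hell : is_bridge_local_time alpha T ell) (hSell : indep_rv_process P S ell).

(** Independence makes the product of the laws the joint law of (S, T), and (S^alpha T^(- alpha))^(1
    / alpha) = S / T wherever both are positive. *)
Lemma local_time_ratio : eq_in_law P (fun w => ell (S w) w `^ alpha^-1) (fun w => S w / T w).
Proof.
move=> A mA; have [_ /(_ S S0 hSell)] := hell.
have mp : measurable_fun (setT : set R) (fun x : R => x `^ alpha^-1) by exact: measurable_powR.
have mB : measurable ((fun x : R => x `^ alpha^-1) @^-1` A).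
  by have := mp measurableT A mA; rewrite setTI.
move=> /(_ _ mB) ->.
pose ST (w : Omega) : R * R := (S w, T w).
have mST : measurable_fun setT ST.
  by apply: measurable_fun_pair; exact: measurable_funPT.
pose PST := measure_function_pushforward__canonical__measure_function_Measure P mST.
pose f (r : R * R) : R := (r.1 `^ alpha * r.2 `^ (- alpha)) `^ alpha^-1.
have mf : measurable_fun setT f.
  apply: (measurableT_comp mp); apply: measurable_funM.
    exact: (measurableT_comp (measurable_powR alpha) measurable_fst).
  exact: (measurableT_comp (measurable_powR (- alpha)) measurable_snd).
have mfA : measurable (f @^-1` A) by have := mf measurableT A mA; rewrite setTI.
have -> := @product_measure_unique _ _ _ _ R (distribution P S) (distribution P T) PST _ _ mfA.
  have mfST : measurable_fun setT (f \o ST) := measurableT_comp mf mST.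
  have mq : measurable_fun setT (fun w => S w / T w : R).
    by move=> _ B mB'; have := measurable_rv_ratio S T; apply.
  apply: (@probability_ae_eq _ _ _ P ((f \o ST) @^-1` A) ((fun w => S w / T w) @^-1` A)).
  - by have := mfST measurableT A mA; rewrite setTI.
  - by have := mq measurableT A mA; rewrite setTI.
  have S0' : {ae P, forall w, 0 < S w} by [].
  have T0' : {ae P, forall w, 0 < T w} by [].
  apply: filterS2 S0' T0' => w s0 t0 /=.
  rewrite /f /ST /= powRN -powR_inv1 ?powR_ge0// -powRrM mulrN1.
  have -> : T w `^ (- alpha) = ((T w)^-1) `^ alpha by rewrite -powR_inv1 ?(ltW t0)// -powRrM mulN1r.
  rewrite -powRM ?invr_ge0 ?(ltW t0) ?(ltW s0)// -powRrM mulfV ?gt_eqF// powRr1//.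
  by rewrite divr_ge0 ?(ltW t0) ?(ltW s0).
move=> B C mB' mC; apply: iST; [by exists B|by exists C].
Qed.

End local_time.

Theorem theorem4p2 (R : realType) (alpha theta : R)
  (halpha0 : 0 < alpha) (halpha1 : alpha < 1) (htheta : 0 < theta)
  (d : measure_display) (Omega : measurableType d) (P : probability Omega R)
  (S S' T : {RV P >-> R}) (f : R -> R)
  (ell : R -> Omega -> R) (D : R.-pker Omega ~> (measurableTypeR R))
  (hS : is_pos_stable P alpha S) (hf : has_pos_density P S f)
  (hS' : is_pos_stable P alpha S') (hSS' : indep_rv P S S')
  (hT : is_neg_power_tilt P (alpha * theta) f T) (hST : indep_rv P S T)
  (hell : is_bridge_local_time alpha T ell) (hSell : indep_rv_process P S ell)
  (hD : is_dirichlet_process P D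
          (density_measure (fun x => alpha * theta * varrho alpha x))) :
  let M := random_mean D in
  let F_X := real_cdf P (fun w => S w / S' w) in
  [/\ eq_in_law P M (fun w => ell (S w) w `^ alpha^-1),
      eq_in_law P M (fun w => S w / T w),
      (forall x, 0 < x ->
        P [set w | M w <= x] =
        (abel (alpha * theta) (Delta alpha theta F_X) x)%:E),
      (forall x, 0 < x ->
        F_X x = 1 - (pi * alpha)^-1 *
                    acot (cot (pi * alpha) + x `^ alpha / sin (pi * alpha))) &
      has_pos_density P M
        (abel (alpha * theta) (d_dens alpha theta F_X))].
Proof.
move=> M F_X.
have a0 : 0 < alpha * theta by exact: mulr_gt0.
have F_XE x : 0 < x -> F_X x = lamperti_cdf alpha x.
  exact: cdf_stable_ratio.
(* The closed form of [F_X] is available only on ]0, +oo[, which is all that an Abel integral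
   sees. *)
have abelE (h1 h2 : R -> R) x : (forall t, 0 < t -> h1 t = h2 t) ->
    abel (alpha * theta) h1 x = abel (alpha * theta) h2 x.
  move=> h; apply: eq_Rintegral => t /set_mem; rewrite /= in_itv/= => /andP[t0 _].
  by rewrite h.
have DeE : abel (alpha * theta) (Delta alpha theta F_X) =
    abel (alpha * theta) (Delta alpha theta (lamperti_cdf alpha)).
  by apply/funext => x; apply: abelE => t t0; rewrite /Delta F_XE.
have deE : abel (alpha * theta) (d_dens alpha theta F_X) =
    abel (alpha * theta) (d_dens alpha theta (lamperti_cdf alpha)).
  by apply/funext => x; apply: abelE => t t0; rewrite /d_dens F_XE.
(* The computation for S / T also rests on the finiteness of Gamma(a), here drawn from the Dirichlet
   process. *)
have [gam hgam gam0] := egamma_dirichlet halpha0 halpha1 htheta hD.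
have S0 : positive_rv P S by case: hS.
have T0 : positive_rv P T by case: hT => c _; exact: pos_density_positive.
have [X XE] := rv_of_measurable P (measurable_rv_ratio S T).
have X0 : P [set w | X w < 0] = 0%E by rewrite XE rv_ratio_ge0.
have [_ dX] : (forall x, 0 < x -> P [set w | X w <= x] =
      (abel (alpha * theta) (Delta alpha theta (lamperti_cdf alpha)) x)%:E) /\
    has_pos_density P X (abel (alpha * theta) (d_dens alpha theta (lamperti_cdf alpha))).
  apply: (stieltjes_law halpha0 halpha1 htheta X0) => z z1; rewrite XE.
  rewrite (stieltjes_tilted_ratio halpha0 hS a0 hf hT hST hgam gam0 (lt_trans ltr01 z1)).
  by congr (_ `^ _)%:E; field; rewrite gt_eqF.
have [Y YE] := rv_of_measurable P (measurable_random_mean D).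
have Y0 : P [set w | Y w < 0] = 0%E by rewrite YE (random_mean_ge0 halpha0 halpha1 htheta hD).
have [cY dY] : (forall x, 0 < x -> P [set w | Y w <= x] =
      (abel (alpha * theta) (Delta alpha theta (lamperti_cdf alpha)) x)%:E) /\
    has_pos_density P Y (abel (alpha * theta) (d_dens alpha theta (lamperti_cdf alpha))).
  apply: (stieltjes_law halpha0 halpha1 htheta Y0) => z z1; rewrite YE.
  exact: random_mean_stieltjes.
rewrite XE in dX; rewrite YE in dY cY.
(* Both have the same density, hence the same law. *)
have MX : eq_in_law P M (fun w => S w / T w).
  by move=> A mA; case: dX => _ _ ->//; case: dY => _ _ ->.
split.
- move=> A mA; rewrite (MX A mA); apply/esym.
  exact: (local_time_ratio halpha0 S0 T0 hST hell hSell mA).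
- exact: MX.
- by move=> x x0; rewrite DeE; exact: cY.
- exact: F_XE.
- by rewrite deE.
Qed.
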